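(* Let $Z(Z_\infty)$ be an admissible cyclic poset with finite limit set $Z\subset S^1$. Let $\rho$ be a noncrossing equivalence relation on $Z$, and let $D_1,\dots,D_k$ be the disks of the cactus space $D_\rho$. Then there is a 1-1 correspondence between (a) the set of locally finite clusters $\mathcal S$ in $\mathcal C_{can}(Z(Z_\infty))$ with $\rho_{\mathcal S}=\rho$, and (b) the set of families $\mathcal T=\{\mathcal T_1,\dots,\mathcal T_k\}$ where each $\mathcal T_i$ is a triangulation cluster for the disk $D_i$ of the cactus space $D_\rho$.
   Context: For finite $Z\subset S^1$, with $z^+$ the next element of $Z$ counterclockwise from $z$, $$Z(Z_\infty)=\bigcup_{z\in Z}\left\{\tfrac{z^++z}2+\tfrac{z^+-z}\pi\arctan n: n\in\mathbb Z\right\}\subset S^1$$ (angles, with consecutive lifts $z<z^+$ to $\mathbb R$): a copy of $\mathbb Z$ is inserted between consecutive points of $Z$ and $Z$ itself is deleted; its set of limit points is $Z$. Let $Y$ be a discrete subset of a circle bounding a closed disk $D$, such that $|Y|\ge4$ and every limit point of $Y$ on the circle is a limit from both sides; let $y^\pm$ be the next/previous elements of $Y$. $\mathcal C_{can}(Y)$ is the associated triangulated category (the stable category of a Frobenius category of matrix factorizations of $t$ over $k[[t]]$, twisted by the canonical automorphism $y\mapsto y^+$). Only the following is needed: its indecomposable objects, up to isomorphism, are $E(x,y)\cong E(y,x)$ for $x,y\in Y$, $y\ne x,x^+,x^-$, and two of them are compatible iff the corresponding chords (closed hyperbolic geodesics $\widehat{xy}$ in $D$, identified with the unit disk) do not cross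 in the interior. A cluster is a maximal set of pairwise compatible, pairwise nonisomorphic indecomposables; it is locally finite if each element of $Y$ is an endpoint of only finitely many of its members. For a cluster $\mathcal S$, let $K(\mathcal S)$ be the simplicial complex with vertex set $Y$, with $\{x,y\}$ a 1-simplex iff $E(x,y)\in\mathcal S$ or $y\in\{x^+,x^-\}$, and $\{x,y,z\}$ a 2-simplex iff all its pairs are 1-simplices; $\psi_{\mathcal S}:|K(\mathcal S)|\to D$ sends vertices to themselves, $\{z,z^+\}$ to the boundary arc from $z$ to $z^+$, other 1-simplices to the geodesics $\widehat{xy}$, and 2-simplices homeomorphically onto the enclosed regions. $\mathcal S$ is a triangulation cluster if $\psi_{\mathcal S}$ is a homeomorphism onto $D$ minus the set of limit points of $Y$. For a locally finite cluster $\mathcal S$ in $\mathcal C_{can}(Z(Z_\infty))$, $\rho_{\mathcal S}$ is the equivalence relation on $Z$ generated by $w\sim w'$ whenever there is a sequence of objects $E(x_i,y_i)$ in $\mathcal S$ with $x_i\to w$ and $y_i\to w'$. An equivalence relation $\rho$ on $Z$ is noncrossing if, whenever $a,b,c,d\in Z$ are in cyclic order and $a\sim_\rho c$, $b\sim_\rho d$, then $a\sim_\rho b\sim_\rho c\sim_\rho d$. Points $x,y\in Z(Z_\infty)$ are $\rho$-noncrossing if $\widehat{xy}$ does not cross any $\widehat{ww'}$ with $w\sim_\rho w'$; this is an equivalence relation on $Z(Z_\infty)$ with finitely many classes $V_i$. Cactus space $D_\rho$: for each $\rho$-equivalence class $\{w_1,\dots,w_n\}\subseteq Z$ (in cyclic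 order) contract to a separate point the following subset of the closed unit disk $D^2$: the point itself if $n=1$; the closed geodesic $\widehat{w_1w_2}$ if $n=2$; the closed region bounded by the closed geodesics $\widehat{w_iw_{i+1}}$ (indices mod $n$) if $n\ge3$. The quotient $D_\rho$ is homeomorphic to a finite union of 2-disks $D_i$ attached together at finitely many boundary points. The disks $D_i$ are in bijection with the $\rho$-noncrossing classes $V_i$: the points of $Z(Z_\infty)$ on the boundary circle of $D_i$ form $V_i$, whose limit set there is the image $Z_i$ of $Z$ in $D_i$, and $V_i$ satisfies the conditions imposed on $Y$ above. A triangulation cluster for the disk $D_i$ is a triangulation cluster in $\mathcal C_{can}(V_i)$, with respect to $V_i\subset\partial D_i$ (giving a triangulation of $D_i\setminus Z_i$). *)

(* Defs.v *)
From HB Require Import structures.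
From Stdlib Require Import Relation_Operators.
From mathcomp Require Import all_boot all_order all_algebra.
From mathcomp Require Import all_classical all_reals all_analysis.

Set Implicit Arguments.
Unset Strict Implicit.
Unset Printing Implicit Defensive.

Import Order.TTheory GRing.Theory Num.Theory.
Import numFieldNormedType.Exports.
Local Open Scope classical_set_scope.
Local Open Scope ring_scope.

(* {within A, continuous f} uses the subspace topology of A, so this says that
   f restricts to a homeomorphism from A to B. *)
Definition homeo_on (T U : topologicalType) (A : set T) (B : set U)
    (f : T -> U) : Prop :=
  [/\ set_bij A B f, {within A, continuous f} &
      exists g : U -> T,
        {within B, continuous g} /\ (forall x, A x -> g (f x) = x)].

(* A simplicial complex on a vertex type V is given by its set of faces. Points
   of the geometric realization are barycentric coordinates supported on a
   face. *)
Definition support_of (R : realType) (V : choiceType) (a : V -> R) : set V :=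
  [set v | a v != 0].

Definition barycentric (R : realType) (V : choiceType) (K : set (set V)) :
    set (V -> R) :=
  [set a | [/\ forall v, 0 <= a v, K (support_of a) &
               \sum_(v \in support_of a) a v = 1]].

Definition realization (R : realType) (V : choiceType) (K : set (set V)) : Type :=
  set_type (@barycentric R V K).
HB.instance Definition _ (R : realType) (V : choiceType) (K : set (set V)) :=
  Choice.on (@realization R V K).

Definition bary (R : realType) (V : choiceType) (K : set (set V))
  (a : @realization R V K) : V -> R := set_val a.

Definition closed_simplex (R : realType) (V : choiceType) (K : set (set V))
    (A : set V) : set (@realization R V K) :=
  [set a | support_of (bary a) `<=` A].

(* The weak (coherent) topology: U is open iff its trace on every closed simplex
   is open for the Euclidean topology of that simplex (faces being finite, the
   sup distance on coordinates defines it). *)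
Definition realization_open (R : realType) (V : choiceType) (K : set (set V))
    (U : set (@realization R V K)) : Prop :=
  forall A, K A -> forall a, closed_simplex A a -> U a ->
    exists2 e : R, 0 < e & forall b, closed_simplex A b ->
      (forall v, `|bary a v - bary b v| < e) -> U b.

Lemma realization_openT (R : realType) (V : choiceType) (K : set (set V)) :
  realization_open [set: @realization R V K].
Proof. by move=> A _ a _ _; exists 1. Qed.

Lemma realization_openI (R : realType) (V : choiceType) (K : set (set V))
    (U W : set (@realization R V K)) :
  realization_open U -> realization_open W -> realization_open (U `&` W).
Proof.
move=> oU oW A KA a Aa [Ua Wa].
have [e e0 He] := oU _ KA _ Aa Ua; have [d d0 Hd] := oW _ KA _ Aa Wa.
exists (Num.min e d); first by rewrite lt_min e0 d0.
move=> b Ab ab; split; [apply: He|apply: Hd] => // v;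
  by have := ab v; rewrite lt_min => /andP[].
Qed.

Lemma realization_open_bigU (R : realType) (V : choiceType) (K : set (set V))
    (I : Type) (f : I -> set (@realization R V K)) :
  (forall i, realization_open (f i)) -> realization_open (\bigcup_i f i).
Proof.
move=> of_ A KA a Aa [i _ fia]; have [e e0 He] := of_ i _ KA _ Aa fia.
by exists e => // b Ab ab; exists i => //; exact: He.
Qed.

HB.instance Definition _ (R : realType) (V : choiceType) (K : set (set V)) :=
  isOpenTopological.Build (@realization R V K) (@realization_openT R V K)
    (@realization_openI R V K) (@realization_open_bigU R V K).

Notation plane R := (R^o * R^o)%type.

Section Clusters.
Context {R : realType}.
Local Notation plane := (plane R).

Definition disk : set plane := [set p | p.1 ^+ 2 + p.2 ^+ 2 <= 1].
Definition open_disk : set plane := [set p | p.1 ^+ 2 + p.2 ^+ 2 < 1].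
Definition circle : set plane := [set p | p.1 ^+ 2 + p.2 ^+ 2 = 1].

Definition cexp (t : R) : plane := (cos t, sin t).

(* a < b are consecutive elements of the preimage of Y under the universal cover
   cexp : R -> S^1; hence cexp b is the next element of Y counterclockwise from
   cexp a. When Y is a single point, b = a + 2 pi. *)
Definition consecutive (Y : set plane) (a b : R) : Prop :=
  [/\ a < b, Y (cexp a), Y (cexp b) & forall c, a < c < b -> ~ Y (cexp c)].

Definition next_point (Y : set plane) (x y : plane) : Prop :=
  exists a b, [/\ consecutive Y a b, x = cexp a & y = cexp b].

Definition Zinfty (Z : set plane) : set plane :=
  [set x | exists (a b : R) (n : int), consecutive Z a b /\
     x = cexp ((b + a) / 2 + (b - a) / pi * atan n%:~R)].

Definition conv_hull (A : set plane) : set plane :=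
  \bigcap_(C in [set C : set plane |
                  @convex_set R plane C /\ A `<=` C]) C.

(* The open disk is taken with the Beltrami-Klein model of the hyperbolic plane:
   the closed geodesic between two points of the circle is the straight chord,
   that is, the convex hull of the pair. *)
Definition geodesic (A : set plane) : set plane := conv_hull A.

(* The isomorphism class of E(x,y) = E(y,x) is the unordered pair {x,y}. *)
Definition objects (Y : set plane) : set (set plane) :=
  [set A | exists x y, [/\ Y x, Y y,
      [/\ y <> x, ~ next_point Y x y & ~ next_point Y y x] & A = [set x; y]]].

Definition crossing (A B : set plane) : Prop :=
  A <> B /\ geodesic A `&` geodesic B `&` open_disk !=set0.

Definition compatible_set (Y : set plane) (S : set (set plane)) : Prop :=
  S `<=` objects Y /\ forall A B, S A -> S B -> ~ crossing A B.

Definition is_cluster (Y : set plane) (S : set (set plane)) : Prop :=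
  compatible_set Y S /\
  forall S', compatible_set Y S' -> S `<=` S' -> S' = S.

Definition locally_finite (Y : set plane) (S : set (set plane)) : Prop :=
  forall y, Y y -> finite_set [set A | S A /\ A y].

Definition boundary_edge (Y : set plane) (A : set plane) : Prop :=
  exists x y, next_point Y x y /\ A = [set x; y].

Definition edge (Y : set plane) (S : set (set plane)) (A : set plane) : Prop :=
  S A \/ boundary_edge Y A.

Definition triangle (Y : set plane) (S : set (set plane)) (A : set plane) : Prop :=
  exists x y z, [/\ x <> y, y <> z, x <> z, A = [set x; y; z] &
    [/\ edge Y S [set x; y], edge Y S [set y; z] & edge Y S [set x; z]]].

Definition cluster_complex (Y : set plane) (S : set (set plane)) :
    set (set plane) :=
  [set A | [\/ exists2 y, Y y & A = [set y], edge Y S A | triangle Y S A]].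

Definition boundary_arc (Y : set plane) (A : set plane) : set plane :=
  [set p | exists a b c, [/\ consecutive Y a b, A = [set cexp a; cexp b],
                             a <= c <= b & p = cexp c]].

Definition edge_image (Y : set plane) (A : set plane) : set plane :=
  if `[< boundary_edge Y A >] then boundary_arc Y A else geodesic A.

(* The closed region enclosed by the images of the three edges of a triangle is
   the disk cut by half-planes along the geodesic edges; it is convex, and is the
   convex hull of its boundary curve. *)
Definition triangle_region (Y : set plane) (S : set (set plane)) (A : set plane) :
    set plane :=
  conv_hull (\bigcup_(B in [set B | B `<=` A /\ edge Y S B]) edge_image Y B).

Definition is_psi (Y : set plane) (S : set (set plane))
    (psi : @realization R plane (cluster_complex Y S) -> plane) : Prop :=
  [/\ forall y, Y y -> psi @` closed_simplex [set y] = [set y],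
      forall A, edge Y S A -> psi @` closed_simplex A = edge_image Y A &
      forall A, triangle Y S A ->
        homeo_on (closed_simplex A) (triangle_region Y S A) psi].

(* Any two maps psi as in is_psi agree up to homeomorphisms of the simplices, so
   the choice is immaterial. *)
Definition triangulation_cluster (Y : set plane) (S : set (set plane)) : Prop :=
  is_cluster Y S /\
  exists psi, is_psi psi /\
    homeo_on [set: @realization R plane (cluster_complex Y S)]
             (disk `\` limit_point Y) psi.

Definition equivalence_on (Z : set plane) (rho : plane -> plane -> Prop) : Prop :=
  [/\ forall x y, rho x y -> Z x /\ Z y,
      forall x, Z x -> rho x x,
      forall x y, rho x y -> rho y x &
      forall x y z, rho x y -> rho y z -> rho x z].

Definition cyclic_order (a b c d : plane) : Prop :=
  exists ta tb tc td : R, [/\ [/\ ta < tb, tb < tc, tc < td & td < ta + 2 * pi],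
    a = cexp ta, b = cexp tb, c = cexp tc & d = cexp td].

Definition noncrossing (rho : plane -> plane -> Prop) : Prop :=
  forall a b c d, cyclic_order a b c d -> rho a c -> rho b d ->
    [/\ rho a b, rho b c & rho c d].

Definition limit_pair (S : set (set plane)) (w w' : plane) : Prop :=
  exists x y : nat -> plane, [/\ forall n, S [set x n; y n],
    x n @[n --> \oo] --> w & y n @[n --> \oo] --> w'].

(* rho_S: the smallest equivalence relation on Z containing limit_pair S *)
Definition cluster_rel (Z : set plane) (S : set (set plane)) (w w' : plane) : Prop :=
  forall r, equivalence_on Z r ->
    (forall u u', Z u -> Z u' -> limit_pair S u u' -> r u u') -> r w w'.

(* The subset contracted to a point for the class of w: in the Klein model the
   point, the chord or the ideal polygon spanned by a class is in each case its
   convex hull. *)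
Definition class_region (rho : plane -> plane -> Prop) (w : plane) : set plane :=
  conv_hull [set w' | rho w w'].

Definition cactus_eq (Z : set plane) (rho : plane -> plane -> Prop) :
    rel (set_type disk) :=
  fun p q => `[< clos_refl_sym_trans _
    (fun p q : set_type disk => exists2 w, Z w &
       class_region rho w (set_val p) /\ class_region rho w (set_val q)) p q >].

Lemma cactus_eq_equiv (Z : set plane) (rho : plane -> plane -> Prop) :
  equiv_class_of (cactus_eq Z rho).
Proof.
split.
- by move=> p; apply/asboolP/rst_refl.
- by move=> p q; apply/idP/idP => /asboolP pq; apply/asboolP/rst_sym.
- move=> q p r /asboolP pq /asboolP qr; apply/asboolP.
  exact: rst_trans pq qr.
Qed.

Canonical cactus_equiv (Z : set plane) (rho : plane -> plane -> Prop) :=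
  EquivRelPack (cactus_eq_equiv Z rho).

Local Open Scope quotient_scope.

Definition cactus (Z : set plane) (rho : plane -> plane -> Prop) : Type :=
  quotient_topology {eq_quot (cactus_equiv Z rho)}.
HB.instance Definition _ Z rho := Topological.on (cactus Z rho).

Definition cactus_proj (Z : set plane) (rho : plane -> plane -> Prop)
    (p : set_type disk) : cactus Z rho :=
  \pi_({eq_quot (cactus_equiv Z rho)}) p.
Arguments cactus_proj Z rho p : clear implicits.

Definition cactus_image (Z : set plane) (rho : plane -> plane -> Prop)
    (A : set plane) : set (cactus Z rho) :=
  cactus_proj Z rho @` [set p | A (set_val p)].
Arguments cactus_image Z rho A : clear implicits.

(* The disks are attached together only at contracted points, which lie on their
   boundaries and so disconnect none of them: the disks are the closures of the
   components of the complement of the contracted points, i.e. of the image of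
   Z. *)
Definition cactus_disks (Z : set plane) (rho : plane -> plane -> Prop) :
    set (set (cactus Z rho)) :=
  [set closure (connected_component (~` cactus_image Z rho Z) p)
    | p in ~` cactus_image Z rho Z].

Definition disk_boundary (Z : set plane) (rho : plane -> plane -> Prop)
    (E : set (cactus Z rho)) : set (cactus Z rho) :=
  E `&` cactus_image Z rho circle.

Definition disk_points (Z : set plane) (rho : plane -> plane -> Prop)
    (E : set (cactus Z rho)) : set plane :=
  Zinfty Z `&` set_val @` (cactus_proj Z rho @^-1` disk_boundary E).

(* Here V = disk_points E is the set of points of Z(Z_oo) on the boundary circle
   of E, and T is a set of unordered pairs of points of V. The disk E with
   its boundary circle is identified with the unit disk by a homeomorphism g;
   the choice of g, even its orientation, does not matter, since homeomorphisms
   of circles preserve or reverse cyclic order, hence preserve the set {y+, y-}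
   and crossings. *)
Definition disk_triangulation (Z : set plane) (rho : plane -> plane -> Prop)
    (E : set (cactus Z rho)) (T : set (set plane)) : Prop :=
  (forall A, T A -> A `<=` disk_points E) /\
  exists g : cactus Z rho -> plane,
    [/\ homeo_on E disk g, g @` disk_boundary E = circle &
        triangulation_cluster (g @` cactus_image Z rho (disk_points E))
          [set g @` cactus_image Z rho A | A in T]].

End Clusters.

Arguments cactus_proj {R} Z rho p.
Arguments cactus_image {R} Z rho A.
Arguments cactus_disks {R} Z rho.

(* Main.v *)
Require Import Defs.
From mathcomp Require Import all_boot all_order all_algebra.
From mathcomp Require Import all_classical all_reals all_analysis.
From mathcomp Require Import ring lra zify.

(* The sign of the area of a triple of circle points records its cyclic order, and two chords cross
   iff each separates the ends of the other; so clusters depend only on the cyclic order of their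
   vertices.

   A triangulation cluster is locally finite, and its edges do not converge to a chord joining two
   different limit points: a sequence of points on such edges would be closed and discrete for the
   weak topology of the complex, but its image converges in the disk. Conversely, for a locally
   finite cluster with this property only finitely many edges separate two given points of the open
   disk, so that the triangles cover the disk minus the limit points, and pushing the boundary edges
   of each triangle onto their arcs gives the homeomorphism psi.

   The disks of the cactus are the images of the closed pieces into which the chords joining
   equivalent points cut the disk. A closed piece, with its sides collapsed, is identified with the
   unit disk in polar coordinates around an interior point, the angle being rescaled by a primitive
   of a function of the boundary point that vanishes exactly outside the piece. As homeomorphisms of
   the circle preserve crossings, the triangulations of a disk are the locally finite clusters on
   its points whose limit pairs are equivalent.

   A chord of S never crosses a chord joining points equivalent under rho_S, since crossings persist
   for nearby chords; so S is the union of its restrictions to the disks. Conversely, the union of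
   clusters on the disks is a cluster, because a chord leaving a piece runs through a triangle there
   and has to cross one of its sides. Finally, equivalent points w and w', adjacent in their class,
   form a limit pair: otherwise the midpoint of w w' would lie in a triangle whose edges do not cross
   w w', and then w would lie on the arc of a boundary edge. *)

Set Implicit Arguments.
Unset Strict Implicit.
Unset Printing Implicit Defensive.

Import Order.TTheory GRing.Theory Num.Theory.
Import numFieldNormedType.Exports.
Local Open Scope classical_set_scope.
Local Open Scope ring_scope.

(** * Signed areas and angles *)

Section Circle.
Context {R : realType}.
Local Notation plane := (plane R).
Implicit Types (x y z p q u v w : plane) (a b c s t : R).

(** The disks of the cactus are subsets of a quotient space, known only up to homeomorphism, whereas
    clusters, triangles and limit pairs live in the plane. To bridge this gap, being a triangulation
    cluster is reduced to conditions on cyclic order, local finiteness and limit pairs, which are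
    carried along by maps that respect the order of the boundary points. A triangulated disk comes
    with an arbitrary homeomorphism, though; so an explicit chart is built for one direction, and
    compared with the given homeomorphism on the circle for the other.

    Equivalent points on a closed piece become one boundary point of its disk. This is why the
    condition that limit pairs of a triangulation be equal turns into the condition that limit pairs
    be equivalent under [rho]. A piece is described by strict signs of products of two areas, its
    closure by weak ones.

    The weak topology of the complex makes the inverse of psi the delicate map: its continuity rests
    on every point off the limit set having a neighbourhood that meets only finitely many
    triangles. *)

Definition area x y z : R :=
  (y.1 - x.1 : R) * (z.2 - x.2 : R) - (y.2 - x.2 : R) * (z.1 - x.1 : R).

Definition mix s p q : plane :=
  ((1 - s) * (p.1 : R) + s * (q.1 : R), (1 - s) * (p.2 : R) + s * (q.2 : R)).

Lemma area_rot x y z : area x y z = area y z x.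
Proof. by case: x y z => [x1 x2] [y1 y2] [z1 z2]; rewrite /area/=; ring. Qed.

Lemma area_swap x y z : area y x z = - area x y z.
Proof. by case: x y z => [x1 x2] [y1 y2] [z1 z2]; rewrite /area/=; ring. Qed.

Lemma area_mix x y s p q :
  area x y (mix s p q) = (1 - s) * area x y p + s * area x y q.
Proof.
by case: x y p q => [x1 x2] [y1 y2] [z1 z2] [w1 w2]; rewrite /area/=; ring.
Qed.

Lemma areaxx x y : area x x y = 0. Proof. by rewrite /area; ring. Qed.
Lemma areaxyx x y : area x y x = 0. Proof. by rewrite /area; ring. Qed.
Lemma areaxyy x y : area x y y = 0. Proof. by rewrite /area; ring. Qed.

Lemma plane_eq p q : (p.1 : R) = q.1 -> (p.2 : R) = q.2 -> p = q.
Proof. by case: p q => [? ?] [? ?] /= -> ->. Qed.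

Lemma circleP x : circle x <-> (x.1 : R) ^+ 2 + (x.2 : R) ^+ 2 = 1.
Proof. by []. Qed.

Lemma cexp_circle t : circle (cexp t : plane).
Proof. by rewrite /circle/= cos2Dsin2. Qed.

Lemma cexpD2pi t : cexp (t + 2 * pi) = cexp t :> plane.
Proof. by rewrite /cexp mulr_natl sinD2pi cosD2pi. Qed.

(** Twice the area of an inscribed triangle is a product of sines of half-angles; the sign of [area]
    can thus be read off from the order of the angles. *)
Lemma area_cexp a b c : area (cexp a) (cexp b) (cexp c) =
  4 * (sin ((b - a) / 2) * sin ((c - b) / 2) * sin ((c - a) / 2)).
Proof.
have half (x y : R) : x = x / 2 + x / 2 by field.
rewrite /area/=.
set A := a / 2; set B := b / 2; set C := c / 2.
have -> : (b - a) / 2 = B - A by rewrite /A /B; field.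
have -> : (c - b) / 2 = C - B by rewrite /C /B; field.
have -> : (c - a) / 2 = C - A by rewrite /A /C; field.
rewrite (half a 0) (half b 0) (half c 0) -/A -/B -/C.
rewrite !sinD !cosD !sinN !cosN.
have := cos2Dsin2 A; have := cos2Dsin2 B; have := cos2Dsin2 C.
move: (cos A) (sin A) (cos B) (sin B) (cos C) (sin C) => x1 x2 y1 y2 z1 z2.
move=> hz hy hx.
(* With the squared sines eliminated, the identity is polynomial. *)
have ex : x2 ^+ 2 = 1 - x1 ^+ 2 by rewrite -hx; ring.
have ey : y2 ^+ 2 = 1 - y1 ^+ 2 by rewrite -hy; ring.
have ez : z2 ^+ 2 = 1 - z1 ^+ 2 by rewrite -hz; ring.
ring: ex ey ez.
Qed.


(** Rotating by [- t0] makes the window start at 0, where [acos] of the first coordinate gives the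
    angle or its complement to [2 * pi], according to the sign of the second coordinate. *)
Lemma cexp_surj t0 p : circle p ->
  exists t, [/\ t0 <= t, t < t0 + 2 * pi & p = cexp t].
Proof.
pose q : plane := ((p.1 : R) * cos t0 + (p.2 : R) * sin t0,
                   (p.2 : R) * cos t0 - (p.1 : R) * sin t0).
move=> cp; have pi0 := pi_gt0 R.
have cq : (q.1 : R) ^+ 2 + (q.2 : R) ^+ 2 = 1.
  transitivity (((p.1 : R) ^+ 2 + (p.2 : R) ^+ 2) * (cos t0 ^+ 2 + sin t0 ^+ 2)).
    by rewrite /q/=; ring.
  by rewrite cos2Dsin2 (circleP p).1// mulr1.
suff [s [s0 s1 qs]] : exists s, [/\ 0 <= s, s < 2 * pi & q = cexp s].
  exists (t0 + s); split; [lra|lra|].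
  have q1 : (q.1 : R) = cos s by rewrite qs.
  have q2 : (q.2 : R) = sin s by rewrite qs.
  rewrite /cexp sinD cosD -q1 -q2 /q/=; case: p {cp cq q q1 q2 qs} => p1 p2 /=.
  have e : sin t0 ^+ 2 = 1 - cos t0 ^+ 2 by rewrite -(cos2Dsin2 t0); ring.
  by apply: plane_eq => /=; ring: e.
case: q cq => /= q1' q2' cq; move: q1' q2' cq => q1 q2 cq.
have {}cq : (q1 : R) ^+ 2 + (q2 : R) ^+ 2 = 1 by [].
move: (q1 : R) (q2 : R) cq => {}q1 {}q2 cq.
have q1b : -1 <= q1 <= 1 by apply/andP; split; nra.
have a0 := acos_ge0 q1b; have a1 := acos_lepi q1b.
have sq : Num.sqrt (1 - q1 ^+ 2) = `|q2|.
  by rewrite -sqrtr_sqr; congr Num.sqrt; rewrite -cq; ring.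
have [q20|q20] := leP 0 q2.
- exists (acos q1); split; [by []|lra|].
  by rewrite /cexp acosK ?in_itv//= sin_acos// sq ger0_norm.
- exists (2 * pi - acos q1); split; [lra| |].
  + have : acos q1 != 0.
      apply/eqP => h; have : cos (acos q1) = 1 by rewrite h cos0.
      by rewrite acosK ?in_itv// => e1; move: cq; rewrite e1; nra.
    move=> h; have : 0 < acos q1 by rewrite lt_neqAle eq_sym h a0.
    by lra.
  + rewrite /cexp addrC mulr_natl sinD2pi cosD2pi sinN cosN.
    by rewrite acosK ?in_itv//= sin_acos// sq ltr0_norm// opprK.
Qed.

(** Equal points have [cos (b - a) = 1], so the sine of half the difference vanishes, which is
    impossible strictly between 0 and [pi]. *)
Lemma cexp_inj t0 a b : t0 <= a -> a < t0 + 2 * pi -> t0 <= b ->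
  b < t0 + 2 * pi -> cexp a = cexp b :> plane -> a = b.
Proof.
wlog ab : a b / a <= b.
  move=> W; have [/W//|/ltW/W h *] := leP a b; exact/esym/h.
move=> a0 a1 b0 b1 [c s]; apply/eqP; rewrite eq_le ab leNgt/=; apply/negP => lab.
have s0 : 0 < sin ((b - a) / 2) by apply: sin_gt0_pi; apply/andP; split; lra.
have : cos (b - a) = 1 by rewrite cosB c s -!expr2 cos2Dsin2.
have -> : b - a = ((b - a) / 2) *+ 2 by rewrite mulr2n; field.
rewrite cos_mulr2n cos2sin2 mulr2n => e.
by have := mulr_gt0 s0 s0; rewrite -expr2; lra.
Qed.

Lemma area_cexp_gt0 a b c : a < b -> b < c -> c < a + 2 * pi ->
  0 < area (cexp a) (cexp b) (cexp c).
Proof.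
move=> ab bc ca; have pi0 := pi_gt0 R; rewrite area_cexp.
have H (d : R) : 0 < d -> d < 2 * pi -> 0 < sin (d / 2).
  by move=> *; apply: sin_gt0_pi; apply/andP; split; lra.
by rewrite !mulr_gt0// H//; lra.
Qed.

(** Questions of cyclic order become linear arithmetic: with all angles in one window, starting at
    any [t0], positive orientation is one of the three rotations of a linear order. *)
Lemma area_cexp_order t0 a b c : t0 <= a < t0 + 2 * pi ->
  t0 <= b < t0 + 2 * pi -> t0 <= c < t0 + 2 * pi ->
  (0 < area (cexp a) (cexp b) (cexp c)) =
  [|| (a < b) && (b < c), (b < c) && (c < a) | (c < a) && (a < b)].
Proof.
move=> /andP[a0 a1] /andP[b0 b1] /andP[c0 c1]; apply/idP/idP; last first.
  case/or3P => /andP[h1 h2].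
  - by apply: area_cexp_gt0; lra.
  - by rewrite area_rot; apply: area_cexp_gt0; lra.
  - by rewrite -area_rot; apply: area_cexp_gt0; lra.
have [->|nab] := eqVneq a b; first by rewrite areaxx !ltxx.
have [->|nac] := eqVneq a c; first by rewrite areaxyx !ltxx.
have [->|nbc] := eqVneq b c; first by rewrite areaxyy !ltxx.
have H (x y z : R) : x < y -> y < z -> t0 <= x -> z < t0 + 2 * pi ->
    0 < area (cexp x) (cexp y) (cexp z).
  by move=> *; apply: area_cexp_gt0; lra.
move: nab nac nbc; rewrite !neq_lt => /orP[ab|ab] /orP[ac|ac] /orP[bc|bc];
  rewrite ?ab ?bc ?ac ?andbT ?orbT//=.
- by rewrite area_swap oppr_gt0 area_rot lt_gtF// H.
- by rewrite area_swap oppr_gt0 lt_gtF// H.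
- by rewrite area_swap oppr_gt0 lt_gtF// H.
- by rewrite area_swap oppr_gt0 -area_rot lt_gtF// H.
Qed.

End Circle.

(** * Chords of the disk *)

Section Chords.
Context {R : realType}.
Local Notation plane := (plane R).
Implicit Types (x y z p q u v w : plane) (a b c s t : R) (A B C : set plane).

Definition sq p : R := (p.1 : R) ^+ 2 + (p.2 : R) ^+ 2.

Lemma diskE p : disk p = (sq p <= 1) :> Prop. Proof. by []. Qed.
Lemma odiskE p : open_disk p = (sq p < 1) :> Prop. Proof. by []. Qed.
Lemma circleE p : circle p = (sq p = 1) :> Prop. Proof. by []. Qed.

(** The metric of the product type is the sup distance; the squared Euclidean distance is polynomial
    and fits the equation of the circle. *)
Definition dsq p q : R := ((p.1 : R) - q.1) ^+ 2 + ((p.2 : R) - q.2) ^+ 2.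

Lemma dsq_ge0 p q : 0 <= dsq p q.
Proof. by rewrite addr_ge0// sqr_ge0. Qed.

Lemma dsq_eq0 p q : (dsq p q == 0) = (p == q).
Proof.
apply/idP/eqP => [|->]; last by rewrite /dsq !subrr expr0n/= addr0.
rewrite /dsq paddr_eq0 ?sqr_ge0// !sqrf_eq0 !subr_eq0 => /andP[/eqP h1 /eqP h2].
exact: plane_eq.
Qed.

Lemma dsq_gt0 p q : (0 < dsq p q) = (p != q).
Proof. by rewrite lt_neqAle dsq_ge0 andbT eq_sym dsq_eq0. Qed.

Lemma circle_disk p : circle p -> disk p.
Proof. by rewrite circleE diskE => ->. Qed.

Lemma odisk_disk p : open_disk p -> disk p.
Proof. by rewrite odiskE diskE => /ltW. Qed.

Lemma odisk_ncircle p : open_disk p -> ~ circle p.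
Proof. by rewrite odiskE circleE => h e; rewrite e ltxx in h. Qed.

Lemma disk_case p : disk p -> open_disk p \/ circle p.
Proof.
by rewrite diskE odiskE circleE le_eqVlt => /orP[/eqP|]; [right|left].
Qed.

(** The last term is the defect of convexity of the squared norm; where it is positive, chords run
    in the open disk. *)
Lemma sq_mix s p q :
  sq (mix s p q) = (1 - s) * sq p + s * sq q - s * (1 - s) * dsq p q.
Proof. by case: p q => [p1 p2] [q1 q2]; rewrite /sq/dsq/=; ring. Qed.

Lemma mix0 p q : mix 0 p q = p.
Proof. by apply: plane_eq => /=; ring. Qed.
Lemma mix1 p q : mix 1 p q = q.
Proof. by apply: plane_eq => /=; ring. Qed.
Lemma mixxx s p : mix s p p = p.
Proof. by apply: plane_eq => /=; ring. Qed.
Lemma mixC s p q : mix s p q = mix (1 - s) q p.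
Proof. by apply: plane_eq => /=; ring. Qed.

Definition cvx C := forall p q s, C p -> C q -> 0 <= s -> s <= 1 -> C (mix s p q).

Lemma cvx_disk : cvx disk.
Proof.
move=> p q s; rewrite !diskE sq_mix => dp dq s0 s1; have d0 := dsq_ge0 p q.
have s1' : 0 <= 1 - s by lra.
have h1 := ler_wpM2l s1' dp; have h2 := ler_wpM2l s0 dq.
have h3 := mulr_ge0 (mulr_ge0 s0 s1') d0; lra.
Qed.

Lemma odisk_mix s p q : disk p -> disk q -> p <> q -> 0 < s -> s < 1 ->
  open_disk (mix s p q).
Proof.
move=> dp dq /eqP; rewrite -dsq_gt0 odiskE sq_mix => d s0 s1.
move: dp dq; rewrite !diskE => dp dq.
have h3 : 0 < s * (1 - s) * dsq p q by rewrite !mulr_gt0// subr_gt0.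
have s1' : 0 <= 1 - s by lra.
have h1 := ler_wpM2l s1' dp; have h2 := ler_wpM2l (ltW s0) dq; lra.
Qed.

Lemma odisk_mixl s p q : open_disk p -> disk q -> 0 <= s -> s < 1 ->
  open_disk (mix s p q).
Proof.
move=> dp dq; rewrite le_eqVlt => /orP[/eqP<- _|s0 s1]; first by rewrite mix0.
have [<-|/eqP pq] := eqVneq p q; first by rewrite mixxx.
exact: (odisk_mix (odisk_disk dp)).
Qed.

Lemma odisk_mixr s p q : disk p -> open_disk q -> 0 < s -> s <= 1 ->
  open_disk (mix s p q).
Proof. by move=> dp dq s0 s1; rewrite mixC; apply: odisk_mixl => //; lra. Qed.

Lemma cvx_ge x y : cvx [set p | 0 <= area x y p].
Proof. by move=> p q s /= hp hq s0 s1; rewrite area_mix; nra. Qed.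

Lemma cvx_gt x y : cvx [set p | 0 < area x y p].
Proof. by move=> p q s /= hp hq s0 s1; rewrite area_mix; nra. Qed.

(** [conv] puts its parameter on the first point and [mix] on the second, whence the exchange of [s]
    and [1 - s]. *)
Lemma convex_setP C : @convex_set R plane C <-> cvx C.
Proof.
split=> h.
- move=> p q s Cp Cq s0 s1.
  have h0 : 0 <= 1 - s by lra.
  have h1 : 1 - s <= 1 by lra.
  have := h p q (Itv01 h0 h1) (mem_set Cp) (mem_set Cq); rewrite inE.
  have oE : unstable.onem (1 - s) = s by rewrite /unstable.onem subKr.
  by congr C; apply: plane_eq => /=; rewrite oE.
- move=> p q l; rewrite !inE => Cp Cq.
  have -> : conv l p q = mix (1 - l%:num) p q.
    by apply: plane_eq => /=; rewrite subKr.
  by apply: h => //; rewrite ?subr_ge0// lerBlDr lerDl.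
Qed.

Lemma conv_hull_cvx A : cvx (conv_hull A).
Proof.
move=> p q s Ap Aq s0 s1 C CA; have [/convex_setP cC _] := CA.
exact: (cC p q s (Ap C CA) (Aq C CA) s0 s1).
Qed.

Lemma sub_conv_hull A : A `<=` conv_hull A.
Proof. by move=> p Ap C [_]; apply. Qed.

Lemma conv_hull_min A C : cvx C -> A `<=` C -> conv_hull A `<=` C.
Proof. by move=> cC AC p; apply; split => //; apply/convex_setP. Qed.

Lemma geodesicP x y p : geodesic [set x; y] p <->
  exists s, [/\ 0 <= s, s <= 1 & p = mix s x y].
Proof.
split=> [|[s [s0 s1 ->]]]; last first.
  by apply: conv_hull_cvx => //; apply: sub_conv_hull; [left|right].
suff H : geodesic [set x; y] `<=`
   [set p | exists s, [/\ 0 <= s, s <= 1 & p = mix s x y]] by exact: H.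
apply: conv_hull_min.
- move=> u v k [a [a0 a1 ->]] [b [b0 b1 ->]] k0 k1.
  exists ((1 - k) * a + k * b); split; [nra|nra|].
  by apply: plane_eq => /=; ring.
- move=> u [->|->]; [exists 0; rewrite mix0|exists 1; rewrite mix1];
  by split.
Qed.

(* Completing the square along the chord: |x + s (y - x)|^2 = 1 - s (1 - s) |y - x|^2 when x and
   y are on the circle. *)
Lemma disk_chord x y p : circle x -> circle y -> x <> y -> disk p ->
  area x y p = 0 -> exists s, [/\ 0 <= s, s <= 1 & p = mix s x y].
Proof.
move=> cx cy /eqP; rewrite -dsq_gt0 => d dp e.
pose s := (((p.1 : R) - x.1) * ((y.1 : R) - x.1) +
           ((p.2 : R) - x.2) * ((y.2 : R) - x.2)) / dsq x y.
have d0 : dsq x y != 0 by rewrite gt_eqF.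
have ps : p = mix s x y.
  have H (d1 d2 e1 e2 : R) : d1 ^+ 2 + d2 ^+ 2 != 0 -> d1 * e2 = d2 * e1 ->
      e1 = (e1 * d1 + e2 * d2) / (d1 ^+ 2 + d2 ^+ 2) * d1.
    move=> n0 de; apply: (mulIf n0); rewrite mulrAC divfK//.
    have -> : (e1 * d1 + e2 * d2) * d1 = e1 * d1 ^+ 2 + (d1 * e2) * d2 by ring.
    by rewrite de; ring.
  have dE : dsq x y = (y.1 - x.1 : R) ^+ 2 + (y.2 - x.2 : R) ^+ 2.
    by rewrite /dsq; ring.
  have n1 := d0; rewrite dE in n1.
  have n2 := n1; rewrite addrC in n2.
  move/eqP: e; rewrite /area subr_eq0 => /eqP e.
  have h1 := H _ _ _ _ n1 e; have h2 := H _ _ _ _ n2 (esym e).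
  apply: plane_eq; rewrite /= /s dE.
  - by rewrite mulrBl mul1r -addrA [X in _ + X]addrC -mulrBr -h1 addrC subrK.
  - rewrite mulrBl mul1r -addrA [X in _ + X]addrC -mulrBr.
    by rewrite [X in _ + X / _ * _]addrC [X in _ + _ / X * _]addrC -h2 addrC subrK.
exists s; rewrite -ps; move: dp; rewrite diskE ps sq_mix.
move: cx cy; rewrite !circleE => -> -> h.
have : s * (1 - s) >= 0.
  rewrite leNgt; apply/negP => n0.
  have : s * (1 - s) * dsq x y < 0 by rewrite pmulr_llt0.
  lra.
by move=> h0; split=> //; nra.
Qed.

End Chords.

(** * Crossing chords and clusters *)

Section Crossing.
Context {R : realType}.
Local Notation plane := (plane R).
Implicit Types (x y z p q u v w : plane) (a b c s t : R) (A B C Y : set plane)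
  (S : set (set plane)).

(** The line through [x] and [y] strictly separates [u] from [v]. For four points of the circle this
    is the crossing of two chords, and then symmetric in the two pairs. *)
Definition sep x y u v := area x y u * area x y v < 0.

Lemma set2C x y : [set x; y] = [set y; x] :> set plane.
Proof. by rewrite setUC. Qed.

Lemma set2_inj x y u v : [set x; y] = [set u; v] ->
  (x = u /\ y = v) \/ (x = v /\ y = u).
Proof.
move=> e.
have hx : [set u; v] x by rewrite -e; left.
have hy : [set u; v] y by rewrite -e; right.
have hu : [set x; y] u by rewrite e; left.
have hv : [set x; y] v by rewrite e; right.
case: hx => hx; case: hy => hy; [|by left|by right|]; rewrite /= in hx hy.
- by left; split=> //; subst x y; case: hv.
- by right; split=> //; subst x y; case: hu.
Qed.

Lemma set2_neq x y u v : [set x; y] = [set u; v] -> x <> y -> u <> v.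
Proof. by move=> /set2_inj[] [-> ->] // h e; apply: h. Qed.

Lemma sepC x y u v : sep x y v u = sep x y u v.
Proof. by rewrite /sep mulrC. Qed.

Lemma sepS x y u v : sep y x u v = sep x y u v.
Proof. by rewrite /sep ![area y x _]area_swap mulrNN. Qed.

Lemma sep_case x y u v : sep x y u v ->
  (0 < area x y u /\ area x y v < 0) \/ (area x y u < 0 /\ 0 < area x y v).
Proof.
rewrite /sep; have [h|h|->] := ltgtP (area x y u) 0; last by rewrite mul0r ltxx.
  by rewrite nmulr_rlt0// => ?; right.
by rewrite pmulr_rlt0// => ?; left.
Qed.

Lemma sep_neq x y u v : sep x y u v -> x <> y.
Proof. by move=> h e; move: h; rewrite /sep e !areaxx mulr0 ltxx. Qed.

Lemma sep_neq2 x y u v : sep x y u v -> u <> v.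
Proof. by move=> h e; move: h; rewrite /sep e -expr2 ltNge sqr_ge0. Qed.

Lemma sep_disj x y u v : sep x y u v -> [/\ u <> x, u <> y, v <> x & v <> y].
Proof.
by rewrite /sep => h; split=> e; move: h;
  rewrite e ?areaxyx ?areaxyy ?mulr0 ?mul0r ltxx.
Qed.

(** A line meets the circle in at most two points, because the inner points of a chord are in the
    open disk. *)
Lemma area_circle0 x y z : circle x -> circle y -> circle z -> x <> y ->
  area x y z = 0 -> z = x \/ z = y.
Proof.
move=> cx cy cz xy e.
have [s [s0 s1 zE]] := disk_chord cx cy xy (circle_disk cz) e.
have [s0'|s0'] := eqVneq s 0; first by left; rewrite zE s0' mix0.
have [s1'|s1'] := eqVneq s 1; first by right; rewrite zE s1' mix1.
have : open_disk z.
  rewrite zE; apply: odisk_mix; [exact: circle_disk|exact: circle_disk|by []| |].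
  - by rewrite lt_neqAle eq_sym s0'.
  - by rewrite lt_neqAle s1'.
by move/odisk_ncircle.
Qed.

Lemma area_circle_neq0 x y z : circle x -> circle y -> circle z -> x <> y ->
  z <> x -> z <> y -> area x y z != 0.
Proof.
by move=> cx cy cz xy zx zy; apply/eqP => /(area_circle0 cx cy cz xy)[].
Qed.

Lemma crossingC A B : crossing A B -> crossing B A.
Proof.
move=> [AB [p [[pA pB] po]]]; split; first by move=> e; apply: AB.
by exists p.
Qed.

Lemma crossingP x y u v : circle x -> circle y -> circle u -> circle v ->
  x <> y -> u <> v -> crossing [set x; y] [set u; v] <-> sep x y u v.
Proof.
move=> cx cy cu cv xy uv; split.
- move=> [AB [p [[/geodesicP[s [s0 s1 ps]] /geodesicP[t [t0 t1 pt]]] po]]].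
  (* [area x y] is affine along the chord [uv] and vanishes at the common point, which is not an end
     of the chord; so it has opposite signs at [u] and [v], unless it vanishes at both. *)
  have e : (1 - t) * area x y u + t * area x y v = 0.
    by rewrite -area_mix -pt ps area_mix areaxyx areaxyy !mulr0 addr0.
  have tn0 : t != 0.
    by apply/eqP => t00; apply: (odisk_ncircle po); rewrite pt t00 mix0.
  have tn1 : t != 1.
    by apply/eqP => t00; apply: (odisk_ncircle po); rewrite pt t00 mix1.
  have {}t0 : 0 < t by rewrite lt_neqAle eq_sym tn0.
  have {}t1 : 0 < 1 - t by rewrite subr_gt0 lt_neqAle tn1.
  have n1 : area x y u = 0 -> area x y v = 0 -> False.
    move=> /(area_circle0 cx cy cu xy) h1 /(area_circle0 cx cy cv xy) h2.
    apply: AB; case: h1 => h1; case: h2 => h2; subst u v => //.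
    by rewrite set2C.
  rewrite /sep.
  have [h|h|h] := ltgtP (area x y u) 0.
  + by rewrite nmulr_rlt0//; nra.
  + by rewrite pmulr_rlt0//; nra.
  + exfalso; apply: n1 => //; move/eqP: e; rewrite h mulr0 add0r mulf_eq0.
    by rewrite (negPf tn0)/= => /eqP.
- move=> h; have [ux uy vx vy] := sep_disj h; split.
    by move=> /set2_inj[[e1 e2]|[e1 e2]]; [apply: ux|apply: vx].
  wlog hu : u v cu cv uv h ux uy vx vy / 0 < area x y u.
    move=> W; have [[h1 _]|[_ h2]] := sep_case h; first exact: (W u v).
    rewrite [in geodesic [set u; v]]set2C; apply: (W v u) => //.
      by move=> e; apply: uv.
    by rewrite sepC.
  have hv : area x y v < 0 by have [[]//|[]] := sep_case h; lra.
  (* Parameter of the zero of the affine function [area x y] on the segment from [u] to [v]. *)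
  pose t := area x y u / (area x y u - area x y v).
  have d0 : 0 < area x y u - area x y v by lra.
  have t0 : 0 < t by rewrite divr_gt0.
  have t1 : t < 1 by rewrite ltr_pdivrMr// mul1r; lra.
  have dm : open_disk (mix t u v) by apply: odisk_mix => //; exact: circle_disk.
  exists (mix t u v); split=> //; split; last first.
    by apply/geodesicP; exists t; split=> //; exact: ltW.
  apply/geodesicP; apply: disk_chord => //; first exact: odisk_disk.
  rewrite area_mix; have td : t * (area x y u - area x y v) = area x y u.
    by rewrite divfK// gt_eqF.
  lra.
Qed.

(** [sep] compares a line with a pair and is not symmetric for arbitrary points; on the circle it
    inherits the symmetry of [crossing]. *)
Lemma sep_sym x y u v : circle x -> circle y -> circle u -> circle v ->
  sep x y u v -> sep u v x y.
Proof.
move=> cx cy cu cv h; apply/crossingP => //; first exact: sep_neq2 h.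
  exact: sep_neq h.
by apply: crossingC; apply/crossingP => //; [exact: sep_neq h|exact: sep_neq2 h].
Qed.

Lemma next_area Y x y u : Y `<=` circle -> x <> y -> next_point Y x y -> Y u ->
  [\/ u = x, u = y | 0 < area x y u].
Proof.
move=> Yc xy [a [b [[ab Ya Yb H] xE yE]]] Yu; subst x y.
(* A full turn comes back to [x] itself, so the lift of the next point cannot be farther away. *)
have b1 : b < a + 2 * pi.
  rewrite ltNge le_eqVlt; apply/negP => /orP[/eqP h|h].
    by apply: xy; rewrite -h cexpD2pi.
  apply: (H (a + 2 * pi)); last by rewrite cexpD2pi.
  by have := pi_gt0 R => ?; apply/andP; split; lra.
have [c [c0 c1 uE]] := cexp_surj a (Yc _ Yu); subst u.
have [->|ac] := eqVneq c a; first by constructor 1.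
have [->|bc] := eqVneq c b; first by constructor 2.
have [cb|cb] := ltP c b.
  exfalso; apply: (H c) => //; rewrite cb andbT lt_neqAle eq_sym ac//.
constructor 3; apply: area_cexp_gt0 => //.
by rewrite lt_neqAle eq_sym bc.
Qed.

Lemma next_pointY Y x y : next_point Y x y -> Y x /\ Y y.
Proof. by move=> [a [b [[_ ? ? _] -> ->]]]. Qed.

Lemma area_next Y x y : Y `<=` circle -> x <> y -> Y x -> Y y ->
  (forall u, Y u -> 0 <= area x y u) -> next_point Y x y.
Proof.
move=> Yc xy Yx Yy H.
have [a [_ _ xE]] := cexp_surj 0 (Yc _ Yx).
have [b [b0 b1 yE]] := cexp_surj a (Yc _ Yy); subst x y.
have ab : a < b.
  by rewrite lt_neqAle b0 andbT; apply/eqP => e; apply: xy; rewrite e.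
exists a, b; split=> //; split=> // c /andP[ac cb] Yc'.
have := H _ Yc'; rewrite area_rot -area_rot area_rot area_rot area_swap.
by rewrite oppr_ge0 leNgt area_cexp_gt0.
Qed.

Lemma nextP Y x y : Y `<=` circle -> x <> y ->
  next_point Y x y <-> [/\ Y x, Y y & forall u, Y u -> 0 <= area x y u].
Proof.
move=> Yc xy; split=> [n|[? ? ?]]; last exact: area_next.
have [Yx Yy] := next_pointY n; split=> // u /(next_area Yc xy n)[->|->|/ltW//].
- by rewrite areaxyx.
- by rewrite areaxyy.
Qed.

Lemma boundary_edgeP Y x y : x <> y ->
  boundary_edge Y [set x; y] <-> next_point Y x y \/ next_point Y y x.
Proof.
move=> xy; split=> [[u [v [n /set2_inj[[-> ->]|[-> ->]]]]]|[n|n]].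
- by left.
- by right.
- by exists x, y.
- by exists y, x; rewrite set2C.
Qed.

Lemma boundary_nsep Y x y u v : Y `<=` circle -> Y u -> Y v ->
  boundary_edge Y [set x; y] -> ~ sep x y u v.
Proof.
move=> Yc Yu Yv n h; have xy := sep_neq h.
have {}n := (boundary_edgeP Y xy).1 n.
wlog {n} n : x y xy h / next_point Y x y.
  move=> W; case: n => n; first exact: (W x y).
  by apply: (W y x) => //; [move=> e; apply: xy|rewrite sepS].
have [_ _ H] := (nextP Yc xy).1 n.
have := H _ Yu; have := H _ Yv; have [[]|[]] := sep_case h; lra.
Qed.

Lemma nsep_boundary Y x y : Y `<=` circle -> x <> y -> Y x -> Y y ->
  (forall u v, Y u -> Y v -> ~ sep x y u v) -> boundary_edge Y [set x; y].
Proof.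
move=> Yc xy Yx Yy H; apply/boundary_edgeP => //.
have [K|] := pselect (forall u, Y u -> 0 <= area x y u).
  by left; exact: area_next.
move=> /existsNP[u /not_implyP[Yu /negP]]; rewrite -ltNge => hu; right.
apply: area_next => //; first by move=> e; apply: xy.
move=> v Yv; rewrite area_swap oppr_ge0 leNgt; apply/negP => hv.
by apply: (H u v Yu Yv); rewrite /sep pmulr_llt0.
Qed.

(** A chord fails to be a boundary edge exactly when points of [Y] lie strictly on both of its
    sides. *)
Lemma objectsP Y A : Y `<=` circle -> objects Y A <->
  exists x y u v, [/\ Y x, Y y, Y u, Y v & A = [set x; y] /\ sep x y u v].
Proof.
move=> Yc; split.
- move=> [x [y [Yx Yy [yx n1 n2] AE]]]; apply: contrapT => H.
  have xy : x <> y by move=> e; apply: yx.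
  have : boundary_edge Y [set x; y].
    by apply: nsep_boundary => // u v Yu Yv h; apply: H; exists x, y, u, v.
  by move/(boundary_edgeP Y xy) => [].
- move=> [x [y [u [v [Yx Yy Yu Yv [AE h]]]]]]; exists x, y; split=> //.
  have xy := sep_neq h.
  have nb : ~ boundary_edge Y [set x; y] by move/(boundary_nsep Yc Yu Yv).
  by split=> [e|n|n]; [exact: xy|apply: nb; apply/boundary_edgeP; [|left]
    |apply: nb; apply/boundary_edgeP; [|right]].
Qed.

(** Maximality need only be tested by adding one chord, so being a cluster becomes a condition on
    [sep] alone; this form is the one transported between circles. *)
Lemma clusterP Y S : Y `<=` circle -> is_cluster Y S <->
  [/\ forall A, S A -> exists x y u v,
        [/\ Y x, Y y, Y u, Y v & A = [set x; y] /\ sep x y u v],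
      forall x y u v, S [set x; y] -> S [set u; v] -> ~ sep x y u v &
      forall x y, Y x -> Y y -> (exists u v, [/\ Y u, Y v & sep x y u v]) ->
        (forall u v, S [set u; v] -> ~ sep x y u v) -> S [set x; y]].
Proof.
move=> Yc; split.
- move=> [[SO SN] SM].
  have SP A : S A -> exists x y u v,
        [/\ Y x, Y y, Y u, Y v & A = [set x; y] /\ sep x y u v].
    by move/SO/(objectsP A Yc).
  have SY x y : S [set x; y] -> [/\ circle x, circle y & x <> y].
    move=> /SP[x' [y' [u' [v' [Yx Yy _ _ [+ /sep_neq h]]]]]].
    by move=> e; split; [| |exact: (set2_neq (esym e))];
      case: (set2_inj e) => [[ex ey]|[ex ey]]; rewrite ?ex ?ey; exact: Yc.
  split=> //.
  + move=> x y u v Sx Su h.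
    have [cx cy xy] := SY _ _ Sx; have [cu cv uv] := SY _ _ Su.
    by apply: (SN _ _ Sx Su); apply/crossingP.
  + move=> x y Yx Yy [u0 [v0 [Yu Yv hs]]] H.
    have xy := sep_neq hs.
    have Hc B : S B -> ~ crossing [set x; y] B.
      move=> SB; have [u [v [? [? [Yu' Yv' _ _ [BE h]]]]]] := SP _ SB.
      subst B; have uv := sep_neq h.
      by move/(crossingP (Yc _ Yx) (Yc _ Yy) (Yc _ Yu') (Yc _ Yv') xy uv)/H; apply.
    suff <- : S `|` [set [set x; y]] = S by right.
    apply: SM; last by move=> B; left.
    split.
      move=> B [/SO//|->]; apply/(objectsP _ Yc).
      by exists x, y, u0, v0.
    move=> B C [SB|->] [SC|->].
    * exact: SN.
    * by move/crossingC/Hc; apply.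
    * exact: Hc.
    * by case.
- move=> [SP SN SM]; split; first split.
  + by move=> A /SP h; apply/objectsP.
  + move=> A B SA SB.
    have [x [y [u [v [Yx Yy _ _ [AE /sep_neq xy]]]]]] := SP _ SA.
    have [x' [y' [u' [v' [Yx' Yy' _ _ [BE /sep_neq xy']]]]]] := SP _ SB.
    subst A B; move/(crossingP (Yc _ Yx) (Yc _ Yy) (Yc _ Yx') (Yc _ Yy') xy xy').
    exact: SN.
  + move=> S' [S'O S'N] SS'; apply/seteqP; split=> // A S'A.
    have [x [y [u [v [Yx Yy Yu Yv [AE h]]]]]] := (objectsP A Yc).1 (S'O _ S'A).
    subst A; apply: SM => //; first by exists u, v.
    move=> u' v' Suv h'; apply: (S'N _ _ S'A (SS' _ Suv)).
    have [a [b [? [? [Ya Yb _ _ [e /sep_neq ab]]]]]] := SP _ Suv.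
    have hab : sep x y a b.
      by move: h'; case: (set2_inj e) => [[-> ->]|[-> ->]] //; rewrite sepC.
    rewrite e; apply/crossingP; [exact: Yc|exact: Yc|exact: Yc|exact: Yc| | |] => //.
    exact: sep_neq h'.
Qed.

End Crossing.

(** * Topology of the plane *)

Section PlaneTopology.
Context {R : realType}.
Local Notation plane := (plane R).
Implicit Types (x y z p q u v w : plane) (a b c s t : R) (A B C Y : set plane).

Lemma nbhs_planeP p (U : set plane) : nbhs p U <->
  exists e : R, 0 < e /\ forall q, `|(p.1 : R) - q.1| < e ->
    `|(p.2 : R) - q.2| < e -> U q.
Proof.
split.
- move/nbhs_ballP => [e /= e0 H]; exists e; split => // q h1 h2; apply: H.
  by split.
- move=> [e [e0 H]]; apply/nbhs_ballP; exists e => //= q [h1 h2].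
  exact: H.
Qed.

Section Cvg.
Context {T : Type} (F : set_system T) {FF : Filter F}.

Lemma cvg_plane (f : T -> plane) p :
  (fun i => (f i).1 : R) @ F --> (p.1 : R) ->
  (fun i => (f i).2 : R) @ F --> (p.2 : R) -> f @ F --> p.
Proof.
move=> h1 h2; rewrite (surjective_pairing p).
have -> : f = (fun i => ((f i).1, (f i).2)).
  by apply: funext => i; case: (f i).
exact: (@cvg_pair T R^o R^o F (nbhs p.1) (nbhs p.2) FF _ _ _ _ h1 h2).
Qed.

Lemma cvg_coord1 (f : T -> plane) p : f @ F --> p ->
  (fun i => (f i).1 : R) @ F --> (p.1 : R).
Proof. by move=> h; apply: cvg_comp h _; exact: cvg_fst. Qed.

Lemma cvg_coord2 (f : T -> plane) p : f @ F --> p ->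
  (fun i => (f i).2 : R) @ F --> (p.2 : R).
Proof. by move=> h; apply: cvg_comp h _; exact: cvg_snd. Qed.

Lemma cvg_area (f g h : T -> plane) x y z : f @ F --> x -> g @ F --> y ->
  h @ F --> z -> (fun i => area (f i) (g i) (h i)) @ F --> area x y z.
Proof.
move=> fx gy hz; have f1 := cvg_coord1 fx; have f2 := cvg_coord2 fx.
have g1 := cvg_coord1 gy; have g2 := cvg_coord2 gy.
have h1 := cvg_coord1 hz; have h2 := cvg_coord2 hz.
by apply: cvgB; apply: cvgM; apply: cvgB.
Qed.

Lemma cvg_mix (k : T -> R) (f g : T -> plane) s x y : k @ F --> s ->
  f @ F --> x -> g @ F --> y -> (fun i => mix (k i) (f i) (g i)) @ F --> mix s x y.
Proof.
move=> ks fx gy; have f1 := cvg_coord1 fx; have f2 := cvg_coord2 fx.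
have g1 := cvg_coord1 gy; have g2 := cvg_coord2 gy.
by apply: cvg_plane => /=; apply: cvgD; apply: cvgM => //; apply: cvgB => //;
  exact: cvg_cst.
Qed.

Lemma cvg_sq (f : T -> plane) x : f @ F --> x ->
  (fun i => sq (f i)) @ F --> sq x.
Proof.
move=> fx; have f1 := cvg_coord1 fx; have f2 := cvg_coord2 fx.
rewrite /sq; under eq_fun do rewrite !expr2; rewrite !expr2.
by apply: cvgD; apply: cvgM.
Qed.

Lemma cvg_dsq (f g : T -> plane) x y : f @ F --> x -> g @ F --> y ->
  (fun i => dsq (f i) (g i)) @ F --> dsq x y.
Proof.
move=> fx gy; have f1 := cvg_coord1 fx; have f2 := cvg_coord2 fx.
have g1 := cvg_coord1 gy; have g2 := cvg_coord2 gy.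
rewrite /dsq; under eq_fun do rewrite !expr2; rewrite !expr2.
by apply: cvgD; apply: cvgM; apply: cvgB.
Qed.

Lemma cvg_cexp (f : T -> R) t : f @ F --> t ->
  (fun i => cexp (f i) : plane) @ F --> (cexp t : plane).
Proof.
move=> ft; apply: cvg_plane => /=.
  by apply: cvg_comp ft _; exact: continuous_cos.
by apply: cvg_comp ft _; exact: continuous_sin.
Qed.

End Cvg.

Lemma continuous_area x y : continuous (area x y : plane -> R).
Proof. by move=> p; apply: cvg_area; [exact: cvg_cst|exact: cvg_cst|exact: cvg_id]. Qed.

Lemma continuous_sq : continuous (sq : plane -> R).
Proof. by move=> p; apply: cvg_sq; exact: cvg_id. Qed.

Lemma continuous_cexp : continuous (cexp : R -> plane).
Proof. by move=> t; apply: cvg_cexp; exact: cvg_id. Qed.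

Lemma closed_ge0 (T : topologicalType) (f : T -> R) : continuous f ->
  closed [set p | 0 <= f p].
Proof.
move=> cf; have -> : [set p | 0 <= f p] = f @^-1` [set t | 0 <= t] by [].
by apply: closed_comp => [p _|]; [exact: cf|exact: closed_ge].
Qed.

Lemma open_gt0 (T : topologicalType) (f : T -> R) : continuous f ->
  open [set p | 0 < f p].
Proof.
move=> cf; have -> : [set p | 0 < f p] = f @^-1` [set t | 0 < t] by [].
by apply: open_comp => [p _|]; [exact: cf|exact: open_gt].
Qed.

Lemma closed_disk : closed (disk : set plane).
Proof.
have -> : disk = [set p : plane | 0 <= 1 - sq p].
  by apply/seteqP; split=> p /=; rewrite diskE subr_ge0.
apply: closed_ge0 => p; apply: cvgB; [exact: cvg_cst|exact: continuous_sq].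
Qed.

Lemma open_odisk : open (open_disk : set plane).
Proof.
have -> : open_disk = [set p : plane | 0 < 1 - sq p].
  by apply/seteqP; split=> p /=; rewrite odiskE subr_gt0.
apply: open_gt0 => p; apply: cvgB; [exact: cvg_cst|exact: continuous_sq].
Qed.

Lemma closed_circle : closed (circle : set plane).
Proof.
have -> : circle = disk `&` [set p : plane | 0 <= sq p - 1].
  apply/seteqP; split=> p /=; rewrite circleE diskE subr_ge0.
    by move=> ->.
  by move=> [h1 h2]; apply/eqP; rewrite eq_le h1.
apply: closedI; first exact: closed_disk.
by apply: closed_ge0 => p; apply: cvgB; [exact: continuous_sq|exact: cvg_cst].
Qed.

Lemma compact_disk : compact (disk : set plane).
Proof.
have cI : compact ([set` `[(-1 : R), 1]] : set R^o) by exact: segment_compact.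
apply: (subclosed_compact closed_disk (compact_setX cI cI)).
move=> [p1 p2]; rewrite diskE /sq /= => h; split; rewrite /= in_itv /=;
  apply/andP; split; nra.
Qed.

Lemma compact_circle : compact (circle : set plane).
Proof.
apply: subclosed_compact compact_disk _; first exact: closed_circle.
by move=> p; exact: circle_disk.
Qed.

(** The sets containing all but finitely many points of [F] form a proper filter, whose cluster
    points are the accumulation points sought. *)
Lemma compact_infinite (T : topologicalType) (K F : set T) : compact K ->
  F `<=` K -> infinite_set F -> exists2 p, K p &
  forall U, nbhs p U -> infinite_set (U `&` F).
Proof.
move=> cK FK iF; pose G : set_system T := [set U | finite_set (F `\` U)].
have GG : ProperFilter G.
  apply: Build_ProperFilter_ex.
    move=> U fU; apply: contrapT => nU; apply: iF.
    suff -> : F = F `\` U by [].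
    apply/seteqP; split=> p Fp; last by case: Fp.
    by split=> // Up; apply: nU; exists p.
  split.
  - by rewrite /G/= setDT; exact: finite_set0.
  - move=> U W fU fW; rewrite /G/= setDIr; by rewrite finite_setU; split.
  - by move=> U W UW; apply: sub_finite_set => p [Fp nW]; split=> // /UW.
have [|p [Kp cp]] := cK G GG.
  rewrite /G/=; suff -> : F `\` K = set0 by exact: finite_set0.
  by apply/seteqP; split=> // p [/FK].
exists p => // U nU fU.
have [|q [[Fq nq] Uq]] := cp (F `\` U) U _ nU; last by [].
rewrite /G/=; apply: sub_finite_set fU => q [Fq nq]; split=> //.
by apply: contrapT => nUq; apply: nq.
Qed.

Lemma cvg_ball_seq (T : pseudoMetricType R) (u : nat -> T) l :
  (forall n, ball l n.+1%:R^-1 (u n)) -> u n @[n --> \oo] --> l.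
Proof.
move=> H; apply/cvg_ballP => e e0.
near=> n; apply: le_ball (H n).
rewrite invf_ple ?posrE//; apply: ltW.
near: n; exists (Num.bound (e^-1)) => //= n hn.
apply: lt_le_trans (archi_boundP _) _; first by rewrite invr_ge0 ltW.
by rewrite ler_nat; apply: leq_trans hn _.
Unshelve. all: by end_near. Qed.

(** Finite fibres allow the pairs to be chosen with [x n <> w] and [y n <> w'], which later makes
    both limits limit points. *)
Lemma infinite_pairs (F : set (plane * plane)) :
  (forall x y, F (x, y) -> circle x /\ circle y) ->
  (forall x, finite_set [set y | F (x, y)]) ->
  (forall y, finite_set [set x | F (x, y)]) -> infinite_set F ->
  exists w w' (x y : nat -> plane), [/\ circle w, circle w',
    forall n, [/\ F (x n, y n), x n <> w & y n <> w'],
    x n @[n --> \oo] --> w & y n @[n --> \oo] --> w'].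
Proof.
move=> Fc f1 f2 iF.
have FK : F `<=` circle `*` circle by move=> [x y] /Fc.
have [[w w'] [/= cw cw'] H] :=
  compact_infinite (compact_setX compact_circle compact_circle) FK iF.
have N (n : nat) : exists q : plane * plane,
    [/\ F q, q.1 <> w, q.2 <> w' & ball ((w, w') : plane * plane) n.+1%:R^-1 q].
  apply: contrapT => nE.
  have e0 : 0 < (n.+1%:R^-1 : R) by rewrite invr_gt0.
  apply: (H _ (nbhsx_ballx (w, w') _ e0)).
  apply: (@sub_finite_set _ _ ([set (w, y) | y in [set y | F (w, y)]] `|`
    [set (x, w') | x in [set x | F (x, w')]])).
    move=> [x y] [xb Fx].
    have [xw|xw] := pselect (x = w); first by left; exists y; rewrite /= -xw.
    have [yw|yw] := pselect (y = w'); first by right; exists x; rewrite /= -yw.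
    by exfalso; apply: nE; exists (x, y).
  by rewrite finite_setU; split; apply: finite_image.
have [q qP] := choice N.
have qc : q n @[n --> \oo] --> ((w, w') : plane * plane).
  by apply: cvg_ball_seq => n; have [] := qP n.
exists w, w', (fun n => (q n).1), (fun n => (q n).2); split=> //.
- by move=> n; have [Fq ? ? _] := qP n; split=> //; rewrite -surjective_pairing.
- by apply: cvg_comp qc _; exact: cvg_fst.
- by apply: cvg_comp qc _; exact: cvg_snd.
Qed.

End PlaneTopology.

(** * Minima over finite sets and caps cut off by a triangle *)

Section Triangles.
Context {R : realType}.
Local Notation plane := (plane R).
Implicit Types (x y z p q u v w : plane) (a b c s t : R) (A B C : set plane).

Lemma finite_argmin (T : choiceType) (A : set T) (f : T -> R) : finite_set A ->
  A !=set0 -> exists2 z, A z & forall i : T, A i -> f z <= f i.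
Proof.
move=> /finite_seqP[s ->] [x0 /= xs0].
have [i0 [r sE]] : exists (i : T) (r : seq T), s = i :: r.
  by case: s xs0 => // i r _; exists i, r.
rewrite sE {s xs0 sE}; elim: r i0 => [|j r IH] i0.
  by exists i0 => [|i]; rewrite /= inE// => /eqP->.
have [k kr km] := IH j; have [fki|fik] := leP (f k) (f i0).
  exists k => [|i]; first by rewrite /= inE kr orbT.
  by rewrite /= inE => /orP[/eqP->//|/km].
exists i0 => [|i]; first by rewrite /= inE eqxx.
by rewrite /= inE => /orP[/eqP->//|/km]; apply: le_trans; exact: ltW.
Qed.

Lemma area_order_base a b c : a <= b < a + 2 * pi -> a <= c < a + 2 * pi ->
  (0 < area (cexp a) (cexp b) (cexp c)) = (a < b) && (b < c).
Proof.
move=> hb hc; have pi0 := pi_gt0 R; move: (hb) (hc) => /andP[? ?] /andP[? ?].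
rewrite (@area_cexp_order _ a)//; last by lra.
apply/idP/idP => [|->//].
by case/or3P => /andP[? ?]//; apply/andP; split; lra.
Qed.

Lemma area_lt0 x y z : (area x y z < 0) = (0 < area y x z).
Proof. by rewrite [area y x z]area_swap oppr_gt0. Qed.

Lemma circle_between w w' : circle w -> circle w' -> w <> w' ->
  exists2 u, circle u & area w w' u < 0.
Proof.
move=> cw cw' ww'; have [a [_ _ wE]] := cexp_surj 0 cw.
have [b [b0 b1 w'E]] := cexp_surj a cw'; subst w w'.
have ab : a < b.
  by rewrite lt_neqAle b0 andbT; apply/eqP => e; apply: ww'; rewrite e.
exists (cexp ((a + b) / 2)); first exact: cexp_circle.
rewrite -area_rot area_lt0.
by apply: area_cexp_gt0; lra.
Qed.

(** A cap beyond one side stays on the inner side of the other two: if [q] beyond [ab] were also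
    beyond [bc], the segment from [q] to [a] would meet the chord [bc] at a point not strictly on
    the inner side of [ab], that is at [b], although this point is in the open disk. *)
Lemma cap_side x y z p : circle x -> circle y -> circle z -> disk p ->
  0 < area x y z -> area x y p <= 0 -> 0 <= area y z p /\ 0 <= area z x p.
Proof.
move=> cx cy cz dp h hp.
have H (a b c q : plane) : circle a -> circle b -> circle c -> disk q ->
    0 < area a b c -> area a b q <= 0 -> 0 <= area b c q.
  move=> {h hp dp} ca cb cc dq h1 h2; rewrite leNgt; apply/negP => h3.
  have hbca : 0 < area b c a by rewrite -area_rot.
  have d0 : 0 < area b c a - area b c q by lra.
  pose t := - area b c q / (area b c a - area b c q).
  have td : t * (area b c a - area b c q) = - area b c q.
    by rewrite divfK// gt_eqF.
  have t0 : 0 < t by rewrite divr_gt0// oppr_gt0.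
  have t1 : t < 1 by rewrite ltr_pdivrMr// mul1r; lra.
  have dr : disk (mix t q a).
    by apply: cvx_disk => //; [exact: circle_disk|exact: ltW|exact: ltW].
  have er : area b c (mix t q a) = 0 by rewrite area_mix; lra.
  have bc : b <> c by move=> e; move: h1; rewrite e areaxyy ltxx.
  have [s [s0 s1 rE]] := disk_chord cb cc bc dr er.
  have : area a b (mix t q a) = s * area a b c.
    by rewrite rE area_mix areaxyy mulr0 add0r.
  rewrite area_mix areaxyx mulr0 addr0 => e.
  have h5 : 0 <= s * area a b c by rewrite mulr_ge0// ltW.
  have h6 : 0 < 1 - t by lra.
  have h7 : area a b q = 0.
    apply/eqP; rewrite eq_le h2/=; rewrite -(pmulr_rge0 _ h6) e//.
  have s00 : s = 0.
    apply/eqP; move: e; rewrite h7 mulr0 => /esym/eqP.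
    by rewrite mulf_eq0 (gt_eqF h1) orbF.
  have ab : a <> b by move=> e'; move: h1; rewrite e' areaxx ltxx.
  have : ~ circle (mix t q a).
    apply: odisk_ncircle; apply: odisk_mix => //; first exact: circle_disk.
    by move=> qa; move: h3; rewrite qa; lra.
  by rewrite rE s00 mix0.
split; first exact: (H x).
(* A reflection reverses the orientation and thereby exchanges the two remaining sides. *)
pose conj (q : plane) : plane := ((q.1 : R), - (q.2 : R)).
have aC (a b c : plane) : area (conj a) (conj b) (conj c) = - area a b c.
  by rewrite /area/=; ring.
have sC (a : plane) : sq (conj a) = sq a by rewrite /sq/=; ring.
rewrite area_swap oppr_ge0.
have := H (conj y) (conj x) (conj z) (conj p).
rewrite !circleE !diskE !sC !aC oppr_ge0; apply => //.
  by rewrite -area_swap.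
by rewrite -area_swap.
Qed.

End Triangles.

(** * Locally finite clusters *)

Section Cluster.
Context {R : realType}.
Local Notation plane := (plane R).
Implicit Types (x y z p q u v w : plane) (a b c s t : R) (A B C : set plane).

Variables (Y : set plane) (S : set (set plane)).
Hypothesis Yc : Y `<=` circle.
Hypothesis Yi : infinite_set Y.

Lemma infinite_other (A : set plane) : finite_set A -> exists2 u, Y u & ~ A u.
Proof.
move=> fA; apply: contrapT => H; apply: Yi; apply: sub_finite_set fA => u Yu.
by apply: contrapT => nA; apply: H; exists u.
Qed.

(** A point is its own successor only across a full turn, and any other point of [Y] interrupts that
    turn. *)
Lemma next_neq x y : next_point Y x y -> x <> y.
Proof.
move=> [a [b [[ab Ya Yb H] -> ->]]] e.
have [u Yu nu] := infinite_other (finite_set1 (cexp a)).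
have [c [c0 c1 uE]] := cexp_surj a (Yc Yu); subst u.
have ac : a < c.
  by rewrite lt_neqAle c0 andbT; apply/eqP => e'; apply: nu; rewrite e'.
apply: (H c) => //; rewrite ac/= (lt_le_trans c1)// leNgt; apply/negP => h.
have pi0 := pi_gt0 R.
have ab' : a = b by apply: (cexp_inj (t0 := a)) e; lra.
by rewrite ab' ltxx in ab.
Qed.

Lemma next_uniq x y z : next_point Y x y -> next_point Y x z -> y = z.
Proof.
move=> n1 n2; have xy := next_neq n1; have xz := next_neq n2.
have [Yx Yy H1] := (nextP Yc xy).1 n1; have [_ Yz H2] := (nextP Yc xz).1 n2.
have e : area x y z = 0.
  apply/eqP; rewrite eq_le H1// andbT -oppr_ge0 -area_swap area_rot.
  exact: H2.
have [zx|->//] := area_circle0 (Yc Yx) (Yc Yy) (Yc Yz) xy e.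
by have := xz (esym zx).
Qed.

Lemma prev_uniq x y z : next_point Y y x -> next_point Y z x -> y = z.
Proof.
move=> n1 n2; have xy := next_neq n1; have xz := next_neq n2.
have [Yy Yx H1] := (nextP Yc xy).1 n1; have [Yz _ H2] := (nextP Yc xz).1 n2.
have e : area y x z = 0.
  apply/eqP; rewrite eq_le H1// andbT -oppr_ge0 -area_swap -area_rot.
  exact: H2.
have [->//|zx] := area_circle0 (Yc Yy) (Yc Yx) (Yc Yz) xy e.
by have := xz zx.
Qed.

Hypothesis cl : is_cluster Y S.

Lemma S_obj A : S A -> exists x y u v,
   [/\ Y x, Y y, Y u, Y v & A = [set x; y] /\ sep x y u v].
Proof. by have [H _ _] := (clusterP S Yc).1 cl; exact: H. Qed.

Lemma S_nsep x y u v : S [set x; y] -> S [set u; v] -> ~ sep x y u v.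
Proof. by have [_ H _] := (clusterP S Yc).1 cl; exact: H. Qed.

Lemma S_sep x y : S [set x; y] ->
  [/\ Y x, Y y, x <> y & exists u v, [/\ Y u, Y v & sep x y u v]].
Proof.
move=> /S_obj[a [b [u [v [Ya Yb Yu Yv [e h]]]]]].
have ab := sep_neq h; split; last first.
- exists u, v; split=> //; by case: (set2_inj e) => -[ex ey]; rewrite ex ey // sepS.
- exact: set2_neq (esym e) ab.
- by case: (set2_inj e) => -[ex ey]; rewrite ?ex ?ey.
- by case: (set2_inj e) => -[ex ey]; rewrite ?ex ?ey.
Qed.

Definition E x y := edge Y S [set x; y].

Lemma EC x y : E x y -> E y x. Proof. by rewrite /E set2C. Qed.

Lemma E_Y x y : E x y -> [/\ Y x, Y y & x <> y].
Proof.
move=> [/S_sep[]//|[u [v [n e]]]].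
have [Yu Yv] := next_pointY n; have uv := next_neq n.
split; last exact: set2_neq (esym e) uv.
- by case: (set2_inj e) => -[ex ey]; rewrite ?ex ?ey.
- by case: (set2_inj e) => -[ex ey]; rewrite ?ex ?ey.
Qed.

Lemma E_nsep x y u v : E x y -> E u v -> ~ sep x y u v.
Proof.
move=> Exy Euv; have [Yx Yy _] := E_Y Exy; have [Yu Yv _] := E_Y Euv.
case: Exy => [Sx|bx]; last exact: (boundary_nsep Yc Yu Yv bx).
case: Euv => [Su|bu]; first exact: (S_nsep Sx Su).
by move/(sep_sym (Yc Yx) (Yc Yy) (Yc Yu) (Yc Yv)); exact: (boundary_nsep Yc Yx Yy bu).
Qed.

Lemma S_nboundary x y : S [set x; y] -> ~ boundary_edge Y [set x; y].
Proof.
move=> /S_sep[_ _ _ [u [v [Yu Yv h]]]] bd.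
exact: (boundary_nsep Yc Yu Yv bd h).
Qed.

(** If points of [Y] lie on both sides, maximality of the cluster applies; otherwise the chord is a
    boundary edge. *)
Lemma E_max x y : Y x -> Y y -> x <> y ->
  (forall u v, S [set u; v] -> ~ sep x y u v) -> E x y.
Proof.
move=> Yx Yy xy H.
have [h|h] := pselect (exists u v, [/\ Y u, Y v & sep x y u v]).
  by left; have [_ _ K] := (clusterP S Yc).1 cl; exact: K.
right; apply: nsep_boundary => // u v Yu Yv h'; apply: h.
by exists u, v.
Qed.

Hypothesis lf : locally_finite Y S.

Lemma S_finite x : finite_set [set y | S [set x; y]].
Proof.
have [Yx|nYx] := pselect (Y x); last first.
  rewrite (_ : [set y | _] = set0)//.
  by apply/seteqP; split=> // y /= /S_sep[].
have -> : [set y | S [set x; y]] =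
    (fun y => [set x; y]) @^-1` [set A | S A /\ A x].
  by apply/seteqP; split=> y /=; [split=> //; left|case].
apply: finite_preimage; last exact: lf.
by move=> y z _ _ /set2_inj[[]|[-> ->]].
Qed.

Lemma finite_sub1 (T : choiceType) (A : set T) :
  (forall i j, A i -> A j -> i = j) -> finite_set A.
Proof.
move=> H; have [->|/set0P[i Ai]] := eqVneq A set0; first exact: finite_set0.
by apply: (sub_finite_set _ (finite_set1 i)) => j Aj; exact: H.
Qed.

Lemma next_finite x : finite_set [set y | next_point Y x y].
Proof. by apply: finite_sub1 => y z; exact: next_uniq. Qed.

Lemma prev_finite x : finite_set [set y | next_point Y y x].
Proof. by apply: finite_sub1 => y z; exact: prev_uniq. Qed.

Lemma E_cases x y : E x y <-> [\/ S [set x; y], next_point Y x y | next_point Y y x].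
Proof.
split=> [Exy|[?|n|n]]; last 3 first.
- by left.
- by right; apply/boundary_edgeP; [exact: next_neq|left].
- by right; apply/boundary_edgeP; [move=> e; exact: (next_neq n)|right].
have [_ _ xy] := E_Y Exy; case: Exy => [?|/(boundary_edgeP _ xy)[]].
- by constructor 1.
- by constructor 2.
- by constructor 3.
Qed.

Lemma E_finite x : finite_set [set y | E x y].
Proof.
apply: (@sub_finite_set _ _ ([set y | S [set x; y]] `|`
  ([set y | next_point Y x y] `|` [set y | next_point Y y x]))).
  by move=> y /E_cases[]; [left|right; left|right; right].
rewrite !finite_setU; split; first exact: S_finite.
by split; [exact: next_finite|exact: prev_finite].
Qed.

Hypothesis Yprev : forall y, Y y -> exists y', next_point Y y' y.

(* Among the neighbours of x to the left of the edge xy, the one closest to y in the angular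
   order from x is also a neighbour of y: an arc crossing the missing edge would give a closer
   neighbour. *)
Lemma third_vertex x y u : E x y -> Y u -> 0 < area x y u ->
  exists z, [/\ E x z, E y z & 0 < area x y z].
Proof.
move=> Exy Yu hu; have [Yx Yy xy] := E_Y Exy.
have [a [_ _ xE]] := cexp_surj 0 (Yc Yx).
have angle z : exists t, circle z -> [/\ a <= t, t < a + 2 * pi & z = cexp t].
  have [cz|ncz] := pselect (circle z); last by exists 0.
  by have [t ?] := cexp_surj a cz; exists t.
have [K KP] := choice angle.
pose N := [set z | E x z /\ 0 < area x y z].
have fN : finite_set N by apply: sub_finite_set (E_finite x) => z [].
(* The predecessor of [x] is a candidate; the point [u] shows that it differs from [y]. *)
have N0 : N !=set0.
  have [q nq] := Yprev Yx; have qx := next_neq nq.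
  have [Yq _ Hq] := (nextP Yc qx).1 nq.
  have hyq : q <> y.
    move=> qy; have := Hq _ Yu; rewrite qy area_swap; lra.
  exists q; split; first by apply/E_cases; constructor 3.
  have := area_circle_neq0 (Yc Yx) (Yc Yy) (Yc Yq) xy qx hyq.
  rewrite neq_lt => /orP[|//] h; have := Hq _ Yy.
  by rewrite area_rot leNgt h.
have [z [Exz hz] zmin] := finite_argmin K fN N0.
exists z; split=> //.
have [_ Yz xz] := E_Y Exz.
have yz : y <> z by move=> e; move: hz; rewrite e areaxyy ltxx.
apply: E_max => // u1 v1 Suv h1.
wlog [hu1 hv1] : u1 v1 Suv h1 / area y z u1 < 0 /\ 0 < area y z v1.
  move=> W; case: (sep_case h1) => [[? ?]|[? ?]]; last exact: (W u1 v1).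
  by apply: (W v1 u1) => //; [rewrite set2C|rewrite sepC].
have Euv : E u1 v1 by left.
have [Yu1 Yv1 _] := E_Y Euv.
have [b0 b1 yE] := KP _ (Yc Yy); have [c0 c1 zE] := KP _ (Yc Yz).
have [k0 k1 uE] := KP _ (Yc Yu1); have [l0 l1 vE] := KP _ (Yc Yv1).
have hb : a <= K y < a + 2 * pi by rewrite b0 b1.
have hc : a <= K z < a + 2 * pi by rewrite c0 c1.
have hk : a <= K u1 < a + 2 * pi by rewrite k0 k1.
have hl : a <= K v1 < a + 2 * pi by rewrite l0 l1.
have {}zmin w : N w -> K z <= K w by exact: zmin.
have nxy := E_nsep Exy Euv; have nxz := E_nsep Exz Euv.
move: hz; rewrite xE [in area _ y z]yE [in area _ _ z]zE area_order_base//.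
move=> /andP[ab bc].
move: hu1; rewrite [in area y]yE [in area _ z]zE [in area _ _ u1]uE.
rewrite area_lt0 (@area_cexp_order _ a)// => hu1.
have {hu1} [bk kc] : K y < K u1 /\ K u1 < K z.
  by case/or3P: hu1 => /andP[? ?]; split; lra.
move: hv1; rewrite [in area y]yE [in area _ z]zE [in area _ _ v1]vE.
rewrite (@area_cexp_order _ a)// => hv1.
have hxyu : 0 < area x y u1.
  by rewrite xE [in area _ y]yE [in area _ _ u1]uE area_order_base// ab bk.
have hxzu : area x z u1 < 0.
  rewrite -area_rot area_lt0 xE [in area _ u1]uE [in area _ _ z]zE.
  by rewrite area_order_base// kc (lt_trans ab bk).
(* [u1] is strictly between [y] and [z]. If [v1] is beyond [z], the chord [u1 v1] crosses [xz]; if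
   [v1] is strictly between [x] and [y], it crosses [xy]; and if [v1] is [x], then [u1] is a
   neighbour of [x] closer than [z]. *)
have [lc|cl1] := leP (K v1) (K z); last first.
  apply: nxz; rewrite /sep nmulr_rlt0//.
  rewrite xE [in area _ z]zE [in area _ _ v1]vE area_order_base// cl1 andbT.
  by lra.
have lb : K v1 < K y by case/or3P: hv1 => /andP[? ?]; lra.
have [la|la] := eqVneq (K v1) a.
  have vx : v1 = x by rewrite vE la xE.
  have := zmin u1; rewrite leNgt kc => H; suff // : false by [].
  by apply: H; split=> //; rewrite -vx; exact: EC.
apply: nxy; rewrite /sep pmulr_rlt0//.
rewrite -area_rot area_lt0 xE [in area _ v1]vE [in area _ _ y]yE.
by rewrite area_order_base// lb andbT lt_neqAle eq_sym la.
Qed.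

(** [area x y u < 0] puts [u] on the open arc of the boundary edge; different arcs are disjoint
    because no open arc contains a point of [Y]. *)
Lemma next_arc_uniq x y x' y' u : circle u -> next_point Y x y ->
  next_point Y x' y' -> area x y u < 0 -> area x' y' u < 0 -> x = x'.
Proof.
move=> cu n n' h h'; have xy := next_neq n; have xy' := next_neq n'.
have [Yx Yy H] := (nextP Yc xy).1 n; have [Yx' Yy' H'] := (nextP Yc xy').1 n'.
have [a [_ _ xE]] := cexp_surj 0 (Yc Yx).
have [b [b0 b1 yE]] := cexp_surj a (Yc Yy).
have [c [c0 c1 xE']] := cexp_surj a (Yc Yx').
have [d [d0 d1 yE']] := cexp_surj a (Yc Yy').
have [k [k0 k1 uE]] := cexp_surj a cu.
have pi0 := pi_gt0 R.
have ha : a <= a < a + 2 * pi by apply/andP; split; lra.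
have hb : a <= b < a + 2 * pi by rewrite b0 b1.
have hc : a <= c < a + 2 * pi by rewrite c0 c1.
have hd : a <= d < a + 2 * pi by rewrite d0 d1.
have hk : a <= k < a + 2 * pi by rewrite k0 k1.
have hx := H _ Yx'; have hy := H _ Yy'; have hx' := H' _ Yx.
subst x y x' y' u.
suff -> : c = a by [].
move: h; rewrite area_lt0 (@area_cexp_order _ a)// => h.
have {h} [ak kb] : a < k /\ k < b.
  by case/or3P: h => /andP[? ?]; split; lra.
have cb : ~ (a < c /\ c < b).
  move=> [? ?]; move: hx; rewrite leNgt area_lt0 area_rot.
  by rewrite area_order_base//; apply/negP/negPn/andP.
have db : ~ (a < d /\ d < b).
  move=> [? ?]; move: hy; rewrite leNgt area_lt0 area_rot.
  by rewrite area_order_base//; apply/negP/negPn/andP.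
have cd : ~ (d < c /\ a < d).
  move=> [? ?]; move: hx'; rewrite leNgt area_lt0 -area_rot.
  by rewrite area_order_base//; apply/negP/negPn/andP.
move: h'; rewrite area_lt0 (@area_cexp_order _ a)// => h'.
have [//|/eqP ca] := eqVneq c a.
have {}ca : a < c by rewrite lt_neqAle c0 andbT eq_sym; apply/eqP.
by exfalso; case/or3P: h' => /andP[? ?]; [apply: cb|apply: cb|apply: cd]; split; lra.
Qed.

(** Were the limits different, a fixed point of the circle would lie on all late arcs. These would
    then be one and the same arc, while [x n] tends to [w] without reaching it. *)
Lemma next_limit w w' (x y : nat -> plane) : circle w -> circle w' ->
  (forall n, next_point Y (x n) (y n)) -> (forall n, x n <> w) ->
  x n @[n --> \oo] --> w -> y n @[n --> \oo] --> w' -> w = w'.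
Proof.
move=> cw cw' nx xw xc yc; apply: contrapT => ww'.
have [u cu hu] := circle_between cw cw' ww'.
have ca : (fun n => area (x n) (y n) u) @ \oo --> area w w' u.
  by apply: cvg_area => //; exact: cvg_cst.
have [N _ HN] : \forall n \near \oo, area (x n) (y n) u < 0.
  exact: (cvgr_lt _ ca _ hu).
have [M _ HM] : \forall n \near \oo, x n != x N.
  have /nbhs_planeP H : nbhs w [set p | p != x N].
    have : open (~` [set x N]).
      apply: closed_openC; apply: compact_closed; last exact: compact_set1.
      exact: norm_hausdorff.
    move=> o; have := open_nbhs_nbhs (conj o (not_eq_sym (xw N) : (~` [set x N]) w)).
    by apply: filterS => p /= /eqP.
  by have /xc := (nbhs_planeP _ _).2 H.
have := HM (maxn N M) (leq_maxr _ _); rewrite /= => /eqP; apply.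
apply: (next_arc_uniq cu (nx _) (nx N)).
  by apply: HN; rewrite /= leq_maxl.
by apply: HN => /=.
Qed.

Lemma limit_point_seq (T : topologicalType) (A : set T) (w : T) (x : nat -> T) :
  (forall n, A (x n)) -> (forall n, x n <> w) -> x n @[n --> \oo] --> w ->
  limit_point A w.
Proof.
move=> Ax xw xc U nU; have [N _ HN] := xc _ nU.
exists (x N); split=> //; first exact/eqP.
by apply: HN => /=.
Qed.

(* Each vertex has finitely many neighbours, so infinitely many edges accumulate only at pairs
   of limit points. *)
Lemma infinite_edges (F : set (plane * plane)) :
  (forall x y, F (x, y) -> E x y) -> infinite_set F ->
  exists w w' (x y : nat -> plane), [/\
    [/\ circle w, circle w', limit_point Y w & limit_point Y w'],
    forall n, F (x n, y n), x n @[n --> \oo] --> w, y n @[n --> \oo] --> w' &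
    w <> w' -> limit_pair S w w'].
Proof.
move=> FE iF.
have sub (G : set (plane * plane)) : G `<=` F -> infinite_set G ->
    exists w w' (x y : nat -> plane), [/\ circle w, circle w',
      [/\ forall n, G (x n, y n), forall n, x n <> w & forall n, y n <> w'],
      x n @[n --> \oo] --> w & y n @[n --> \oo] --> w'].
  move=> GF iG.
  have GE x y : G (x, y) -> E x y by move/GF/FE.
  have Gc x y : G (x, y) -> circle x /\ circle y by move/GE/E_Y => [/Yc ? /Yc].
  have G1 x : finite_set [set y | G (x, y)].
    by apply: sub_finite_set (E_finite x) => y /GE.
  have G2 y : finite_set [set x | G (x, y)].
    by apply: sub_finite_set (E_finite y) => x /GE/EC.
  have [w [w' [x [y [cw cw' H xc yc]]]]] := infinite_pairs Gc G1 G2 iG.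
  by exists w, w', x, y; split=> //; split=> n; have [] := H n.
have lim (G : set (plane * plane)) w w' (x y : nat -> plane) : G `<=` F ->
    (forall n, G (x n, y n)) -> (forall n, x n <> w) -> (forall n, y n <> w') ->
    x n @[n --> \oo] --> w -> y n @[n --> \oo] --> w' ->
    limit_point Y w /\ limit_point Y w'.
  move=> GF GG xw yw xc yc; split; apply: limit_point_seq; eauto => n /=.
  - by have /GF/FE/E_Y[] := GG n.
  - by have /GF/FE/E_Y[] := GG n.
have [fS|iS] := pselect (finite_set (F `&` [set e | S [set e.1; e.2]])); last first.
  have GF : F `&` [set e | S [set e.1; e.2]] `<=` F by move=> ? [].
  have [w [w' [x [y [cw cw' [H xw yw] xc yc]]]]] := sub _ GF iS.
  have [lw lw'] := lim _ _ _ _ _ GF H xw yw xc yc.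
  exists w, w', x, y; split=> //; first by move=> n; have [] := H n.
  by move=> _; exists x, y; split=> // n; have [] := H n.
have [fN|iN] := pselect (finite_set (F `&` [set e | next_point Y e.1 e.2])); last first.
  have GF : F `&` [set e | next_point Y e.1 e.2] `<=` F by move=> ? [].
  have [w [w' [x [y [cw cw' [H xw yw] xc yc]]]]] := sub _ GF iN.
  have [lw lw'] := lim _ _ _ _ _ GF H xw yw xc yc.
  exists w, w', x, y; split=> //; first by move=> n; have [] := H n.
  by move=> []; apply: (next_limit (x := x) (y := y)) => // n; have [] := H n.
have GF : F `&` [set e | next_point Y e.2 e.1] `<=` F by move=> ? [].
have [fP|iP] := pselect (finite_set (F `&` [set e | next_point Y e.2 e.1])); last first.
  have [w [w' [x [y [cw cw' [H xw yw] xc yc]]]]] := sub _ GF iP.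
  have [lw lw'] := lim _ _ _ _ _ GF H xw yw xc yc.
  exists w, w', x, y; split=> //; first by move=> n; have [] := H n.
  move=> []; apply/esym; apply: (next_limit (x := y) (y := x)) => // n.
  by have [] := H n.
exfalso; apply: iF; apply: (@sub_finite_set _ _
  ((F `&` [set e | S [set e.1; e.2]]) `|` ((F `&` [set e | next_point Y e.1 e.2]) `|`
   (F `&` [set e | next_point Y e.2 e.1])))); last first.
  by rewrite !finite_setU.
move=> [x y] Fxy; have /E_cases[] := FE _ _ Fxy.
- by left.
- by right; left.
- by right; right.
Qed.

Definition ctri x y z := [/\ E x y, E y z, E z x & 0 < area x y z].

(** Only sides in the cluster cut the disk; along a boundary edge the region extends to the arc. *)
Definition treg x y z p := [/\ disk p, S [set x; y] -> 0 <= area x y p,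
  S [set y; z] -> 0 <= area y z p & S [set z; x] -> 0 <= area z x p].

Lemma ctri_rot x y z : ctri x y z -> ctri y z x.
Proof. by move=> [? ? ? ?]; split=> //; rewrite -area_rot. Qed.

Lemma treg_rot x y z p : treg x y z p -> treg y z x p.
Proof. by move=> [? ? ? ?]; split. Qed.

Lemma ctri_third x y u : E x y -> Y u -> 0 < area x y u ->
  exists z, ctri x y z.
Proof.
move=> Exy Yu /(third_vertex Exy Yu)[z [Exz Eyz h]].
by exists z; split=> //; exact: EC.
Qed.

Lemma E_ctri x y : E x y -> exists z, ctri x y z \/ ctri y x z.
Proof.
move=> Exy; have [Yx Yy xy] := E_Y Exy.
have [u Yu /not_orP[ux uy]] : exists2 u, Y u & ~ ([set x; y] u).
  by apply: infinite_other; exact: finite_set2.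
have := area_circle_neq0 (Yc Yx) (Yc Yy) (Yc Yu) xy ux uy.
rewrite neq_lt => /orP[|] h; last first.
  by have [z ?] := ctri_third Exy Yu h; exists z; left.
rewrite area_lt0 in h.
by have [z ?] := ctri_third (EC Exy) Yu h; exists z; right.
Qed.

Lemma chord_treg x y z s : ctri x y z -> 0 <= s -> s <= 1 -> treg x y z (mix s x y).
Proof.
move=> [Exy Eyz Ezx h] s0 s1; have [Yx Yy _] := E_Y Exy.
split; first by apply: cvx_disk => //; apply: circle_disk; exact: Yc.
- by move=> _; rewrite area_mix areaxyx areaxyy !mulr0 addr0.
- move=> _; rewrite area_mix areaxyx mulr0 addr0.
  by apply: mulr_ge0; [lra|rewrite -area_rot; exact: ltW].
- move=> _; rewrite area_mix areaxyy mulr0 add0r.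
  by apply: mulr_ge0 => //; rewrite area_rot; exact: ltW.
Qed.

(* Among the finitely many edges separating p from m0, the one met last on the way from m0 to p
   bounds the triangle containing p. *)
Lemma coverage p m0 x0 y0 : open_disk p -> open_disk m0 -> E x0 y0 ->
  area x0 y0 m0 = 0 ->
  (forall w w', limit_point Y w -> limit_point Y w' -> w <> w' ->
     limit_pair S w w' -> ~ (0 <= area w w' p /\ area w w' m0 <= 0)) ->
  exists x y z, ctri x y z /\ treg x y z p.
Proof.
move=> op om E0 hm0 Hsep; have dp := odisk_disk op; have dm := odisk_disk om.
have [[x [y [Exy hxy]]]|Hn] := pselect (exists x y, E x y /\ area x y p = 0).
  have [Yx Yy xy] := E_Y Exy.
  have [s [s0 s1 pE]] := disk_chord (Yc Yx) (Yc Yy) xy dp hxy.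
  have [z [t|t]] := E_ctri Exy; rewrite pE.
    by exists x, y, z; split=> //; exact: chord_treg.
  by exists y, x, z; split=> //; rewrite mixC; apply: chord_treg => //; lra.
have n0 x y : E x y -> area x y p != 0.
  by move=> Exy; apply/eqP => e; apply: Hn; exists x, y.
pose F := [set e : plane * plane |
  [/\ E e.1 e.2, 0 < area e.1 e.2 p & area e.1 e.2 m0 <= 0]].
(* Parameter at which the segment from [p] to [m0] meets the chord, so that small values are close
   to [p]. *)
pose key (e : plane * plane) := area e.1 e.2 p / (area e.1 e.2 p - area e.1 e.2 m0).
have F0 : F !=set0.
  have := n0 _ _ E0; rewrite neq_lt => /orP[h|h].
    exists (y0, x0); split => /=; first exact: EC.
      by rewrite -area_lt0.
    by rewrite area_swap hm0 oppr0.
  by exists (x0, y0); split => //=; rewrite hm0.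
have keyP e : F e -> exists r, [/\ 0 < key e, key e <= 1,
     r = mix (key e) p m0 & [/\ area e.1 e.2 r = 0, open_disk r &
     exists k, [/\ 0 < k, k < 1 & r = mix k e.1 e.2]]].
  case: e => x y [/= Exy hp hm]; have [Yx Yy xy] := E_Y Exy.
  have d0 : 0 < area x y p - area x y m0 by lra.
  have kd : key (x, y) * (area x y p - area x y m0) = area x y p.
    by rewrite divfK// gt_eqF.
  have k0 : 0 < key (x, y) by rewrite divr_gt0.
  have k1 : key (x, y) <= 1 by rewrite ler_pdivrMr// mul1r; lra.
  exists (mix (key (x, y)) p m0).
  have or : open_disk (mix (key (x, y)) p m0) by apply: odisk_mixr.
  have ar : area x y (mix (key (x, y)) p m0) = 0 by rewrite area_mix; lra.
  split=> //; split=> //.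
  have [k [h0 h1 kE]] := disk_chord (Yc Yx) (Yc Yy) xy (odisk_disk or) ar.
  exists k; split=> //; rewrite lt_neqAle ?h0 ?h1 andbT.
  - apply/eqP => e; apply: (odisk_ncircle or); rewrite kE -e mix0; exact: Yc.
  - apply/eqP => e; apply: (odisk_ncircle or); rewrite kE e mix1; exact: Yc.
have fF : finite_set F.
  apply: contrapT => iF.
  have [//|w [w' [x [y [[cw cw' lw lw'] FF xc yc hl]]]]] := infinite_edges _ iF.
    by move=> x y [].
  have [ww'|/eqP ww'] := eqVneq w w'; last first.
    apply: (Hsep w w' lw lw' ww' (hl ww')); split.
    + by apply: cvgr_to_ge (cvg_area xc yc (cvg_cst p)) _; apply: nearW => n;
        have [_ /ltW] := FF n.
    + by apply: cvgr_to_le (cvg_area xc yc (cvg_cst m0)) _; apply: nearW => n;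
        have [] := FF n.
  (* The segment from [p] to [m0] stays where the squared norm is at most [M], whereas a chord of
     squared length below [1 - M] stays where it exceeds [M]. *)
  pose M := Num.max (sq p) (sq m0).
  have M1 : 0 < 1 - M by rewrite subr_gt0 gt_max; apply/andP; split.
  have dc : (fun n => dsq (x n) (y n)) @ \oo --> dsq w w' by exact: cvg_dsq.
  have [N _ /(_ N (leqnn _)) /= HN] : \forall n \near \oo, dsq (x n) (y n) < 1 - M.
    apply: (cvgr_lt (dsq w w') dc).
    by have /eqP -> : dsq w w' == 0 by rewrite dsq_eq0 ww'.
  have [r [k0 k1 rE [_ _ [k [l0 l1 rE2]]]]] := keyP _ (FF N).
  have [/= ExN _ _] := FF N; have [YxN YyN _] := E_Y ExN.
  have e : sq r = sq r by [].
  move: e; rewrite {1}rE2 {1}rE !sq_mix /=.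
  have -> : sq (x N) = 1 by exact: Yc.
  have -> : sq (y N) = 1 by exact: Yc.
  move: k0 k1; set K := key _ => k0 k1 e.
  have h1 : (1 - K) * sq p <= (1 - K) * M.
    by apply: ler_wpM2l; [lra|rewrite /M le_max lexx].
  have h2 : K * sq m0 <= K * M by apply: ler_wpM2l; [lra|rewrite /M le_max lexx orbT].
  have h3 : 0 <= K * (1 - K) * dsq p m0.
    by apply: mulr_ge0; [nra|exact: dsq_ge0].
  have h4 : k * (1 - k) * dsq (x N) (y N) <= 1 * dsq (x N) (y N).
    by apply: ler_wpM2r; [exact: dsq_ge0|nra].
  by lra.
have [[x y] Fe kmin] := finite_argmin key fF F0.
have [/= Exy hp hm] := Fe; have [Yx Yy xy] := E_Y Exy.
have [r [k0 k1 rE [ar or [k [l0 l1 rE2]]]]] := keyP _ Fe.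
have step x' y' : E x' y' -> 0 < area x' y' p -> area x' y' r < 0 -> False.
  move=> E' h' hr.
  have hr2 : (1 - key (x, y)) * area x' y' p + key (x, y) * area x' y' m0 < 0.
    by rewrite -area_mix -rE.
  have h1 : 0 <= (1 - key (x, y)) * area x' y' p.
    by apply: mulr_ge0; [lra|exact: ltW].
  have h2 : area x' y' m0 < 0 by rewrite -(pmulr_rlt0 _ k0); lra.
  have := kmin (x', y'); rewrite leNgt => H; suff // : false by [].
  have H2 : key (x', y') < key (x, y).
    by rewrite {1}/key/= ltr_pdivrMr; lra.
  by rewrite H2 in H; apply: H; split=> //=; exact: ltW.
have [[u [Yu hu]]|nu] := pselect (exists u, Y u /\ 0 < area x y u).
- have [z t] := ctri_third Exy Yu hu; exists x, y, z; split=> //.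
  have [_ Eyz Ezx h] := t; split=> //= _; first exact: ltW.
  + rewrite leNgt; apply/negP; rewrite area_lt0 => h'.
    apply: (step z y (EC Eyz) h'); rewrite rE2/= area_mix areaxyy mulr0 addr0.
    by rewrite pmulr_rlt0 ?subr_gt0// area_lt0 -area_rot.
  + rewrite leNgt; apply/negP; rewrite area_lt0 => h'.
    apply: (step x z (EC Ezx) h'); rewrite rE2/= area_mix areaxyx mulr0 add0r.
    by rewrite pmulr_rlt0// area_lt0 area_rot.
(* No point of [Y] is on the side of [p], so [p] is in the cap of a boundary edge, and this cap
   belongs to the region of the triangle on the other side. *)
- have nxt : boundary_edge Y [set x; y].
    apply/boundary_edgeP => //; right; apply/nextP => //; first exact: nesym.
    split=> // u Yu; rewrite leNgt area_lt0; apply/negP => h; apply: nu.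
    by exists u.
  have [u Yu /not_orP[ux uy]] : exists2 u, Y u & ~ ([set x; y] u).
    by apply: infinite_other; exact: finite_set2.
  have := area_circle_neq0 (Yc Yx) (Yc Yy) (Yc Yu) xy ux uy.
  rewrite neq_lt => /orP[|] hu; last by exfalso; apply: nu; exists u.
  rewrite area_lt0 in hu.
  have [z t] := ctri_third (EC Exy) Yu hu; exists y, x, z; split=> //.
  have [_ Exz Ezy h] := t; have [_ Yz _] := E_Y Exz.
  have hp' : area y x p <= 0 by rewrite area_swap oppr_le0 ltW.
  have [h1 h2] := cap_side (Yc Yy) (Yc Yx) (Yc Yz) dp h hp'.
  by split=> // Sxy; case: (S_nboundary Sxy); rewrite set2C.
Qed.

End Cluster.

(** * Transport of clusters *)

Section Transport.
Context {R : realType}.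
Local Notation plane := (plane R).
Implicit Types (x y z p q u v w : plane) (a b c s t : R) (A B C : set plane).

Lemma image2 (f : plane -> plane) x y : f @` [set x; y] = [set f x; f y].
Proof. by rewrite image_setU !image_set1. Qed.

Variables (V W : set plane) (f : plane -> plane) (T : set (set plane)).
Hypothesis Vc : V `<=` circle.
Hypothesis Wc : W `<=` circle.
Hypothesis fVW : f @` V = W.
Hypothesis fI : forall x y, V x -> V y -> f x = f y -> x = y.
Hypothesis fsep : forall x y u v, V x -> V y -> V u -> V v ->
  sep (f x) (f y) (f u) (f v) <-> sep x y u v.
Hypothesis TV : forall A, T A -> A `<=` V.

Let T' := [set f @` A | A in T].

Let Wf x : V x -> W (f x). Proof. by rewrite -fVW => Vx; exists x. Qed.

Let Wex y : W y -> exists2 x, V x & f x = y. Proof. by rewrite -fVW. Qed.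

Lemma image_pair A x y : A `<=` V -> V x -> V y -> f @` A = [set f x; f y] ->
  A = [set x; y].
Proof.
move=> AV Vx Vy e; apply/seteqP; split=> a.
- move=> Aa; have : [set f x; f y] (f a) by rewrite -e; exists a.
  by move=> [/fI|/fI] ->; [left| | |right| |]; rewrite //; exact: AV.
- move=> [->|->].
  + have [b Ab /fI <-//] : (f @` A) (f x) by rewrite e; left.
    exact: AV.
  + have [b Ab /fI <-//] : (f @` A) (f y) by rewrite e; right.
    exact: AV.
Qed.

Lemma transport_pair x y : V x -> V y -> T' [set f x; f y] <-> T [set x; y].
Proof.
move=> Vx Vy; split=> [[A TA e]|Txy]; last first.
  by exists [set x; y] => //; rewrite image2.
by rewrite -(image_pair (TV TA) Vx Vy e).
Qed.

(** In the form of [clusterP] every clause is about [sep] of points of [V], which [f] preserves. *)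
Lemma transport_cluster : is_cluster V T <-> is_cluster W T'.
Proof.
split=> cl; apply/clusterP => //.
- have [H1 H2 H3] := (clusterP T Vc).1 cl; split.
  + move=> _ [A TA <-].
    have [x [y [u [v [Vx Vy Vu Vv [-> h]]]]]] := H1 _ TA.
    exists (f x), (f y), (f u), (f v); rewrite image2.
    by split; [exact: Wf|exact: Wf|exact: Wf|exact: Wf|split=> //; apply/fsep].
  + have K x' y' : T' [set x'; y'] -> exists x y, [/\ V x, V y, T [set x; y],
        x' = f x & y' = f y].
      move=> [A TA e]; have [x [y [_ [_ [Vx Vy _ _ [AE _]]]]]] := H1 _ TA.
      subst A; move: e; rewrite image2 => /set2_inj[[<- <-]|[<- <-]].
        by exists x, y.
      by exists y, x; rewrite set2C.
    move=> x' y' u' v' /K[x [y [Vx Vy Txy -> ->]]] /K[u [v [Vu Vv Tuv -> ->]]].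
    by move/fsep => /(_ Vx Vy Vu Vv); exact: H2.
  + move=> x' y' /Wex[x Vx <-] /Wex[y Vy <-] [_ [_ [/Wex[u Vu <-] /Wex[v Vv <-]]]].
    move=> /fsep h H; apply/transport_pair => //; apply: H3 => //.
      by exists u, v; split=> //; exact: h.
    move=> u1 v1 Tuv h1; have Vu1 : V u1 by apply: (TV Tuv); left.
    have Vv1 : V v1 by apply: (TV Tuv); right.
    by apply: (H (f u1) (f v1)); [apply/transport_pair|apply/fsep].
- have [H1 H2 H3] := (clusterP T' Wc).1 cl; split.
  + move=> A TA; have [|x' [y' [u' [v' [Wx Wy Wu Wv [e h]]]]]] := H1 (f @` A).
      by exists A.
    have [x Vx xE] := Wex Wx; have [y Vy yE] := Wex Wy.
    have [u Vu uE] := Wex Wu; have [v Vv vE] := Wex Wv; subst x' y' u' v'.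
    exists x, y, u, v; split=> //; split; last exact/fsep.
    exact: (image_pair (TV TA)).
  + move=> x y u v Txy Tuv h.
    have Vx : V x by apply: (TV Txy); left.
    have Vy : V y by apply: (TV Txy); right.
    have Vu : V u by apply: (TV Tuv); left.
    have Vv : V v by apply: (TV Tuv); right.
    by apply: (H2 (f x) (f y) (f u) (f v)); [exact/transport_pair|
      exact/transport_pair|exact/fsep].
  + move=> x y Vx Vy [u [v [Vu Vv h]]] H; apply/transport_pair => //.
    apply: H3; [exact: Wf|exact: Wf| |].
      by exists (f u), (f v); split; [exact: Wf|exact: Wf|exact/fsep].
    move=> u' v' Tuv h1.
    have [x1 [y1 [_ [_ [Wx1 Wy1 _ _ [e _]]]]]] := H1 _ Tuv.
    have Wu' : W u' by case: (set2_inj e) => -[-> _].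
    have Wv' : W v' by case: (set2_inj e) => -[_ ->].
    have [u1 Vu1 uE] := Wex Wu'; have [v1 Vv1 vE] := Wex Wv'; subst u' v'.
    by apply: (H u1 v1); [exact/transport_pair|exact/fsep].
Qed.

Lemma transport_locally_finite : locally_finite V T <-> locally_finite W T'.
Proof.
split=> lf y Wy.
- have [x Vx xy] := Wex Wy; subst y.
  apply: (sub_finite_set _ (finite_image (fun A => f @` A) (lf x Vx))).
  move=> _ [[A TA <-] [a Aa /fI e]]; exists A => //; split=> //.
  by rewrite -e//; exact: (TV TA).
- have := lf _ (Wf Wy).
  set B := [set A | T' A /\ A (f y)] => fB.
  apply: (sub_finite_set _ (finite_image (fun A => V `&` f @^-1` A) fB)).
  move=> A [TA Ay]; exists (f @` A); first by split; [exists A|exists y].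
  apply/seteqP; split=> x.
    by move=> [Vx [a Aa /fI <-//]]; exact: (TV TA).
  by move=> Ax; split; [exact: (TV TA)|exists x].
Qed.


End Transport.

(** * Triangulation clusters are locally finite *)

Section Realization.
Context {R : realType}.
Local Notation plane := (plane R).
Implicit Types (x y z p q u v w : plane) (s t : R).

Lemma within_cvg (T U : topologicalType) (A : set T) (f : T -> U) (q : nat -> T) (p : T) :
  {within A, continuous f} -> A p -> (forall n, A (q n)) ->
  q n @[n --> \oo] --> p -> f (q n) @[n --> \oo] --> f p.
Proof.
move=> /subspace_continuousP cf Ap Aq qp W /(cf _ Ap) /= nW.
have [N _ HN] := qp _ nW; exists N => // n /HN /=; apply; exact: Aq.
Qed.

Lemma infinite_inj (A : set plane) : infinite_set A ->
  exists f : nat -> plane, injective f /\ forall n, A (f n).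
Proof.
move=> /infiniteP/pcard_leP[f]; exists f; split; last by move=> n; exact: funS.
by move=> m n e; apply: ('inj_f); rewrite ?inE.
Qed.

Lemma limit_point_closed (C A : set plane) : closed C -> A `<=` C ->
  limit_point A `<=` C.
Proof.
move=> cC AC p lp; apply: cC => U nU; have [y [_ Ay Uy]] := lp _ nU.
by exists y; split=> //; exact: AC.
Qed.

Lemma closed_finite (A : set plane) : finite_set A -> closed A.
Proof.
by move=> /finite_compact; apply: compact_closed; exact: norm_hausdorff.
Qed.

Section Complex.
Variable K : set (set plane).
Local Notation RK := (@realization R plane K).

Lemma bary_inj (a b : RK) : bary a = bary b -> a = b.
Proof. exact: val_inj. Qed.

Lemma realization_openE (U : set RK) : open U <-> realization_open U.
Proof. by []. Qed.

(** In each simplex, finitely many points of [X] have a positive distance from a point outside [X];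
    the weak topology asks for no uniformity between simplices. *)
Lemma closed_locally_finite (X : set RK) :
  (forall B, K B -> finite_set (X `&` closed_simplex B)) -> closed X.
Proof.
move=> fX; rewrite -openC; apply/realization_openE => B KB b Bb nXb.
have [E0|/set0P E0] := eqVneq (X `&` closed_simplex B) set0.
  exists 1 => // c Bc _ Xc; suff : (X `&` closed_simplex B) c by rewrite E0.
  by split.
have ex (c : RK) : exists v, c <> b -> 0 < `|bary b v - bary c v|.
  have [->|cb] := pselect (c = b); first by exists (0, 0).
  apply: contrapT => H; apply: cb; apply: bary_inj; apply: funext => v.
  apply: contrapT => /eqP; rewrite eq_sym -subr_eq0 -normr_gt0 => h; apply: H.
  by exists v.
have [v vP] := choice ex.
have [c [Xc Bc] cmin] :=
  finite_argmin (fun c => `|bary b (v c) - bary c (v c)|) (fX _ KB) E0.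
exists `|bary b (v c) - bary c (v c)|.
  by apply: vP => e; apply: nXb; rewrite -e.
move=> d Bd H Xd; have := cmin d (conj Xd Bd).
by rewrite leNgt H.
Qed.

(** The inverse turns convergence in the plane into convergence in the complex, where the range
    without the limit is closed; so the sequence is eventually constant. *)
Lemma homeo_seq (D : set plane) (psi : RK -> plane) (a : nat -> RK) (a0 : RK) :
  homeo_on [set: RK] D psi ->
  (forall B, K B -> finite_set (range a `&` closed_simplex B)) ->
  psi (a n) @[n --> \oo] --> psi a0 -> \forall n \near \oo, a n = a0.
Proof.
move=> [[psiD _ _] _ [g [cg gK]]] fX pc.
have Dp b : D (psi b) by apply: psiD.
have ca : a n @[n --> \oo] --> a0.
  have := within_cvg cg (Dp a0) (fun n => Dp (a n)) pc.
  have -> : (fun n => g (psi (a n))) = a by apply: funext => n; exact: gK.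
  by rewrite gK.
have cX : closed (range a `\ a0).
  apply: closed_locally_finite => B /fX; apply: sub_finite_set.
  by move=> b [[]].
have nX : nbhs a0 (~` (range a `\ a0)).
  by apply: open_nbhs_nbhs; split; [rewrite openC|move=> [_]; apply].
have [N _ HN] := ca _ nX; exists N => // n /HN /= H.
by apply: contrapT => na; apply: H; split=> //; exists n.
Qed.

End Complex.

Variables (Y : set plane) (S : set (set plane)).
Hypothesis Yc : Y `<=` circle.
Hypothesis Yi : infinite_set Y.
Hypothesis tr : triangulation_cluster Y S.

Let cl : is_cluster Y S. Proof. by have [] := tr. Qed.

Let face_finite B : cluster_complex Y S B -> finite_set B.
Proof.
case=> [[y _ ->]|[/(S_obj Yc cl)[x [y [u [v [_ _ _ _ [-> _]]]]]]|[x [y [_ ->]]]]|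
   [x [y [z [_ _ _ -> _]]]]].
- exact: finite_set1.
- exact: finite_set2.
- exact: finite_set2.
- by rewrite !finite_setU; split; [split|]; exact: finite_set1.
Qed.

Lemma triangulation_isolated y : Y y -> ~ limit_point Y y.
Proof.
move=> Yy; have [_ [psi [[pv _ _] [[h _ _] _ _]]]] := tr.
have [a _ <-] : (psi @` closed_simplex [set y]) y by rewrite pv.
by have [] := h a I.
Qed.

(** A point of the edge with one end missing from its support belongs to the other vertex and is
    sent to the circle, unlike the inner points of the chord. *)
Let chord_point (psi : @realization R plane (cluster_complex Y S) -> plane) x y s :
  is_psi psi -> S [set x; y] -> 0 < s -> s < 1 ->
  exists a, [/\ psi a = mix s x y, support_of (bary a) x & support_of (bary a) y].
Proof.
move=> [pv pe _] Sxy s0 s1.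
have [Yx Yy xy _] := S_sep Yc cl Sxy.
have := pe [set x; y] (or_introl Sxy); rewrite /edge_image asboolF; last first.
  exact: (S_nboundary Yc cl).
move=> e; have : geodesic [set x; y] (mix s x y).
  by apply/geodesicP; exists s; split=> //; exact: ltW.
have om : open_disk (mix s x y).
  by apply: odisk_mix => //; apply: circle_disk; exact: Yc.
rewrite -e => -[a ha pa]; exists a; split=> //; apply: contrapT => na.
- have : (psi @` closed_simplex [set y]) (psi a).
    by exists a => // v vs; have [vx|] := ha _ vs => //; case: na; rewrite -vx.
  by rewrite pv// pa => h; apply: (odisk_ncircle om); rewrite h; exact: Yc.
- have : (psi @` closed_simplex [set x]) (psi a).
    by exists a => // v vs; have [|vx] := ha _ vs => //; case: na; rewrite -vx.
  by rewrite pv// pa => h; apply: (odisk_ncircle om); rewrite h; exact: Yc.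
Qed.

(** On infinitely many edges at [y] one can choose points tending to [y]. Each simplex contains
    finitely many of them, so they would have to reach [y]. *)
Lemma triangulation_locally_finite : locally_finite Y S.
Proof.
move=> y Yy.
suff fS : finite_set [set x | S [set x; y]].
  apply: (sub_finite_set _ (finite_image (fun x => [set x; y]) fS)) => A [SA Ay].
  have [x [x' [_ [_ [_ _ _ _ [AE _]]]]]] := S_obj Yc cl SA; subst A.
  by case: Ay => /= e; rewrite e in SA *; [exists x'; rewrite /= 1?set2C|exists x].
apply: contrapT => /infinite_inj[x [xI Sx]].
have [_ [psi [ps ho]]] := tr.
(* Coordinates of points of the circle differ by at most 2, so the factor 1/3 puts the [n]-th point
   within [n.+1%:R^-1] of [y]. *)
pose s n : R := n.+1%:R^-1 / 3.
have s0 n : 0 < s n by rewrite divr_gt0// invr_gt0.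
have s1 n : s n < 1.
  have : n.+1%:R^-1 <= 1 :> R by rewrite invf_le1// ler1n.
  by rewrite /s; move: (_^-1) => t; lra.
have ex n : exists a, psi a = mix (s n) y (x n) /\ support_of (bary a) (x n).
  have Sn : S [set y; x n] by rewrite set2C; exact: Sx.
  by have [a [? _ ?]] := chord_point ps Sn (s0 n) (s1 n); exists a.
have [a aP] := choice ex.
have [b _ pb] : (psi @` closed_simplex [set y]) y by have [pv _ _] := ps; rewrite pv.
have bnd u v : circle u -> circle v -> `|(u.1 : R) - v.1| <= 2 /\ `|(u.2 : R) - v.2| <= 2.
  have b1 (i j : R) : i ^+ 2 + j ^+ 2 = 1 -> -1 <= i /\ i <= 1.
    by move=> h; split; nra.
  rewrite !circleE /sq => hu hv; have [? ?] := b1 _ _ hu; have [? ?] := b1 _ _ hv.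
  move: hu hv; rewrite addrC => hu; rewrite addrC => hv.
  have [? ?] := b1 _ _ hu; have [? ?] := b1 _ _ hv.
  by split; rewrite ler_norml; apply/andP; split; lra.
have pc : psi (a n) @[n --> \oo] --> psi b.
  apply: cvg_ball_seq => n; have [-> _] := aP n; rewrite pb.
  have [b1 b2] := bnd _ _ (Yc Yy) (Yc (let: And4 _ h _ _ := S_sep Yc cl (Sx n) in
    let: And4 h _ _ _ := S_sep Yc cl (Sx n) in h)).
  have e0 : 0 < n.+1%:R^-1 :> R by rewrite invr_gt0.
  have key (d : R) : `|d| <= 2 -> `|s n * d| < n.+1%:R^-1.
    by move=> h; rewrite normrM gtr0_norm// /s; move: (_^-1) e0 => t t0; nra.
  split; rewrite /ball/=.
  - have -> : (y.1 : R) - ((1 - s n) * y.1 + s n * (x n).1) = s n * (y.1 - (x n).1) by ring.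
    exact: key.
  - have -> : (y.2 : R) - ((1 - s n) * y.2 + s n * (x n).2) = s n * (y.2 - (x n).2) by ring.
    exact: key.
have [|N _ /(_ N (leqnn _)) /= e] := homeo_seq ho _ pc.
  move=> B /face_finite fB.
  have fn : finite_set (x @^-1` B).
    by apply: finite_preimage => // m n _ _; exact: xI.
  apply: (sub_finite_set _ (finite_image a fn)) => _ [[n _ <-] h].
  by exists n => //; apply: h; have [] := aP n.
have [_ _ xy _] := S_sep Yc cl (Sx N).
have [eN _] := aP N; apply: xy; move: eN; rewrite e pb => /esym eN.
have [_ Yy' _ _] := S_sep Yc cl (Sx N); have [Yx _ xy _] := S_sep Yc cl (Sx N).
have := odisk_mix (circle_disk (Yc Yy)) (circle_disk (Yc Yx)) (nesym xy) (s0 N) (s1 N).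
by rewrite eN => /odisk_ncircle; case; exact: Yc.
Qed.

(** The midpoints of the edges converge to the midpoint of [w w'], which is in the image of psi.
    They are therefore eventually constant, so the [x n] are confined to a finite subset of [Y] and
    cannot converge to a limit point, which is outside [Y]. *)
Lemma triangulation_limit_pair w w' : limit_point Y w -> limit_point Y w' ->
  limit_pair S w w' -> w = w'.
Proof.
move=> lw lw' [x [y [Sxy xc yc]]]; apply: contrapT => ww'.
have cw := limit_point_closed closed_circle Yc lw.
have cw' := limit_point_closed closed_circle Yc lw'.
have h0 : (0 : R) < 1 / 2 by lra.
have h1 : (1 / 2 : R) < 1 by lra.
have [_ [psi [ps ho]]] := tr; have [[_ psiS psiT] _ _] := ho.
have ex n := chord_point ps (Sxy n) h0 h1.
have [a aP] := choice ex.
have om : open_disk (mix (1 / 2) w w').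
  by apply: odisk_mix => //; exact: circle_disk.
have [b _ pb] : (psi @` [set: _]) (mix (1 / 2) w w').
  apply: psiT; split; first exact: odisk_disk.
  by move/(limit_point_closed closed_circle Yc)/(odisk_ncircle om).
have pc : psi (a n) @[n --> \oo] --> psi b.
  rewrite pb (_ : (fun n => psi (a n)) = fun n => mix (1/2) (x n) (y n)).
    by apply: cvg_mix => //; exact: cvg_cst.
  by apply: funext => n; have [] := aP n.
have [|N _ HN] := homeo_seq ho _ pc.
  move=> B /face_finite fB.
  have [g [_ gK]] : exists g, True /\ forall b, g (psi b) = b.
    by have [_ _ [g [_ gK]]] := ho; exists g; split=> // c; exact: gK.
  apply: (sub_finite_set _
    (finite_image2 (fun x y => g (mix (1/2) x y)) fB fB)) => _ [[n _ <-] h].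
  have [e sx sy] := aP n; exists (x n); first exact: h.
  by exists (y n); [exact: h|rewrite -e gK].
have fsb : finite_set (support_of (bary b)).
  have : barycentric (cluster_complex Y S) (bary b) by exact: set_valP.
  by move=> [_ /face_finite].
have wn : ~ (support_of (bary b) `&` Y) w.
  by move=> [_ /triangulation_isolated].
have nw : nbhs w (~` (support_of (bary b) `&` Y)).
  apply: open_nbhs_nbhs; split=> //; rewrite openC; apply: closed_finite.
  by apply: sub_finite_set fsb => ? [].
have [M _ HM] := xc _ nw.
have := HM (maxn N M) (leq_maxr _ _); apply; split; last first.
  by have [] := S_sep Yc cl (Sxy (maxn N M)).
have [_ + _] := aP (maxn N M); rewrite HN//= ?leq_maxl//.
Qed.

End Realization.

(** * Triangulations from locally finite clusters *)

Section Arcs.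
Context {R : realType}.
Local Notation plane := (plane R).
Implicit Types (x y z p q u v w : plane) (a b c s t r l m : R).

Variable Y : set plane.

Definition arc_ends v : R * R :=
  xget (0, 0) [set e | consecutive Y e.1 e.2 /\ v = cexp e.1].
Definition arc_start v := (arc_ends v).1.
Definition arc_stop v := (arc_ends v).2.
Definition nxt v : plane := cexp (arc_stop v).
Definition arcpt v r : plane :=
  cexp (arc_start v + (arc_stop v - arc_start v) * r).

(* The affine map of a triangle, corrected so that a boundary edge from v to nxt v is pushed onto
   its arc, along the cone from the barycentre; l and m are the coordinates of v and nxt v. At the
   barycentre the quotient is 0 / 0 = 0, which is harmless since its weight vanishes. *)
Definition push v l m : plane :=
  let l' := Num.max (l + l + m - 1) 0 in
  let m' := Num.max (l + m + m - 1) 0 in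
  let u := arcpt v (m' / (l' + m')) in
  (l * (v.1 : R) + ((l' + m') * (u.1 : R) - l' * (v.1 : R) - m' * (nxt v).1),
   l * (v.2 : R) + ((l' + m') * (u.2 : R) - l' * (v.2 : R) - m' * (nxt v).2)).

(** Where [l' + m'] vanishes, the angle of [arcpt] may jump, but it enters only through a cosine and
    a sine multiplied by [l' + m'], which tends to 0. *)
Lemma cvg_push (I : Type) (F : set_system I) {FF : Filter F} (f g : I -> R) v l m :
  f @ F --> l -> g @ F --> m ->
  (fun i => push v (f i) (g i)) @ F --> push v l m.
Proof.
move=> fl gm.
pose f' i : R := Num.max (f i + f i + g i - 1) 0.
pose g' i : R := Num.max (f i + g i + g i - 1) 0.
pose l' : R := Num.max (l + l + m - 1) 0.
pose m' : R := Num.max (l + m + m - 1) 0.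
have cm (h : I -> R) k : h @ F --> k -> (fun i => Num.max (h i) 0) @ F --> Num.max k 0.
  move=> hk; apply: (cvg_comp _ (fun k => Num.max k 0) hk).
  by apply: (@continuous_max R R^o id (cst 0) k); [exact: cvg_id|exact: cvg_cst].
have fl' : f' @ F --> l'.
  by apply: cm; apply: cvgB; [apply: cvgD => //; exact: cvgD|exact: cvg_cst].
have gm' : g' @ F --> m'.
  by apply: cm; apply: cvgB; [apply: cvgD => //; exact: cvgD|exact: cvg_cst].
have l0 : 0 <= l' by rewrite le_max lexx orbT.
have m0 : 0 <= m' by rewrite le_max lexx orbT.
have f0 i : 0 <= f' i by rewrite le_max lexx orbT.
have g0 i : 0 <= g' i by rewrite le_max lexx orbT.
have sc : (fun i => f' i + g' i) @ F --> l' + m' by exact: cvgD.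
have wc (h : R -> R) : continuous h -> (forall t, `|h t| <= 1) ->
    (fun i => (f' i + g' i) * h (arc_start v + (arc_stop v - arc_start v) * (g' i / (f' i + g' i)))) @ F -->
    (l' + m') * h (arc_start v + (arc_stop v - arc_start v) * (m' / (l' + m'))).
  move=> ch h1.
  have [e|n0] := eqVneq (l' + m') 0.
    rewrite e mul0r; apply/cvgr0Pnorm_lt => eps eps0.
    have sc0 : (fun i => f' i + g' i) @ F --> (0 : R) by rewrite -e.
    have H := (cvgr0Pnorm_lt _).1 sc0 _ eps0; near=> i; have hi : `|f' i + g' i| < eps by near: i; exact: H.
    by rewrite normrM (le_lt_trans _ hi)// ler_piMr.
  apply: cvgM => //; apply: (cvg_comp _ h _ (ch _)).
  apply: cvgD; first exact: cvg_cst.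
  apply: cvgM; first exact: cvg_cst.
  by apply: cvgM => //; apply: cvgV.
have c1 := wc cos (@continuous_cos R) (@cos_max R).
have c2 := wc sin (@continuous_sin R) (@sin_max R).
apply: cvg_plane.
  apply: cvgD; first by apply: cvgM => //; exact: cvg_cst.
  apply: cvgB; last by apply: cvgM => //; exact: cvg_cst.
  by apply: cvgB => //; apply: cvgM => //; exact: cvg_cst.
apply: cvgD; first by apply: cvgM => //; exact: cvg_cst.
apply: cvgB; last by apply: cvgM => //; exact: cvg_cst.
by apply: cvgB => //; apply: cvgM => //; exact: cvg_cst.
Unshelve. all: by end_near. Qed.

Hypothesis Yc : Y `<=` circle.
Hypothesis Yi : infinite_set Y.
Hypothesis Ynext : forall y, Y y -> exists y', next_point Y y y'.

Lemma arc_endsP v : Y v -> [/\ consecutive Y (arc_start v) (arc_stop v),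
  v = cexp (arc_start v) & arc_stop v < arc_start v + 2 * pi].
Proof.
move=> Yv; have [] : consecutive Y (arc_start v) (arc_stop v) /\ v = cexp (arc_start v).
  apply: (@xgetPex _ (0, 0) [set e | consecutive Y e.1 e.2 /\ v = cexp e.1]).
  by have [y [a [b [c vE yE]]]] := Ynext Yv; exists (a, b).
move=> c e; split=> //; rewrite ltNge; apply/negP => h.
have nv : next_point Y v (nxt v) by exists (arc_start v), (arc_stop v).
have := next_neq Yc Yi nv; have [ab Ya Yb H] := c.
move: h; rewrite le_eqVlt => /orP[/eqP h|h]; apply.
  by rewrite /nxt -h cexpD2pi.
exfalso; apply: (H (arc_start v + 2 * pi)).
  by rewrite h andbT ltrDl mulr_gt0// pi_gt0.
by rewrite cexpD2pi.
Qed.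

Lemma nxtP v : Y v -> next_point Y v (nxt v).
Proof. by move=> /arc_endsP[c e _]; exists (arc_start v), (arc_stop v). Qed.

Lemma nxt_neq v : Y v -> v <> nxt v.
Proof. by move=> /nxtP; exact: next_neq. Qed.

Lemma next_nxt v w : next_point Y v w -> w = nxt v.
Proof. by move=> n; have [Yv _] := next_pointY n; exact: (next_uniq Yc Yi n (nxtP Yv)). Qed.

Lemma arcpt0 v : Y v -> arcpt v 0 = v.
Proof. by move=> /arc_endsP[_ e _]; rewrite /arcpt mulr0 addr0 -e. Qed.

Lemma arcpt1 v : arcpt v 1 = nxt v.
Proof. by rewrite /arcpt mulr1 addrC subrK. Qed.

Lemma arcpt_circle v r : circle (arcpt v r).
Proof. exact: cexp_circle. Qed.

Lemma arcpt_inj v r r' : Y v -> 0 <= r <= 1 -> 0 <= r' <= 1 ->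
  arcpt v r = arcpt v r' -> r = r'.
Proof.
move=> /arc_endsP[[ab _ _ _] _ b2] /andP[r0 r1] /andP[r0' r1'] e.
have d0 : 0 < arc_stop v - arc_start v by rewrite subr_gt0.
have H (t : R) : 0 <= t -> t <= 1 ->
    arc_start v <= arc_start v + (arc_stop v - arc_start v) * t /\
    arc_start v + (arc_stop v - arc_start v) * t < arc_start v + 2 * pi.
  move=> t0 t1; split; first by rewrite lerDl mulr_ge0// ltW.
  rewrite ltrD2l (@le_lt_trans _ _ (arc_stop v - arc_start v))//; last lra.
  by rewrite ger_pMr.
have [h1 h2] := H _ r0 r1; have [h3 h4] := H _ r0' r1'.
have /addrI := cexp_inj h1 h2 h3 h4 e.
by apply: mulfI; rewrite gt_eqF.
Qed.

Lemma arcpt_area v r : Y v -> 0 < r < 1 -> area v (nxt v) (arcpt v r) < 0.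
Proof.
move=> /arc_endsP[[ab _ _ _] e b2] /andP[r0 r1].
rewrite [in area v]e -area_rot area_lt0; apply: area_cexp_gt0.
- by rewrite ltrDl mulr_gt0// subr_gt0.
- by nra.
- by lra.
Qed.

Lemma arcpt_nY v r : Y v -> 0 < r < 1 -> ~ Y (arcpt v r).
Proof.
move=> Yv h Ya; have := arcpt_area Yv h.
have [_ _ H] := (nextP Yc (nxt_neq Yv)).1 (nxtP Yv).
by rewrite ltNge H.
Qed.

Lemma arc_ex v u : Y v -> circle u -> area v (nxt v) u < 0 ->
  exists r, 0 < r < 1 /\ u = arcpt v r.
Proof.
move=> /arc_endsP[[ab _ _ _] e b2] cu h.
have [c [c0 c1 uE]] := cexp_surj (arc_start v) cu; subst u.
have pi0 := pi_gt0 R.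
move: h; rewrite [in area v]e area_lt0 (@area_cexp_order _ (arc_start v));
  [|apply/andP; split; lra..].
move=> h; have [h1 h2] : arc_start v < c /\ c < arc_stop v.
  by case/or3P: h => /andP[? ?]; split; lra.
have d0 : 0 < arc_stop v - arc_start v by rewrite subr_gt0.
exists ((c - arc_start v) / (arc_stop v - arc_start v)); split.
  apply/andP; split; first by rewrite divr_gt0// subr_gt0.
  by rewrite ltr_pdivrMr// mul1r; lra.
by rewrite /arcpt mulrC divfK ?gt_eqF// addrC subrK.
Qed.

(** No end of the chord is on the open arc, so the arc stays on one side of it. The chord may touch
    the arc at [v] or at its successor; only the boundary edge itself would leave the side
    undetermined. *)
Lemma arc_sign v r p q : Y v -> 0 < r < 1 -> Y p -> Y q -> p <> q ->
  ~ boundary_edge Y [set p; q] ->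
  0 <= area p q v -> 0 <= area p q (nxt v) -> 0 < area p q (arcpt v r).
Proof.
move=> Yv h Yp Yq pq nb h1 h2; have pi0 := pi_gt0 R.
have := arc_endsP Yv; move=> [[ab _ _ H] e b2]; move: (h) => /andP[r0 r1].
set a := arc_start v in ab H e b2 *; set b := arc_stop v in ab H b2 *.
have cE : arcpt v r = cexp (a + (b - a) * r) by [].
set c := a + (b - a) * r in cE.
have ac : a < c by rewrite /c ltrDl mulr_gt0// subr_gt0.
have cb : c < b by rewrite /c; nra.
have [i [i0 i1 pE]] := cexp_surj a (Yc Yp).
have [j [j0 j1 qE]] := cexp_surj a (Yc Yq).
have ib : i = a \/ b <= i.
  have [->|ia] := eqVneq i a; [by left|right]; rewrite leNgt; apply/negP => ib.
  by apply: (H i); [rewrite ib andbT lt_neqAle eq_sym ia|rewrite -pE].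
have jb : j = a \/ b <= j.
  have [->|ja] := eqVneq j a; [by left|right]; rewrite leNgt; apply/negP => jb.
  by apply: (H j); [rewrite jb andbT lt_neqAle eq_sym ja|rewrite -qE].
have ij : i <> j by move=> ij; apply: pq; rewrite pE qE ij.
have nij : ~ (i = a /\ j = b).
  move=> [ia jb']; apply: nb; apply/boundary_edgeP => //; left.
  rewrite pE qE ia jb' -e; exact: nxtP.
have nb' : b = arc_stop v by [].
have ha : a <= a < a + 2 * pi by apply/andP; split; lra.
have hb : a <= b < a + 2 * pi by apply/andP; split; lra.
have hc : a <= c < a + 2 * pi by apply/andP; split; lra.
have hi : a <= i < a + 2 * pi by rewrite i0 i1.
have hj : a <= j < a + 2 * pi by rewrite j0 j1.
rewrite cE pE qE (@area_cexp_order _ a)//.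
move: h1; rewrite leNgt area_lt0 [in area _ _ v]e pE qE (@area_cexp_order _ a)//.
move: h2; rewrite leNgt area_lt0 /nxt pE qE (@area_cexp_order _ a)//.
move=> /negP h2 /negP h1.
case: ib => ib; case: jb => jb.
- by exfalso; apply: ij; rewrite ib jb.
- have bj : b < j.
    rewrite lt_neqAle jb andbT; apply/eqP => e'; apply: nij; split=> //.
  by exfalso; apply: h2; apply/orP; right; apply/orP; left; rewrite -/b; apply/andP; split; lra.
- by apply/orP; right; apply/orP; left; apply/andP; split; lra.
- have [lt_ij|lt_ji|//] := ltgtP i j.
  + by apply/orP; right; apply/orP; right; apply/andP; split; lra.
  + exfalso; apply: h1; apply/orP; right; apply/orP; right; apply/andP; split; lra.
Qed.

(** In a triangle [1 - l - m] is the third coordinate, and the hypothesis says that [l] or [m] does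
    not exceed it; the correction then cancels. *)
Lemma push_lin v l m : Y v -> l + l + m <= 1 \/ l + m + m <= 1 ->
  push v l m = (l * (v.1 : R), l * (v.2 : R)).
Proof.
move=> Yv; rewrite /push => -[h|h].
- have -> : Num.max (l + l + m - 1) 0 = 0 by apply/max_idPr; lra.
  set m' := Num.max _ _; rewrite !add0r; have [->|n0] := eqVneq m' 0.
    by apply: plane_eq => /=; ring.
  by rewrite divff// arcpt1; apply: plane_eq => /=; ring.
- have -> : Num.max (l + m + m - 1) 0 = 0 by apply/max_idPr; lra.
  set l' := Num.max _ _; rewrite mul0r arcpt0//.
  by apply: plane_eq => /=; ring.
Qed.

(** When the third coordinate is the smallest, [3 * (l + m) - 2] is the height in the cone over the
    edge: 0 at the barycentre and 1 on the edge. *)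
Lemma push_cone v l m : 1 <= l + l + m -> 1 <= l + m + m ->
  let u := arcpt v ((l + m + m - 1) / (3 * (l + m) - 2)) in
  push v l m = ((1 - l - m) * (v.1 : R) + (3 * (l + m) - 2) * u.1 - (l + m + m - 1) * (nxt v).1,
                (1 - l - m) * (v.2 : R) + (3 * (l + m) - 2) * u.2 - (l + m + m - 1) * (nxt v).2).
Proof.
move=> h1 h2 u; rewrite /push.
have -> : Num.max (l + l + m - 1) 0 = l + l + m - 1 by apply/max_idPl; lra.
have -> : Num.max (l + m + m - 1) 0 = l + m + m - 1 by apply/max_idPl; lra.
have -> : l + l + m - 1 + (l + m + m - 1) = 3 * (l + m) - 2 by ring.
by apply: plane_eq => /=; rewrite -/u; ring.
Qed.

End Arcs.

(** * The map psi on the complex of a tame cluster *)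

Section Psi.
Context {R : realType}.
Local Notation plane := (plane R).
Implicit Types (x y z p q u v w : plane) (s t r : R).

(** What the construction of psi requires: points have successors and predecessors and are isolated,
    the arcs of boundary edges cover the circle off the limit set, and no limit pair joins different
    limit points. *)
Definition tame (Y : set plane) (S : set (set plane)) :=
  [/\ Y `<=` circle, infinite_set Y, is_cluster Y S, locally_finite Y S &
  [/\ forall y, Y y -> exists y', next_point Y y y',
      forall y, Y y -> exists y', next_point Y y' y,
      forall y, Y y -> ~ limit_point Y y,
      forall p, circle p -> ~ limit_point Y p ->
        exists a b c, [/\ consecutive Y a b, a <= c <= b & p = cexp c] &
      forall w w', limit_point Y w -> limit_point Y w' -> limit_pair S w w' ->
        w = w']].

Variables (Y : set plane) (S : set (set plane)).
Hypothesis tm : tame Y S.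

Let Yc : Y `<=` circle. Proof. by have [] := tm. Qed.
Let Yi : infinite_set Y. Proof. by have [] := tm. Qed.
Let cl : is_cluster Y S. Proof. by have [] := tm. Qed.
Let lf : locally_finite Y S. Proof. by have [] := tm. Qed.
Let Ynext y : Y y -> exists y', next_point Y y y'.
Proof. by have [_ _ _ _ [+ _ _ _ _]] := tm; apply. Qed.
Let Yprev y : Y y -> exists y', next_point Y y' y.
Proof. by have [_ _ _ _ [_ + _ _ _]] := tm; apply. Qed.

Local Notation K := (cluster_complex Y S).
Local Notation RK := (@realization R plane K).
Local Notation E := (E Y S).
Local Notation ctri := (ctri Y S).
Local Notation treg := (treg S).
Local Notation nx := (nxt Y).

Lemma ctri_Y x y z : ctri x y z ->
  [/\ Y x, Y y, Y z & [/\ x <> y, y <> z & z <> x]].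
Proof.
move=> [/(E_Y Yc Yi cl)[? ? ?] /(E_Y Yc Yi cl)[? ? ?] /(E_Y Yc Yi cl)[? ? ?] _].
by split.
Qed.

Lemma ctri_nxt x y z : ctri x y z -> S [set x; y] \/ nx x = y.
Proof.
move=> t; have [Yx Yy Yz [xy _ _]] := ctri_Y t; have [Exy _ _ h] := t.
have /(E_cases Yc Yi cl)[?|n|n] := Exy.
- by left.
- by right; apply/esym; exact: (next_nxt Yc Yi Ynext).
- have yx := nesym xy.
  have [_ _ /(_ _ Yz)] := (nextP Yc yx).1 n.
  by rewrite area_swap oppr_ge0 leNgt h.
Qed.

Lemma ctri_nxt_neq x y z : ctri x y z -> nx x <> z.
Proof.
move=> t e; have [Yx Yy Yz [xy yz zx]] := ctri_Y t; have [_ _ _ h] := t.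
have := nxtP Yc Yi Ynext Yx; rewrite e => n.
have [_ _ /(_ _ Yy)] := (nextP Yc (nesym zx)).1 n.
by rewrite -area_rot area_swap oppr_ge0 leNgt h.
Qed.

Lemma S_nnxt x y : S [set x; y] -> nx x <> y.
Proof.
move=> Sxy e; have [Yx Yy xy _] := S_sep Yc cl Sxy.
apply: (S_nboundary Yc cl Sxy); apply/boundary_edgeP => //; left.
by rewrite -e; exact: nxtP.
Qed.

(** The image of a side: an arc for a boundary edge and a chord otherwise. In a positively oriented
    triangle a boundary edge can only lead to the successor, hence the test. *)
Definition sidept x y r : plane := if nx x == y then arcpt Y x r else mix r x y.

Lemma Gam0 x y : Y x -> sidept x y 0 = x.
Proof. by move=> Yx; rewrite /sidept; case: eqP => _; rewrite ?mix0// (arcpt0 Yc Yi Ynext). Qed.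

Lemma Gam1 x y : sidept x y 1 = y.
Proof. by rewrite /sidept; case: eqP => [<-|_]; rewrite ?mix1 ?arcpt1. Qed.

Lemma Gam_S x y r : S [set x; y] -> sidept x y r = mix r x y.
Proof. by move=> /S_nnxt; rewrite /sidept; case: eqP. Qed.

Lemma Gam_arc x r : sidept x (nx x) r = arcpt Y x r.
Proof. by rewrite /sidept eqxx. Qed.

Lemma arcpt_area_le v r : Y v -> 0 <= r -> r <= 1 -> area v (nx v) (arcpt Y v r) <= 0.
Proof.
move=> Yv; rewrite le_eqVlt => /orP[/eqP<- _|r0].
  by rewrite (arcpt0 Yc Yi Ynext)// areaxyx.
rewrite le_eqVlt => /orP[/eqP->|r1]; first by rewrite arcpt1 areaxyy.
by apply/ltW/(arcpt_area Yc Yi Ynext) => //; rewrite r0.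
Qed.

Lemma Gam_treg x y z r : ctri x y z -> 0 <= r -> r <= 1 -> treg x y z (sidept x y r).
Proof.
move=> t r0 r1; have [Yx Yy Yz _] := ctri_Y t; have [_ _ _ h] := t.
have [Sxy|e] := ctri_nxt t.
  by rewrite Gam_S//; exact: (chord_treg Yc Yi cl).
rewrite -e Gam_arc; rewrite -e in t h.
have cu := @arcpt_circle R Y x r; have du := circle_disk cu.
have hle := arcpt_area_le Yx r0 r1.
have Ynx : Y (nx x) by rewrite e.
have [h1 h2] := cap_side (Yc Yx) (Yc Ynx) (Yc Yz) du h hle.
by split=> // /S_nnxt.
Qed.

Lemma Gam_pos x y z r : ctri x y z -> 0 <= r -> r < 1 -> S [set y; z] ->
  0 < area y z (sidept x y r).
Proof.
move=> t r0 r1 Syz; have [Yx Yy Yz [xy yz zx]] := ctri_Y t; have [_ _ _ h] := t.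
have h' : 0 < area y z x by rewrite -area_rot.
rewrite /sidept; case: eqP => [e|_].
  move: r0; rewrite le_eqVlt => /orP[/eqP<-|r0].
    by rewrite (arcpt0 Yc Yi Ynext).
  apply: (arc_sign Yc Yi Ynext) => //; first by rewrite r0.
  - exact: (S_nboundary Yc cl).
  - exact: ltW.
  - by rewrite e areaxyx.
by rewrite area_mix areaxyx mulr0 addr0 mulr_gt0// subr_gt0.
Qed.

Lemma Gam_pos2 x y z r : ctri x y z -> 0 < r -> r <= 1 -> S [set z; x] ->
  0 < area z x (sidept x y r).
Proof.
move=> t r0 r1 Szx; have [Yx Yy Yz [xy yz zx]] := ctri_Y t; have [_ _ _ h] := t.
have h' : 0 < area z x y by rewrite area_rot.
rewrite /sidept; case: eqP => [e|_].
  move: r1; rewrite le_eqVlt => /orP[/eqP->|r1].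
    by rewrite arcpt1 e.
  apply: (arc_sign Yc Yi Ynext) => //; first by rewrite r0.
  - exact: (S_nboundary Yc cl).
  - by rewrite areaxyy.
  - by rewrite e; exact: ltW.
by rewrite area_mix areaxyy mulr0 add0r mulr_gt0.
Qed.

Definition centre x y z : plane :=
  (((x.1 : R) + y.1 + z.1) / 3, ((x.2 : R) + y.2 + z.2) / 3).

Lemma centreE x y z : centre x y z = mix (1 / 3) (mix (1 / 2) x y) z.
Proof. by apply: plane_eq => /=; field. Qed.

Lemma centre_rot x y z : centre x y z = centre y z x.
Proof. by apply: plane_eq => /=; congr (_ / _); ring. Qed.

Lemma area_centre p q x y z :
  area p q (centre x y z) = (area p q x + area p q y + area p q z) / 3.
Proof. by rewrite centreE !area_mix; field. Qed.

Lemma centre_odisk x y z : ctri x y z -> open_disk (centre x y z).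
Proof.
move=> t; have [/Yc/circle_disk dx /Yc/circle_disk dy /Yc/circle_disk dz [xy _ _]] := ctri_Y t.
have h1 : (0 : R) < 1 / 2 by lra.
have h2 : (1 / 2 : R) < 1 by lra.
have h3 : (0 : R) <= 1 / 3 by lra.
have h4 : (1 / 3 : R) < 1 by lra.
rewrite centreE; exact: (odisk_mixl (odisk_mix dx dy xy h1 h2)).
Qed.

Lemma area_centre_gt0 x y z : 0 < area x y z -> 0 < area x y (centre x y z).
Proof. by move=> h; rewrite area_centre areaxyx areaxyy; lra. Qed.

Lemma treg_cvx x y z : cvx (treg x y z).
Proof.
move=> p q s [d1 h1 h2 h3] [d2 k1 k2 k3] s0 s1; split.
- exact: cvx_disk.
- by move=> S1; rewrite area_mix; have := h1 S1; have := k1 S1; nra.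
- by move=> S1; rewrite area_mix; have := h2 S1; have := k2 S1; nra.
- by move=> S1; rewrite area_mix; have := h3 S1; have := k3 S1; nra.
Qed.

Lemma centre_treg x y z : ctri x y z -> treg x y z (centre x y z).
Proof.
move=> t; have [_ _ _ h] := t; split; first exact/odisk_disk/centre_odisk.
- by move=> _; apply/ltW/area_centre_gt0.
- by move=> _; rewrite centre_rot; apply/ltW/area_centre_gt0; rewrite -area_rot.
- by move=> _; rewrite -centre_rot; apply/ltW/area_centre_gt0; rewrite area_rot.
Qed.

Lemma sum3 (f G : plane -> R) x y z : x <> y -> y <> z -> z <> x ->
  (forall v, v <> x -> v <> y -> v <> z -> f v = 0) ->
  (forall v, f v = 0 -> G v = 0) ->
  \sum_(v \in support_of f) G v = G x + G y + G z.
Proof.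
move=> xy yz zx f0 G0.
have sub : support_of f `<=` [set x; y; z].
  move=> v /eqP fv; apply: contrapT => /not_orP[/not_orP[vx vy] vz].
  by apply: fv; exact: f0.
rewrite (fsbig_widen _ _ _ sub); last first.
  move=> v [_ nv] /=; apply: G0; apply: contrapT => /eqP fv; exact: nv.
rewrite fsbigU0; [|exact: finite_set2|exact: finite_set1|]; last first.
  by move=> v [[->|->] /= e]; [exact: (zx (esym e))|exact: (yz e)].
rewrite fsbigU0; [|exact: finite_set1|exact: finite_set1|]; last first.
  by move=> v [-> /= e]; exact: (xy e).
by rewrite !fsbig_set1.
Qed.

(** Cone coordinates of a simplex: [s] leads from the barycentre to the side [xy], and [r] runs
    along this side. *)
Definition tripoint x y z s r v : R :=
  if v == x then (1 - s) / 3 + s * (1 - r)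
  else if v == y then (1 - s) / 3 + s * r
  else if v == z then (1 - s) / 3 else 0.

Lemma tripointE x y z s r : x <> y -> y <> z -> z <> x ->
  [/\ tripoint x y z s r x = (1 - s) / 3 + s * (1 - r),
      tripoint x y z s r y = (1 - s) / 3 + s * r,
      tripoint x y z s r z = (1 - s) / 3 &
      forall v, v <> x -> v <> y -> v <> z -> tripoint x y z s r v = 0].
Proof.
move=> /eqP xy /eqP yz /eqP zx; rewrite /tripoint; split.
- by rewrite eqxx.
- by rewrite eq_sym (negPf xy) eqxx.
- by rewrite (negPf zx) eq_sym (negPf yz) eqxx.
- by move=> v /eqP vx /eqP vy /eqP vz; rewrite (negPf vx) (negPf vy) (negPf vz).
Qed.

Lemma face_sub x y z (A : set plane) : ctri x y z -> A `<=` [set x; y; z] ->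
  A !=set0 -> K A.
Proof.
move=> t AT A0; have [Yx Yy Yz [xy yz zx]] := ctri_Y t; have [Exy Eyz Ezx _] := t.
have H B : (forall v, B v <-> A v) -> A = B.
  by move=> h; apply/seteqP; split=> v /h.
have [ax|ax] := pselect (A x); have [ay|ay] := pselect (A y);
  have [az|az] := pselect (A z).
- constructor 3; exists x, y, z; split=> //; first exact: nesym.
    apply: H => v; split=> [|/AT//].
    by move=> [[->|->]|->].
  by split=> //; exact: EC.
- constructor 2; suff -> : A = [set x; y] by [].
  by apply: H => v; split=> [[->|->]//|Av]; have [[?|?]|vz] := AT _ Av;
    [left|right|rewrite -vz in az].
- constructor 2; suff -> : A = [set z; x] by [].
  by apply: H => v; split=> [[->|->]//|Av]; have [[?|vy]|?] := AT _ Av;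
    [right|rewrite -vy in ay|left].
- constructor 1; exists x => //.
  by apply: H => v; split=> [->//|Av]; have [[?|vy]|vz] := AT _ Av;
    [|rewrite -vy in ay|rewrite -vz in az].
- constructor 2; suff -> : A = [set y; z] by [].
  by apply: H => v; split=> [[->|->]//|Av]; have [[vx|?]|?] := AT _ Av;
    [rewrite -vx in ax|left|right].
- constructor 1; exists y => //.
  by apply: H => v; split=> [->//|Av]; have [[vx|?]|vz] := AT _ Av;
    [rewrite -vx in ax| |rewrite -vz in az].
- constructor 1; exists z => //.
  by apply: H => v; split=> [->//|Av]; have [[vx|vy]|?] := AT _ Av;
    [rewrite -vx in ax|rewrite -vy in ay|].
- by exfalso; have [v Av] := A0; have [[e|e]|e] := AT _ Av; rewrite -e in ax ay az.
Qed.

Lemma mk_realization x y z (f : plane -> R) : ctri x y z -> (forall v, 0 <= f v) ->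
  (forall v, v <> x -> v <> y -> v <> z -> f v = 0) -> f x + f y + f z = 1 ->
  exists a : RK, bary a = f.
Proof.
move=> t f0 fN f1; have [Yx Yy Yz [xy yz zx]] := ctri_Y t.
have h : barycentric K f.
  split=> //; last by rewrite (sum3 (f := f) (G := f) xy yz zx).
  apply: (face_sub t).
    move=> v /eqP fv; apply: contrapT => /not_orP[/not_orP[vx vy] vz].
    by apply: fv; exact: fN.
  apply/set0P/negP => /eqP s0.
  have z0 v : f v = 0.
    by apply: contrapT => /eqP fv; have : support_of f v by []; rewrite s0.
  by move: f1; rewrite !z0; lra.
by exists (exist _ f (mem_set h)).
Qed.

Lemma mk_tripoint x y z s r : ctri x y z -> 0 <= s <= 1 -> 0 <= r <= 1 ->
  exists a : RK, bary a = tripoint x y z s r.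
Proof.
move=> t /andP[s0 s1] /andP[r0 r1]; have [_ _ _ [xy yz zx]] := ctri_Y t.
have [ex ey ez e0] := tripointE s r xy yz zx.
apply: (mk_realization t) => //; last by rewrite ex ey ez; field.
move=> v; rewrite /tripoint; have c0 : 0 <= (1 - s) / 3 by lra.
have h1 : 0 <= s * (1 - r) by apply: mulr_ge0 => //; lra.
have h2 : 0 <= s * r by exact: mulr_ge0.
by do !case: ifP => _ //; apply: addr_ge0.
Qed.

(** Each vertex carries the correction for the edge to its successor, so the formula refers to no
    triangle and needs no gluing along common faces. *)
Definition psi (a : RK) : plane :=
  (\sum_(v \in support_of (bary a)) (push Y v (bary a v) (bary a (nx v))).1,
   \sum_(v \in support_of (bary a)) (push Y v (bary a v) (bary a (nx v))).2).

Definition push3 x y z (f : plane -> R) : plane :=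
  (((push Y x (f x) (f (nx x))).1 : R) + (push Y y (f y) (f (nx y))).1 +
     (push Y z (f z) (f (nx z))).1,
   ((push Y x (f x) (f (nx x))).2 : R) + (push Y y (f y) (f (nx y))).2 +
     (push Y z (f z) (f (nx z))).2).

Lemma bary_ge0 (a : RK) v : 0 <= bary a v.
Proof. by have [] : barycentric K (bary a) by exact: set_valP. Qed.

Lemma bary_face (a : RK) : K (support_of (bary a)).
Proof. by have [] : barycentric K (bary a) by exact: set_valP. Qed.

Lemma bary_sum (a : RK) : \sum_(v \in support_of (bary a)) bary a v = 1.
Proof. by have [] : barycentric K (bary a) by exact: set_valP. Qed.

Lemma bary_out (a : RK) (A : set plane) v : closed_simplex A a -> ~ A v -> bary a v = 0.
Proof. by move=> h nA; apply: contrapT => /eqP H; apply: nA; exact: h. Qed.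

Lemma faceY A v : K A -> A v -> Y v.
Proof.
case=> [[y Yy ->] ->//|[/(S_obj Yc cl)|]|].
- by move=> [x [y [_ [_ [? ? _ _ [-> _]]]]]] [->|->].
- by move=> [x [y [n ->]]]; have [? ?] := next_pointY n; move=> [->|->].
- move=> [x [y [z [_ _ _ -> [/(E_Y Yc Yi cl)[? ? _] /(E_Y Yc Yi cl)[_ ? _] _]]]]].
  by move=> [[->|->]|->].
Qed.

Lemma bary_le1 (a : RK) x y z : ctri x y z -> closed_simplex [set x; y; z] a ->
  bary a x + bary a y + bary a z = 1.
Proof.
move=> t ha; have [_ _ _ [xy yz zx]] := ctri_Y t; rewrite -(bary_sum a).
rewrite (sum3 (f := bary a) (G := bary a) xy yz zx)// => v vx vy vz.
by apply: (bary_out ha) => -[[]|].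
Qed.

Lemma psi_tri (a : RK) x y z : ctri x y z -> closed_simplex [set x; y; z] a ->
  psi a = push3 x y z (bary a).
Proof.
move=> t ha; have [Yx Yy Yz [xy yz zx]] := ctri_Y t.
have f0 v : v <> x -> v <> y -> v <> z -> bary a v = 0.
  by move=> vx vy vz; apply: (bary_out ha) => -[[]|].
have le1 v : bary a v <= 1.
  have h := bary_le1 t ha; have := bary_ge0 a x; have := bary_ge0 a y.
  have := bary_ge0 a z => *.
  have [->|/eqP vx] := eqVneq v x; first lra.
  have [->|/eqP vy] := eqVneq v y; first lra.
  have [->|/eqP vz] := eqVneq v z; first lra.
  by rewrite f0//; lra.
have p0 v : Y v -> bary a v = 0 -> push Y v (bary a v) (bary a (nx v)) = (0, 0).
  move=> Yv e; rewrite e (push_lin Yc Yi Ynext)//.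
    by apply: plane_eq => /=; rewrite mul0r.
  by left; have := le1 (nx v); lra.
pose G1 v := if `[< Y v >] then (push Y v (bary a v) (bary a (nx v))).1 else 0 : R.
pose G2 v := if `[< Y v >] then (push Y v (bary a v) (bary a (nx v))).2 else 0 : R.
have sY v : support_of (bary a) v -> Y v by move/(faceY (bary_face a)).
rewrite /psi /push3; congr (_, _).
- rewrite (eq_fsbigr G1); last first.
    by move=> v /set_mem /sY Yv; rewrite /G1 asboolT.
  rewrite (sum3 (f := bary a) (G := G1) xy yz zx)//.
    by rewrite /G1 !asboolT.
  by move=> v e; rewrite /G1; case: asboolP => // Yv; rewrite p0.
- rewrite (eq_fsbigr G2); last first.
    by move=> v /set_mem /sY Yv; rewrite /G2 asboolT.
  rewrite (sum3 (f := bary a) (G := G2) xy yz zx)//.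
    by rewrite /G2 !asboolT.
  by move=> v e; rewrite /G2; case: asboolP => // Yv; rewrite p0.
Qed.

Lemma tripoint_simplex x y z s r (a : RK) : x <> y -> y <> z -> z <> x ->
  bary a = tripoint x y z s r -> closed_simplex [set x; y; z] a.
Proof.
move=> xy yz zx e v /eqP; rewrite e => h.
apply: contrapT => /not_orP[/not_orP[vx vy] vz]; apply: h.
by have [_ _ _ ->] := tripointE s r xy yz zx.
Qed.

(** [z] has the smallest coordinate, so the corrections for the sides [yz] and [zx] vanish. Only
    that of [xy] bends the map, and it does so along the cone from the barycentre. *)
Lemma psi_tripoint x y z s r (a : RK) : ctri x y z -> 0 <= s <= 1 -> 0 <= r <= 1 ->
  bary a = tripoint x y z s r -> psi a = mix s (centre x y z) (sidept x y r).
Proof.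
move=> t /andP[s0 s1] /andP[r0 r1] e; have [Yx Yy Yz [xy yz zx]] := ctri_Y t.
rewrite (psi_tri t (tripoint_simplex xy yz zx e)) e /push3.
have [ex ey ez e0] := tripointE s r xy yz zx.
have t1 := ctri_rot t; have t2 := ctri_rot t1.
set f := tripoint x y z s r in e ex ey ez e0 *.
have sr0 : 0 <= s * r by exact: mulr_ge0.
have sr1 : 0 <= s * (1 - r) by apply: mulr_ge0 => //; lra.
(* In a positively oriented triangle the successor of a vertex is the following vertex or none of
   the three. *)
have nx0 u v w : ctri u v w -> [\/ u = x /\ v = y /\ w = z, u = y /\ v = z /\ w = x | u = z /\ v = x /\ w = y] ->
    nx u <> v -> f (nx u) = 0.
  move=> tu huvw nuv; have nuw := ctri_nxt_neq tu.
  have nuu : nx u <> u.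
    by have [Yu _ _ _] := ctri_Y tu; move=> e1; apply: (nxt_neq Yc Yi Ynext Yu).
  by apply: e0; case: huvw nuv nuw nuu => -[-> [-> ->]].
have py : push Y y (f y) (f (nx y)) = (f y * (y.1 : R), f y * (y.2 : R)).
  apply: (push_lin Yc Yi Ynext) => //; right.
  have [->|/eqP n] := eqVneq (nx y) z; first by rewrite ey ez; lra.
  by rewrite (nx0 _ _ _ t1)//; [rewrite ey; lra|constructor 2].
have pz : push Y z (f z) (f (nx z)) = (f z * (z.1 : R), f z * (z.2 : R)).
  apply: (push_lin Yc Yi Ynext) => //; left.
  have [->|/eqP n] := eqVneq (nx z) x; first by rewrite ex ez; lra.
  by rewrite (nx0 _ _ _ t2)//; [rewrite ez; lra|constructor 3].
rewrite py pz /sidept; case: eqP => [nxy|nxy].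
- rewrite nxy ex ey ez push_cone; [|lra|lra].
  rewrite (_ : 3 * _ - 2 = s); last by field.
  rewrite (_ : (1 - s) / 3 + s * (1 - r) + ((1 - s) / 3 + s * r) +
     ((1 - s) / 3 + s * r) - 1 = s * r); last by field.
  have [->|sn0] := eqVneq s 0.
    by rewrite nxy; apply: plane_eq => /=; field.
  rewrite [s * r]mulrC mulfK//.
  by rewrite nxy; apply: plane_eq => /=; field.
- rewrite (nx0 _ _ _ t)//; last by constructor 1.
  rewrite (push_lin Yc Yi Ynext)//; last by right; rewrite ex; lra.
  by rewrite ex ey ez; apply: plane_eq; rewrite /=; field.
Qed.

End Psi.

(** * Rays from an interior point of a convex region *)

Section Rays.
Context {R : realType}.
Local Notation plane := (plane R).
Implicit Types (x y z p q u v w o : plane) (s t r : R).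

Lemma dsq_mix t o p : dsq o (mix t o p) = t ^+ 2 * dsq o p.
Proof. by rewrite /dsq /=; ring. Qed.

Lemma dsq_disk p q : disk p -> disk q -> dsq p q <= 4.
Proof.
rewrite !diskE /sq /dsq.
case: p q => [p1 p2] [q1 q2] /=.
move: (p1 : R) (p2 : R) (q1 : R) (q2 : R) => {}p1 {}p2 {}q1 {}q2 h1 h2.
have := sqr_ge0 (p1 + q1); have := sqr_ge0 (p2 + q2); nra.
Qed.

Lemma open_area_list (l : seq (plane * plane)) :
  open [set q : plane | forall e, e \in l -> 0 < area e.1 e.2 q].
Proof.
elim: l => [|e l IH].
  rewrite (_ : [set _ | _] = setT); first exact: openT.
  by apply/seteqP; split=> // q _ e; rewrite in_nil.
rewrite (_ : [set _ | _] = [set q | 0 < area e.1 e.2 q] `&`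
    [set q | forall e, e \in l -> 0 < area e.1 e.2 q]).
  by apply: openI => //; apply: open_gt0; exact: continuous_area.
apply/seteqP; split=> q /= H.
  split; first by apply: H; rewrite mem_head.
  by move=> e' he'; apply: H; rewrite inE he' orbT.
by move=> e'; rewrite inE => /orP[/eqP->|]; [case: H|case: H => _; apply].
Qed.

Lemma closed_area_list (l : seq (plane * plane)) :
  closed [set q : plane | forall e, e \in l -> 0 <= area e.1 e.2 q].
Proof.
rewrite (_ : [set _ | _] = \bigcap_(e in [set` l]) [set q | 0 <= area e.1 e.2 q]).
  by apply: closed_bigI => e _; apply: closed_ge0; exact: continuous_area.
by apply/seteqP; split=> q /= H e el; exact: H.
Qed.

(** Take the largest parameter for which the ray is still in the closed region; if no constraint
    were tight there, the ray could be prolonged. *)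
Lemma ray_exit (l : seq (plane * plane)) o p : open_disk o ->
  (forall e, e \in l -> 0 < area e.1 e.2 o) -> disk p ->
  (forall e, e \in l -> 0 <= area e.1 e.2 p) -> p <> o ->
  exists s u, [/\ 0 < s <= 1, disk u, forall e, e \in l -> 0 <= area e.1 e.2 u,
    p = mix s o u & circle u \/ exists2 e, e \in l & area e.1 e.2 u = 0].
Proof.
move=> oo lo dp lp /eqP po; have d0 : 0 < dsq o p by rewrite dsq_gt0 eq_sym.
pose A := [set t : R | 1 <= t /\ (disk `&`
  [set q | forall e, e \in l -> 0 <= area e.1 e.2 q]) (mix t o p)].
have cm : continuous (fun t => mix t o p).
  by move=> t; apply: cvg_mix; [exact: cvg_id|exact: cvg_cst|exact: cvg_cst].
(* [t ^+ 2 * dsq o p] is a squared distance between points of the disk, hence at most 4, and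
   [t <= t ^+ 2]. *)
have Ab : A `<=` `[1, 4 / dsq o p].
  move=> t [t1 [dt _]]; rewrite /= in_itv/= t1/= ler_pdivlMr//.
  have := dsq_disk (odisk_disk oo) dt; rewrite dsq_mix; nra.
have Acl : closed A.
  rewrite (_ : A = [set t | 1 <= t] `&` ((fun t => mix t o p) @^-1` (disk `&`
  [set q | forall e, e \in l -> 0 <= area e.1 e.2 q])))//.
  apply: closedI; first exact: closed_ge.
  apply: closed_comp => [t _|]; first exact: cm.
  by apply: closedI; [exact: closed_disk|exact: closed_area_list].
have cA : compact A by apply: subclosed_compact Acl (@segment_compact _ _ _) Ab.
have A1 : A !=set0 by exists 1; split=> //; rewrite mix1.
have ci : {within A, continuous (id : R -> R)}.
  by apply: continuous_subspaceT => i; exact: cvg_id.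
have [t] := compact_EVT_max A1 cA ci.
rewrite inE => -[t1 [dt lt]] tmax.
have t0 : 0 < t by lra.
exists t^-1, (mix t o p); split=> //.
- by rewrite invr_gt0 t0 invf_le1.
- by apply: plane_eq => /=; field; rewrite gt_eqF.
- apply: contrapT => /not_orP[nc nl].
  have ou : open_disk (mix t o p) by case: (disk_case dt).
  have lu e : e \in l -> 0 < area e.1 e.2 (mix t o p).
    move=> el; rewrite lt_neqAle lt//= andbT; apply/eqP => e0.
    by apply: nl; exists e.
  have nU : nbhs (mix t o p) (open_disk `&`
      [set q | forall e, e \in l -> 0 < area e.1 e.2 q]).
    apply: open_nbhs_nbhs; split=> //.
    by apply: openI; [exact: open_odisk|exact: open_area_list].
  have /nbhs_ballP[e /= e0 He] := cm t _ nU.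
  have [|d1 d2] := He (t + e / 2).
    by rewrite /ball/= opprD addrA subrr add0r normrN gtr0_norm; lra.
  have : A (t + e / 2).
    split; first lra; split; first exact: odisk_disk.
    by move=> e' /d2/ltW.
  by move/mem_set/tmax; lra.
Qed.

(** [u'] divides the segment from [o] to [u] in the ratio [s / s' < 1]; it is then in the interior,
    neither on the circle nor on a line bounding the region. *)
Lemma cone_lt o u u' s s' : open_disk o -> disk u -> 0 <= s -> s < s' ->
  mix s o u = mix s' o u' ->
  circle u' \/ (exists p q, [/\ area p q u' = 0, 0 < area p q o & 0 <= area p q u]) ->
  False.
Proof.
move=> oo du s0 ss e.
have s'0 : s' != 0 by rewrite gt_eqF//; lra.
have [e1 e2] : (mix s o u).1 = (mix s' o u').1 :> R /\ (mix s o u).2 = (mix s' o u').2 :> R.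
  by rewrite e.
have k0 : 0 <= s / s' by rewrite divr_ge0//; lra.
have k1 : s / s' < 1 by rewrite ltr_pdivrMr ?mul1r//; lra.
have uE : u' = mix (s / s') o u.
  rewrite /= in e1 e2; apply: plane_eq; rewrite /=; apply: (mulfI s'0).
  - transitivity (((1 - s) * (o.1 : R) + s * u.1) - (1 - s') * o.1); first by rewrite e1; ring.
    by field.
  - transitivity (((1 - s) * (o.2 : R) + s * u.2) - (1 - s') * o.2); first by rewrite e2; ring.
    by field.
case=> [cu'|[p [q [h1 h2 h3]]]].
- have : open_disk u' by rewrite uE; exact: odisk_mixl.
  by move/odisk_ncircle.
- move: h1; rewrite uE area_mix => h1.
  have : 0 < (1 - s / s') * area p q o by rewrite mulr_gt0// subr_gt0.
  have : 0 <= s / s' * area p q u by rewrite mulr_ge0.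
  lra.
Qed.

Lemma circle_tri x y z u : circle x -> circle y -> circle z -> circle u ->
  0 < area x y z -> 0 <= area x y u -> 0 <= area y z u -> 0 <= area z x u ->
  [\/ u = x, u = y | u = z].
Proof.
move=> cx cy cz cu; have [a [_ _ xE]] := cexp_surj 0 cx.
have [b [b0 b1 yE]] := cexp_surj a cy; have [c [c0 c1 zE]] := cexp_surj a cz.
have [d [d0 d1 uE]] := cexp_surj a cu; have pi0 := pi_gt0 R.
have ha : a <= a < a + 2 * pi by apply/andP; split; lra.
have hb : a <= b < a + 2 * pi by rewrite b0 b1.
have hc : a <= c < a + 2 * pi by rewrite c0 c1.
have hd : a <= d < a + 2 * pi by rewrite d0 d1.
subst x y z u; rewrite area_order_base// => /andP[ab bc].
rewrite !leNgt !area_lt0 !(@area_cexp_order _ a)// => /negP h1 /negP h2 /negP h3.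
have [->|da] := eqVneq d a; first by constructor 1.
have [->|db] := eqVneq d b; first by constructor 2.
have [->|dc] := eqVneq d c; first by constructor 3.
have {}da : a < d by rewrite lt_neqAle eq_sym da.
exfalso; move: db dc; rewrite !neq_lt => /orP[db|db] /orP[dc|dc].
- by apply: h1; apply/orP; right; apply/orP; left; apply/andP; split; lra.
- by lra.
- by apply: h2; apply/orP; right; apply/orP; left; apply/andP; split; lra.
- by apply: h3; apply/orP; left; apply/andP; split; lra.
Qed.

End Rays.

(** * Injectivity of psi *)

Section PsiBijective.
Context {R : realType}.
Local Notation plane := (plane R).
Implicit Types (x y z p q u v w o : plane) (s t r : R).

Variables (Y : set plane) (S : set (set plane)).
Hypothesis tm : tame Y S.

Let Yc : Y `<=` circle. Proof. by have [] := tm. Qed.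
Let Yi : infinite_set Y. Proof. by have [] := tm. Qed.
Let cl : is_cluster Y S. Proof. by have [] := tm. Qed.
Let lf : locally_finite Y S. Proof. by have [] := tm. Qed.
Let Ynext y : Y y -> exists y', next_point Y y y'.
Proof. by have [_ _ _ _ [+ _ _ _ _]] := tm; apply. Qed.
Let Yprev y : Y y -> exists y', next_point Y y' y.
Proof. by have [_ _ _ _ [_ + _ _ _]] := tm; apply. Qed.

Local Notation K := (cluster_complex Y S).
Local Notation RK := (@realization R plane K).
Local Notation E := (E Y S).
Local Notation ctri := (ctri Y S).
Local Notation treg := (treg S).
Local Notation nx := (nxt Y).
Local Notation Gam := (sidept Y).
Local Notation psi := (@psi R Y S).

Definition rot3 x y z x' y' z' := [\/ [/\ x' = x, y' = y & z' = z],
  [/\ x' = y, y' = z & z' = x] | [/\ x' = z, y' = x & z' = y]].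

Lemma rot3_ctri x y z x' y' z' : rot3 x y z x' y' z' -> ctri x y z -> ctri x' y' z'.
Proof.
by case=> [[-> -> ->]|[-> -> ->]|[-> -> ->]] // t;
  [exact: ctri_rot|exact/ctri_rot/ctri_rot].
Qed.

Lemma rot3_centre x y z x' y' z' : rot3 x y z x' y' z' ->
  centre x' y' z' = centre x y z.
Proof.
by case=> [[-> -> ->]|[-> -> ->]|[-> -> ->]] //; rewrite centre_rot// centre_rot.
Qed.

Lemma rot3_treg x y z x' y' z' u : rot3 x y z x' y' z' -> treg x' y' z' u ->
  treg x y z u.
Proof.
by case=> [[-> -> ->]|[-> -> ->]|[-> -> ->]] // t;
  [exact/treg_rot/treg_rot|exact: treg_rot].
Qed.

Lemma rot3_set x y z x' y' z' : rot3 x y z x' y' z' ->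
  [set x'; y'; z'] = [set x; y; z].
Proof.
by case=> [[-> -> ->]|[-> -> ->]|[-> -> ->]] //; apply/seteqP; split=> v /=; tauto.
Qed.

Lemma rot3_sym x y z x' y' z' : rot3 x y z x' y' z' -> rot3 x' y' z' x y z.
Proof.
case=> [[-> -> ->]|[-> -> ->]|[-> -> ->]]; by [constructor 1|constructor 3|constructor 2].
Qed.

Lemma E_tri x y : E x y -> exists z x' y', [/\ ctri x' y' z,
  [set x; y] = [set x'; y'] & (x' = x /\ y' = y) \/ (x' = y /\ y' = x)].
Proof.
move=> Exy; have [z [t|t]] := E_ctri Yc Yi cl lf Yprev Exy; exists z.
  by exists x, y; split=> //; left.
by exists y, x; split=> //; [exact: set2C|right].
Qed.

Lemma face_tri A : K A -> exists x y z, ctri x y z /\ A `<=` [set x; y; z].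
Proof.
have H (B : set plane) x y : E x y -> B `<=` [set x; y] ->
    exists x y z, ctri x y z /\ B `<=` [set x; y; z].
  move=> /E_tri[z [x' [y' [t e _]]]] As; exists x', y', z; split=> //.
  by rewrite e in As; move=> v /As; left.
case=> [[y Yy ->]|EA|].
- apply: (H _ y (nx y)); last by move=> v ->; left.
  by apply/(E_cases Yc Yi cl); constructor 2; exact: nxtP.
- have [x [y e]] : exists x y, A = [set x; y].
    case: EA => [/(S_obj Yc cl)[x [y [_ [_ [_ _ _ _ [-> _]]]]]]|[x [y [_ ->]]]].
      by exists x, y.
    by exists x, y.
  by subst A; exact: (H _ x y).
- move=> [x [y [z [xy yz xz -> [Exy Eyz Exz]]]]].
  have [Yx Yy _] := E_Y Yc Yi cl Exy; have [_ Yz _] := E_Y Yc Yi cl Eyz.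
  have := area_circle_neq0 (Yc Yx) (Yc Yy) (Yc Yz) xy (nesym xz) (nesym yz).
  rewrite neq_lt => /orP[h|h].
    rewrite area_lt0 in h; exists y, x, z; split.
      by split=> //; apply: EC.
    by move=> v [[->|->]|->]; [left; right|left; left|right].
  by exists x, y, z; split=> //; split=> //; exact: EC.
Qed.

Lemma real_tri (a : RK) : exists x y z, ctri x y z /\ closed_simplex [set x; y; z] a.
Proof. exact: (face_tri (bary_face a)). Qed.

Lemma fun3_eq (f g : plane -> R) x y z :
  (forall v, v <> x -> v <> y -> v <> z -> f v = 0) ->
  (forall v, v <> x -> v <> y -> v <> z -> g v = 0) ->
  f x = g x -> f y = g y -> f z = g z -> f = g.
Proof.
move=> f0 g0 ex ey ez; apply: funext => v.
have [->//|/eqP vx] := eqVneq v x; have [->//|/eqP vy] := eqVneq v y.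
have [->//|/eqP vz] := eqVneq v z; by rewrite f0// g0.
Qed.

Lemma normal_form (a : RK) x y z : ctri x y z -> closed_simplex [set x; y; z] a ->
  bary a z <= bary a x -> bary a z <= bary a y ->
  exists s r, [/\ 0 <= s <= 1, 0 <= r <= 1 & bary a = tripoint x y z s r].
Proof.
move=> t ha zx0 zy0; have [_ _ _ [xy yz zx]] := ctri_Y tm t.
have sum := bary_le1 tm t ha; have c0 := bary_ge0 a z.
(* The smallest coordinate, that of [z], is to be [(1 - s) / 3]. At the barycentre any [r] would do,
   and 0 is taken. *)
pose s := 1 - 3 * bary a z.
pose r := if s == 0 then 0 else (bary a y - bary a z) / s.
have sr : s * r = bary a y - bary a z.
  rewrite /r; case: eqP => [e|/eqP n]; last by rewrite mulrC divfK.
  by move: e; rewrite /s => e; lra.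
have s0 : 0 <= s by rewrite /s; lra.
have s1 : s <= 1 by rewrite /s; lra.
have r01 : 0 <= r <= 1.
  rewrite /r; case: eqP => [//|/eqP n]; first by rewrite ?lexx ?ler01.
  have sp : 0 < s by rewrite lt_neqAle eq_sym n.
  apply/andP; split; first by rewrite divr_ge0// subr_ge0.
  by rewrite ler_pdivrMr// mul1r /s; lra.
exists s, r; split; [by apply/andP|by []|].
have [ex ey ez e0] := tripointE s r xy yz zx.
apply: (fun3_eq (x := x) (y := y) (z := z)) => //.
- by move=> v vx vy vz; apply: (bary_out ha) => -[[]|].
- by rewrite ex mulrBr mulr1 sr /s; lra.
- by rewrite ey sr /s; lra.
- by rewrite ez /s; lra.
Qed.

Lemma normal_form_rot (a : RK) x y z : ctri x y z ->
  closed_simplex [set x; y; z] a -> exists x' y' z' s r,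
  [/\ rot3 x y z x' y' z', 0 <= s <= 1, 0 <= r <= 1 &
      bary a = tripoint x' y' z' s r].
Proof.
move=> t ha.
have N x' y' z' : rot3 x y z x' y' z' -> bary a z' <= bary a x' ->
  bary a z' <= bary a y' -> exists x' y' z' s r,
  [/\ rot3 x y z x' y' z', 0 <= s <= 1, 0 <= r <= 1 &
      bary a = tripoint x' y' z' s r].
  move=> rt h1 h2; have t' := rot3_ctri rt t.
  have ha' : closed_simplex [set x'; y'; z'] a by rewrite (rot3_set rt).
  by have [s [r [? ? ?]]] := normal_form t' ha' h1 h2; exists x', y', z', s, r.
have [h1|h1] := leP (bary a z) (bary a x);
  have [h2|h2] := leP (bary a z) (bary a y);
  have [h3|h3] := leP (bary a x) (bary a y).
- by apply: (N x y z) => //; constructor 1.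
- by apply: (N x y z) => //; constructor 1.
- by apply: (N z x y); [constructor 3|lra|lra].
- by apply: (N z x y); [constructor 3|lra|lra].
- by apply: (N y z x); [constructor 2|lra|lra].
- by apply: (N y z x); [constructor 2|lra|lra].
- by apply: (N y z x); [constructor 2|lra|lra].
- by apply: (N z x y); [constructor 3|lra|lra].
Qed.

Lemma psi_treg (a : RK) x y z : ctri x y z -> closed_simplex [set x; y; z] a ->
  treg x y z (psi a).
Proof.
move=> t ha; have [x' [y' [z' [s [r [rt s01 r01 e]]]]]] := normal_form_rot t ha.
have t' := rot3_ctri rt t; rewrite (psi_tripoint tm t' s01 r01 e).
move: s01 r01 => /andP[s0 s1] /andP[r0 r1].
apply: (rot3_treg rt); apply: treg_cvx => //; first exact: (centre_treg tm).
exact: (Gam_treg tm).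
Qed.

Lemma Gam_sign p q x y z r : S [set p; q] -> ctri x y z -> 0 <= r -> r <= 1 ->
  0 <= area p q x -> 0 <= area p q y ->
  0 <= area p q (Gam x y r) /\
  (0 < r < 1 -> 0 < area p q x \/ 0 < area p q y -> 0 < area p q (Gam x y r)).
Proof.
move=> Spq t r0 r1 hx hy; have [Yp Yq pq _] := S_sep Yc cl Spq.
have [Yx Yy Yz _] := ctri_Y tm t.
have [Sxy|e] := ctri_nxt tm t.
  rewrite (Gam_S tm)// area_mix; split.
    by apply: addr_ge0; apply: mulr_ge0 => //; lra.
  move=> /andP[r0' r1'] [h|h].
    by apply: ltr_pwDl; [rewrite mulr_gt0// subr_gt0|exact: mulr_ge0].
  by apply: ltr_wpDl; [apply: mulr_ge0 => //; lra|exact: mulr_gt0].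
have nb := S_nboundary Yc cl Spq.
rewrite -e Gam_arc; rewrite -e in hy.
have pos : 0 < r < 1 -> 0 < area p q (arcpt Y x r).
  by move=> h; exact: (arc_sign Yc Yi Ynext).
split=> [|h _]; last exact: pos.
move: r0; rewrite le_eqVlt => /orP[/eqP<-|r0]; first by rewrite (arcpt0 Yc Yi Ynext).
move: r1; rewrite le_eqVlt => /orP[/eqP->|r1]; first by rewrite arcpt1.
by apply/ltW/pos; rewrite r0.
Qed.

(** Bending sides onto arcs moves no point across a chord of the cluster, so the side on which a
    point is sent is dictated by the vertices in its support. *)
Lemma psi_sign (a : RK) p q : S [set p; q] ->
  (forall v, support_of (bary a) v -> 0 <= area p q v) ->
  0 <= area p q (psi a) /\
  ((exists2 v, support_of (bary a) v & 0 < area p q v) -> 0 < area p q (psi a)).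
Proof.
move=> Spq H; have [x0 [y0 [z0 [t0 ha0]]]] := real_tri a.
have [x [y [z [s [r [rt s01 r01 e]]]]]] := normal_form_rot t0 ha0.
have t := rot3_ctri rt t0; rewrite (psi_tripoint tm t s01 r01 e) area_mix.
have [_ _ _ [xy yz zx]] := ctri_Y tm t.
have [ex ey ez e0] := tripointE s r xy yz zx.
move: s01 r01 => /andP[s0 s1] /andP[r0 r1].
have sr0 : 0 <= s * r by exact: mulr_ge0.
have sr1 : 0 <= s * (1 - r) by apply: mulr_ge0 => //; lra.
move: s1; rewrite le_eqVlt => /orP[/eqP s1|s1].
- subst s; rewrite subrr mul0r add0r mul1r.
  have sx : r < 1 -> support_of (bary a) x.
    by move=> h; rewrite /support_of/= e ex gt_eqF//; lra.
  have sy : 0 < r -> support_of (bary a) y.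
    by move=> h; rewrite /support_of/= e ey gt_eqF//; lra.
  have sv v : support_of (bary a) v -> [\/ v = x /\ r < 1 | v = y /\ 0 < r].
    rewrite /support_of/= e => h.
    have [vx|/eqP vx] := eqVneq v x.
      left; split=> //; rewrite lt_neqAle r1 andbT; apply/eqP => e1.
      by move: h; rewrite vx ex e1 !subrr mul0r mulr0 addr0 eqxx.
    have [vy|/eqP vy] := eqVneq v y.
      right; split=> //; rewrite lt_neqAle r0 andbT eq_sym; apply/eqP => e1.
      by move: h; rewrite vy ey e1 subrr mul0r mulr0 addr0 eqxx.
    have [vz|/eqP vz] := eqVneq v z.
      by exfalso; move: h; rewrite vz ez subrr mul0r eqxx.
    by move: h; rewrite e0// eqxx.
  have [Yx _ _ _] := ctri_Y tm t.
  have [r00|rn0] := eqVneq r 0.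
    rewrite r00 (Gam0 tm)//; split; first by apply/H/sx; rewrite r00.
    by move=> [v /sv[[->//]|[_]]]; rewrite r00 ltxx.
  have [r11|rn1] := eqVneq r 1.
    rewrite r11 Gam1//; split; first by apply/H/sy; rewrite r11.
    by move=> [v /sv[[_]|[->//]]]; rewrite r11 ltxx.
  have rp : 0 < r by rewrite lt_neqAle eq_sym rn0.
  have rl : r < 1 by rewrite lt_neqAle rn1.
  have [h1 h2] := Gam_sign Spq t r0 r1 (H _ (sx rl)) (H _ (sy rp)).
  split=> // -[v /sv hv hp]; apply: h2; first by rewrite rp.
  by case: hv hp => -[-> _] ?; [left|right].
- have sx : support_of (bary a) x by rewrite /support_of/= e ex gt_eqF//; lra.
  have sy : support_of (bary a) y by rewrite /support_of/= e ey gt_eqF//; lra.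
  have sz : support_of (bary a) z by rewrite /support_of/= e ez gt_eqF//; lra.
  have [h1 _] := Gam_sign Spq t r0 r1 (H _ sx) (H _ sy).
  have := H _ sx; have := H _ sy; have := H _ sz => hz hy hx.
  rewrite area_centre.
  have h3 : 0 <= s * area p q (Gam x y r) by exact: mulr_ge0.
  split.
    by apply: addr_ge0 => //; apply: mulr_ge0; [lra|apply: mulr_ge0; lra].
  move=> [v hv hp].
  have : 0 < area p q x + area p q y + area p q z.
    have [vx|/eqP vx] := eqVneq v x; first by rewrite vx in hp; lra.
    have [vy|/eqP vy] := eqVneq v y; first by rewrite vy in hp; lra.
    have [vz|/eqP vz] := eqVneq v z; first by rewrite vz in hp; lra.
    by move: hv; rewrite /support_of/= e e0// eqxx.
  move=> h; apply: ltr_pwDl => //; apply: mulr_gt0; [lra|].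
  by apply: mulr_gt0; lra.
Qed.

Lemma face_E A v v' : K A -> A v -> A v' -> v <> v' -> E v v'.
Proof.
move=> /face_tri[x [y [z [[Exy Eyz Ezx _] As]]]] /As[[->|->]|->] /As[[->|->]|->] //;
  by [|move=> _; exact: EC].
Qed.

Lemma face_oneside A p q : K A -> S [set p; q] ->
  (forall v, A v -> 0 <= area p q v) \/ (forall v, A v -> area p q v <= 0).
Proof.
move=> KA Spq; have [|/existsNP[v /not_implyP[Av /negP]]] :=
  pselect (forall v, A v -> 0 <= area p q v); first by left.
rewrite -ltNge => hv; right=> w Aw; rewrite leNgt; apply/negP => hw.
have vw : v <> w by move=> e; move: hv hw; rewrite e; lra.
apply: (E_nsep Yc Yi cl (or_introl Spq) (face_E KA Av Aw vw)).
by rewrite /sep nmulr_rlt0.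
Qed.

(** A vertex of [b] strictly beyond a side would put [psi b] strictly beyond it, by [psi_sign]. So
    the vertices of [b] are circle points in the closed triangle, that is, vertices of it. *)
Lemma psi_same_tri (a b : RK) x y z : ctri x y z -> closed_simplex [set x; y; z] a ->
  psi a = psi b -> closed_simplex [set x; y; z] b.
Proof.
move=> t ha e.
have key p q w : ctri p q w -> closed_simplex [set p; q; w] a ->
    forall v, support_of (bary b) v -> 0 <= area p q v.
  move=> t' ha' v bv; have [Yp Yq Yw [pq _ _]] := ctri_Y tm t'.
  have [_ _ _ hw] := t'.
  have Yv := faceY tm (bary_face b) bv.
  have [Spq|e'] := ctri_nxt tm t'; last first.
    have n := nxtP Yc Yi Ynext Yp; rewrite e' in n.
    by have [_ _ ] := (nextP Yc pq).1 n; apply.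
  have Sqp : S [set q; p] by rewrite set2C.
  have [h1 _] : 0 <= area p q (psi a) /\
    ((exists2 v, support_of (bary a) v & 0 < area p q v) -> 0 < area p q (psi a)).
    apply: psi_sign => // u /ha'[[->|->]|->]; rewrite ?areaxyx ?areaxyy//.
    exact: ltW.
  have [h2|h2] := face_oneside (bary_face b) Spq; first exact: h2.
  rewrite leNgt; apply/negP => hv.
  have [_ h3] : 0 <= area q p (psi b) /\
    ((exists2 v, support_of (bary b) v & 0 < area q p v) -> 0 < area q p (psi b)).
    by apply: psi_sign => // u /h2; rewrite [area q p u]area_swap oppr_ge0.
  have : 0 < area q p (psi b) by apply: h3; exists v; rewrite // -area_lt0.
  by rewrite -area_lt0 -e ltNge h1.
move=> v bv; have [Yx Yy Yz _] := ctri_Y tm t; have [_ _ _ h] := t.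
have Yv := faceY tm (bary_face b) bv.
have t1 := ctri_rot t; have t2 := ctri_rot t1.
have r1 : rot3 x y z y z x by constructor 2.
have r2 : rot3 x y z z x y by constructor 3.
have h1 := key _ _ _ t ha v bv.
have h2 : 0 <= area y z v by apply: (key _ _ _ t1) => //; rewrite (rot3_set r1).
have h3 : 0 <= area z x v by apply: (key _ _ _ t2) => //; rewrite (rot3_set r2).
by have [->|->|->] := circle_tri (Yc Yx) (Yc Yy) (Yc Yz) (Yc Yv) h h1 h2 h3;
  [left; left|left; right|right].
Qed.

Lemma mix_inj s s' x y : x <> y -> mix s x y = mix s' x y -> s = s'.
Proof.
move=> /eqP; rewrite -dsq_gt0 => d e; apply/eqP; rewrite -subr_eq0.
have h : (s - s') * dsq x y = 0.
  have e1 : (1 - s) * (x.1 : R) + s * y.1 = (1 - s') * (x.1 : R) + s' * y.1.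
    exact: (congr1 (fun p : plane => p.1 : R) e).
  have e2 : (1 - s) * (x.2 : R) + s * y.2 = (1 - s') * (x.2 : R) + s' * y.2.
    exact: (congr1 (fun p : plane => p.2 : R) e).
  have d1 : (s - s') * ((x.1 : R) - y.1) = 0 by lra.
  have d2 : (s - s') * ((x.2 : R) - y.2) = 0 by lra.
  by rewrite /dsq mulrDr !expr2 !mulrA d1 d2 !mul0r addr0.
by move/eqP: h; rewrite mulf_eq0 (gt_eqF d) orbF.
Qed.

Lemma Gam_inj x y z r r' : ctri x y z -> 0 <= r <= 1 -> 0 <= r' <= 1 ->
  Gam x y r = Gam x y r' -> r = r'.
Proof.
move=> t r01 r01'; have [Yx _ _ [xy _ _]] := ctri_Y tm t.
rewrite /sidept; case: eqP => _; last exact: mix_inj.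
exact: (arcpt_inj Yc Yi Ynext).
Qed.

(** Signs keep a chord apart from the neighbouring side, and [next_arc_uniq] keeps two arcs apart;
    only the common vertex remains. *)
Lemma Gam_meet x y z r r' : ctri x y z -> 0 <= r <= 1 -> 0 <= r' <= 1 ->
  Gam x y r = Gam y z r' -> r = 1 /\ r' = 0.
Proof.
move=> t r01 r01' e; have [Yx Yy Yz [xy yz zx]] := ctri_Y tm t.
have t1 := ctri_rot t.
have y1 : Gam x y 1 = y by exact: Gam1.
have y0 : Gam y z 0 = y by exact: (Gam0 tm).
have i0 : 0 <= (0 : R) <= 1 by rewrite lexx ler01.
have i1 : 0 <= (1 : R) <= 1 by rewrite lexx ler01.
have fr' : r' = 0 -> r = 1 /\ r' = 0.
  move=> r0; split=> //; apply: (Gam_inj t) => //; by rewrite e r0 y0 y1.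
have fr : r = 1 -> r = 1 /\ r' = 0.
  move=> r1; split=> //; apply: (Gam_inj t1) => //; by rewrite -e r1 y0 y1.
move: (r01) (r01') => /andP[r0 r1] /andP[r0' r1'].
have [Sxy|nxy] := ctri_nxt tm t.
  apply: fr'; apply/eqP; rewrite eq_le r0' andbT leNgt; apply/negP => h.
  have := Gam_pos2 tm t1 h r1' Sxy.
  by rewrite -e (Gam_S tm)// area_mix areaxyx areaxyy !mulr0 addr0 ltxx.
have [Syz|nyz] := ctri_nxt tm t1.
  apply: fr; apply/eqP; rewrite eq_le r1/= leNgt; apply/negP => h.
  have := Gam_pos tm t r0 h Syz.
  by rewrite e (Gam_S tm)// area_mix areaxyx areaxyy !mulr0 addr0 ltxx.
move: e; rewrite -[in Gam x y _]nxy -nyz !Gam_arc => e.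
have [r00|rn0] := eqVneq r 0.
  have [r0''|rn0'] := eqVneq r' 0; first exact: fr'.
  have [r1''|rn1'] := eqVneq r' 1.
    by move: e; rewrite r00 r1'' arcpt1 (arcpt0 Yc Yi Ynext)// nyz => xz; case: zx.
  have := @arcpt_nY _ _ Yc Yi Ynext y r' Yy; rewrite -e r00 (arcpt0 Yc Yi Ynext)// => H.
  by exfalso; apply: H => //; rewrite !lt_neqAle eq_sym rn0' rn1' r0' r1'.
have [r11|rn1] := eqVneq r 1; first exact: fr.
have ri : 0 < r < 1 by rewrite !lt_neqAle eq_sym rn0 rn1 r0 r1.
have [r0''|rn0'] := eqVneq r' 0; first exact: fr'.
have nY := arcpt_nY Yc Yi Ynext Yx ri.
have [r1''|rn1'] := eqVneq r' 1.
  by case: nY; rewrite e r1'' arcpt1 nyz.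
have ri' : 0 < r' < 1 by rewrite !lt_neqAle eq_sym rn0' rn1' r0' r1'.
exfalso; apply: xy; apply: (next_arc_uniq Yc Yi (@arcpt_circle R Y x r)
  (nxtP Yc Yi Ynext Yx) (nxtP Yc Yi Ynext Yy)).
  exact: (arcpt_area Yc Yi Ynext).
by rewrite e; exact: (arcpt_area Yc Yi Ynext).
Qed.

(** In a common triangle both points have cone coordinates around the same centre. By [cone_lt]
    their heights agree; off the centre the side points then coincide, on one side or at a shared
    vertex. *)
Lemma psi_inj : injective psi.
Proof.
move=> a b e; apply: bary_inj.
have [x0 [y0 [z0 [t0 ha0]]]] := real_tri a.
have hb0 := psi_same_tri t0 ha0 e.
have [x [y [z [s [r [rt s01 r01 ea]]]]]] := normal_form_rot t0 ha0.
have t := rot3_ctri rt t0.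
have hb : closed_simplex [set x; y; z] b by rewrite (rot3_set rt).
have [x' [y' [z' [s' [r' [rt' s01' r01' eb]]]]]] := normal_form_rot t hb.
have t' := rot3_ctri rt' t.
move: e; rewrite (psi_tripoint tm t s01 r01 ea) (psi_tripoint tm t' s01' r01' eb).
rewrite (rot3_centre rt') => e.
have oo := centre_odisk tm t.
have [_ _ _ [xy yz zx]] := ctri_Y tm t.
have bdy x1 y1 z1 x2 y2 z2 i j : ctri x1 y1 z1 -> rot3 x1 y1 z1 x2 y2 z2 ->
    0 <= i <= 1 -> 0 <= j <= 1 ->
    circle (Gam x1 y1 i) \/ (exists p q, [/\ area p q (Gam x1 y1 i) = 0,
      0 < area p q (centre x1 y1 z1) & 0 <= area p q (Gam x2 y2 j)]).
  move=> t1 rt1 /andP[i0 i1] /andP[j0 j1]; have [_ _ _ h1] := t1.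
  have [S1|<-] := ctri_nxt tm t1; last by left; rewrite Gam_arc; exact: arcpt_circle.
  right; exists x1, y1; split.
  - by rewrite (Gam_S tm)// area_mix areaxyx areaxyy !mulr0 addr0.
  - exact: area_centre_gt0.
  - have [_ + _ _] := rot3_treg rt1 (Gam_treg tm (rot3_ctri rt1 t1) j0 j1).
    exact.
move: (s01) (s01') => /andP[s0 s1] /andP[s0' s1'].
move: (r01) (r01') => /andP[r0 r1] /andP[r0' r1'].
have [du _ _ _] := Gam_treg tm t r0 r1.
have [du' _ _ _] := Gam_treg tm t' r0' r1'.
have ss : s = s'.
  have [lt_ss|lt_ss|//] := ltgtP s s'.
  - exfalso; apply: (cone_lt oo du s0 lt_ss e).
    have := bdy _ _ _ _ _ _ _ _ t' (rot3_sym rt') r01' r01.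
    by rewrite (rot3_centre rt').
  - exfalso; apply: (cone_lt oo du' s0' lt_ss (esym e)).
    exact: (bdy _ _ _ _ _ _ _ _ t rt' r01 r01').
subst s'.
have [ex ey ez e0] := tripointE s r xy yz zx.
have [_ _ _ [xy' yz' zx']] := ctri_Y tm t'.
have [ex' ey' ez' e0'] := tripointE s r' xy' yz' zx'.
rewrite ea eb; apply: (fun3_eq (x := x) (y := y) (z := z)) => //.
  by move=> v vx vy vz; apply: e0';
    case: rt' => -[? ? ?]; subst x' y' z'.
all: have [sn0|sn0] := eqVneq s 0.
all: try by rewrite ?ex ?ey ?ez; case: rt' ex' ey' ez' => -[-> -> ->] ex' ey' ez';
  rewrite ?ex' ?ey' ?ez' sn0 ?mul0r ?addr0.
all: have eG : Gam x y r = Gam x' y' r'.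
1,3,5: have e1 := congr1 (fun p : plane => p.1 : R) e;
  have e2 := congr1 (fun p : plane => p.2 : R) e; rewrite /= in e1 e2;
  by apply: plane_eq; apply: (mulfI sn0); lra.
all: case: rt' eG ex' ey' ez' => -[-> -> ->] eG ex' ey' ez'.
all: rewrite ?ex ?ey ?ez ?ex' ?ey' ?ez'.
all: try by rewrite ?(Gam_inj t r01 r01' eG).
all: try by have [h1 h2] := Gam_meet t r01 r01' eG; rewrite ?h1 ?h2; ring.
all: by have [h1 h2] := Gam_meet (ctri_rot (ctri_rot t)) r01' r01 (esym eG);
  rewrite ?h1 ?h2; ring.
Qed.

End PsiBijective.

(** * Image and continuity of psi *)

Section PsiImage.
Context {R : realType}.
Local Notation plane := (plane R).
Implicit Types (x y z p q u v w o : plane) (s t r : R).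

Variables (Y : set plane) (S : set (set plane)).
Hypothesis tm : tame Y S.

Let Yc : Y `<=` circle. Proof. by have [] := tm. Qed.
Let Yi : infinite_set Y. Proof. by have [] := tm. Qed.
Let cl : is_cluster Y S. Proof. by have [] := tm. Qed.
Let lf : locally_finite Y S. Proof. by have [] := tm. Qed.
Let Ynext y : Y y -> exists y', next_point Y y y'.
Proof. by have [_ _ _ _ [+ _ _ _ _]] := tm; apply. Qed.
Let Yprev y : Y y -> exists y', next_point Y y' y.
Proof. by have [_ _ _ _ [_ + _ _ _]] := tm; apply. Qed.

Local Notation K := (cluster_complex Y S).
Local Notation RK := (@realization R plane K).
Local Notation E := (E Y S).
Local Notation ctri := (ctri Y S).
Local Notation treg := (treg S).
Local Notation nx := (nxt Y).
Local Notation Gam := (sidept Y).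
Local Notation psi := (@psi R Y S).

Lemma tri_next v : Y v -> exists z, ctri v (nx v) z.
Proof.
move=> Yv; have n := nxtP Yc Yi Ynext Yv; have vn := next_neq Yc Yi n.
have Ev : E v (nx v) by apply/(E_cases Yc Yi cl); constructor 2.
have [z [x' [y' [t _ [[e1 e2]|[e1 e2]]]]]] := E_tri tm Ev; subst x' y'.
  by exists z.
have [_ _ Yz _] := ctri_Y tm t; have [_ _ _ h] := t.
have [_ _ /(_ _ Yz)] := (nextP Yc vn).1 n.
by rewrite leNgt area_lt0 h.
Qed.

Lemma boundary_point x y z u : ctri x y z -> treg x y z u ->
  circle u \/ (exists p q, [/\ S [set p; q], area p q u = 0 &
     [\/ p = x /\ q = y, p = y /\ q = z | p = z /\ q = x]]) ->
  exists x' y' z' r, [/\ rot3 x y z x' y' z', 0 <= r <= 1 & u = Gam x' y' r].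
Proof.
move=> t [du h1 h2 h3]; have [Yx Yy Yz _] := ctri_Y tm t; have [_ _ _ h] := t.
have i0 : 0 <= (0 : R) <= 1 by rewrite lexx ler01.
have i1 : 0 <= (1 : R) <= 1 by rewrite lexx ler01.
have C x' y' z' : rot3 x y z x' y' z' -> (S [set x'; y'] -> 0 <= area x' y' u) ->
    circle u -> area x' y' u < 0 ->
    exists x' y' z' r, [/\ rot3 x y z x' y' z', 0 <= r <= 1 & u = Gam x' y' r].
  move=> rt H cu hu; have t' := rot3_ctri rt t; have [Yx' _ _ _] := ctri_Y tm t'.
  have [/H|e] := ctri_nxt tm t'; first by rewrite leNgt hu.
  rewrite -e in hu; have [r [/andP[r0 r1] ->]] := arc_ex Yc Yi Ynext Yx' cu hu.
  exists x', y', z', r; split=> //; first by rewrite !ltW.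
  by rewrite -[in RHS]e Gam_arc.
case=> [cu|[p [q [Spq e0 pq]]]].
- have [hu|hu] := ltP (area x y u) 0; first by apply: (C x y z) => //; constructor 1.
  have [hu'|hu'] := ltP (area y z u) 0; first by apply: (C y z x) => //; constructor 2.
  have [hu''|hu''] := ltP (area z x u) 0; first by apply: (C z x y) => //; constructor 3.
  have [->|->|->] := circle_tri (Yc Yx) (Yc Yy) (Yc Yz) cu h hu hu' hu''.
  + by exists x, y, z, 0; split=> //; [constructor 1|rewrite (Gam0 tm)].
  + by exists x, y, z, 1; split=> //; [constructor 1|rewrite Gam1].
  + by exists z, x, y, 0; split=> //; [constructor 3|rewrite (Gam0 tm)].
- have [Yp Yq pq' _] := S_sep Yc cl Spq.
  have [r [r0 r1 uE]] := disk_chord (Yc Yp) (Yc Yq) pq' du e0.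
  rewrite -(Gam_S tm r Spq) in uE.
  have r01 : 0 <= r <= 1 by apply/andP.
  case: pq uE => -[-> ->] uE.
  + by exists x, y, z, r; split=> //; constructor 1.
  + by exists y, z, x, r; split=> //; constructor 2.
  + by exists z, x, y, r; split=> //; constructor 3.
Qed.

(** Projection from the centre: the ray through [p] leaves the region at a point of a side, whose
    cone coordinates give the preimage. *)
Lemma treg_surj x y z p : ctri x y z -> treg x y z p ->
  exists2 a : RK, closed_simplex [set x; y; z] a & psi a = p.
Proof.
move=> t tp; have [Yx Yy Yz [xy yz zx]] := ctri_Y tm t; have [_ _ _ h] := t.
have i0 : 0 <= (0 : R) <= 1 by rewrite lexx ler01.
have mk x' y' z' s r : rot3 x y z x' y' z' -> 0 <= s <= 1 -> 0 <= r <= 1 ->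
    p = mix s (centre x y z) (Gam x' y' r) ->
    exists2 a : RK, closed_simplex [set x; y; z] a & psi a = p.
  move=> rt s01 r01 ->; have t' := rot3_ctri rt t.
  have [a ea] := mk_tripoint tm t' s01 r01; exists a.
    have [_ _ _ [xy' yz' zx']] := ctri_Y tm t'.
    by rewrite -(rot3_set rt); exact: tripoint_simplex xy' yz' zx' ea.
  by rewrite (psi_tripoint tm t' s01 r01 ea) (rot3_centre rt).
have [po|po] := pselect (p = centre x y z).
  by apply: (mk x y z 0 0) => //; [constructor 1|rewrite mix0].
(* Only sides in the cluster are half-plane constraints; at a boundary edge the ray is stopped by
   the circle. *)
pose l := [seq e <- [:: (x, y); (y, z); (z, x)] | `[< S [set e.1; e.2] >]].
have lP e : e \in l -> S [set e.1; e.2] /\ [\/ e = (x, y), e = (y, z) | e = (z, x)].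
  rewrite mem_filter /= => /andP[/asboolP Se]; rewrite !inE => he; split=> //.
  by case/or3P: he => /eqP; [constructor 1|constructor 2|constructor 3].
have [dp h1 h2 h3] := tp.
have lo e : e \in l -> 0 < area e.1 e.2 (centre x y z).
  move=> /lP[_ [->|->|->]] /=; first exact: area_centre_gt0.
    by rewrite centre_rot; apply: area_centre_gt0; rewrite -area_rot.
  by rewrite -centre_rot; apply: area_centre_gt0; rewrite area_rot.
have lp e : e \in l -> 0 <= area e.1 e.2 p.
  by move=> /lP[Se [eE|eE|eE]]; rewrite eE in Se *; [exact: h1|exact: h2|exact: h3].
have [s [u [s01 du lu pE bu]]] := ray_exit (centre_odisk tm t) lo dp lp po.
have lin e : S [set e.1; e.2] -> [\/ e = (x, y), e = (y, z) | e = (z, x)] -> e \in l.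
  move=> Se he; rewrite mem_filter asboolT//= !inE.
  by case: he => ->; rewrite eqxx ?orbT.
have tu : treg x y z u.
  split=> // Se; first by apply: (lu (x, y)); apply: lin => //; constructor 1.
    by apply: (lu (y, z)); apply: lin => //; constructor 2.
  by apply: (lu (z, x)); apply: lin => //; constructor 3.
have [|x' [y' [z' [r [rt r01 uE]]]]] := boundary_point t tu.
  case: bu => [cu|[e /lP[Se he] e0]]; [by left|right; exists e.1, e.2; split=> //].
  by case: he => ->; [constructor 1|constructor 2|constructor 3].
apply: (mk x' y' z' s r) => //; last by rewrite -uE.
by move: s01 => /andP[s0 s1]; rewrite ltW.
Qed.

Lemma consecutive_arcpt a b c : consecutive Y a b -> a <= c <= b ->
  exists2 r, 0 <= r <= 1 & cexp c = arcpt Y (cexp a) r.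
Proof.
move=> ab /andP[ac cb]; have [lt_ab Ya Yb H] := ab.
have n : next_point Y (cexp a) (cexp b) by exists a, b.
have bn := next_nxt Yc Yi Ynext n.
have i0 : 0 <= (0 : R) <= 1 by rewrite lexx ler01.
have i1 : 0 <= (1 : R) <= 1 by rewrite lexx ler01.
have b2 : b < a + 2 * pi.
  rewrite ltNge le_eqVlt; apply/negP => /orP[/eqP h|h].
    by apply: (next_neq Yc Yi n); rewrite -h cexpD2pi.
  apply: (H (a + 2 * pi)); last by rewrite cexpD2pi.
  by rewrite h andbT ltrDl mulr_gt0// pi_gt0.
have [->|ca] := eqVneq c a; first by exists 0; rewrite // (arcpt0 Yc Yi Ynext).
have [->|cb'] := eqVneq c b; first by exists 1; rewrite // arcpt1.
have h : area (cexp a) (nx (cexp a)) (cexp c) < 0.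
  rewrite -bn -area_rot area_lt0; apply: area_cexp_gt0 => //.
    by rewrite lt_neqAle eq_sym ca.
  by rewrite lt_neqAle cb'.
have [r [/andP[r0 r1] e]] := arc_ex Yc Yi Ynext Ya (cexp_circle c) h.
by exists r => //; rewrite !ltW.
Qed.

Lemma psi_range (a : RK) : (disk `\` limit_point Y) (psi a).
Proof.
have [x0 [y0 [z0 [t0 ha0]]]] := real_tri tm a.
have [x [y [z [s [r [rt s01 r01 e]]]]]] := normal_form_rot tm t0 ha0.
have t := rot3_ctri rt t0; have [Yx Yy _ [xy _ _]] := ctri_Y tm t.
have [dp _ _ _] := psi_treg tm t0 ha0; split=> // lp.
have iso v : Y v -> ~ limit_point Y v by have [_ _ _ _ [_ _ + _ _]] := tm; apply.
have cp := limit_point_closed closed_circle Yc lp.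
move: lp cp; rewrite (psi_tripoint tm t s01 r01 e).
move: s01 (r01) => /andP[s0 s1] /andP[r0 r1].
have [du _ _ _] := Gam_treg tm t r0 r1.
move: s1; rewrite le_eqVlt => /orP[/eqP->|s1]; last first.
  by move=> _ /odisk_ncircle; apply; exact: odisk_mixl (centre_odisk tm t) du s0 s1.
rewrite mix1.
have [->|rn0] := eqVneq r 0; first by rewrite (Gam0 tm)// => /iso.
have [->|rn1] := eqVneq r 1; first by rewrite Gam1// => /iso.
have rp : 0 < r by rewrite lt_neqAle eq_sym rn0.
have rl : r < 1 by rewrite lt_neqAle rn1.
have [Sxy|nxy] := ctri_nxt tm t.
  rewrite (Gam_S tm)// => _ /odisk_ncircle; apply.
  by apply: odisk_mix => //; apply: circle_disk; exact: Yc.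
rewrite -nxy Gam_arc => lp _.
have ha : area x (nx x) (arcpt Y x r) < 0 by apply: (arcpt_area Yc Yi Ynext); rewrite ?rp.
(* The open half-plane beyond a boundary edge is a neighbourhood of its open arc and contains no
   point of [Y]. *)
have nU : nbhs (arcpt Y x r) [set u | 0 < area (nx x) x u].
  apply: open_nbhs_nbhs; split; last by rewrite /= -area_lt0.
  by apply: open_gt0; exact: continuous_area.
have [v [_ Yv]] := lp _ nU; rewrite /= -area_lt0 => hv.
have [_ _ /(_ _ Yv)] := (nextP Yc (nxt_neq Yc Yi Ynext Yx)).1 (nxtP Yc Yi Ynext Yx).
by rewrite leNgt hv.
Qed.

(** Inner points are reached by [coverage], starting at the midpoint of any boundary edge; points of
    the circle off the limit set are on arcs by tameness. *)
Lemma psi_onto p : (disk `\` limit_point Y) p -> exists a : RK, psi a = p.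
Proof.
have i1 : 0 <= (1 : R) <= 1 by rewrite lexx ler01.
move=> [dp lp]; case: (disk_case dp) => [op|cp].
- have [v Yv _] := infinite_other Yi (finite_set0 plane).
  have [z t] := tri_next Yv; have [Ev _ _ _] := t.
  have [_ _ _ [vn _ _]] := ctri_Y tm t.
  have om : open_disk (mix (1 / 2) v (nx v)).
    have dv := circle_disk (Yc Yv); have dn := circle_disk (cexp_circle (arc_stop Y v)).
    by apply: (odisk_mix dv dn vn); lra.
  have am : area v (nx v) (mix (1 / 2) v (nx v)) = 0.
    by rewrite area_mix areaxyx areaxyy !mulr0 addr0.
  have [|x [y [z' [t' tp]]]] := coverage Yc Yi cl lf Yprev op om Ev am.
    move=> w w' lw lw' ww' lp'; exfalso; apply: ww'.
    by have [_ _ _ _ [_ _ _ _ H]] := tm; exact: H.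
  by have [a _ ?] := treg_surj t' tp; exists a.
- have [_ _ _ _ [_ _ _ H _]] := tm.
  have [a [b [c [ab cab ->]]]] := H _ cp lp.
  have [_ Ya _ _] := ab.
  have [r r01 ->] := consecutive_arcpt ab cab.
  have [z t] := tri_next Ya; have [f ef] := mk_tripoint tm t i1 r01.
  by exists f; rewrite (psi_tripoint tm t i1 r01 ef) mix1 Gam_arc.
Qed.

Lemma psi_vertex y : Y y -> psi @` closed_simplex [set y] = [set y].
Proof.
move=> Yy; have [z t] := tri_next Yy.
have [_ _ _ [xy yz zx]] := ctri_Y tm t.
have i0 : 0 <= (0 : R) <= 1 by rewrite lexx ler01.
have i1 : 0 <= (1 : R) <= 1 by rewrite lexx ler01.
have [a ea] := mk_tripoint tm t i1 i0.
have [ey en ez e0] := tripointE 1 0 xy yz zx.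
have pa : psi a = y by rewrite (psi_tripoint tm t i1 i0 ea) mix1 (Gam0 tm).
have ha : closed_simplex [set y] a.
  move=> v /eqP; rewrite ea => h; apply: contrapT => vy; apply: h.
  have [->|/eqP vn] := eqVneq v (nx y); first by rewrite en subrr mul0r mulr0 addr0.
  have [->|/eqP vz] := eqVneq v z; first by rewrite ez subrr mul0r.
  exact: e0.
apply/seteqP; split=> u; last by move=> ->; exists a.
move=> [b hb <-] /=; rewrite -pa; congr psi; apply: bary_inj.
have hb3 : closed_simplex [set y; nx y; z] b by move=> v /hb; left; left.
have out v : v <> y -> bary b v = 0 by move=> vy; exact: (bary_out hb).
have := bary_le1 tm t hb3; rewrite (out (nx y)) ?(out z)//; [|exact: nesym..] => e1.
rewrite ea; apply: (fun3_eq (x := y) (y := nx y) (z := z)) => //.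
- by move=> v vy _ _; exact: out.
- by rewrite ey; lra.
- by rewrite en out; [lra|exact: nesym].
- by rewrite ez out//; lra.
Qed.

Lemma psi_edge_Gam x y z : ctri x y z ->
  psi @` closed_simplex [set x; y] = [set Gam x y r | r in [set r | 0 <= r <= 1]].
Proof.
move=> t; have [_ _ _ [xy yz zx]] := ctri_Y tm t.
have i1 : 0 <= (1 : R) <= 1 by rewrite lexx ler01.
apply/seteqP; split=> u.
- move=> [b hb <-].
  have hb3 : closed_simplex [set x; y; z] b by move=> v /hb; left.
  have bz : bary b z = 0 by apply: (bary_out hb) => -[//|/esym].
  have := bary_le1 tm t hb3; rewrite bz addr0 => e1.
  have b0 := bary_ge0 b x; have b1 := bary_ge0 b y.
  have r01 : 0 <= bary b y <= 1 by apply/andP; split; lra.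
  exists (bary b y) => //.
  have [ex ey ez e0] := tripointE 1 (bary b y) xy yz zx.
  rewrite (psi_tripoint tm t i1 r01) ?mix1//.
  apply: (fun3_eq (x := x) (y := y) (z := z)) => //.
  + by move=> v vx vy _; apply: (bary_out hb) => -[].
  + by rewrite ex; lra.
  + by rewrite ey; lra.
  + by rewrite ez bz; lra.
- move=> [r r01 <-]; have [a ea] := mk_tripoint tm t i1 r01.
  exists a; last by rewrite (psi_tripoint tm t i1 r01 ea) mix1.
  have [ex ey ez e0] := tripointE 1 r xy yz zx.
  move=> v /eqP; rewrite ea => h; apply: contrapT => /not_orP[vx vy]; apply: h.
  have [->|/eqP vz] := eqVneq v z; first by rewrite ez subrr mul0r.
  exact: e0.
Qed.

Lemma edge_image_Gam x y z : ctri x y z ->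
  edge_image Y [set x; y] = [set Gam x y r | r in [set r | 0 <= r <= 1]].
Proof.
move=> t; have [Yx Yy _ [xy _ _]] := ctri_Y tm t; rewrite /edge_image.
case: asboolP => [bd|nbd].
- have nxy : nx x = y.
    by have [/(S_nboundary Yc cl)|//] := ctri_nxt tm t.
  apply/seteqP; split=> u.
  + move=> [a [b [c [ab e cab ->]]]]; have [_ Ya _ _] := ab.
    have n : next_point Y (cexp a) (cexp b) by exists a, b.
    have bn := next_nxt Yc Yi Ynext n.
    have [r r01 ->] := consecutive_arcpt ab cab; exists r => //.
    case: (set2_inj e) => -[ex ey]; first by rewrite -ex -nxy Gam_arc.
    by case: (ctri_nxt_neq tm (ctri_rot t)); rewrite ey -bn.
  + move=> [r /andP[r0 r1] <-]; rewrite -nxy Gam_arc.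
    have [c e _] := arc_endsP Yc Yi Ynext Yx; have [ab _ _ _] := c.
    exists (arc_start Y x), (arc_stop Y x), (arc_start Y x + (arc_stop Y x - arc_start Y x) * r).
    split=> //; first by rewrite -e.
    by apply/andP; split; nra.
- have Sxy : S [set x; y].
    have [//|nxy] := ctri_nxt tm t; case: nbd; apply/boundary_edgeP => //; left.
    by rewrite -nxy; exact: nxtP.
  apply/seteqP; split=> u.
  + by move=> /geodesicP[r [r0 r1 ->]]; exists r; [apply/andP|rewrite (Gam_S tm)].
  + by move=> [r /andP[r0 r1] <-]; apply/geodesicP; exists r; split=> //; rewrite (Gam_S tm).
Qed.

Lemma edge_pair A : edge Y S A -> exists x y, A = [set x; y] /\ E x y.
Proof.
move=> EA; have [x [y e]] : exists x y, A = [set x; y].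
  case: EA => [/(S_obj Yc cl)[x [y [_ [_ [_ _ _ _ [-> _]]]]]]|[x [y [_ ->]]]].
    by exists x, y.
  by exists x, y.
by exists x, y; split=> //; rewrite e in EA.
Qed.

Lemma edge_tri A : edge Y S A -> exists x y z, ctri x y z /\ A = [set x; y].
Proof.
move=> /edge_pair[x [y [-> /(E_tri tm)[z [x' [y' [t e _]]]]]]].
by exists x', y', z.
Qed.

Lemma psi_edge A : edge Y S A -> psi @` closed_simplex A = edge_image Y A.
Proof.
move=> /edge_tri[x [y [z [t ->]]]].
by rewrite (psi_edge_Gam t) (edge_image_Gam t).
Qed.

Lemma triangle_ctri A : triangle Y S A -> exists x y z, ctri x y z /\ A = [set x; y; z].
Proof.
move=> [x [y [z [xy yz xz -> [Exy Eyz Exz]]]]].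
have [Yx Yy _] := E_Y Yc Yi cl Exy; have [_ Yz _] := E_Y Yc Yi cl Eyz.
have := area_circle_neq0 (Yc Yx) (Yc Yy) (Yc Yz) xy (nesym xz) (nesym yz).
rewrite neq_lt => /orP[h|h].
  rewrite area_lt0 in h; exists y, x, z; split.
    by split=> //; apply: EC.
  by rewrite [in RHS]set2C.
by exists x, y, z; split=> //; split=> //; exact: EC.
Qed.

Lemma triangle_regionE x y z : ctri x y z ->
  triangle_region Y S [set x; y; z] = treg x y z.
Proof.
move=> t; have [_ _ _ [xy yz zx]] := ctri_Y tm t; apply/seteqP; split.
- apply: conv_hull_min; first exact: treg_cvx.
  move=> u [B [Bs EB]]; rewrite -psi_edge// => -[a ha <-].
  by apply: (psi_treg tm t) => v /ha; exact: Bs.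
- have sub x' y' z' r : rot3 x y z x' y' z' -> 0 <= r <= 1 ->
      triangle_region Y S [set x; y; z] (Gam x' y' r).
    move=> rt r01; have t' := rot3_ctri rt t; have [E' _ _ _] := t'.
    apply: sub_conv_hull; exists [set x'; y'].
      by split=> //; rewrite -(rot3_set rt) => v; left.
    by rewrite (edge_image_Gam t'); exists r.
  have i0 : 0 <= (0 : R) <= 1 by rewrite lexx ler01.
  have r1 : rot3 x y z x y z by constructor 1.
  have r2 : rot3 x y z y z x by constructor 2.
  have r3 : rot3 x y z z x y by constructor 3.
  have [Yx Yy Yz _] := ctri_Y tm t.
  have hx := sub _ _ _ _ r1 i0; have hy := sub _ _ _ _ r2 i0.
  have hz := sub _ _ _ _ r3 i0.
  rewrite !(Gam0 tm)// in hx hy hz.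
  have ho : triangle_region Y S [set x; y; z] (centre x y z).
    have q0 : (0 : R) <= 1 / 3 by lra.
    have q1 : (1 / 3 : R) <= 1 by lra.
    have q2 : (0 : R) <= 1 / 2 by lra.
    have q3 : (1 / 2 : R) <= 1 by lra.
    rewrite centreE; apply: (conv_hull_cvx _ hz q0 q1).
    exact: (conv_hull_cvx hx hy q2 q3).
  move=> p /(treg_surj t)[a ha <-].
  have [x' [y' [z' [s [r [rt s01 r01 e]]]]]] := normal_form_rot tm t ha.
  rewrite (psi_tripoint tm (rot3_ctri rt t) s01 r01 e) (rot3_centre rt).
  move: s01 => /andP[s0 s1]; apply: conv_hull_cvx => //.
  exact: sub rt r01.
Qed.

(** Neighbourhoods for the sup distance of coordinates. Openness for the weak topology is tested
    with this distance on one closed simplex at a time, so convergence along this filter is enough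
    for the continuity of psi. *)
Definition bary_nbhs (a : RK) : set_system RK :=
  [set U | exists2 e : R, 0 < e & forall b, (forall v, `|bary a v - bary b v| < e) -> U b].

Lemma bary_nbhs_filter a : Filter (bary_nbhs a).
Proof.
split.
- by exists 1.
- move=> U V [e e0 He] [d d0 Hd]; exists (Num.min e d); first by rewrite lt_min e0.
  move=> b ab; split; [apply: He|apply: Hd] => v; have := ab v; rewrite lt_min => /andP[]//.
- by move=> U V UV [e e0 He]; exists e => // b /He /UV.
Qed.

Lemma cvg_bary (a : RK) v : (fun b => bary b v) @ bary_nbhs a --> bary a v.
Proof.
have FF := bary_nbhs_filter a.
by apply/cvgrPdist_lt => e e0; exists e.
Qed.

Lemma psi_continuous : continuous psi.
Proof.
apply/continuousP => W oW; apply/realization_openE => A KA a Aa Wa.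
have [x [y [z [t As]]]] := face_tri tm KA.
have st (b : RK) : closed_simplex A b -> closed_simplex [set x; y; z] b.
  by move=> hb v /hb /As.
pose F (b : RK) := push3 Y x y z (bary b).
have FF := bary_nbhs_filter a.
have cF : F @ bary_nbhs a --> psi a.
  rewrite (psi_tri tm t (st _ Aa)).
  have cp v : (fun b : RK => push Y v (bary b v) (bary b (nx v))) @ bary_nbhs a -->
      push Y v (bary a v) (bary a (nx v)) by apply: cvg_push; exact: cvg_bary.
  by apply: cvg_plane; (apply: cvgD; [apply: cvgD|]);
    [exact: cvg_coord1 (cp _)|exact: cvg_coord1 (cp _)|exact: cvg_coord1 (cp _)
    |exact: cvg_coord2 (cp _)|exact: cvg_coord2 (cp _)|exact: cvg_coord2 (cp _)].
have [|e e0 He] := cF W; first by apply: open_nbhs_nbhs.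
exists e => // b Ab ab; have := He b ab.
by rewrite /= /F -(psi_tri tm t (st _ Ab)).
Qed.

End PsiImage.

(** * Continuity of the inverse of psi *)

Section PsiInverse.
Context {R : realType}.
Local Notation plane := (plane R).
Implicit Types (x y z p q u v w o : plane) (s t r : R).

Lemma dsqxx x : dsq x x = 0 :> R.
Proof. by rewrite /dsq; ring. Qed.

Lemma dsqC x y : dsq x y = dsq y x :> R.
Proof. by rewrite /dsq; ring. Qed.

Lemma dsq_triangle x y z : dsq x z <= 2 * dsq x y + 2 * dsq y z :> R.
Proof.
case: x y z => [x1 x2] [y1 y2] [z1 z2]; rewrite /dsq /=.
move: (x1 : R) (x2 : R) (y1 : R) (y2 : R) (z1 : R) (z2 : R).
move=> {}x1 {}x2 {}y1 {}y2 {}z1 {}z2.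
have := sqr_ge0 (x1 - y1 - (y1 - z1)); have := sqr_ge0 (x2 - y2 - (y2 - z2)); nra.
Qed.

Lemma cvx_dsq x r : cvx [set u | dsq u x <= r].
Proof.
move=> p q s /= hp hq s0 s1.
have e : dsq (mix s p q) x = (1 - s) * dsq p x + s * dsq q x - s * (1 - s) * dsq p q.
  by rewrite /dsq /=; ring.
have d0 := dsq_ge0 p q; have s1' : 0 <= 1 - s by lra.
have h1 := ler_wpM2l s1' hp; have h2 := ler_wpM2l s0 hq.
have h3 := mulr_ge0 (mulr_ge0 s0 s1') d0; rewrite e; lra.
Qed.

Lemma nbhs_dsq p (U : set plane) : nbhs p U <->
  exists2 e : R, 0 < e & forall q, dsq p q < e -> U q.
Proof.
split=> [/nbhs_planeP[e [e0 H]]|[e e0 H]].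
  exists (e ^+ 2); first by rewrite exprn_gt0.
  have lt (d : R) : d ^+ 2 < e ^+ 2 -> `|d| < e.
    move=> h; rewrite ltNge; apply/negP => h2.
    have := ler_pM (ltW e0) (ltW e0) h2 h2.
    by rewrite -!expr2 real_normK ?num_real// leNgt h.
  move=> q h; apply: H; apply: lt; apply: le_lt_trans h; rewrite /dsq.
    by rewrite lerDl sqr_ge0.
  by rewrite lerDr sqr_ge0.
apply/nbhs_planeP; exists (Num.min 1 (e / 2)); split.
  by rewrite lt_min ltr01 divr_gt0.
have lt (d : R) : `|d| < Num.min 1 (e / 2) -> d ^+ 2 < e / 2.
  rewrite lt_min => /andP[h1 h2]; rewrite -real_normK ?num_real// expr2.
  by apply: le_lt_trans h2; rewrite ler_piMl// ltW.
by move=> q /lt h1 /lt h2; apply: H; rewrite /dsq; lra.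
Qed.

Variables (Y : set plane) (S : set (set plane)).
Hypothesis tm : tame Y S.

Let Yc : Y `<=` circle. Proof. by have [] := tm. Qed.
Let Yi : infinite_set Y. Proof. by have [] := tm. Qed.
Let cl : is_cluster Y S. Proof. by have [] := tm. Qed.
Let lf : locally_finite Y S. Proof. by have [] := tm. Qed.
Let Ynext y : Y y -> exists y', next_point Y y y'.
Proof. by have [_ _ _ _ [+ _ _ _ _]] := tm; apply. Qed.

Local Notation K := (cluster_complex Y S).
Local Notation RK := (@realization R plane K).
Local Notation E := (E Y S).
Local Notation ctri := (ctri Y S).
Local Notation treg := (treg S).
Local Notation nx := (nxt Y).
Local Notation Gam := (sidept Y).
Local Notation psi := (@psi R Y S).

(** Infinitely many such edges would accumulate at a limit pair of points at squared distance at
    least [r], against tameness. *)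
Lemma long_edges_finite r : 0 < r ->
  finite_set [set e : plane * plane | E e.1 e.2 /\ r <= dsq e.1 e.2].
Proof.
move=> r0; apply: contrapT => iF.
have [//|w [w' [x [y [[cw cw' lw lw'] FF xc yc hl]]]]] :=
  infinite_edges Yc Yi cl lf _ iF; first by move=> x y [].
have : r <= dsq w w'.
  apply: cvgr_to_ge (cvg_dsq xc yc) _; apply: nearW => n.
  by have [_] := FF n.
have [<-|/eqP ww'] := eqVneq w w'.
  by rewrite dsqxx leNgt r0.
exfalso; apply: (ww'); have [_ _ _ _ [_ _ _ _ H]] := tm.
by apply: H => //; exact: hl.
Qed.

Let O : plane := (0, 0).

(** If the origin is beyond a boundary edge, so is the antipode [u] of a point [v0] of [Y], as [v0]
    itself is not; and [u] is on one arc only. *)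
Lemma wide_edges_finite :
  finite_set [set e : plane * plane | next_point Y e.1 e.2 /\ area e.1 e.2 O < 0].
Proof.
have [v0 Yv0 _] := infinite_other Yi (finite_set0 plane).
pose u : plane := (- (v0.1 : R), - (v0.2 : R)).
have cu : circle u.
  by have := Yc Yv0; rewrite !circleE /sq /= !sqrrN.
have H x y : next_point Y x y -> area x y O < 0 -> area x y u < 0.
  move=> n h; have xy := next_neq Yc Yi n.
  have [_ _ /(_ _ Yv0) h0] := (nextP Yc xy).1 n.
  have : area x y u = 2 * area x y O - area x y v0 by rewrite /area/=; ring.
  by lra.
apply: finite_sub1 => -[x y] [x' y'] [/= n h] [/= n' h'].
have xx : x = x' by apply: (next_arc_uniq Yc Yi cu n n'); exact: H.
by subst x'; congr (_, _); exact: (next_uniq Yc Yi n n').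
Qed.

(** With the origin on the inner side the arc is at most a half-turn, and along such an arc the
    distance from [v] increases. *)
Lemma arc_short v r : Y v -> 0 <= area v (nx v) O -> 0 <= r -> r <= 1 ->
  dsq (arcpt Y v r) v <= dsq v (nx v).
Proof.
move=> Yv h r0 r1; have [[ab _ _ _] e b2] := arc_endsP Yc Yi Ynext Yv.
set a := arc_start Y v in ab e b2; set b := arc_stop Y v in ab b2.
have dE (i j : R) : dsq (cexp i) (cexp j) = 2 - 2 * cos (j - i).
  rewrite /dsq/= cosB.
  have e1 : sin i ^+ 2 = 1 - cos i ^+ 2 by rewrite -(cos2Dsin2 i); ring.
  have e2 : sin j ^+ 2 = 1 - cos j ^+ 2 by rewrite -(cos2Dsin2 j); ring.
  by ring: e1 e2.
have hs : 0 <= sin (b - a).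
  by move: h; rewrite [in area v]e /area /nxt -/b/= sinB; congr (0 <= _); ring.
have bap : b - a <= pi.
  rewrite leNgt; apply/negP => hp.
  have : 0 < sin (b - a - pi) by apply: sin_gt0_pi; apply/andP; split; lra.
  by rewrite sinB sinpi cospi; lra.
have d1 : dsq v (nx v) = 2 - 2 * cos (b - a) by rewrite {1}e /nxt dE.
have d2 : dsq (arcpt Y v r) v = 2 - 2 * cos ((b - a) * r).
  rewrite dsqC {1}e dE; congr (2 - 2 * cos _).
  by rewrite -/a -/b; ring.
rewrite d1 d2; have le : (b - a) * r <= b - a by rewrite ger_pMr// subr_gt0.
move: le; rewrite le_eqVlt => /orP[/eqP->|hlt]; first by rewrite lexx.
have : cos (b - a) < cos ((b - a) * r).
  have h0 : 0 <= (b - a) * r by apply: mulr_ge0 => //; lra.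
  have i1 : b - a \in `[0, pi] by rewrite in_itv/=; apply/andP; split; lra.
  have i2 : (b - a) * r \in `[0, pi].
    by rewrite in_itv/= h0 (le_trans (ltW hlt) bap).
  by rewrite ltr_cos.
lra.
Qed.

(** The vertices are near [x], and so are the arcs, being at most half-turns; balls are convex, so
    the whole region is near [x]. The factor 4 is the loss of [dsq_triangle] along an arc. *)
Lemma treg_small x y z q r : ctri x y z -> treg x y z q ->
  (forall x' y' z', rot3 x y z x' y' z' ->
     dsq x' y' < r /\ (next_point Y x' y' -> 0 <= area x' y' O)) ->
  dsq q x <= 4 * r.
Proof.
move=> t tq H; have [Yx Yy Yz _] := ctri_Y tm t.
have r1 : rot3 x y z x y z by constructor 1.
have r2 : rot3 x y z y z x by constructor 2.
have r3 : rot3 x y z z x y by constructor 3.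
have [h1 _] := H _ _ _ r1; have [h2 _] := H _ _ _ r2; have [h3 _] := H _ _ _ r3.
have r0 : 0 < r by apply: le_lt_trans h1; exact: dsq_ge0.
have bx : dsq x x <= 4 * r by rewrite dsqxx; lra.
have by' : dsq y x <= 4 * r by rewrite dsqC; lra.
have bz : dsq z x <= 4 * r by lra.
have [a ha <-] := treg_surj tm t tq.
have [x' [y' [z' [s [k [rt s01 k01 e]]]]]] := normal_form_rot tm t ha.
have t' := rot3_ctri rt t.
rewrite (psi_tripoint tm t' s01 k01 e) (rot3_centre rt).
have C := @cvx_dsq x (4 * r).
have q0 : (0 : R) <= 1 / 3 by lra.
have q1 : (1 / 3 : R) <= 1 by lra.
have q2 : (0 : R) <= 1 / 2 by lra.
have q3 : (1 / 2 : R) <= 1 by lra.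
have bo : dsq (centre x y z) x <= 4 * r.
  by rewrite centreE; exact: (C _ _ _ (C _ _ _ bx by' q2 q3) bz q0 q1).
have vb v : [set x; y; z] v -> dsq v x < 2 * r.
  move=> [[->|->]|->]; [|rewrite dsqC; lra|lra].
  by rewrite dsqxx; lra.
have bx' : dsq x' x < 2 * r.
  by apply: vb; rewrite -(rot3_set rt); left; left.
have by1 : dsq y' x < 2 * r.
  by apply: vb; rewrite -(rot3_set rt); left; right.
move: s01 k01 => /andP[s0 s1] /andP[k0 k1].
have bG : dsq (Gam x' y' k) x <= 4 * r.
  have [Sxy|nxy] := ctri_nxt tm t'.
    rewrite (Gam_S tm)//; apply: C => //=; lra.
  have [Yx' _ _ _] := ctri_Y tm t'.
  have [hd hw] := H _ _ _ rt.
  have n := nxtP Yc Yi Ynext Yx'.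
  rewrite -nxy Gam_arc; rewrite -nxy in hd hw.
  have h4 := arc_short Yx' (hw n) k0 k1.
  have h5 : dsq x' x <= r.
    have : [set x; y; z] x' by rewrite -(rot3_set rt); left; left.
    move=> [[->|->]|->]; [|by rewrite dsqC; lra|by lra].
    by rewrite dsqxx; lra.
  have := dsq_triangle (arcpt Y x' k) x' x; lra.
exact: (C _ _ _ bo bG s0 s1).
Qed.

(** Triangles with a long side or an arc of more than a half-turn are finitely many, as each vertex
    has finitely many neighbours. Any other triangle near [p] is so small that its vertex [x] must
    be [p], and [p] too is a vertex of finitely many triangles. *)
Lemma locally_finite_triangles p : ~ limit_point Y p ->
  exists e (T : set (plane * plane * plane)), [/\ 0 < e, finite_set T &
    forall q x y z, dsq p q < e -> ctri x y z -> treg x y z q -> T (x, y, z)].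
Proof.
move=> lp.
have [d d0 Hd] : exists2 d : R, 0 < d & forall y, Y y -> dsq p y < d -> y = p.
  move: lp => /existsNP[U /not_implyP[/nbhs_dsq[d d0 H] nU]]; exists d => // y Yy h.
  by apply: contrapT => yp; apply: nU; exists y; split=> //; [exact/eqP|exact: H].
(* For a small triangle [dsq p x < 2 * r + 8 * r], which is half of [d]. *)
pose r := d / 20; have r0 : 0 < r by rewrite divr_gt0.
pose B := [set e : plane * plane | E e.1 e.2 /\ r <= dsq e.1 e.2] `|`
  [set e : plane * plane | next_point Y e.1 e.2 /\ area e.1 e.2 O < 0].
have fB : finite_set B.
  by rewrite finite_setU; split; [exact: long_edges_finite|exact: wide_edges_finite].
have fN := E_finite Yc Yi cl lf.
pose T1 := \bigcup_(e in B) ((fun z => (e.1, e.2, z)) @` [set z | E e.2 z]).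
pose T2 := \bigcup_(e in B) ((fun x => (x, e.1, e.2)) @` [set x | E e.1 x]).
pose T3 := \bigcup_(e in B) ((fun y => (e.2, y, e.1)) @` [set y | E e.2 y]).
pose T4 := \bigcup_(y in [set y | E p y]) ((fun z => (p, y, z)) @` [set z | E y z]).
exists r, (T1 `|` T2 `|` (T3 `|` T4)); split=> //.
  by rewrite !finite_setU; split; split; apply: bigcup_finite => // *;
    exact/finite_image/fN.
move=> q x y z hq t tq; have [Exy Eyz Ezx _] := t.
have [b1|b1] := pselect (B (x, y)); first by left; left; exists (x, y) => //; exists z.
have [b2|b2] := pselect (B (y, z)).
  by left; right; exists (y, z) => //; exists x => //=; exact: EC.
have [b3|b3] := pselect (B (z, x)).
  by right; left; exists (z, x) => //; exists y.
right; right; suff xp : x = p.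
  by exists y; [rewrite /= -xp|exists z; rewrite // xp].
have [Yx _ _] := E_Y Yc Yi cl Exy; apply: Hd => //.
have : dsq q x <= 4 * r.
  have nb x' y' : E x' y' -> ~ B (x', y') ->
      dsq x' y' < r /\ (next_point Y x' y' -> 0 <= area x' y' O).
    move=> E' nB; split=> [|n].
      by rewrite ltNge; apply/negP => h; apply: nB; left.
    by rewrite leNgt; apply/negP => h; apply: nB; right.
  apply: (treg_small t tq) => x' y' z' [[-> -> _]|[-> -> _]|[-> -> _]]; exact: nb.
have := dsq_triangle p q x; rewrite /r in hq *; lra.
Qed.

(** In the coordinates of [x] and [y] the closed simplex is a compact triangle of the plane on which
    psi is continuous; so its part outside an open set has a compact image. *)
Lemma closed_psi_simplex x y z (U : set RK) : ctri x y z -> open U ->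
  closed (psi @` (closed_simplex [set x; y; z] `\` U)).
Proof.
move=> t /realization_openE oU; have [_ _ _ [xy yz zx]] := ctri_Y tm t.
pose bb (i : plane) v : R := if v == x then (i.1 : R) else if v == y then (i.2 : R)
  else if v == z then 1 - i.1 - i.2 else 0.
have bbx i : bb i x = i.1 by rewrite /bb eqxx.
have bby i : bb i y = i.2 by rewrite /bb eqxx (introF eqP (nesym xy)).
have bbz i : bb i z = 1 - i.1 - i.2.
  by rewrite /bb eqxx (introF eqP zx) (introF eqP (nesym yz)).
have bb0 i v : v <> x -> v <> y -> v <> z -> bb i v = 0.
  by move=> /eqP/negPf vx /eqP/negPf vy /eqP/negPf vz; rewrite /bb vx vy vz.
pose D := [set i : plane | [/\ 0 <= (i.1 : R), 0 <= (i.2 : R) & 0 <= 1 - i.1 - i.2 :> R]].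
have mk i : D i -> exists a : RK, bary a = bb i.
  move=> [i1 i2 i3]; apply: (mk_realization tm t).
  - by move=> v; rewrite /bb; do !case: ifP => _.
  - exact: bb0.
  - by rewrite bbx bby bbz; ring.
have simp i (a : RK) : bary a = bb i -> closed_simplex [set x; y; z] a.
  move=> e v /eqP; rewrite e => h; apply: contrapT => /not_orP[/not_orP[vx vy] vz].
  by apply: h; exact: bb0.
have coord (a : RK) : closed_simplex [set x; y; z] a ->
    let i := (bary a x, bary a y) : plane in D i /\ bary a = bb i.
  move=> ha i; have s1 := bary_le1 tm t ha; have b1 := bary_ge0 a x.
  have b2 := bary_ge0 a y; have b3 := bary_ge0 a z.
  split; first by split=> //=; lra.
  apply: (fun3_eq (x := x) (y := y) (z := z)); rewrite ?bbx ?bby ?bbz//=.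
  + by move=> v vx vy vz; apply: (bary_out ha) => -[[]|].
  + exact: bb0.
  + lra.
pose Q := D `&` [set i | exists a : RK, bary a = bb i /\ ~ U a].
have cb v : continuous (fun i : plane => bb i v).
  move=> i; rewrite /bb; case: (v == x).
    by apply: cvg_coord1; exact: cvg_id.
  case: (v == y); first by apply: cvg_coord2; exact: cvg_id.
  case: (v == z); last exact: cvg_cst.
  apply: cvgB; last by apply: cvg_coord2; exact: cvg_id.
  by apply: cvgB; [exact: cvg_cst|apply: cvg_coord1; exact: cvg_id].
have cD : closed D.
  have -> : D = [set i | 0 <= bb i x] `&` ([set i | 0 <= bb i y] `&` [set i | 0 <= bb i z]).
    apply/seteqP; split=> i; rewrite /D/= bbx bby bbz.
      by move=> [? ? ?].
    by move=> [? [? ?]].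
  by apply: closedI; [|apply: closedI]; apply: closed_ge0; exact: cb.
have cQ : closed Q.
  move=> i ci; have Di : D i by apply: cD => W /ci [j [[Dj _] Wj]]; exists j.
  split=> //; have [a ea] := mk _ Di; exists a; split=> // Ua.
  have KA : K [set x; y; z] by apply: (face_sub tm t) => //; exists x; left; left.
  have [e e0 He] := oU _ KA a (simp _ _ ea) Ua.
  have [|j [[Dj [b [eb nb]]] /= [h1 h2]]] := ci [set j | `|(i.1 : R) - j.1| < e / 2 /\ `|(i.2 : R) - j.2| < e / 2].
    by apply/nbhs_planeP; exists (e / 2); split=> //; rewrite divr_gt0.
  apply: nb; apply: He; first exact: simp eb.
  move=> v; rewrite ea eb.
  have [->|/eqP vx] := eqVneq v x; first by rewrite !bbx; lra.
  have [->|/eqP vy] := eqVneq v y; first by rewrite !bby; lra.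
  have [->|/eqP vz] := eqVneq v z; last by rewrite !bb0// subrr normr0.
  rewrite !bbz.
  have -> : 1 - i.1 - i.2 - (1 - j.1 - j.2) = - (i.1 - j.1) + - (i.2 - j.2) :> R by ring.
  by apply: le_lt_trans (ler_normD _ _) _; rewrite !normrN; lra.
have cpQ : compact Q.
  have cI : compact ([set` `[(0 : R), 1]] : set R^o) by exact: segment_compact.
  apply: (subclosed_compact cQ (compact_setX cI cI)) => i [[i1 i2 i3] _].
  by split; rewrite /= in_itv/=; apply/andP; split; lra.
pose F i := push3 Y x y z (bb i).
have cF : continuous F.
  move=> i; have cp v : (fun i => push Y v (bb i v) (bb i (nx v))) @ nbhs i -->
      push Y v (bb i v) (bb i (nx v)) by apply: cvg_push; exact: cb.
  by apply: cvg_plane; (apply: cvgD; [apply: cvgD|]);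
    [exact: cvg_coord1 (cp _)|exact: cvg_coord1 (cp _)|exact: cvg_coord1 (cp _)
    |exact: cvg_coord2 (cp _)|exact: cvg_coord2 (cp _)|exact: cvg_coord2 (cp _)].
suff -> : psi @` (closed_simplex [set x; y; z] `\` U) = F @` Q.
  apply: compact_closed; first exact: norm_hausdorff.
  by apply: continuous_compact => //; exact: continuous_subspaceT.
apply/seteqP; split=> u.
- move=> [a [ha nU] <-]; have [Di e] := coord a ha.
  exists (bary a x, bary a y); first by split=> //; exists a.
  by rewrite (psi_tri tm t ha) /F -e.
- move=> [i [Di [a [ea nU]]] <-]; exists a; first by split=> //; exact: simp ea.
  by rewrite (psi_tri tm t (simp _ _ ea)) ea.
Qed.

Lemma finite_bigcap_nbhs (I : choiceType) (T : topologicalType) (A : set I)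
    (p : T) (f : I -> set T) : finite_set A -> (forall i, A i -> nbhs p (f i)) ->
  nbhs p (\bigcap_(i in A) f i).
Proof.
move=> /finite_seqP[s ->]; elim: s => [|i s IH] H.
  by apply: filterS filterT => q _ i /=; rewrite in_nil.
have h1 : nbhs p (f i) by apply: H => /=; rewrite mem_head.
have h2 : nbhs p (\bigcap_(j in [set` s]) f j).
  by apply: IH => j js; apply: H => /=; rewrite inE [X in _ || X]js orbT.
apply: filterS (filterI h1 h2) => q [q1 q2] j /=.
by rewrite inE => /orP[/eqP->//|]; exact: q2.
Qed.

Lemma psi_homeo : homeo_on [set: RK] (disk `\` limit_point Y) psi.
Proof.
split.
- split; first by move=> a _; exact: (psi_range tm).
    by move=> a b _ _; exact: (psi_inj tm).
  by move=> p /(psi_onto tm)[a <-]; exists a.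
- by apply: continuous_subspaceT; exact: (psi_continuous tm).
have ex p : exists a : RK, (disk `\` limit_point Y) p -> psi a = p.
  have [Dp|nDp] := pselect ((disk `\` limit_point Y) p).
    by have [a ?] := psi_onto tm Dp; exists a.
  have [v Yv _] := infinite_other Yi (finite_set0 plane).
  have [a _ _] : (psi @` closed_simplex [set v]) v by rewrite (psi_vertex tm).
  by exists a.
have [g gP] := choice ex.
have gK a : g (psi a) = a by apply: (psi_inj tm); apply: gP; exact: (psi_range tm).
exists g; split=> [|a _]; last exact: gK.
apply/subspace_continuousP => p Dp W [U [oU Ug UW]].
have [e [T [e0 fT HT]]] := locally_finite_triangles Dp.2.
(* Near [p] only finitely many triangles occur; avoiding the closed images of their parts outside
   [U] forces the preimage into [U]. *)
pose N (t : plane * plane * plane) : set plane :=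
  ~` (psi @` (closed_simplex [set t.1.1; t.1.2; t.2] `\` U)).
pose T' := T `&` [set t | ctri t.1.1 t.1.2 t.2].
have nN : nbhs p (\bigcap_(t in T') N t).
  apply: finite_bigcap_nbhs.
    by apply: sub_finite_set fT => t [].
  move=> t [_ tt]; apply: open_nbhs_nbhs; split.
    by rewrite openC; exact: closed_psi_simplex.
  by move=> [a [_ nU] pa]; apply: nU; rewrite -(gK a) pa.
have nB : nbhs p [set q | dsq p q < e] by apply/nbhs_dsq; exists e.
apply: filterS (filterI nN nB) => q [qN qe] Dq; apply: UW.
apply: contrapT => nU; have [x [y [z [t ha]]]] := real_tri tm (g q).
have tq : treg x y z q by rewrite -(gP q Dq); exact: (psi_treg tm t ha).
apply: (qN (x, y, z)); first by split=> //; exact: (HT q).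
by exists (g q); [split|exact: gP].
Qed.

Theorem tame_triangulation : triangulation_cluster Y S.
Proof.
split=> //; exists psi; split; last exact: psi_homeo.
have [[_ _ _] cpsi [g [cg gK]]] := psi_homeo.
split.
- exact: (psi_vertex tm).
- exact: (psi_edge tm).
- move=> A /(triangle_ctri tm)[x [y [z [t ->]]]]; rewrite (triangle_regionE tm t).
  have sub : treg x y z `<=` disk `\` limit_point Y.
    by move=> p /(treg_surj tm t)[a _ <-]; exact: (psi_range tm).
  split.
  + split; first by move=> a ha; exact: (psi_treg tm t ha).
      by move=> a b _ _; exact: (psi_inj tm).
    by move=> p /(treg_surj tm t)[a ha <-]; exists a.
  + exact: continuous_subspaceW cpsi.
  + exists g; split; last by move=> a _; exact: gK.
    exact: continuous_subspaceW sub cg.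
Qed.

End PsiInverse.

(** * Regions of equivalent points and pieces between them *)

Section Classes.
Context {R : realType}.
Local Notation plane := (plane R).
Implicit Types (x y z p q u v w o : plane) (s t r : R).

(** The disk without one point of the circle is still convex. *)
Lemma circle_hull (A : set plane) p : A `<=` circle -> circle p ->
  conv_hull A p -> A p.
Proof.
move=> Ac cp hp; apply: contrapT => nA.
suff : (disk `&` [set q | q <> p]) p by case.
apply: (conv_hull_min _ _ hp) => [u v s [du up] [dv vp] s0 s1|a Aa]; last first.
  by split; [exact/circle_disk/Ac|move=> e; rewrite e in Aa].
split; first exact: cvx_disk.
have [->|/eqP uv] := eqVneq u v; first by rewrite mixxx.
have [->|s0'] := eqVneq s 0; first by rewrite mix0.
have [->|s1'] := eqVneq s 1; first by rewrite mix1.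
move=> e; have : open_disk (mix s u v).
  have s0p : 0 < s by rewrite lt_neqAle eq_sym s0'.
  have s1p : s < 1 by rewrite lt_neqAle s1'.
  exact: odisk_mix.
by rewrite e => /odisk_ncircle.
Qed.

(** The points [mix k a p] on the circle are the roots of a quadratic equation in [k]; one root is
    0, the other [1 + (1 - sq p) / dsq a p]. *)
Lemma second_point a p : circle a -> open_disk p ->
  exists s u, [/\ 0 < s < 1, circle u & p = mix s a u].
Proof.
rewrite circleE odiskE => ca op.
have ap : a <> p by move=> e; move: op; rewrite -e ca ltxx.
have d0 : 0 < dsq a p by rewrite dsq_gt0; exact/eqP.
pose m : R := 2 * ((a.1 : R) ^+ 2 + a.2 ^+ 2) - 2 * ((a.1 : R) * p.1 + a.2 * p.2).
have mE : m = 1 - sq p + dsq a p.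
  by rewrite -[1]ca /m /sq /dsq; ring.
pose k := m / dsq a p.
have kd : k * dsq a p = m by rewrite divfK// gt_eqF.
have k1 : 1 < k by rewrite ltr_pdivlMr// mul1r mE; lra.
have cu : circle (mix k a p).
  rewrite circleE sq_mix ca.
  have -> : k * (1 - k) * dsq a p = (1 - k) * (k * dsq a p) by ring.
  rewrite kd mE; move: kd; rewrite mE; move: (k) (sq p) (dsq a p) => i j l e.
  by transitivity (j - l + i * l); [ring|rewrite e; ring].
exists k^-1, (mix k a p); split=> //.
  by rewrite invr_gt0 invf_lt1; lra.
by apply: plane_eq => /=; field; lra.
Qed.

(** For a point of the circle, cut the circle there: the first and the last point of [A] bound a
    chord with [A] on its other side. For an inner point, use the end [u] of the ray from [a0]
    through [p]; if [p] were on the side of [A], it would be between [a0] and a point of the chord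
    [ab]. *)
Lemma hull_sep (A : set plane) p : finite_set A -> A `<=` circle ->
  (exists a b, [/\ A a, A b & a <> b]) -> disk p -> ~ conv_hull A p ->
  exists a b, [/\ A a, A b, a <> b, 0 < area a b p & forall c, A c -> area a b c <= 0].
Proof.
move=> fA Ac [a0 [b0 [Aa0 Ab0 ab0]]].
have H q : circle q -> ~ A q ->
    exists a b, [/\ A a, A b, a <> b, 0 < area a b q & forall c, A c -> area a b c <= 0].
  move=> cq nAq; have [e [_ _ qE]] := cexp_surj 0 cq.
  have ex u : exists t : R, circle u -> [/\ e <= t, t < e + 2 * pi & u = cexp t].
    have [cu|ncu] := pselect (circle u); last by exists 0.
    by have [t ?] := cexp_surj e cu; exists t.
  have [K KP] := choice ex.
  have A0 : A !=set0 by exists a0.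
  have [a Aa amin] := finite_argmin K fA A0.
  have [b Ab bmax] := finite_argmin (fun u => - K u) fA A0.
  have KA u : A u -> [/\ e <= K u, K u < e + 2 * pi, u = cexp (K u) & e <> K u].
    move=> Au; have [h1 h2 h3] := KP _ (Ac _ Au); split=> // h.
    by apply: nAq; rewrite qE h -h3.
  have Kab : K a < K b.
    rewrite lt_neqAle amin// andbT; apply/eqP => h.
    apply: ab0; have [_ _ -> _] := KA _ Aa0; have [_ _ -> _] := KA _ Ab0.
    have := amin _ Aa0; have := amin _ Ab0.
    have := bmax _ Aa0; have := bmax _ Ab0 => *; congr cexp; lra.
  have [ha1 ha2 aE ha4] := KA _ Aa; have [hb1 hb2 bE _] := KA _ Ab.
  have pi0 := pi_gt0 R.
  have ha : e <= K a < e + 2 * pi by rewrite ha1 ha2.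
  have hb : e <= K b < e + 2 * pi by rewrite hb1 hb2.
  have he : e <= e < e + 2 * pi by apply/andP; split; lra.
  have ea : e < K a by rewrite lt_neqAle ha1 andbT; exact/eqP.
  exists a, b; split=> //.
  - by move=> ab; move: Kab; rewrite ab ltxx.
  - rewrite aE bE qE (@area_cexp_order _ e)//.
    by apply/orP; right; apply/orP; right; rewrite ea Kab.
  - move=> c Acc; have [hc1 hc2 cE _] := KA _ Acc.
    have hc : e <= K c < e + 2 * pi by rewrite hc1 hc2.
    have h1 := amin _ Acc; have h2 := bmax _ Acc.
    rewrite leNgt aE bE cE (@area_cexp_order _ e)//; apply/negP.
    by case/or3P => /andP[h3 h4]; clear - h1 h2 h3 h4 Kab; lra.
move=> dp np; case: (disk_case dp) => [op|cp]; last first.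
  by apply: H => // Ap; apply: np; exact: sub_conv_hull.
have pa0 : a0 <> p.
  by move=> e; apply: np; rewrite -e; exact: sub_conv_hull.
have da0 := circle_disk (Ac _ Aa0).
have [s [u [/andP[s0 s1] cu pE]]] := second_point (Ac _ Aa0) op.
have hA v : A v -> conv_hull A v by move=> ?; exact: sub_conv_hull.
have nu : ~ A u.
  by move=> Au; apply: np; rewrite pE; apply: conv_hull_cvx; [exact: hA|exact: hA|lra|lra].
have [a [b [Aa Ab ab hu le]]] := H u cu nu; exists a, b; split=> //.
rewrite ltNge; apply/negP => hp; apply: np.
have d0 : 0 < area a b u - area a b p by lra.
pose t := - area a b p / (area a b u - area a b p).
have td : t * (area a b u - area a b p) = - area a b p by rewrite divfK// gt_eqF.
have t0 : 0 <= t by rewrite divr_ge0// ?oppr_ge0// ltW.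
have t1 : t < 1 by rewrite ltr_pdivrMr// mul1r; lra.
have dr : disk (mix t p u) by apply: cvx_disk => //; [exact: circle_disk|exact: ltW].
have er : area a b (mix t p u) = 0 by rewrite area_mix; lra.
have [k [k0 k1 rE]] := disk_chord (Ac _ Aa) (Ac _ Ab) ab dr er.
have hr : conv_hull A (mix t p u).
  by rewrite rE; apply: conv_hull_cvx => //; exact: hA.
(* Parameter, on the segment from [a0] to [u], of the point where it meets the chord [ab]. *)
pose s' := s + t * (1 - s).
have ts : 0 <= t * (1 - s) by apply: mulr_ge0 => //; lra.
have s'0 : 0 < s' by rewrite /s'; lra.
have -> : p = mix (s / s') a0 (mix t p u).
  by rewrite pE; apply: plane_eq => /=; rewrite /s' in s'0 *; field; rewrite gt_eqF.
apply: conv_hull_cvx => //; [exact: hA| |].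
  by rewrite divr_ge0// ltW.
by rewrite ler_pdivrMr// mul1r /s'; lra.
Qed.

Variables (Z : set plane) (rho : plane -> plane -> Prop).
Hypothesis Zc : Z `<=` circle.
Hypothesis Zf : finite_set Z.
Hypothesis eqv : equivalence_on Z rho.
Hypothesis nc : noncrossing rho.

Let rZ x y : rho x y -> Z x /\ Z y. Proof. by have [H _ _ _] := eqv; exact: H. Qed.
Let rxx x : Z x -> rho x x. Proof. by have [_ H _ _] := eqv; exact: H. Qed.
Let rC x y : rho x y -> rho y x. Proof. by have [_ _ H _] := eqv; exact: H. Qed.
Let rT x y z : rho x y -> rho y z -> rho x z.
Proof. by have [_ _ _ H] := eqv; exact: H. Qed.

Local Notation reg := (class_region rho).

Lemma reg_circle w : [set w' | rho w w'] `<=` circle.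
Proof. by move=> w' /rZ[_ /Zc]. Qed.

Lemma reg_finite w : finite_set [set w' | rho w w'].
Proof. by apply: sub_finite_set Zf => w' /rZ[]. Qed.

Lemma reg_disk w : reg w `<=` disk.
Proof.
by apply: conv_hull_min; [exact: cvx_disk|move=> w' /reg_circle/circle_disk].
Qed.

Lemma reg_self w : Z w -> reg w w.
Proof. by move=> Zw; apply: sub_conv_hull; exact: rxx. Qed.

Lemma reg_class w w' : rho w w' -> reg w = reg w'.
Proof.
move=> r; rewrite /class_region; congr conv_hull; apply/seteqP; split=> v /=.
  by move=> h; exact: rT (rC r) h.
by move=> h; exact: rT r h.
Qed.

Lemma reg_Z w p : circle p -> reg w p -> rho w p.
Proof. by move=> cp /(circle_hull (@reg_circle w) cp). Qed.

Lemma reg_single w : Z w -> ~ (exists a b, [/\ rho w a, rho w b & a <> b]) ->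
  reg w = [set w].
Proof.
move=> Zw H; rewrite /class_region (_ : [set w' | rho w w'] = [set w]).
  apply/seteqP; split=> v; last by move=> ->; exact: sub_conv_hull.
  by apply: conv_hull_min => // p q s -> -> _ _; rewrite /= mixxx.
apply/seteqP; split=> v /=; last by move=> ->; exact: rxx.
move=> rv; apply: contrapT => vw; apply: H; exists v, w; split=> //; exact: rxx.
Qed.

Lemma noncrossing_sep x y u v : rho x y -> rho u v -> sep x y u v -> rho x u.
Proof.
wlog hu : u v / area x y u < 0.
  move=> W rxy ruv h; case: (sep_case h) => [[h1 h2]|[h1 h2]]; last exact: (W u v).
  apply: rT (rC ruv); apply: (W v u) => //; [exact: rC|by rewrite sepC].
move=> rxy ruv h; have hv : 0 < area x y v by case: (sep_case h) => [[]|[]]; lra.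
have [Zx Zy] := rZ rxy; have [Zu Zv] := rZ ruv.
have [a [_ _ xE]] := cexp_surj 0 (Zc Zx).
have [b [b0 b1 yE]] := cexp_surj a (Zc Zy).
have [c [c0 c1 uE]] := cexp_surj a (Zc Zu).
have [d [d0 d1 vE]] := cexp_surj a (Zc Zv).
have pi0 := pi_gt0 R.
have ha : a <= a < a + 2 * pi by apply/andP; split; lra.
have hb : a <= b < a + 2 * pi by rewrite b0 b1.
have hc : a <= c < a + 2 * pi by rewrite c0 c1.
have hd : a <= d < a + 2 * pi by rewrite d0 d1.
move: hv; rewrite xE yE vE area_order_base// => /andP[ab bd].
move: hu; rewrite area_lt0 xE yE uE (@area_cexp_order _ a)// => hu.
have [ac cb] : a < c /\ c < b by case/or3P: hu => /andP[? ?]; split; lra.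
have co : cyclic_order x u y v by exists a, c, b, d.
by rewrite -xE -uE; have [] := nc co rxy ruv.
Qed.

Lemma reg_sep w p : disk p -> ~ reg w p -> (exists a b, [/\ rho w a, rho w b & a <> b]) ->
  exists a b, [/\ rho w a, rho w b, a <> b, 0 < area a b p &
    forall q, reg w q -> area a b q <= 0].
Proof.
move=> dp np ab0.
have [a [b [ra rb ab h le]]] := hull_sep (reg_finite w) (@reg_circle w) ab0 dp np.
exists a, b; split=> // q.
suff : reg w `<=` [set q | 0 <= area b a q] by move=> /[apply] /=; rewrite area_swap oppr_ge0.
apply: conv_hull_min; first exact: cvx_ge.
by move=> c /le /=; rewrite [area b a c]area_swap oppr_ge0.
Qed.

(** Some chord [ab] of the class of [w] has the region of [w] on one side and [w'] strictly on the
    other. By noncrossing the whole class of [w'], and so its hull, is strictly on the side of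
    [w']. *)
Lemma reg_disjoint w w' p : Z w -> Z w' -> reg w p -> reg w' p -> rho w w'.
Proof.
move=> Zw Zw' hp hp'; apply: contrapT => nr.
have nw' : ~ reg w w' by move/(reg_Z (Zc Zw')).
have [ab|nab] := pselect (exists a b, [/\ rho w a, rho w b & a <> b]); last first.
  move: hp; rewrite reg_single// => e; move: hp'; rewrite e => /(reg_Z (Zc Zw)).
  by move/rC.
have [a [b [ra rb {}ab h le]]] := reg_sep (circle_disk (Zc Zw')) nw' ab.
have [_ Za] := rZ ra; have [_ Zb] := rZ rb.
have := le _ hp; rewrite leNgt => /negP; apply.
suff : reg w' `<=` [set q | 0 < area a b q] by apply.
apply: conv_hull_min; first exact: cvx_gt.
move=> c rc /=; have [_ Zcc] := rZ rc.
have nc1 v : rho w v -> c <> v.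
  by move=> rv e; apply: nr; apply: (rT rv); rewrite -e; exact: rC.
have := area_circle_neq0 (Zc Za) (Zc Zb) (Zc Zcc) ab (nc1 _ ra) (nc1 _ rb).
rewrite neq_lt => /orP[hc|//]; exfalso; apply: nr.
apply: (rT ra); apply: (@noncrossing_sep a b w' c) => //; first exact: rT (rC ra) rb.
by rewrite /sep pmulr_rlt0.
Qed.

(** By [reg_sep] the complement is a union of open half-planes and of the complement of the disk. *)
Lemma reg_closed w : closed (reg w).
Proof.
have [ab|nab] := pselect (exists a b, [/\ rho w a, rho w b & a <> b]); last first.
  have [Zw|nZ] := pselect (Z w).
    by rewrite reg_single//; apply: closed_finite; exact: finite_set1.
  rewrite (_ : reg w = set0); first exact: closed0.
  apply/seteqP; split=> // q; apply: conv_hull_min.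
    by move=> ? ? ? [].
  by move=> v /rZ[].
rewrite -openC; have -> : ~` reg w = ~` disk `|`
    \bigcup_(e in [set e : plane * plane | forall q, reg w q -> area e.1 e.2 q <= 0])
      [set q | 0 < area e.1 e.2 q].
  apply/seteqP; split=> q.
    move=> nq; have [dq|nd] := pselect (disk q); last by left.
    right; have [a [b [_ _ _ h le]]] := reg_sep dq nq ab.
    by exists (a, b).
  by move=> [nd /reg_disk//|[e le h] /le]; rewrite leNgt h.
apply: openU; first by rewrite openC; exact: closed_disk.
by apply: bigcup_open => e _; apply: open_gt0; exact: continuous_area.
Qed.

(* When p lies outside all the contracted regions, piece p and cpiece p are the preimages of its
   component in the complement of the contracted points and of the closure of this component. *)
Definition piece p : set plane := [set q | [/\ disk q, ~ Z q &
  forall w w', rho w w' -> w <> w' -> 0 < area w w' p * area w w' q]].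

Definition cpiece p : set plane := [set q | disk q /\
  forall w w', rho w w' -> w <> w' -> 0 <= area w w' p * area w w' q].

Definition off p := disk p /\ forall w, Z w -> ~ reg w p.

Lemma off_area p w w' : off p -> rho w w' -> w <> w' -> area w w' p != 0.
Proof.
move=> [dp np] r ww'; have [Zw Zw'] := rZ r; apply/eqP => e; apply: (np w Zw).
have [s [s0 s1 ->]] := disk_chord (Zc Zw) (Zc Zw') ww' dp e.
by apply: conv_hull_cvx => //; apply: sub_conv_hull; [exact: rxx|].
Qed.

Lemma off_nZ p : off p -> ~ Z p.
Proof. by move=> [_ np] Zp; apply: (np p Zp); exact: reg_self. Qed.

Lemma piece_self p : off p -> piece p p.
Proof.
move=> op; split; [by case: op|exact: off_nZ|] => w w' r ww'.
by rewrite -expr2 lt_neqAle sqr_ge0 andbT eq_sym sqrf_eq0 off_area.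
Qed.

Lemma piece_off p q : off p -> piece p q -> off q.
Proof.
move=> op [dq nq H]; split=> // w Zw rq.
have [ab|nab] := pselect (exists a b, [/\ rho w a, rho w b & a <> b]); last first.
  by move: rq; rewrite reg_single// => e; apply: nq; rewrite e.
have [a [b [ra rb {}ab h le]]] := reg_sep op.1 (op.2 w Zw) ab.
have := H a b (rT (rC ra) rb) ab; rewrite pmulr_rgt0// => h'.
by have := le _ rq; rewrite leNgt h'.
Qed.

Lemma piece_sym p q : piece p q -> ~ Z p -> disk p -> piece q p.
Proof. by move=> [dq nq H] Zp dp; split=> // w w' r ww'; rewrite mulrC; exact: H. Qed.

Lemma piece_trans p q u : piece p q -> piece q u -> piece p u.
Proof.
move=> [dq nq H] [du nu H']; split=> // w w' r ww'.
have h1 := H _ _ r ww'; have h2 := H' _ _ r ww'.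
have := mulr_gt0 h1 h2.
have -> : area w w' p * area w w' q * (area w w' q * area w w' u) =
  area w w' q ^+ 2 * (area w w' p * area w w' u) by ring.
by rewrite pmulr_rgt0// exprn_even_gt0//=; apply/eqP => e; move: h1; rewrite e mulr0 ltxx.
Qed.

(** Signs that are weak at [q] and strict at [p] are strict in between; this makes the closed piece
    the closure of the piece. *)
Lemma cpiece_mix p q t : off p -> cpiece p q -> 0 < t -> t <= 1 -> piece p (mix t q p).
Proof.
move=> op [dq H] t0 t1; have [dp np H'] := piece_self op; split.
- by apply: cvx_disk => //; exact: ltW.
- move: t1; rewrite le_eqVlt => /orP[/eqP->|t1]; first by rewrite mix1.
  have [->|/eqP qp] := eqVneq q p; first by rewrite mixxx.
  by move=> /Zc; apply: odisk_ncircle; exact: odisk_mix.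
- move=> w w' r ww'; rewrite area_mix mulrDr.
  have h1 := H _ _ r ww'; have h2 := H' _ _ r ww'.
  have -> : area w w' p * ((1 - t) * area w w' q) + area w w' p * (t * area w w' p) =
    (1 - t) * (area w w' p * area w w' q) + t * (area w w' p * area w w' p) by ring.
  apply: ltr_wpDl; last exact: mulr_gt0.
  by apply: mulr_ge0 => //; lra.
Qed.

Lemma piece_cpiece p q : piece p q -> cpiece p q.
Proof. by move=> [dq _ H]; split=> // w w' r ww'; exact/ltW/H. Qed.

Lemma cvx_piece p u v s : piece p u -> piece p v -> 0 <= s -> s <= 1 ->
  off p -> piece p (mix s u v).
Proof.
move=> pu pv s0 s1 op; have [du nu Hu] := pu; have [dv nv Hv] := pv; split.
- exact: cvx_disk.
- move: s0 s1; rewrite le_eqVlt => /orP[/eqP<-|s0]; first by rewrite mix0.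
  rewrite le_eqVlt => /orP[/eqP->|s1]; first by rewrite mix1.
  have [<-|/eqP uv] := eqVneq u v; first by rewrite mixxx.
  by move=> /Zc; apply: odisk_ncircle; exact: odisk_mix.
- move=> w w' r ww'; rewrite area_mix mulrDr.
  have := Hu _ _ r ww'; have := Hv _ _ r ww'.
  rewrite [area w w' p * ((1 - s) * _)]mulrCA [area w w' p * (s * _)]mulrCA => h1 h2.
  move: s0; rewrite le_eqVlt => /orP[/eqP<-|s0]; first by rewrite mul0r addr0 subr0 mul1r.
  by apply: ltr_wpDl; [apply: mulr_ge0; [lra|exact: ltW]|exact: mulr_gt0].
Qed.

Lemma pairs_finite :
  finite_set [set e : plane * plane | rho e.1 e.2 /\ e.1 <> e.2].
Proof.
apply: (sub_finite_set _ (finite_setX Zf Zf)) => -[x y] [/= r _].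
by have [] := rZ r.
Qed.

Lemma cpiece_closed p : closed (cpiece p).
Proof.
have -> : cpiece p = disk `&` \bigcap_(e in [set e : plane * plane | rho e.1 e.2 /\ e.1 <> e.2])
    [set q | 0 <= area e.1 e.2 p * area e.1 e.2 q].
  apply/seteqP; split=> q [dq H]; split=> //; first by move=> [w w'] [/= r n]; exact: H.
  by move=> w w' r n; apply: (H (w, w')).
apply: closedI; first exact: closed_disk.
apply: closed_bigI => e _; apply: closed_ge0 => q.
by apply: cvgM; [exact: cvg_cst|exact: continuous_area].
Qed.

Lemma piece_nbhs p q : piece p q -> nbhs q [set u | disk u -> piece p u].
Proof.
move=> [dq nq H].
have n1 : nbhs q (~` Z).
  by apply: open_nbhs_nbhs; split; [rewrite openC; exact: closed_finite|].
have n2 : nbhs q (\bigcap_(e in [set e : plane * plane | rho e.1 e.2 /\ e.1 <> e.2])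
    [set u | 0 < area e.1 e.2 p * area e.1 e.2 u]).
  apply: finite_bigcap_nbhs; first exact: pairs_finite.
  move=> e [r n]; apply: open_nbhs_nbhs; split; last exact: H.
  apply: open_gt0 => u; apply: cvgM; [exact: cvg_cst|exact: continuous_area].
apply: filterS (filterI n1 n2) => u [nZ Hu] du; split=> // w w' r n.
exact: (Hu (w, w')).
Qed.


End Classes.

(** * The cactus space *)

Section Cactus.
Context {R : realType}.
Local Notation plane := (plane R).
Variables (Z : set plane) (rho : plane -> plane -> Prop).
Hypothesis Zc : Z `<=` circle.
Hypothesis Zf : finite_set Z.
Hypothesis eqv : equivalence_on Z rho.
Hypothesis nc : noncrossing rho.

Local Notation reg := (class_region rho).
Local Notation cactus := (cactus Z rho).

Let rZ x y : rho x y -> Z x /\ Z y. Proof. by have [H _ _ _] := eqv; exact: H. Qed.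
Let rC x y : rho x y -> rho y x. Proof. by have [_ _ H _] := eqv; exact: H. Qed.

Lemma disk0 : disk (0 : R, 0 : R).
Proof. by rewrite /disk /= expr0n/= addr0. Qed.

(** Total, with the origin as default, so that points of the quotient can be named by points of the
    plane. *)
Definition in_disk (q : plane) : set_type disk :=
  if pselect (disk q) is left d then exist _ q (mem_set d)
  else exist _ (0, 0) (mem_set disk0).

Lemma in_diskK q : disk q -> set_val (in_disk q) = q.
Proof. by rewrite /in_disk; case: pselect. Qed.

Lemma val_disk (d : set_type (@disk R)) : disk (set_val d).
Proof. exact/set_mem/(svalP d). Qed.

Lemma valK_disk (d : set_type (@disk R)) : in_disk (set_val d) = d.
Proof. by apply: val_inj; exact: (in_diskK (val_disk d)). Qed.

Definition cpi (q : plane) : cactus := cactus_proj Z rho (in_disk q).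

Lemma cpi_proj d : cactus_proj Z rho d = cpi (set_val d).
Proof. by rewrite /cpi valK_disk. Qed.

Lemma cpi_onto e : exists2 q, disk q & cpi q = e.
Proof.
exists (set_val (repr e)); first exact: val_disk.
by rewrite -cpi_proj /cactus_proj reprK.
Qed.

Lemma cpi_reg w p q : Z w -> disk p -> disk q -> reg w p -> reg w q -> cpi p = cpi q.
Proof.
move=> Zw dp dq hp hq; apply/eqmodP/asboolP/Relation_Operators.rst_step.
by exists w => //; rewrite !in_diskK.
Qed.

(** Chains of identifications shorten to a single one, because regions with a common point are
    equal. *)
Lemma cpi_eq p q : disk p -> disk q -> cpi p = cpi q ->
  p = q \/ exists w, [/\ Z w, reg w p & reg w q].
Proof.
move=> dp dq /eqmodP h.
suff : set_val (in_disk p) = set_val (in_disk q) \/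
    exists w, [/\ Z w, reg w (set_val (in_disk p)) & reg w (set_val (in_disk q))].
  by rewrite !in_diskK.
move: (in_disk p) (in_disk q) h => d d' /asboolP; elim=> {d d' p q dp dq}.
- by move=> p q [w Zw [h1 h2]]; right; exists w.
- by left.
- by move=> p q _ [->|[w [h1 h2 h3]]]; [left|right; exists w].
- move=> p q u _ [->|[w [h1 h2 h3]]] _ [<-|[w' [h1' h2' h3']]]; first by left.
  + by right; exists w'.
  + by right; exists w.
  + right; exists w; split=> //; rewrite (@reg_class _ Z rho eqv w w')//.
    exact: (@reg_disjoint _ Z rho Zc Zf eqv nc _ _ (set_val q)).
Qed.

Lemma cpi_off p q : disk p -> off Z rho q -> cpi p = cpi q -> p = q.
Proof. by move=> dp [dq nq] /(cpi_eq dp dq)[//|[w [Zw _ /(nq _ Zw)]]]. Qed.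

Lemma closed_cactus (F : set cactus) : closed F <->
  exists2 G : set plane, closed G & forall q, disk q -> (F (cpi q) <-> G q).
Proof.
split=> [|[G cG FG]].
  move=> /closed_openC oF; have [G oG GE] : open (@cactus_proj R Z rho @^-1` ~` F) := oF.
  exists (~` G) => [|q dq]; first by rewrite closedC.
  have := congr1 (fun A : set _ => A (in_disk q)) GE; rewrite /preimage /= in_diskK// => ->.
  by rewrite notK.
rewrite -openC; have : open (@cactus_proj R Z rho @^-1` ~` F); last by [].
exists (~` G); first exact: closed_openC.
apply/seteqP; split=> d; rewrite /preimage /= cpi_proj => h.
  by move/(FG _ (val_disk d)).
by move/(FG _ (val_disk d)).
Qed.

Lemma cpi_continuous : {within disk, continuous cpi}.
Proof.
apply/continuous_closedP => F /closed_cactus[G cG FG].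
apply/closed_subspaceP; exists G => //; apply/seteqP; split=> q [h dq]; split=> //;
  exact/(FG q dq).
Qed.

Lemma cactus_imageE A : cactus_image Z rho A = cpi @` (A `&` disk).
Proof.
apply/seteqP; split=> e.
  by move=> [d /= Ad <-]; exists (set_val d); [split=> //; exact: val_disk|rewrite -cpi_proj].
by move=> [q [Aq dq] <-]; exists (in_disk q) => //=; rewrite in_diskK.
Qed.

Lemma cpi_closed F : F `<=` disk -> closed F -> closed (cpi @` F).
Proof.
move=> Fd cF; apply/closed_cactus.
exists (F `|` \bigcup_(w in [set w | Z w /\ (reg w `&` F !=set0)]) reg w).
  apply: closedU => //; apply: closed_bigcup => [|w _].
    by apply: sub_finite_set Zf => w [].
  exact: (@reg_closed _ Z).
move=> q dq; split.
  move=> [p Fp /(cpi_eq (Fd _ Fp) dq)[<-|[w [Zw wp wq]]]]; first by left.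
  by right; exists w => //; split=> //; exists p.
case=> [Fq|[w [Zw [p [wp Fp]]] wq]]; first by exists q.
by exists p => //; exact: (cpi_reg Zw (Fd _ Fp) dq).
Qed.

Lemma imageZ_off q : disk q -> ~ cactus_image Z rho Z (cpi q) <-> off Z rho q.
Proof.
move=> dq; rewrite cactus_imageE; split=> [H|[_ nq]].
  split=> // w Zw wq; apply: H; exists w; first by split=> //; exact/circle_disk/Zc.
  apply: (cpi_reg Zw) => //; first exact/circle_disk/Zc.
  exact: (reg_self eqv).
move=> [w [Zw dw] /(cpi_eq dw dq)[e|[w' [Zw' _ h]]]]; last exact: (nq w').
by apply: (nq w) => //; rewrite -e; exact: (reg_self eqv).
Qed.

Lemma piece_connected p : off Z rho p -> connected (piece Z rho p).
Proof.
move=> op; have -> : piece Z rho p =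
    \bigcup_(q in piece Z rho p) ((fun t => mix t p q) @` [set` `[(0 : R), 1]]).
  apply/seteqP; split=> q.
    by move=> pq; exists q => //; exists 1; rewrite ?mix1//= in_itv/= ler01 lexx.
  move=> [u pu [t /=]]; rewrite in_itv/= => /andP[t0 t1] <-.
  by apply: (cvx_piece Zc) => //; exact: (piece_self Zc eqv).
apply: bigcup_connected.
  exists p => q _; exists 0; last by rewrite mix0.
  by rewrite /= in_itv/= lexx ler01.
move=> q pq; apply: connected_continuous_connected; first exact: segment_connected.
apply: continuous_subspaceT => t; apply: cvg_mix; [exact: cvg_id|exact: cvg_cst|exact: cvg_cst].
Qed.

Lemma piece_disk p : piece Z rho p `<=` disk. Proof. by move=> q []. Qed.
Lemma cpiece_disk p : cpiece rho p `<=` disk. Proof. by move=> q []. Qed.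

Lemma cpiece_off p q : off Z rho p -> off Z rho q -> cpiece rho p q -> piece Z rho p q.
Proof.
move=> op oq [dq H]; split=> //; first exact: (off_nZ eqv oq).
move=> w w' r n; rewrite lt_neqAle H// andbT eq_sym mulf_neq0//.
  exact: (@off_area _ Z rho).
exact: (@off_area _ Z rho).
Qed.

Lemma cpi_cpiece p q : off Z rho p -> disk q -> off Z rho q ->
  (cpi @` cpiece rho p) (cpi q) <-> piece Z rho p q.
Proof.
move=> op dq oq; split=> [[u cu e]|pq]; last by exists q => //; exact: (@piece_cpiece _ Z).
have e' : u = q by apply: cpi_off e => //; case: cu.
by apply: cpiece_off => //; rewrite -e'.
Qed.

(** The image of the piece is connected. Within the component it is open, by [piece_nbhs], and
    closed, since the closed piece has no further point outside the regions. *)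
Lemma component_piece p : off Z rho p ->
  connected_component (~` cactus_image Z rho Z) (cpi p) = cpi @` piece Z rho p.
Proof.
move=> op; have dp := op.1; have pp := piece_self Zc eqv op.
apply/seteqP; split; last first.
  apply: connected_component_max.
  - by exists p.
  - by move=> _ [q pq <-]; apply/imageZ_off; [case: pq|exact: (piece_off Zc Zf eqv op pq)].
  - apply: connected_continuous_connected; first exact: piece_connected.
    by apply: continuous_subspaceW cpi_continuous; exact: piece_disk.
set C := connected_component _ _.
have CX : C `<=` ~` cactus_image Z rho Z by exact: connected_component_sub.
suff <- : C `&` cpi @` piece Z rho p = C by move=> e [].
have cC : connected C by exact: component_connected.
have Co q : disk q -> C (cpi q) -> off Z rho q.
  by move=> dq /CX /(imageZ_off dq).
apply: cC.
- exists (cpi p); split; last by exists p.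
  by apply: connected_component_refl; exact/imageZ_off.
- exists (cpi @` piece Z rho p) => //; rewrite -closedC; apply/closed_cactus.
  pose U := \bigcup_(V in [set V | open V /\ V `&` disk `<=` piece Z rho p]) V.
  exists (~` U).
    by rewrite closedC; apply: bigcup_open => V [].
  move=> q dq; split=> nU h; apply: nU.
    by have [V [oV Vp] Vq] := h; exists q => //; apply: Vp.
  have [u pu e] := h.
  have ou := piece_off Zc Zf eqv op pu.
  have {e}e := cpi_off dq ou (esym e); rewrite -e in pu.
  have := piece_nbhs Zf eqv pu; rewrite nbhsE => -[V [oV Vq] VH].
  by exists V => //; split=> // v [/VH]; exact.
- exists (cpi @` cpiece rho p); first by apply: cpi_closed; [exact: cpiece_disk|exact: cpiece_closed].
  apply/seteqP; split=> e [Ce h]; split=> //.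
    by case: h => q pq qe; exists q => //; exact: (@piece_cpiece _ Z).
  have [q dq qe] := cpi_onto e; rewrite -qe in Ce h *.
  have oq := Co _ dq Ce.
  by exists q => //; exact/cpi_cpiece.
Qed.

Lemma closure_piece p : off Z rho p ->
  closure (cpi @` piece Z rho p) = cpi @` cpiece rho p.
Proof.
move=> op; apply/seteqP; split.
  have /closure_id -> : closed (cpi @` cpiece rho p).
    by apply: cpi_closed; [exact: cpiece_disk|exact: cpiece_closed].
  by apply: closureS => _ [q pq <-]; exists q => //; exact: (@piece_cpiece _ Z).
move=> _ [q cq <-].
have /closed_cactus[G cG GE] : closed (closure (cpi @` piece Z rho p)).
  exact: closed_closure.
apply/(GE _ (cpiece_disk cq)).
pose u n : plane := mix n.+1%:R^-1 q p.
have un : u n @[n --> \oo] --> q.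
  rewrite -[X in _ --> X](mix0 q p); apply: cvg_mix; [exact: cvg_harmonic|exact: cvg_cst|exact: cvg_cst].
apply: (closed_cvg G cG _ _ un) => //; apply: nearW => n.
have pu : piece Z rho p (u n).
  by apply: (cpiece_mix Zc eqv) => //; rewrite ?invr_gt0// invf_le1// ler1n.
by apply/GE; [exact: piece_disk pu|apply: subset_closure; exists (u n)].
Qed.

Lemma cactus_disksP E : cactus_disks Z rho E <->
  exists2 p, off Z rho p & E = cpi @` cpiece rho p.
Proof.
split.
  move=> [e he <-]; have [q dq qe] := cpi_onto e; rewrite -qe in he *.
  have oq := (imageZ_off dq).1 he.
  by exists q => //; rewrite component_piece// closure_piece.
move=> [p op ->]; exists (cpi p); first by apply/imageZ_off; [case: op|].
by rewrite component_piece// closure_piece.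
Qed.

Lemma disk_boundaryE E : disk_boundary E = E `&` cpi @` circle.
Proof.
rewrite /disk_boundary cactus_imageE; congr (_ `&` _ @` _).
by apply/seteqP; split=> [q []//|q cq]; split=> //; exact: circle_disk.
Qed.

Hypothesis Zic : Zinfty Z `<=` circle.
Hypothesis ZiZ : forall x, Zinfty Z x -> ~ Z x.

Lemma Zinfty_off x : Zinfty Z x -> off Z rho x.
Proof.
move=> Zx; have cx := Zic Zx; split; first exact: circle_disk.
by move=> w Zw /(reg_Z Zc eqv cx)/rZ[_ /(ZiZ Zx)].
Qed.

Lemma disk_pointsE p : off Z rho p ->
  disk_points (cpi @` cpiece rho p) = Zinfty Z `&` piece Z rho p.
Proof.
move=> op; rewrite /disk_points disk_boundaryE.
apply/seteqP; split=> x [Zx h]; split=> //; have dx := circle_disk (Zic Zx).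
  have [d [h1 _] dE] := h; apply/(cpi_cpiece op dx (Zinfty_off Zx)).
  by rewrite -dE -cpi_proj.
exists (in_disk x); last exact: in_diskK.
rewrite /preimage /= cpi_proj in_diskK//; split; last by exists x => //; exact: Zic.
exact/(cpi_cpiece op dx (Zinfty_off Zx)).
Qed.

End Cactus.

(** * Polar charts of the disks of the cactus *)

Section AngleMap.
Context {R : realType}.
Implicit Types (f h F G : R -> R) (s t : R).

Lemma derive_continuous F (g : R -> R) : (forall t, is_derive t (1 : R) F (g t)) -> continuous F.
Proof.
move=> H t; apply: differentiable_continuous; apply/derivable1_diffP.
by have [] := H t.
Qed.

Lemma MVT_all F (g : R -> R) s t : s < t -> (forall x, s < x < t -> is_derive x (1 : R) F (g x)) ->
  {within `[s, t], continuous F} ->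
  exists2 x, s < x < t & F t - F s = g x * (t - s).
Proof.
move=> st H cF; have H' x : x \in `]s, t[%R -> is_derive x (1 : R) F (g x) by rewrite in_itv/=; exact: H.
by have [x] := MVT st H' cF; rewrite in_itv/= => xst e; exists x.
Qed.

Lemma primitive_right f (A : R) : continuous f ->
  exists F, forall t, A < t -> is_derive t (1 : R) F (f t).
Proof.
move=> cf; exists (fun x => \int[lebesgue_measure]_(y in `[A, x]) f y) => t At.
have t1 : t < t + 1 by rewrite ltrDl.
have int : lebesgue_measure.-integrable `[A, t + 1] (EFin \o f).
  apply: continuous_compact_integrable; first exact: segment_compact.
  exact: continuous_subspaceT.
have [d e] := continuous_FTC1_closed t1 int At (cf t).
by apply: DeriveDef => //; rewrite -derive1E.
Qed.

(** Integrals with different starting points [A] differ by constants, so once normalised at 0 they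
    agree on common domains. Near [t] the varying start [-(|t| + 1)] can therefore be replaced by a
    fixed one. *)
Lemma primitive_exists f : continuous f ->
  exists F, F 0 = 0 /\ forall t, is_derive t (1 : R) F (f t).
Proof.
move=> cf; have /choice[G GP] := fun A => primitive_right A cf.
have uniq A B t : A < 0 -> B < 0 -> A < t -> B < t -> G A t - G A 0 = G B t - G B 0.
  move=> A0 B0 At Bt.
  have D x : A < x -> B < x -> is_derive x (1 : R) (G A - G B) (f x - f x).
    by move=> Ax Bx; apply: is_deriveB; exact: GP.
  have C x y : A < x -> B < x -> {within `[x, y], continuous (G A - G B)}.
    move=> Ax Bx; apply: continuous_in_subspaceT => z /set_mem/=.
    rewrite in_itv/= => /andP[xz _].
    apply: differentiable_continuous; apply/derivable1_diffP.
    by have [] := D z (lt_le_trans Ax xz) (lt_le_trans Bx xz).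
  have [t0|t0|->] := ltgtP t 0; last by rewrite !subrr.
  - have H x : t < x < 0 -> is_derive x (1 : R) (G A - G B) (f x - f x).
      by move=> /andP[tx _]; apply: D; [exact: lt_trans tx|exact: lt_trans tx].
    have [x _ /eqP] := MVT_all t0 H (C _ _ At Bt).
    by rewrite subrr mul0r /= !fctE => /eqP; lra.
  - have H x : 0 < x < t -> is_derive x (1 : R) (G A - G B) (f x - f x).
      by move=> /andP[tx _]; apply: D; [exact: lt_trans tx|exact: lt_trans tx].
    have [x _ /eqP] := MVT_all t0 H (C _ _ A0 B0).
    by rewrite subrr mul0r /= !fctE => /eqP; lra.
have neg t : - (`|t| + 1) < 0 /\ - (`|t| + 1) < t.
  by have := ler_norm (- t); rewrite normrN; have := normr_ge0 t; lra.
exists (fun t => G (- (`|t| + 1)) t - G (- (`|t| + 1)) 0); split; first by rewrite subrr.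
move=> t; pose A := - (`|t| + 2); have [n1 n2] := neg t.
have A0 : A < 0 by rewrite /A; lra.
have At : A < t by rewrite /A; lra.
have D : is_derive t (1 : R) (fun x => G A x - G A 0) (f t).
  have -> : (fun x => G A x - G A 0) = G A - cst (G A 0) by [].
  rewrite -[f t]subr0; apply: is_deriveB; exact: GP.
apply: (@near_eq_is_derive R R^o R^o _ _ t 1 (f t) _ D).
near=> x; have [m1 m2] := neg x; apply: uniq => //.
near: x; exact: lt_nbhsr.
Unshelve. all: by end_near. Qed.

(** A primitive of [f], rescaled to gain exactly [2 * pi] over one period; it stands still exactly
    where [f] vanishes. *)
Lemma angle_map f : continuous f -> (forall t, 0 <= f t) ->
  (forall t, f (t + 2 * pi) = f t) -> (exists t, 0 < f t) ->
  exists h, [/\ continuous h, h 0 = 0, forall t, h (t + 2 * pi) = h t + 2 * pi,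
    forall s t, s <= t -> h s <= h t &
    forall s t, s < t -> (h s = h t <-> forall x, s < x < t -> f x = 0)].
Proof.
move=> cf f0 fp [t0 ft0]; have pi0 := pi_gt0 R.
have [F [F0 FD]] := primitive_exists cf.
have cF := derive_continuous FD.
have cFw s t : {within `[s, t], continuous F} by exact: continuous_subspaceT.
have mono s t : s <= t -> F s <= F t.
  rewrite le_eqVlt => /orP[/eqP->//|st].
  have [x _ e] := MVT_all st (fun x _ => FD x) (cFw _ _).
  by rewrite -subr_ge0 e mulr_ge0// subr_ge0 ltW.
have FE s t : s < t -> (F s = F t <-> forall x, s < x < t -> f x = 0).
  move=> st; split=> [e x /andP[sx xt]|H]; last first.
    have [x xst e] := MVT_all st (fun x _ => FD x) (cFw _ _).
    by apply/eqP; rewrite eq_sym -subr_eq0 e (H x xst) mul0r.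
  have c y : s < y -> y < t -> F y = F s.
    by move=> sy yt; apply/eqP; rewrite eq_le {1}e !mono// ltW.
  have : is_derive x (1 : R) F 0.
    apply: (@near_eq_is_derive R R^o R^o (cst (F s)) F x 1 0) => //.
    by near=> y; rewrite /cst c//; near: y; [exact: lt_nbhsr|exact: lt_nbhsl].
  by move=> h; have := FD x; move=> [_ <-]; case: h.
have per t : F (t + 2 * pi) - F t = F (2 * pi).
  pose D x := F (x + 2 * pi) - F x.
  have DD x : is_derive x (1 : R) D 0.
    have -> : D = F \o shift (2 * pi) - F by [].
    rewrite -(subrr (f x)); apply: is_deriveB => //.
    have -> : f x = f (x + 2 * pi) * 1 by rewrite mulr1 fp.
    have FD' := FD (x + 2 * pi); apply: is_derive1_comp; exact: (@is_derive_shift R x 1 (2 * pi)).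
  by have := is_derive_0_is_cst t 0 DD; rewrite /D add0r F0 subr0.
have M0 : 0 < F (2 * pi).
  have perm n t : F (t + 2 * pi *+ n) = F t + F (2 * pi) *+ n.
    elim: n => [|n IH]; first by rewrite !mulr0n !addr0.
    by rewrite mulrSr addrA -[LHS](subrK (F (t + 2 * pi *+ n))) per IH mulrSr; ring.
  rewrite lt_neqAle -{2}F0 mono ?mulr_ge0 ?ltW// andbT; apply/eqP => e.
  (* One period is longer than 2, so the window starting at [t0 - 1] has [t0] in its interior. *)
  have [n hn] : exists n : nat, t0 + 1 < t0 - 1 + 2 * pi *+ n.
    exists 1%N; have := pi_ge2 R; rewrite mulr1n; lra.
  have h1 : F (t0 - 1) = F (t0 - 1 + 2 * pi *+ n) by rewrite perm -e mul0rn addr0.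
  have st : t0 - 1 < t0 - 1 + 2 * pi *+ n by lra.
  have := (FE _ _ st).1 h1 t0; move: ft0 => /[swap] ->; rewrite ?ltxx//.
  by apply/andP; split; lra.
have k0 : 0 < 2 * pi / F (2 * pi) by rewrite divr_gt0// mulr_gt0.
exists (fun t => 2 * pi / F (2 * pi) * F t); split.
- by move=> t; apply: cvgM; [exact: cvg_cst|exact: cF].
- by rewrite F0 mulr0.
- move=> t; have -> : F (t + 2 * pi) = F t + F (2 * pi) by rewrite -(per t); ring.
  by rewrite mulrDr divfK// gt_eqF.
- by move=> s t st; rewrite ler_pM2l// mono.
- move=> s t st; rewrite -FE//; split=> [|->//].
  by move/(mulfI (lt0r_neq0 k0)).
Unshelve. all: by end_near. Qed.

End AngleMap.

Section Periodic.
Context {R : realType}.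

Lemma period_ind (t0 : R) (P : R -> Prop) : (forall t, P t <-> P (t + 2 * pi)) ->
  (forall t, t0 <= t -> t < t0 + 2 * pi -> P t) -> forall t, P t.
Proof.
move=> PP P0; have pi0 := pi_gt0 R.
have Pn n t : P t <-> P (t + 2 * pi * n%:R).
  elim: n t => [|n IH] t; first by rewrite mulr0 addr0.
  have -> : t + 2 * pi * n.+1%:R = t + 2 * pi * n%:R + 2 * pi by rewrite -[n.+1%:R]natr1; ring.
  by rewrite -PP.
have pos t : t0 <= t -> P t.
  move=> t0t; pose n := Num.truncn ((t - t0) / (2 * pi)).
  have q0 : 0 <= (t - t0) / (2 * pi) by rewrite divr_ge0//; lra.
  have /andP[n1 n2] := truncn_itv q0; rewrite -/n in n1 n2.
  move: n1; rewrite ler_pdivlMr; last lra; move=> n1.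
  move: n2; rewrite ltr_pdivrMr; last lra; rewrite -[n.+1%:R]natr1 => n2.
  have -> : t = t - 2 * pi * n%:R + 2 * pi * n%:R by ring.
  by apply: (Pn n (t - 2 * pi * n%:R)).1; apply: P0; lra.
move=> t; have [/pos//|tt0] := leP t0 t.
pose n := Num.truncn ((t0 - t) / (2 * pi)).
have q0 : 0 <= (t0 - t) / (2 * pi) by rewrite divr_ge0//; lra.
have /andP[n1 n2] := truncn_itv q0; rewrite -/n in n1 n2.
move: n2; rewrite ltr_pdivrMr; last lra; move=> n2.
by apply: (Pn n.+1 t).2; apply: pos; lra.
Qed.

End Periodic.

(** Both maps identify the same points of [K] and send closed saturated sets to closed sets, so both
    images carry the same quotient topology. *)
Lemma quotient_homeo (T Q U : topologicalType) (K : set T) (p : T -> Q) (b : T -> U) :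
  K !=set0 ->
  (forall F, closed F -> closed (p @` (K `&` b @^-1` F))) ->
  (forall F, closed F -> closed (b @` (K `&` p @^-1` F))) ->
  (forall k k', K k -> K k' -> (p k = p k' <-> b k = b k')) ->
  exists g : Q -> U, homeo_on (p @` K) (b @` K) g /\ forall k, K k -> g (p k) = b k.
Proof.
move=> [k0 _] cp cb pb.
have ex (A B : Type) (f : T -> A) (f' : T -> B) :
    (forall k k', K k -> K k' -> f k = f k' -> f' k = f' k') ->
    exists g : A -> B, forall k, K k -> g (f k) = f' k.
  move=> H; have /choice[g gP] : forall e, exists u, forall k, K k -> f k = e -> u = f' k.
    move=> e; have [[k [Kk fk]]|nk] := pselect (exists k, K k /\ f k = e).
      by exists (f' k) => k' Kk' e'; apply: H => //; rewrite e'.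
    by exists (f' k0) => k Kk fk; case: nk; exists k.
  by exists g => k Kk; exact: gP.
have [g gP] := ex _ _ p b (fun k k' Kk Kk' => (pb k k' Kk Kk').1).
have [g' gP'] := ex _ _ b p (fun k k' Kk Kk' => (pb k k' Kk Kk').2).
exists g; split=> //; split.
- split.
  + by move=> _ [k Kk <-]; exists k => //; rewrite gP.
  + move=> _ _ /set_mem[k Kk <-] /set_mem[k' Kk' <-].
    by rewrite !gP// => /(pb k k' Kk Kk').
  + by move=> _ [k Kk <-]; exists (p k); [exists k|exact: gP].
- apply/continuous_closedP => F cF; apply/closed_subspaceP.
  exists (p @` (K `&` b @^-1` F)); first exact: cp.
  apply/seteqP; split=> [e [[k [Kk Fk] <-] Ek]|e [h [k Kk ke]]].
    by split=> //; rewrite /preimage /from_subspace /= gP.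
  rewrite -ke in h *; split; exists k => //; split=> //.
  by move: h; rewrite /preimage /from_subspace /= gP.
- exists g'; split; last by move=> _ [k Kk <-]; rewrite gP// gP'.
  apply/continuous_closedP => F cF; apply/closed_subspaceP.
  exists (b @` (K `&` p @^-1` F)); first exact: cb.
  apply/seteqP; split=> [e [[k [Kk Fk] <-] Ek]|e [h [k Kk ke]]].
    by split=> //; rewrite /preimage /from_subspace /= gP'.
  rewrite -ke in h *; split; exists k => //; split=> //.
  by move: h; rewrite /preimage /from_subspace /= gP'.
Qed.

Section Mins.
Context {R : realType} {I : eqType}.
Implicit Types (s : seq I).

(** The initial value 1 is the cap needed for rays, which may not go beyond the circle, and is the
    value when there are no chords. *)
Definition mins s (f : I -> R) := foldr (fun e m => Num.min (f e) m) 1 s.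

Lemma mins_le s f e : e \in s -> mins s f <= f e.
Proof.
elim: s => //= e' s IH; rewrite inE => /orP[/eqP->|/IH h]; first by rewrite ge_min lexx.
by rewrite ge_min h orbT.
Qed.

Lemma mins_le1 s f : mins s f <= 1.
Proof. by elim: s => //= e s IH; rewrite ge_min IH orbT. Qed.

Lemma mins_case s f : mins s f = 1 \/ exists2 e, e \in s & mins s f = f e.
Proof.
elim: s => [|e s IH] /=; first by left.
have [h|h] := leP (f e) (mins s f); first by right; exists e; rewrite ?inE ?eqxx.
case: IH => [|[e' es ->]]; first by left.
by right; exists e' => //; rewrite inE es orbT.
Qed.

Lemma mins_gt0 s f : 0 < mins s f <-> forall e, e \in s -> 0 < f e.
Proof.
split=> [h e es|H]; first exact: lt_le_trans h (mins_le f es).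
by case: (mins_case s f) => [->//|[e es ->]]; exact: H.
Qed.

Lemma cvg_mins {T : topologicalType} s (f : T -> I -> R) x :
  (forall e, e \in s -> {for x, continuous (fun t => f t e)}) ->
  {for x, continuous (fun t => mins s (f t))}.
Proof.
elim: s => [|e s IH] H /=; first exact: cvg_cst.
apply: (@continuous_min R T (fun t => f t e) (fun t => mins s (f t)) x).
  by apply: H; rewrite inE eqxx.
by apply: IH => e' es; apply: H; rewrite inE es orbT.
Qed.

End Mins.

Section Period.
Context {R : realType}.

Lemma cexp_eq_period (t t' : R) : 0 <= t -> t < t' -> t' <= 2 * pi ->
  cexp t = cexp t' :> plane R -> t = 0 /\ t' = 2 * pi.
Proof.
move=> t0 tt' t'2 e; have pi0 := pi_gt0 R.
have inj a b : 0 <= a -> a < 2 * pi -> 0 <= b -> b < 2 * pi -> cexp a = cexp b :> plane R -> a = b.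
  by move=> a0 a1 b0 b1; apply: (@cexp_inj R 0); rewrite ?add0r.
have t2 := lt_le_trans tt' t'2; have t'0 := le_trans t0 (ltW tt').
have t'E : t' = 2 * pi.
  apply/eqP; rewrite eq_le t'2 leNgt; apply/negP => h.
  by move: tt'; rewrite (inj _ _ t0 t2 t'0 h e) ltxx.
split=> //; apply: inj => //; first by rewrite mulr_gt0.
by rewrite e t'E -[2 * pi]add0r cexpD2pi.
Qed.

End Period.

(** * Rays from the centre of a piece *)

Section Chart.
Context {R : realType}.
Local Notation plane := (plane R).
Variables (Z : set plane) (rho : plane -> plane -> Prop).
Hypothesis Zc : Z `<=` circle.
Hypothesis Zf : finite_set Z.
Hypothesis eqv : equivalence_on Z rho.
Hypothesis nc : noncrossing rho.
Variable c : plane.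
Hypothesis oc : off Z rho c.
Hypothesis odc : open_disk c.

Local Notation reg := (class_region rho).
Local Notation cpi := (cpi Z rho).

Let rZ x y : rho x y -> Z x /\ Z y. Proof. by have [H _ _ _] := eqv; exact: H. Qed.
Let rxx x : Z x -> rho x x. Proof. by have [_ H _ _] := eqv; exact: H. Qed.
Let rC x y : rho x y -> rho y x. Proof. by have [_ _ H _] := eqv; exact: H. Qed.
Let rT x y z : rho x y -> rho y z -> rho x z.
Proof. by have [_ _ _ H] := eqv; exact: H. Qed.

Variable s : seq (plane * plane).
Hypothesis sP : [set e : plane * plane | rho e.1 e.2 /\ e.1 <> e.2] = [set` s].

Let sr e : e \in s -> rho e.1 e.2 /\ e.1 <> e.2.
Proof. by move=> es; have : [set` s] e by []; rewrite -sP. Qed.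

Let rs w w' : rho w w' -> w <> w' -> (w, w') \in s.
Proof. by move=> r n; have : [set` s] (w, w') by rewrite -sP. Qed.

Definition side (e : plane * plane) (q : plane) : R := area e.1 e.2 c * area e.1 e.2 q.

Lemma side_c e : e \in s -> 0 < side e c.
Proof.
move=> es; have [r n] := sr es; rewrite /side -expr2 lt_neqAle sqr_ge0 andbT eq_sym sqrf_eq0.
exact: (off_area Zc eqv oc).
Qed.

Lemma side_mix e t p q : side e (mix t p q) = (1 - t) * side e p + t * side e q.
Proof. by rewrite /side area_mix; ring. Qed.

Lemma side_cont e : continuous (side e).
Proof. by move=> q; apply: cvgM; [exact: cvg_cst|exact: continuous_area]. Qed.

(* mix r c u stays on the right side of all the chords e exactly when r <= reach u. *)
Definition reach_at (u : plane) (e : plane * plane) : R :=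
  side e c / (side e c + Num.max 0 (- side e u)).

Definition reach u : R := mins s (reach_at u).

(** Positive exactly when [u] is strictly on the side of [c] of all chords between equivalent
    points. Being continuous and nonnegative, it serves as the speed of the boundary angle. *)
Definition inside u : R := Num.max 0 (mins s (side^~ u)).

Let den_gt0 e u : e \in s -> 0 < side e c + Num.max 0 (- side e u).
Proof. by move=> /side_c h; apply: ltr_pwDl => //; rewrite le_max lexx. Qed.

Lemma reach_gt0 u : 0 < reach u.
Proof. by apply/mins_gt0 => e es; rewrite divr_gt0 ?den_gt0 ?side_c. Qed.

Lemma reach_le1 u : reach u <= 1. Proof. exact: mins_le1. Qed.

Lemma reach_side e u r : e \in s -> 0 <= r -> r <= reach u -> 0 <= side e (mix r c u).
Proof.
move=> es r0 ru; have := le_trans ru (mins_le (reach_at u) es).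
rewrite ler_pdivlMr ?den_gt0// side_mix mulrDr => h.
have : r * - side e u <= r * Num.max 0 (- side e u) by rewrite ler_wpM2l// le_max lexx orbT.
by lra.
Qed.

Lemma reach_side_lt e u r : e \in s -> 0 <= r -> r < reach u -> 0 < side e (mix r c u).
Proof.
move=> es r0 ru; have := lt_le_trans ru (mins_le (reach_at u) es).
rewrite ltr_pdivlMr ?den_gt0// side_mix mulrDr => h.
have : r * - side e u <= r * Num.max 0 (- side e u) by rewrite ler_wpM2l// le_max lexx orbT.
by lra.
Qed.

Lemma reach_max u r : 0 <= r -> r <= 1 ->
  (forall e, e \in s -> 0 <= side e (mix r c u)) -> r <= reach u.
Proof.
move=> r0 r1 H; rewrite /reach; case: (mins_case s (reach_at u)) => [->//|[e es ->]].
rewrite ler_pdivlMr ?den_gt0//; have := H _ es; have := side_c es; rewrite side_mix.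
case: (leP 0 (- side e u)) => h.
  by rewrite mulrDr; lra.
by rewrite addr0; nra.
Qed.

Lemma reach_lt1 u : reach u < 1 -> exists2 e, e \in s & side e (mix (reach u) c u) = 0.
Proof.
rewrite /reach; case: (mins_case s (reach_at u)) => [->|[e es e1]]; first by rewrite ltxx.
rewrite e1 ltr_pdivrMr ?den_gt0// mul1r ltrDl => h; exists e => //.
have d := den_gt0 u es; rewrite side_mix /reach_at.
move: h d; case: (leP 0 (- side e u)) => h; rewrite ?ltxx// => _ d.
by field; rewrite gt_eqF.
Qed.

Lemma inside_gt0 u : 0 < inside u <-> forall e, e \in s -> 0 < side e u.
Proof. by rewrite /inside lt_max ltxx /=; exact: mins_gt0. Qed.

Lemma inside_ge0 u : 0 <= inside u. Proof. by rewrite /inside le_max lexx. Qed.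

Lemma inside_cont : continuous inside.
Proof.
move=> u; apply: (@continuous_max R _ (cst 0) (fun u => mins s (side^~ u))); first exact: cvg_cst.
by apply: cvg_mins => e _; exact: side_cont.
Qed.

Lemma reach_cont : continuous reach.
Proof.
move=> u; apply: cvg_mins => e es; apply: cvgM; first exact: cvg_cst.
apply: cvgV; first by rewrite gt_eqF// den_gt0.
apply: cvgD; first exact: cvg_cst.
apply: (@continuous_max R _ (cst 0) (fun u => - side e u)); first exact: cvg_cst.
by apply: cvgN; exact: side_cont.
Qed.

Definition rayto (r t : R) : plane := mix (r * reach (cexp t)) c (cexp t).

Let rr r t : 0 <= r -> r <= 1 -> 0 <= r * reach (cexp t) <= reach (cexp t).
Proof.
move=> r0 r1; have h := ltW (reach_gt0 (cexp t)).
by apply/andP; split; [exact: mulr_ge0|exact: ler_piMl].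
Qed.

Lemma ray_disk r t : 0 <= r -> r <= 1 -> disk (rayto r t).
Proof.
move=> r0 r1; have /andP[h1 h2] := rr t r0 r1.
apply: cvx_disk => //; [exact: odisk_disk|exact/circle_disk/cexp_circle|].
exact: le_trans h2 (reach_le1 _).
Qed.

Lemma ray_cpiece r t : 0 <= r -> r <= 1 -> cpiece rho c (rayto r t).
Proof.
move=> r0 r1; split; first exact: ray_disk.
move=> w w' r' n; have /andP[h1 h2] := rr t r0 r1.
exact: (reach_side (rs r' n) h1 h2).
Qed.

Lemma ray_piece r t : 0 <= r -> r < 1 -> piece Z rho c (rayto r t) /\ open_disk (rayto r t).
Proof.
move=> r0 r1; have h := reach_gt0 (cexp t).
have h1 : 0 <= r * reach (cexp t) by rewrite mulr_ge0 // ltW.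
have h2 : r * reach (cexp t) < reach (cexp t) by rewrite gtr_pMl.
have od : open_disk (rayto r t).
  apply: odisk_mixl => //; first exact/circle_disk/cexp_circle.
  exact: lt_le_trans h2 (reach_le1 _).
split=> //; split; first exact: odisk_disk.
  by move=> /Zc; exact: odisk_ncircle.
move=> w w' r' n; exact: (reach_side_lt (rs r' n) h1 h2).
Qed.

Lemma ray_onto q : cpiece rho c q ->
  exists r t, [/\ 0 <= r <= 1, 0 <= t <= 2 * pi & q = rayto r t].
Proof.
move=> [dq H]; have pi0 := pi_gt0 R.
have [->|/eqP qc] := eqVneq q c.
  by exists 0, 0; rewrite /rayto mul0r mix0 !lexx ler01; split=> //; lra.
have [k [u [/andP[k0 k1] du _ qE hu]]] :=
  @ray_exit R [::] c q odc (fun _ => ltac:(by [])) dq (fun _ => ltac:(by [])) qc.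
have cu : circle u by case: hu => [//|[]].
have [t [t0 t1 uE]] := cexp_surj 0 cu.
have ku : k <= reach u.
  apply: reach_max => //; first exact: ltW.
  by move=> e es; rewrite -qE; have [r n] := sr es; exact: H.
have ru := reach_gt0 u.
exists (k / reach u), t; split.
- by apply/andP; split; [rewrite divr_ge0// ltW|rewrite ler_pdivrMr// mul1r].
- by rewrite t0 ltW// -[ltRHS]add0r.
- by rewrite /rayto -uE divfK// gt_eqF.
Qed.

Lemma reach1 t r : inside (cexp t) > 0 -> rayto r t = mix r c (cexp t).
Proof.
move=> /inside_gt0 H; rewrite /rayto; suff -> : reach (cexp t) = 1 by rewrite mulr1.
apply/eqP; rewrite eq_le reach_le1/=; apply: reach_max => // e es.
by rewrite mix1; exact/ltW/H.
Qed.

Lemma ray1_cpiece t : cpiece rho c (cexp t) -> rayto 1 t = cexp t.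
Proof.
move=> [_ H]; rewrite /rayto mul1r; suff -> : reach (cexp t) = 1 by rewrite mix1.
apply/eqP; rewrite eq_le reach_le1/=; apply: reach_max => // e es.
by rewrite mix1; have [r n] := sr es; exact: H.
Qed.

(** Where the circle is outside the piece, the ray stops on a chord, which is contained in the
    region of its ends. *)
Lemma ray1_reg t : inside (cexp t) <= 0 ->
  exists e, [/\ rho e.1 e.2, e.1 <> e.2 & reg e.1 (rayto 1 t)].
Proof.
move=> h; suff [e es e0] : exists2 e, e \in s & side e (rayto 1 t) = 0.
  have [r n] := sr es; exists e; split=> //; have [Z1 Z2] := rZ r.
  have a0 : area e.1 e.2 (rayto 1 t) = 0.
    move/eqP: e0; rewrite mulf_eq0 (negbTE (off_area Zc eqv oc r n)) => /eqP//.
  have dr := ray_disk t (ler01 : (0 : R) <= 1) (lexx 1).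
  have [k [k0 k1 ->]] := disk_chord (Zc Z1) (Zc Z2) n dr a0.
  by apply: conv_hull_cvx => //; apply: sub_conv_hull; [exact: rxx|].
have [e es le] : exists2 e, e \in s & side e (cexp t) <= 0.
  apply: contrapT => H; move: h; rewrite leNgt => /negP; apply.
  by apply/inside_gt0 => e es; rewrite ltNge; apply/negP => h; apply: H; exists e.
have := reach_le1 (cexp t); rewrite le_eqVlt => /orP[/eqP r1|r1].
  exists e => //; rewrite /rayto mul1r r1 mix1; apply/eqP; rewrite eq_le le/=.
  rewrite -(mix1 c (cexp t)) -r1; apply: reach_side => //; exact/ltW/reach_gt0.
by have [e' es' e0] := reach_lt1 r1; exists e' => //; rewrite /rayto mul1r.
Qed.

Lemma ray_reg r t w : 0 <= r -> r <= 1 -> Z w -> reg w (rayto r t) -> r = 1.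
Proof.
move=> r0; rewrite le_eqVlt => /orP[/eqP//|r1] Zw h.
have [pr _] := ray_piece t r0 r1.
by have [_ /(_ w Zw)] := piece_off Zc Zf eqv oc pr.
Qed.

Lemma ray_reg_single t w : 0 < inside (cexp t) -> Z w -> reg w (rayto 1 t) -> reg w = [set rayto 1 t].
Proof.
move=> it Zw; rewrite reach1// mix1 => h.
have r := reg_Z Zc eqv (cexp_circle t) h.
rewrite (reg_class eqv r); have [_ Zt] := rZ r.
apply: (reg_single eqv) => // -[a [b [ra rb ab]]].
have H u : rho (cexp t) u -> u = cexp t.
  move=> ru; apply: contrapT => n; have /(_ _ (rs ru (nesym n))) := (inside_gt0 _).1 it.
  by rewrite /side areaxyx mulr0 ltxx.
by apply: ab; rewrite (H _ ra) (H _ rb).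
Qed.

(** Half-lines from the inner point [c] to different points of the circle meet only at [c]. *)
Lemma ray_inj r t r' t' : 0 <= r -> r <= 1 -> 0 <= r' -> r' <= 1 ->
  0 <= t <= 2 * pi -> 0 <= t' <= 2 * pi -> rayto r t = rayto r' t' ->
  r = r' /\ (r = 0 \/ cexp t = cexp t' :> plane).
Proof.
have mixinj k k' u u' : circle u -> circle u' -> 0 <= k -> 0 <= k' -> k <= k' ->
    mix k c u = mix k' c u' -> k = k' /\ (k = 0 \/ u = u').
  move=> cu cu' k0 k'0 kk' e.
  have e1 : (1 - k) * (c.1 : R) + k * u.1 = (1 - k') * c.1 + k' * u'.1 := congr1 fst e.
  have e2 : (1 - k) * (c.2 : R) + k * u.2 = (1 - k') * c.2 + k' * u'.2 := congr1 snd e.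
  have [k'E|k'n] := eqVneq k' 0; first by split; [|left]; lra.
  have k'p : 0 < k' by rewrite lt_neqAle eq_sym k'n.
  have uE : u' = mix (k / k') c u.
    apply: plane_eq; apply: (mulfI k'n) => /=.
      have -> : k' * ((1 - k / k') * c.1 + k / k' * u.1) = k' * c.1 - k * c.1 + k * u.1 by field.
      by lra.
    have -> : k' * ((1 - k / k') * c.2 + k / k' * u.2) = k' * c.2 - k * c.2 + k * u.2 by field.
    by lra.
  have : k / k' <= 1 by rewrite ler_pdivrMr// mul1r.
  rewrite le_eqVlt => /orP[/eqP h|h].
    have kE : k = k' by rewrite -[k](divfK k'n) h mul1r.
    by split=> //; right; rewrite uE h mix1.
  have : open_disk u'.
    by rewrite uE; apply: odisk_mixl => //; [exact: circle_disk|rewrite divr_ge0].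
  by move/odisk_ncircle.
move=> r0 r1 r'0 r'1 t0 t1 e.
have ru := reach_gt0 (cexp t); have ru' := reach_gt0 (cexp t').
have cu := cexp_circle t; have cu' := cexp_circle t'.
have a0 : 0 <= r * reach (cexp t) by rewrite mulr_ge0 // ltW.
have a1 : 0 <= r' * reach (cexp t') by rewrite mulr_ge0 // ltW.
have [k1 k2] : r * reach (cexp t) = r' * reach (cexp t') /\
    (r * reach (cexp t) = 0 \/ cexp t = cexp t' :> plane).
  have [h|/ltW h] := leP (r * reach (cexp t)) (r' * reach (cexp t')); first exact: mixinj.
  have [h1 h2] := mixinj _ _ _ _ cu' cu a1 a0 h (esym e).
  by split=> //; case: h2 => [e0|->]; [left; rewrite -h1|right].
case: k2 => [/eqP|k2].
  rewrite mulf_eq0 (gt_eqF ru) orbF => /eqP r00; move: k1; rewrite r00 mul0r.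
  move/esym/eqP; rewrite mulf_eq0 (gt_eqF ru') orbF => /eqP ->.
  by split=> //; left.
move: k1; rewrite k2 => /(mulIf (lt0r_neq0 ru')) ->; split=> //; by right.
Qed.

Lemma ray_cont : continuous (fun k : plane => rayto k.1 k.2).
Proof.
move=> k; have h0 : (fun k : plane => k) @ k --> k by exact: cvg_id.
have h1 := cvg_coord1 h0; have h2 := cvg_coord2 h0.
have h3 : (fun i : plane => cexp i.2 : plane) @ k --> (cexp k.2 : plane) by exact: cvg_cexp.
apply: cvg_mix; [|exact: cvg_cst|exact: h3].
by apply: cvgM; [exact: h1|apply: cvg_comp h3 _; exact: reach_cont].
Qed.

End Chart.

(** * Boundary arcs outside a piece *)

Section Chart.
Context {R : realType}.
Local Notation plane := (plane R).
Variables (Z : set plane) (rho : plane -> plane -> Prop).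
Hypothesis Zc : Z `<=` circle.
Hypothesis Zf : finite_set Z.
Hypothesis eqv : equivalence_on Z rho.
Hypothesis nc : noncrossing rho.
Variable c : plane.
Hypothesis oc : off Z rho c.
Hypothesis odc : open_disk c.

Local Notation reg := (class_region rho).
Local Notation cpi := (cpi Z rho).

Let rZ x y : rho x y -> Z x /\ Z y. Proof. by have [H _ _ _] := eqv; exact: H. Qed.
Let rC x y : rho x y -> rho y x. Proof. by have [_ _ H _] := eqv; exact: H. Qed.
Let rT x y z : rho x y -> rho y z -> rho x z.
Proof. by have [_ _ _ H] := eqv; exact: H. Qed.

Variable s : seq (plane * plane).
Hypothesis sP : [set e : plane * plane | rho e.1 e.2 /\ e.1 <> e.2] = [set` s].

Local Notation ray := (rayto c s).
Local Notation inside := (inside c s).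
Local Notation f t := (inside (cexp t)).

Lemma ray1_continuous : continuous (ray 1).
Proof.
move=> t; have h3 : (fun i : R => cexp i : plane) @ t --> (cexp t : plane).
  exact: continuous_cexp.
apply: cvg_mix; [|exact: cvg_cst|exact: h3].
apply: cvgM; first exact: cvg_cst.
by apply: cvg_comp h3 _; exact: (reach_cont Zc eqv oc sP).
Qed.

Lemma inside_cexp_cont : continuous (fun t => f t : R).
Proof.
move=> t; have h3 : (fun i : R => cexp i : plane) @ t --> (cexp t : plane).
  exact: continuous_cexp.
by apply: cvg_comp h3 _; exact: inside_cont.
Qed.

(* The rays ending on a boundary arc that lies outside the piece all end in the same region:
   finitely many disjoint closed regions cannot cover an interval. *)
Lemma ray1_const t t' w : t < t' -> (forall x, t < x < t' -> f x = 0) ->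
  Z w -> reg w (ray 1 t) -> reg w (ray 1 t').
Proof.
move=> tt' H0 Zw wt.
have H x : t <= x <= t' -> f x <= 0.
  move=> /andP[tx xt']; rewrite leNgt; apply/negP => fx.
  have /nbhs_ballP[e /= e0 He] : nbhs x [set y | 0 < f y].
    by apply: open_nbhs_nbhs; split=> //; apply: open_gt0; exact: inside_cexp_cont.
  have [y [hy1 hy2]] : exists y, t < y < t' /\ `|x - y| < e.
    have [xlt|xge] := ltP x t'.
      exists (Num.min (x + e / 2) ((x + t') / 2)).
      by case: (leP (x + e / 2)) => h; (split; [apply/andP; split; lra|rewrite ltr_norml; apply/andP; split; lra]).
    exists (Num.max (x - e / 2) ((x + t) / 2)).
    by case: (leP (x - e / 2)) => h; (split; [apply/andP; split; lra|rewrite ltr_norml; apply/andP; split; lra]).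
  by have := He y hy2; rewrite /= H0// ltxx.
have cl v : closed [set x : R | reg v (ray 1 x)].
  apply: (@closed_comp _ _ (ray 1) (reg v)); last exact: (reg_closed Zc Zf eqv).
  by move=> x _; exact: ray1_continuous.
pose I := [set` `[t, t']]; pose A := I `&` [set x : R | reg w (ray 1 x)].
suff : A = I.
  move=> AI; have : I t' by rewrite /I /= in_itv/= lexx ltW.
  by rewrite -AI => -[].
apply: (@segment_connected R t t').
- by exists t; split=> //; rewrite /I /= in_itv/= lexx ltW.
- exists (~` \bigcup_(v in [set v | Z v /\ ~ rho w v]) [set x : R | reg v (ray 1 x)]).
    apply: closed_openC; apply: closed_bigcup => [|v _]; last exact: cl.
    by apply: sub_finite_set Zf => v [].
  apply/seteqP; split=> x [Ix h]; split=> //.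
    move=> [v [Zv nv] hv]; apply: nv; exact: (reg_disjoint Zc Zf eqv nc Zw Zv h hv).
  have xI : t <= x <= t' by move: Ix; rewrite /I /= in_itv.
  have [e [r n hx]] := ray1_reg Zc eqv oc odc sP (H x xI).
  have [Ze _] := rZ r.
  rewrite /= (reg_class eqv (_ : rho w e.1))//; apply: contrapT => nr.
  by apply: h; exists e.1.
- by exists [set x : R | reg w (ray 1 x)].
Qed.

(** Otherwise all rays would end in one region, by [ray1_const]. A chord of its class separates this
    region from [c], but the ray prolonging the segment from an end [a] of the chord to [c] stays on
    the side of [c]. *)
Lemma exists_inside : exists t, 0 < f t.
Proof.
apply: contrapT => nf.
have f0 t : f t <= 0 by rewrite leNgt; apply/negP => h; apply: nf; exists t.
have f00 t : f t = 0 by apply/eqP; rewrite eq_le f0 inside_ge0.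
have pi0 := pi_gt0 R.
have [e [r n h0]] := ray1_reg Zc eqv oc odc sP (f0 0); have [Ze _] := rZ r.
have ab : exists a b, [/\ rho e.1 a, rho e.1 b & a <> b].
  by exists e.1, e.2; split=> //; exact: rT r (rC r).
have [a [b [ra rb {}ab hc le]]] := reg_sep Zc Zf eqv oc.1 (oc.2 _ Ze) ab.
have [_ Za] := rZ ra.
have [k [u [/andP[k0 k1] cu cE]]] := second_point (Zc Za) odc.
(* A window starting at 1 makes [t] positive, so that [ray1_const] applies from 0 to [t]. *)
have [t [t0 t1 uE]] := cexp_surj 1 cu.
have hu : 0 < area a b u.
  by move: hc; rewrite cE area_mix areaxyx mulr0 add0r pmulr_rgt0.
have t00 : 0 < t by lra.
have hr := ray1_const t00 (fun x _ => f00 x) Ze h0.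
have := le _ hr; rewrite leNgt => /negP; apply.
rewrite /rayto mul1r area_mix -uE.
have h1 := reach_gt0 Zc eqv oc sP u; have h2 := @reach_le1 _ c s u.
by apply: ltr_wpDl; [apply: mulr_ge0; [lra|exact: ltW]|exact: mulr_gt0].
Qed.

(** A chord [ab] of the class has [cexp t] and [cexp t'] on one side, and the circle points inside
    the piece on the other. Such points on both arcs between [t] and [t'] would span a chord
    crossing the one from [t] to [t'], at a point on both sides of [ab]. *)
Lemma region_arc t t' w : 0 <= t -> t < t' -> t' <= 2 * pi -> Z w ->
  (exists a b, [/\ rho w a, rho w b & a <> b]) ->
  reg w (ray 1 t) -> reg w (ray 1 t') ->
  (forall x, t < x < t' -> f x = 0) \/
  (forall x, 0 <= x -> x < t \/ t' < x -> x < 2 * pi -> f x = 0).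
Proof.
move=> t0 tt' t2 Zw ab rt rt'.
have [a [b [ra rb {}ab hc le]]] := reg_sep Zc Zf eqv oc.1 (oc.2 _ Zw) ab.
have rab : rho a b by exact: rT (rC ra) rb.
have neg x : reg w (ray 1 x) -> area a b (cexp x) <= 0.
  move=> /le; rewrite /rayto mul1r area_mix => h; rewrite leNgt; apply/negP => h'.
  have h1 := reach_gt0 Zc eqv oc sP (cexp x); have h2 := @reach_le1 _ c s (cexp x).
  move: h; rewrite leNgt => /negP; apply.
  by apply: ltr_wpDl; [apply: mulr_ge0; [lra|exact: ltW]|exact: mulr_gt0].
have pos x : 0 < f x -> 0 < area a b (cexp x).
  move=> /(inside_gt0 _)/(_ (a, b)); rewrite /side /= pmulr_rgt0//; apply.
  have : [set` s] (a, b) by rewrite -sP.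
  by [].
have [h|] := pselect (forall x, t < x < t' -> f x = 0); first by left.
move=> /existsNP[x /not_implyP[/andP[tx xt'] /eqP fx]]; right=> y y0 yt y2.
have px : 0 < area a b (cexp x) by apply: pos; rewrite lt_neqAle eq_sym fx inside_ge0.
apply/eqP; rewrite eq_le inside_ge0 andbT leNgt; apply/negP => /pos py.
have nt := neg _ rt; have nt' := neg _ rt'.
have pi0 := pi_gt0 R.
have tl : t' < t + 2 * pi by case: yt => h; lra.
have yl : y < t -> t' < y + 2 * pi.
  move=> yt'; rewrite lt_neqAle; apply/andP; split; last by lra.
  by apply/eqP => e; move: nt'; rewrite e cexpD2pi leNgt py.
have a1 : area (cexp t) (cexp t') (cexp x) < 0.
  by rewrite area_rot area_rot area_swap oppr_lt0; exact: area_cexp_gt0.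
have a2 : 0 < area (cexp t) (cexp t') (cexp y).
  case: yt => h; last by apply: area_cexp_gt0 => //; lra.
  by rewrite -area_rot; apply: area_cexp_gt0 => //; exact: yl.
have sp : sep (cexp t) (cexp t') (cexp x) (cexp y) by rewrite /sep nmulr_rlt0.
have ct := @cexp_circle R.
have := crossingP (ct t) (ct t') (ct x) (ct y) (sep_neq sp) (sep_neq2 sp).
move=> [_ /(_ sp)[_ [p [[]]]]] /geodesicP[k [k0 k1 pE]] /geodesicP[l [l0 l1 pE']] _.
have : area a b p <= 0 by rewrite pE area_mix; nra.
suff : 0 < area a b p by lra.
rewrite pE' area_mix; move: l0; rewrite le_eqVlt => /orP[/eqP <-|l0].
  by rewrite mul0r addr0 subr0 mul1r.
by apply: ltr_wpDl; [apply: mulr_ge0; [lra|exact: ltW]|exact: mulr_gt0].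
Qed.

End Chart.

(** * The polar map of the disk *)

Section PolarMap.
Context {R : realType}.
Local Notation plane := (plane R).
Variable h : R -> R.
Hypothesis hc : continuous h.
Hypothesis h0 : h 0 = 0.
Hypothesis hp : forall t, h (t + 2 * pi) = h t + 2 * pi.
Hypothesis hm : forall s t, s <= t -> h s <= h t.

(** Interpolates from the identity at [r = 0] to [h] at [r = 1]. It is strictly increasing in [t]
    for [r < 1], so [h] collapses arcs on the boundary circle only. *)
Definition phase (r t : R) := (1 - r) * t + r * h t.

Definition polar_pt (r t : R) : plane := mix r (0, 0) (cexp (phase r t)).

Lemma h2pi : h (2 * pi) = 2 * pi.
Proof. by have := hp 0; rewrite add0r h0 add0r. Qed.

Lemma phase0 r : phase r 0 = 0. Proof. by rewrite /phase h0 !mulr0 addr0. Qed.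

Lemma phase2pi r : phase r (2 * pi) = 2 * pi. Proof. by rewrite /phase h2pi; ring. Qed.

Lemma phase_mono r t t' : 0 <= r -> r <= 1 -> t <= t' -> phase r t <= phase r t'.
Proof.
move=> r0 r1 tt'; have := hm tt' => hh; rewrite -subr_ge0.
have -> : phase r t' - phase r t = (1 - r) * (t' - t) + r * (h t' - h t) by rewrite /phase; ring.
by apply: addr_ge0; apply: mulr_ge0 => //; lra.
Qed.

Lemma phase_inj r t t' : 0 <= r -> r < 1 -> t < t' -> phase r t < phase r t'.
Proof.
move=> r0 r1 tt'; have := hm (ltW tt') => hh; rewrite -subr_gt0.
have -> : phase r t' - phase r t = (1 - r) * (t' - t) + r * (h t' - h t) by rewrite /phase; ring.
by apply: ltr_pwDl; [apply: mulr_gt0; lra|apply: mulr_ge0 => //; lra].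
Qed.

Lemma phase1 t : phase 1 t = h t. Proof. by rewrite /phase; ring. Qed.

Lemma phase_cont r : continuous (phase r).
Proof.
move=> t; apply: cvgD; apply: cvgM; try exact: cvg_cst; first exact: cvg_id.
exact: hc.
Qed.

Lemma sq_polar r t : sq (polar_pt r t) = r ^+ 2.
Proof.
rewrite /polar_pt sq_mix; have := cexp_circle (phase r t); rewrite circleE => ->.
have := cexp_circle (phase r t); rewrite /circle /= /sq /dsq /= !sub0r !sqrrN => ->.
by rewrite expr0n /=; ring.
Qed.

Lemma polar_inj r t r' t' : 0 <= r -> 0 <= r' -> polar_pt r t = polar_pt r' t' ->
  r = r' /\ (r = 0 \/ cexp (phase r t) = cexp (phase r' t') :> plane).
Proof.
move=> r0 r'0 e; have rr' : r = r'.
  by apply/eqP; rewrite -(@eqrXn2 _ 2)// -(sq_polar r t) -(sq_polar r' t') e.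
split=> //; have [|rn] := eqVneq r 0; [by left|right].
have e1 : (1 - r) * 0 + r * cos (phase r t) = (1 - r') * 0 + r' * cos (phase r' t') := congr1 fst e.
have e2 : (1 - r) * 0 + r * sin (phase r t) = (1 - r') * 0 + r' * sin (phase r' t') := congr1 snd e.
move: e1 e2; rewrite !mulr0 !add0r -rr' => /(mulfI rn) e1 /(mulfI rn) e2.
by apply: plane_eq => /=; rewrite -?rr'.
Qed.

Lemma polar_disk r t : 0 <= r -> r <= 1 -> disk (polar_pt r t).
Proof. by move=> r0 r1; rewrite diskE sq_polar expr_le1. Qed.

Lemma polar_circle t : circle (polar_pt 1 t).
Proof. by rewrite circleE sq_polar expr1n. Qed.

Lemma polar_onto p : disk p ->
  exists r t, [/\ 0 <= r <= 1, 0 <= t <= 2 * pi & p = polar_pt r t].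
Proof.
rewrite diskE => dp; have pi0 := pi_gt0 R.
have sq0 : 0 <= sq p by rewrite addr_ge0 ?sqr_ge0.
pose r := Num.sqrt (sq p); have r0 : 0 <= r by exact: sqrtr_ge0.
have rE : r ^+ 2 = sq p by rewrite sqr_sqrtr.
have r1 : r <= 1 by rewrite -sqrtr1 ler_wsqrtr.
have [r00|rn] := eqVneq r 0.
  exists 0, 0; rewrite !lexx ler01; split=> //; first by lra.
  rewrite /polar_pt mix0; apply/eqP; rewrite -dsq_eq0.
  by rewrite /dsq !subr0 -/(sq p) -rE r00 expr0n.
pose u : plane := ((p.1 : R) / r, (p.2 : R) / r).
have cu : circle u.
  rewrite circleE /sq /= !expr_div_n -mulrDl -/(sq p) -rE divff//.
  by rewrite expf_eq0.
have [th [th0 th1 uE]] := cexp_surj 0 cu.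
have [t] : exists2 t, t \in `[0, 2 * pi] & phase r t = th.
  apply: IVT; first by lra.
    exact/continuous_subspaceT/phase_cont.
  rewrite phase0 phase2pi; case: (leP 0 (2 * pi)) => hh; apply/andP; split; lra.
rewrite in_itv /= => tI te.
exists r, t; split=> //; first by rewrite r0.
by rewrite /polar_pt te -uE; apply: plane_eq => /=; field.
Qed.

Lemma polar_cont : continuous (fun k : plane => polar_pt k.1 k.2).
Proof.
move=> k; have c0 : (fun k : plane => k) @ k --> k by exact: cvg_id.
have c1 := cvg_coord1 c0; have c2 := cvg_coord2 c0.
have c3 : (fun k : plane => h k.2) @ k --> h k.2 by apply: cvg_comp c2 _; exact: hc.
apply: cvg_mix; [exact: c1|exact: cvg_cst|].
apply: cvg_cexp; apply: cvgD; apply: cvgM; [|exact: c2|exact: c1|exact: c3].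
by apply: cvgB; [exact: cvg_cst|exact: c1].
Qed.

End PolarMap.

(** * The chart of a disk *)

Section Chart.
Context {R : realType}.
Local Notation plane := (plane R).
Variables (Z : set plane) (rho : plane -> plane -> Prop).
Hypothesis Zc : Z `<=` circle.
Hypothesis Zf : finite_set Z.
Hypothesis eqv : equivalence_on Z rho.
Hypothesis nc : noncrossing rho.
Variable c : plane.
Hypothesis oc : off Z rho c.
Hypothesis odc : open_disk c.

Local Notation reg := (class_region rho).
Local Notation cpi := (cpi Z rho).

Let rZ x y : rho x y -> Z x /\ Z y. Proof. by have [H _ _ _] := eqv; exact: H. Qed.
Let rxx x : Z x -> rho x x. Proof. by have [_ H _ _] := eqv; exact: H. Qed.
Let rC x y : rho x y -> rho y x. Proof. by have [_ _ H _] := eqv; exact: H. Qed.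
Let rT x y z : rho x y -> rho y z -> rho x z.
Proof. by have [_ _ _ H] := eqv; exact: H. Qed.

Section Equiv.
Variable s : seq (plane * plane).
Hypothesis sP : [set e : plane * plane | rho e.1 e.2 /\ e.1 <> e.2] = [set` s].
Variable h : R -> R.
Hypothesis hc : continuous h.
Hypothesis h0 : h 0 = 0.
Hypothesis hp : forall t, h (t + 2 * pi) = h t + 2 * pi.
Hypothesis hm : forall s t, s <= t -> h s <= h t.
Hypothesis hf : forall u t, u < t ->
  (h u = h t <-> forall x, u < x < t -> inside c s (cexp x) = 0).

Local Notation ray := (rayto c s).
Local Notation inside := (inside c s).
Local Notation f t := (inside (cexp t)).
Local Notation polar := (polar_pt h).
Local Notation phase := (phase h).

Let r1c t : f t = 0 -> exists w, [/\ Z w,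
  exists a b, [/\ rho w a, rho w b & a <> b] & reg w (ray 1 t)].
Proof.
move=> ft; have ft' : f t <= 0 by rewrite ft.
have [e [r n rt]] := ray1_reg Zc eqv oc odc sP ft'.
have [Ze _] := rZ r; exists e.1; split=> //; exists e.1, e.2; split=> //; exact: rxx.
Qed.

Let fge t : ~ 0 < f t -> f t = 0.
Proof. by move=> n; apply/eqP; rewrite eq_le inside_ge0 andbT leNgt; apply/negP. Qed.

Let f_cont t t' : t < t' -> (forall x, t < x < t' -> f x = 0) -> f t = 0.
Proof.
move=> tt' H; apply: fge => ft.
have /nbhs_ballP[e /= e0 He] : nbhs t [set y | 0 < f y].
  by apply: open_nbhs_nbhs; split=> //; apply: open_gt0; exact: inside_cexp_cont.
have [y [hy1 hy2]] : exists y, t < y < t' /\ `|t - y| < e.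
  exists (Num.min (t + e / 2) ((t + t') / 2)).
  by case: (leP (t + e / 2)) => k; (split; [apply/andP; split; lra|rewrite ltr_norml; apply/andP; split; lra]).
by have := He y hy2; rewrite /= H// ltxx.
Qed.

Let chain t t' : t < t' -> (forall x, t < x < t' -> f x = 0) -> cpi (ray 1 t) = cpi (ray 1 t').
Proof.
move=> tt' H; have [w [Zw _ wt]] := r1c (f_cont tt' H).
have wt' := ray1_const Zc Zf eqv nc oc odc sP tt' H Zw wt.
by apply: (cpi_reg Zw) => //; apply: (ray_disk Zc eqv oc odc sP).
Qed.

Let chain_h t t' : t <= t' -> h t = h t' -> cpi (ray 1 t) = cpi (ray 1 t').
Proof.
by rewrite le_eqVlt => /orP[/eqP->//|tt'] /(hf tt')/(chain tt').
Qed.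

Let ray_period r t : ray r (t + 2 * pi) = ray r t.
Proof. by rewrite /rayto cexpD2pi. Qed.

Let polar_eq r t t' : cexp (phase r t) = cexp (phase r t') :> plane -> polar r t = polar r t'.
Proof. by rewrite /polar_pt => ->. Qed.

(** Both maps identify all angles at the centre, the two ends of the period, and, for [r = 1], the
    intervals on which [h] is constant. By [region_arc], two ray ends in one region bound an arc
    outside the piece, directly or across the cut at 0. *)
Lemma ray_polar r t r' t' : 0 <= r <= 1 -> 0 <= r' <= 1 -> 0 <= t <= 2 * pi ->
  0 <= t' <= 2 * pi -> (cpi (ray r t) = cpi (ray r' t') <-> polar r t = polar r' t').
Proof.
have pi0 := pi_gt0 R.
wlog tt' : r t r' t' / t <= t'.
  move=> W k1 k2 k3 k4; have [l|/ltW l] := leP t t'; first exact: W.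
  by have [a b] := W r' t' r t l k2 k1 k4 k3; split=> /esym; [move/a|move/b].
move=> /andP[r0 r1] /andP[r'0 r'1] tI t'I.
have dr := ray_disk Zc eqv oc odc sP.
have same : ray r t = ray r' t' -> polar r t = polar r' t'.
  move=> e; have [rr' [r00|ct]] := ray_inj Zc eqv oc odc sP r0 r1 r'0 r'1 tI t'I e.
    by rewrite -rr' r00 /polar_pt !mix0.
  rewrite -rr'; apply: polar_eq.
  move: tt'; rewrite le_eqVlt => /orP[/eqP->//|tt'].
  move/andP: tI => [t0 _]; move/andP: t'I => [_ t'2].
  have [-> ->] := cexp_eq_period t0 tt' t'2 ct.
  by rewrite phase0// phase2pi// -[2 * pi]add0r cexpD2pi.
split.
- move=> /(cpi_eq Zc Zf eqv nc (dr _ _ r0 r1) (dr _ _ r'0 r'1))[//|[w [Zw wt wt']]].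
  have rE : r = 1 by exact: (ray_reg Zc Zf eqv oc odc sP) wt.
  have r'E : r' = 1 by exact: (ray_reg Zc Zf eqv oc odc sP) wt'.
  rewrite rE r'E in wt wt' same *.
  have [ft|/fge ft] := pselect (0 < f t).
    have e := ray_reg_single Zc eqv oc sP ft Zw wt.
    by apply: same; move: wt'; rewrite e => ->.
  have [ft'|/fge ft'] := pselect (0 < f t').
    have e := ray_reg_single Zc eqv oc sP ft' Zw wt'.
    by apply: same; move: wt; rewrite e => ->.
  move: tt'; rewrite le_eqVlt => /orP[/eqP->//|tt'].
  move/andP: tI => [t0 t2]; move/andP: t'I => [t'0 t'2].
  have [w' [Zw' ab w't]] := r1c ft.
  have {}ab : exists a b, [/\ rho w a, rho w b & a <> b].
    have rww := reg_disjoint Zc Zf eqv nc Zw Zw' wt w't.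
    by have [a [b [ra rb n]]] := ab; exists a, b; split=> //; exact: rT rww _.
  apply: polar_eq; rewrite !phase1.
  have [H|H] := region_arc Zc Zf eqv oc sP t0 tt' t'2 Zw ab wt wt'.
    by rewrite ((hf tt').2 H).
  have -> : h t = 0.
    move: t0; rewrite le_eqVlt => /orP[/eqP<-//|t0]; rewrite -h0; apply/esym/(hf t0) => x /andP[x0 xt].
    by apply: H; [exact: ltW|left|lra].
  have -> : h t' = 2 * pi.
    rewrite -(h2pi h0 hp); move: t'2; rewrite le_eqVlt => /orP[/eqP->//|t'2].
    by apply/(hf t'2) => x /andP[xt x2]; apply: H; [lra|right|].
  by rewrite -[2 * pi]add0r cexpD2pi.
- move=> /(polar_inj r0 r'0)[<-] {r' r'0 r'1 same} [->|ph].
    by rewrite /rayto !mul0r !mix0.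
  move: tt'; rewrite le_eqVlt => /orP[/eqP->//|tt'].
  move/andP: tI => [t0 t2]; move/andP: t'I => [t'0 t'2].
  have := phase_mono hm r0 r1 (ltW tt'); rewrite le_eqVlt => /orP[/eqP e|lt].
    have rE : r = 1.
      apply/eqP; rewrite eq_le r1 leNgt; apply/negP => rl.
      by have := phase_inj hm r0 rl tt'; rewrite e ltxx.
    by move: e; rewrite rE !phase1; apply: chain_h; exact: ltW.
  have q0 : 0 <= phase r t by rewrite -(phase0 h0 r); exact: phase_mono.
  have q2 : phase r t' <= 2 * pi by rewrite -(phase2pi h0 hp r); exact: phase_mono.
  have [e0 e2] := cexp_eq_period q0 lt q2 ph.
  have rE0 : ray r 0 = ray r (2 * pi) by rewrite -[2 * pi]add0r ray_period.
  move: r1; rewrite le_eqVlt => /orP[/eqP rE|r1].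
    rewrite rE !phase1 in e0 e2 rE0 *.
    have c0 : cpi (ray 1 0) = cpi (ray 1 t) by apply: chain_h; rewrite ?h0 ?e0.
    have c2 : cpi (ray 1 t') = cpi (ray 1 (2 * pi)) by apply: chain_h; rewrite ?(h2pi h0 hp).
    by rewrite -c0 c2 rE0.
  have -> : t = 0.
    apply/eqP; rewrite eq_le t0 andbT leNgt; apply/negP => l.
    by have := phase_inj hm r0 r1 l; rewrite (phase0 h0) e0 ltxx.
  suff -> : t' = 2 * pi by rewrite rE0.
  apply/eqP; rewrite eq_le t'2 leNgt; apply/negP => l.
  by have := phase_inj hm r0 r1 l; rewrite (phase2pi h0 hp) e2 ltxx.
Qed.

End Equiv.

(* Both the closed piece, with its sides collapsed, and the disk are polar quotients of the
   rectangle [0, 1] x [0, 2 pi]; h turns along the boundary with speed proportional to the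
   function [inside], which vanishes exactly on the arcs outside the piece. *)
Lemma disk_chart : exists (g : cactus Z rho -> plane) (h : R -> R),
  [/\ homeo_on (cpi @` cpiece rho c) disk g,
      g @` disk_boundary (cpi @` cpiece rho c) = circle,
      continuous h, forall t, h (t + 2 * pi) = h t + 2 * pi &
    [/\ forall u t, u <= t -> h u <= h t,
        forall u t, u < t -> (h u = h t <-> forall x, u < x < t ->
          ~ forall w w', rho w w' -> w <> w' -> 0 < area w w' c * area w w' (cexp x)) &
        forall t, cpiece rho c (cexp t) -> g (cpi (cexp t)) = cexp (h t)]].
Proof.
have pi0 := pi_gt0 R.
have /finite_seqP[s sP] := pairs_finite Zf eqv.
have ic := inside_cexp_cont (c := c) (s := s).
have [h [hc h0 hp hm hf]] := angle_map ic (fun t => inside_ge0 _ _ _)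
  (fun t => congr1 (inside c s) (cexpD2pi t)) (exists_inside Zc Zf eqv nc oc odc sP).
pose K : set plane := [set` `[(0 : R), 1]] `*` [set` `[(0 : R), 2 * pi]].
have KE (k : plane) : K k <-> 0 <= (k.1 : R) <= 1 /\ 0 <= (k.2 : R) <= 2 * pi.
  by rewrite /K; split=> -[] /=; rewrite !in_itv/=.
have Kc : compact K by apply: compact_setX; exact: segment_compact.
pose a (k : plane) : plane := rayto c s k.1 k.2.
pose b (k : plane) : plane := polar_pt h k.1 k.2.
have ac : continuous a by exact: (ray_cont Zc eqv oc sP).
have bc : continuous b by exact: polar_cont.
have ad k : K k -> disk (a k).
  by move=> /KE[/andP[k1 k2] _]; exact: (ray_disk Zc eqv oc odc sP).
have aK : a @` K = cpiece rho c.
  apply/seteqP; split=> q.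
    by move=> [k /KE[/andP[k1 k2] _] <-]; exact: (ray_cpiece Zc eqv oc odc sP).
  move=> /(ray_onto Zc eqv oc odc sP)[r [t [rI tI qE]]].
  by exists (r, t); [exact/KE|rewrite qE].
have bK : b @` K = disk.
  apply/seteqP; split=> q.
    by move=> [k /KE[/andP[k1 k2] _] <-]; exact: polar_disk.
  move=> /(polar_onto hc h0 hp)[r [t [rI tI qE]]].
  by exists (r, t); [exact/KE|rewrite qE].
have sub F : closed F -> compact (K `&` F).
  move=> cF; apply: (subclosed_compact _ Kc) => [|k []//].
  by apply: closedI => //; apply: compact_closed => //; exact: norm_hausdorff.
have Pa : (cpi \o a) @` K = cpi @` cpiece rho c by rewrite -image_comp aK.
have [||||g [gh gP]] := @quotient_homeo _ _ _ K (cpi \o a) b.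
- by exists (0, 0); apply/KE; rewrite /= !lexx ler01; split=> //; lra.
- move=> F cF; rewrite -image_comp; apply: cpi_closed => //.
    by move=> _ [k [Kk _] <-]; exact: ad.
  apply: compact_closed; first exact: norm_hausdorff.
  apply: continuous_compact; first exact: continuous_subspaceT.
  by apply: sub; apply: closed_comp => // k _; exact: bc.
- move=> F /closed_cactus[G cG FG].
  have -> : K `&` (cpi \o a) @^-1` F = K `&` a @^-1` G.
    by apply/seteqP; split=> k [Kk Fk]; split=> //; apply/(FG _ (ad _ Kk)).
  apply: compact_closed; first exact: norm_hausdorff.
  apply: continuous_compact; first exact: continuous_subspaceT.
  by apply: sub; apply: closed_comp => // k _; exact: ac.
- by move=> k k' /KE[k1 k2] /KE[k'1 k'2]; exact: ray_polar.
rewrite Pa bK in gh; exists g, h.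
have gcirc t : cpiece rho c (cexp t) -> g (cpi (cexp t)) = cexp (h t).
  apply: (@period_ind R 0 (fun t => cpiece rho c (cexp t) -> g (cpi (cexp t)) = cexp (h t))).
    by move=> u; rewrite cexpD2pi hp cexpD2pi.
  move=> u u0; rewrite add0r => u2 cu.
  have Ku : K (1, u) by apply/KE; rewrite /= ler01 lexx u0 ltW.
  have := gP _ Ku; rewrite /= /a /b /= (ray1_cpiece Zc eqv oc sP)// => ->.
  by rewrite /polar_pt mix1 phase1.
split=> //.
- rewrite disk_boundaryE; apply/seteqP; split=> p.
    move=> [_ [[q cq <-] [u cu e]] <-].
    move: cq; rewrite -aK => -[k Kk kE]; have := gP _ Kk; rewrite /= kE => ->.
    have [kI tI] := (KE _).1 Kk; move/andP: kI => [k0 k1].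
    suff e1 : k.1 = 1 by rewrite /b e1; exact: polar_circle.
    move: e; rewrite -kE; have := cpi_eq Zc Zf eqv nc (circle_disk cu) (ad _ Kk).
    move=> /[apply] -[uE|[w [Zw _ wa]]]; last exact: (ray_reg Zc Zf eqv oc odc sP k0 k1 Zw wa).
    apply/eqP; rewrite eq_le k1 leNgt; apply/negP => kl.
    have [_ /odisk_ncircle] := ray_piece Zc eqv oc odc sP k.2 k0 kl.
    by rewrite -/(a k) -uE.
  move=> cp; have : disk p by exact: circle_disk.
  rewrite -bK => -[k Kk kE]; have [kI tI] := (KE _).1 Kk; move/andP: (kI) => [k0 k1].
  have e1 : k.1 = 1.
    move: cp; rewrite -kE circleE sq_polar => /eqP; rewrite sqrp_eq1// => /eqP//.
  exists (cpi (a k)); last by rewrite (gP _ Kk).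
  split; first by exists (a k) => //; rewrite -aK; exists k.
  have [fk|fk] := pselect (0 < inside c s (cexp k.2)).
    exists (cexp k.2); first exact: cexp_circle.
    by rewrite /a e1 (reach1 Zc eqv oc sP)// mix1.
  have fk' : inside c s (cexp k.2) <= 0 by rewrite leNgt; apply/negP.
  have [e [r n rk]] := ray1_reg Zc eqv oc odc sP fk'; have [Ze _] := rZ r.
  exists e.1; first exact: Zc.
  apply: (cpi_reg Ze); [exact/circle_disk/Zc|exact: ad|exact: (reg_self eqv)|by rewrite /a e1].
- split=> // u t ut; rewrite hf//; split=> H x xI.
    move=> H'; have := H x xI; move/eqP; rewrite gt_eqF//.
    apply/inside_gt0 => e es; have [r n] : rho e.1 e.2 /\ e.1 <> e.2.
      by have : [set` s] e by []; rewrite -sP.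
    exact: H'.
  apply/eqP; rewrite eq_le inside_ge0 andbT leNgt; apply/negP => /inside_gt0 H'.
  apply: (H x xI) => w w' r n; apply: (H' (w, w')).
  have : [set` s] (w, w') by rewrite -sP.
  by [].
Qed.

End Chart.

(** * The points of Zinfty *)

Section Lift.
Context {R : realType}.
Local Notation plane := (plane R).

Lemma cexp_lift (s t : R) : cexp s = cexp t :> plane -> exists m : int, s = t + 2 * pi * m%:~R.
Proof.
apply: (@period_ind R t (fun s => cexp s = cexp t :> plane -> exists m : int, s = t + 2 * pi * m%:~R)).
  move=> u; rewrite cexpD2pi; split=> H /H[m e].
    by exists (m + 1); rewrite e intrD; ring.
  by exists (m - 1); rewrite intrB; lra.
move=> u tu u2 e; exists 0; rewrite mulr0 addr0; apply: (@cexp_inj R t) => //.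
by rewrite ltrDl mulr_gt0// pi_gt0.
Qed.

Lemma cexp_shift (t : R) (m : int) : cexp (t + 2 * pi * m%:~R) = cexp t :> plane.
Proof.
have nat u n : cexp (u + 2 * pi * n%:R) = cexp u :> plane.
  elim: n => [|n IH]; first by rewrite mulr0 addr0.
  by rewrite -[RHS]IH -[RHS]cexpD2pi -[n.+1%:R]natr1; congr cexp; ring.
case: m => n; first exact: nat.
by rewrite NegzE mulrNz -[LHS](nat _ n.+1); congr cexp; rewrite pmulrn; ring.
Qed.

Lemma consecutive_shift (Y : set plane) a b (m : int) : consecutive Y a b ->
  consecutive Y (a + 2 * pi * m%:~R) (b + 2 * pi * m%:~R).
Proof.
move=> [ab Ya Yb H]; split; rewrite ?cexp_shift//; first by rewrite ltrD2r.
move=> x /andP[x1 x2] Yx; apply: (H (x + 2 * pi * (- m)%:~R)); last by rewrite cexp_shift.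
by rewrite mulrNz; apply/andP; split; lra.
Qed.

Lemma consecutive_le (Y : set plane) a b : consecutive Y a b -> b <= a + 2 * pi.
Proof.
move=> [ab Ya Yb H]; rewrite leNgt; apply/negP => h.
apply: (H (a + 2 * pi)); last by rewrite cexpD2pi.
by rewrite ltrDl mulr_gt0// pi_gt0.
Qed.

Lemma consecutive_eq (Y : set plane) a b a' b' t : consecutive Y a b -> consecutive Y a' b' ->
  a < t < b -> a' < t < b' -> a = a' /\ b = b'.
Proof.
move=> [ab Ya Yb H] [ab' Ya' Yb' H'] /andP[at_ tb] /andP[a't tb'].
split; apply/eqP; rewrite eq_le !leNgt; apply/andP; split; apply/negP => h.
- by apply: (H' a) => //; rewrite h (lt_trans at_).
- by apply: (H a') => //; rewrite h (lt_trans a't).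
- by apply: (H b') => //; rewrite h (lt_trans at_).
- by apply: (H' b) => //; rewrite h (lt_trans a't).
Qed.

Lemma prev_lift (Z : set plane) (t : R) : Z `<=` circle -> finite_set Z -> Z !=set0 ->
  exists a, [/\ a < t, Z (cexp a) & forall x, a < x < t -> ~ Z (cexp x)].
Proof.
move=> Zc Zf Z0; have pi0 := pi_gt0 R.
have ex u : exists k : R, circle u -> [/\ t - 2 * pi <= k, k < t & u = cexp k].
  have [cu|ncu] := pselect (circle u); last by exists 0.
  have [k [k1 k2 k3]] := cexp_surj (t - 2 * pi) cu; exists k => _; split=> //.
  by move: k2; rewrite subrK.
have [K KP] := choice ex.
have [a Za amax] := finite_argmin (fun u => - K u) Zf Z0.
have [a1 a2 aE] := KP _ (Zc _ Za); exists (K a); split=> //; first by rewrite -aE.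
move=> x /andP[x1 x2] Zx; have [x3 x4 xE] := KP _ (Zc _ Zx).
have e : x = K (cexp x).
  by apply: (@cexp_inj R (t - 2 * pi)); rewrite ?subrK//; lra.
by have := amax _ Zx; rewrite lerN2 -e leNgt x1.
Qed.

Lemma next_lift (Z : set plane) (t : R) : Z `<=` circle -> finite_set Z -> Z !=set0 ->
  exists b, [/\ t < b, Z (cexp b) & forall x, t < x < b -> ~ Z (cexp x)].
Proof.
move=> Zc Zf Z0; have pi0 := pi_gt0 R.
(* Conjugation reverses angles and turns the next lift into the previous one. *)
pose cj (u : plane) : plane := (u.1, - (u.2 : R)).
have cjK u : cj (cj u) = u by apply: plane_eq; rewrite /= ?opprK.
have cjE x : cj (cexp x) = cexp (- x) by rewrite /cj /cexp /= cosN sinN.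
have := @prev_lift (cj @` Z) (- t) _ (finite_image _ Zf) _.
case=> [||a [a1 [u Zu ua] a3]].
- by move=> _ [u /Zc cu <-]; move: cu; rewrite /circle /= sqrrN.
- by have [z Zz] := Z0; exists (cj z), z.
exists (- a); split; first by lra.
  by rewrite -cjE -ua cjK.
move=> x /andP[x1 x2] Zx; apply: (a3 (- x)); first by apply/andP; split; lra.
by exists (cexp x) => //; exact: cjE.
Qed.

End Lift.

(** * Order and successors of the inserted points *)

Section Zinfty.
Context {R : realType}.
Local Notation plane := (plane R).
Implicit Types (a b t : R) (n m : int).

Definition zpt a b n : R := (b + a) / 2 + (b - a) / pi * atan n%:~R.

Lemma zpt_in a b n : a < b -> a < zpt a b n < b.
Proof.
move=> ab; have pi0 := pi_gt0 R; have h1 := atan_gtNpi2 (n%:~R : R); have h2 := atan_ltpi2 (n%:~R : R).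
have k0 : 0 < (b - a) / pi by rewrite divr_gt0// subr_gt0.
have e : (b - a) / pi * (pi / 2) = (b - a) / 2 by rewrite mulrA divfK// gt_eqF.
have := ltr_pM2l k0 (- (pi / 2)) (atan n%:~R); rewrite h1 mulrN e => l1.
have := ltr_pM2l k0 (atan n%:~R) (pi / 2); rewrite h2 e => l2.
by rewrite /zpt; apply/andP; split; lra.
Qed.

Lemma zpt_mono a b n m : a < b -> (zpt a b n < zpt a b m) = (n < m)%R.
Proof.
move=> ab; have k0 : 0 < (b - a) / pi by rewrite divr_gt0 ?pi_gt0// subr_gt0.
rewrite /zpt ltrD2l ltr_pM2l//; apply/idP/idP => [|h]; last by apply: lt_atan; rewrite ltr_int.
by rewrite !ltNge; apply: contra => h; apply: le_atan; rewrite ler_int.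
Qed.

(** Solve for the argument of [atan] and round it down. *)
Lemma zpt_between a b t : a < t < b -> exists n, zpt a b n <= t < zpt a b (n + 1).
Proof.
move=> /andP[at_ tb]; have pi0 := pi_gt0 R.
pose s := (t - (b + a) / 2) * pi / (b - a).
have d0 : 0 < b - a by lra.
have sE : s * (b - a) = (t - (b + a) / 2) * pi by rewrite /s divfK// gt_eqF.
have s1 : - (pi / 2) < s.
  by rewrite -(ltr_pM2r d0) sE; nra.
have s2 : s < pi / 2.
  by rewrite -(ltr_pM2r d0) sE; nra.
have sK : atan (tan s) = s by apply: tanK; rewrite in_itv /= s1 s2.
have tE : t = (b + a) / 2 + (b - a) / pi * s.
  by rewrite mulrAC [(b - a) * s]mulrC sE mulfK ?gt_eqF//; ring.
have k0 : 0 < (b - a) / pi by rewrite divr_gt0.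
exists (Num.floor (tan s)); have /andP[f1 f2] := floor_itv (tan s).
have l1 : atan (Num.floor (tan s))%:~R <= s by rewrite -[leRHS]sK; exact: le_atan.
have l2 : s < atan (Num.floor (tan s) + 1)%:~R by rewrite -[ltLHS]sK; exact: lt_atan.
by rewrite {1}tE [ltLHS]tE /zpt lerD2l ltrD2l ler_pM2l// ltr_pM2l// l1.
Qed.

Lemma cvg_zpt a b : a < b -> forall e, 0 < e -> exists N : nat, forall n : nat, (N <= n)%N ->
  zpt a b (- n%:Z) < a + e /\ b - e < zpt a b n%:Z.
Proof.
move=> ab e e0.
have lo t : a < t -> t < b -> exists N : nat, forall n : nat, (N <= n)%N -> zpt a b (- n%:Z) < t.
  move=> at_ tb; have [|m /andP[m1 m2]] := @zpt_between a b t; first by rewrite at_.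
  exists `|m|.+1 => n Nn; apply: lt_le_trans m1; rewrite zpt_mono//; lia.
have hi t : a < t -> t < b -> exists N : nat, forall n : nat, (N <= n)%N -> t < zpt a b n%:Z.
  move=> at_ tb; have [|m /andP[m1 m2]] := @zpt_between a b t; first by rewrite at_.
  exists `|m|.+2 => n Nn; apply: lt_trans m2 _; rewrite zpt_mono//; lia.
pose d := Num.min e ((b - a) / 2).
have d0 : 0 < d by rewrite lt_min e0 /= divr_gt0// subr_gt0.
have de : d <= e by rewrite ge_min lexx.
have db : d <= (b - a) / 2 by rewrite ge_min lexx orbT.
have [||N1 H1] := lo (a + d); [lra|lra|].
have [||N2 H2] := hi (b - d); [lra|lra|].
exists (maxn N1 N2) => n; rewrite geq_max => /andP[/H1 h1 /H2 h2]; split; lra.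
Qed.

Variable Z : set plane.
Hypothesis Zc : Z `<=` circle.
Hypothesis Zf : finite_set Z.
Hypothesis Z0 : Z !=set0.

Local Notation Y := (Zinfty Z).

Lemma Zinfty_zpt a b n : consecutive Z a b -> Y (cexp (zpt a b n)).
Proof. by move=> ab; exists a, b, n. Qed.

Lemma Zarc t : ~ Z (cexp t) -> exists a b, consecutive Z a b /\ a < t < b.
Proof.
move=> nt; have [a [a1 a2 a3]] := prev_lift t Zc Zf Z0; have [b [b1 b2 b3]] := next_lift t Zc Zf Z0.
exists a, b; split; last by rewrite a1.
split=> //; first exact: lt_trans b1.
move=> x /andP[x1 x2]; have [xt|xt|->//] := ltgtP x t.
  by apply: a3; rewrite x1.
by apply: b3; rewrite xt.
Qed.

Lemma Zinfty_lift a b t : consecutive Z a b -> a < t < b -> Y (cexp t) -> exists n, t = zpt a b n.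
Proof.
move=> ab tab [a' [b' [n [ab' /cexp_lift[m tE]]]]].
rewrite -/(zpt a' b' n) in tE.
have sh := consecutive_shift m ab'.
have /andP[h1 h2] := zpt_in n (let: And4 h _ _ _ := ab' in h).
have tI : a' + 2 * pi * m%:~R < t < b' + 2 * pi * m%:~R by rewrite tE !ltrD2r h1.
have [-> ->] := consecutive_eq ab sh tab tI.
exists n; rewrite tE /zpt; move: (2 * pi * m%:~R) => k.
have -> : b' + k - (a' + k) = b' - a' by ring.
by lra.
Qed.

Lemma Zinfty_arc t : Y (cexp t) -> exists a b n, [/\ consecutive Z a b, a < t < b & t = zpt a b n].
Proof.
move=> Yt; have [a' [b' [n [ab' /cexp_lift[m tE]]]]] := Yt.
rewrite -/(zpt a' b' n) in tE.
have sh := consecutive_shift m ab'.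
have /andP[h1 h2] := zpt_in n (let: And4 h _ _ _ := ab' in h).
have tI : a' + 2 * pi * m%:~R < t < b' + 2 * pi * m%:~R by rewrite tE !ltrD2r h1.
by have [k tk] := Zinfty_lift sh tI Yt; exists (a' + 2 * pi * m%:~R), (b' + 2 * pi * m%:~R), k.
Qed.

Lemma Zinfty_circle : Y `<=` circle.
Proof. by move=> x [a [b [n [_ ->]]]]; exact: cexp_circle. Qed.

Lemma Zinfty_notZ x : Y x -> ~ Z x.
Proof.
move=> [a [b [n [[ab _ _ H] ->]]]]; apply: H.
exact: (zpt_in n ab).
Qed.

Lemma Zinfty_consecutive a b n : consecutive Z a b ->
  consecutive Y (zpt a b n) (zpt a b (n + 1)).
Proof.
move=> abc; have [ab _ _ _] := abc; split.
- by rewrite zpt_mono// ltrDl.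
- exact: Zinfty_zpt.
- exact: Zinfty_zpt.
move=> c /andP[c1 c2] Yc.
have /andP[p1 _] := zpt_in n ab; have /andP[_ p2] := zpt_in (n + 1) ab.
have [|m cE] := Zinfty_lift abc _ Yc; first by rewrite (lt_trans p1)//= (lt_trans c2).
by move: c1 c2; rewrite cE !zpt_mono//; lia.
Qed.

Lemma Zinfty_next t : Y (cexp t) -> exists2 t', consecutive Y t t' &
  forall x, t <= x <= t' -> ~ Z (cexp x).
Proof.
move=> /Zinfty_arc[a [b [n [abc /andP[at_ tb] tE]]]]; have [ab _ _ H] := abc.
exists (zpt a b (n + 1)); first by rewrite tE; exact: Zinfty_consecutive.
have /andP[_ p2] := zpt_in (n + 1) ab.
move=> x /andP[x1 x2]; apply: H.
by rewrite (lt_le_trans at_)//= (le_lt_trans x2).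
Qed.

Lemma Zinfty_prev t : Y (cexp t) -> exists2 t', consecutive Y t' t &
  forall x, t' <= x <= t -> ~ Z (cexp x).
Proof.
move=> /Zinfty_arc[a [b [n [abc /andP[at_ tb] tE]]]]; have [ab _ _ H] := abc.
exists (zpt a b (n - 1)); first by rewrite tE -{2}(subrK 1 n); exact: Zinfty_consecutive.
have /andP[p2 _] := zpt_in (n - 1) ab.
move=> x /andP[x1 x2]; apply: H.
by rewrite (lt_le_trans p2)//= (le_lt_trans x2).
Qed.

Lemma Zinfty_cover t : ~ Z (cexp t) -> exists a b, [/\ consecutive Y a b, a <= t < b &
  forall x, a <= x <= b -> ~ Z (cexp x)].
Proof.
move=> /Zarc[a [b [abc tab]]]; have [ab _ _ H] := abc.
have [n /andP[n1 n2]] := zpt_between tab.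
exists (zpt a b n), (zpt a b (n + 1)); split; [exact: Zinfty_consecutive|by rewrite n1|].
have /andP[p1 _] := zpt_in n ab; have /andP[_ p2] := zpt_in (n + 1) ab.
move=> x /andP[x1 x2]; apply: H.
by rewrite (lt_le_trans p1)//= (le_lt_trans x2).
Qed.

Lemma consecutive_infinite a b (P : set plane) : consecutive Z a b ->
  (forall n, P (cexp (zpt a b n))) -> infinite_set P.
Proof.
move=> abc HP; have [ab _ _ _] := abc; have b2 := consecutive_le abc.
have inj : injective (fun n : nat => cexp (zpt a b n%:Z) : plane).
  move=> n m e; have /andP[n1 n2] := zpt_in n%:Z ab; have /andP[m1 m2] := zpt_in m%:Z ab.
  have : zpt a b n%:Z = zpt a b m%:Z by apply: (@cexp_inj R a) => //; lra.
  move=> h; apply/eqP; rewrite eq_le; apply/andP; split.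
    by have := zpt_mono m%:Z n%:Z ab; rewrite h ltxx; lia.
  by have := zpt_mono n%:Z m%:Z ab; rewrite h ltxx; lia.
move=> fP; apply: infinite_nat.
apply: (sub_finite_set _ (finite_preimage (in2W inj) fP)) => n _; exact: HP.
Qed.

End Zinfty.

(** * Homeomorphisms of the circle *)

Section IntervalSign.
Context {R : realType}.

Lemma interval_sign (f : R -> R) (a b s t : R) :
  (forall x, a < x < b -> {for x, continuous f}) -> (forall x, a < x < b -> f x != 0) ->
  a < s < b -> a < t < b -> 0 < f s -> 0 < f t.
Proof.
move=> fc fn sI tI fs; rewrite ltNge; apply/negP => ft.
wlog st : s t f fc fn sI tI fs ft / s <= t.
  move=> W; have [l|/ltW l] := leP s t; first exact: (W s t f).
  have fc' x : a < x < b -> {for x, continuous (fun x => - f x)}.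
    by move=> xI; apply: cvgN; exact: fc.
  have fn' x : a < x < b -> - f x != 0 by move=> xI; rewrite oppr_eq0 fn.
  apply: (W t s (fun x => - f x)) => //; last by rewrite oppr_le0 ltW.
  by rewrite oppr_gt0 lt_neqAle fn.
move: sI tI => /andP[s1 s2] /andP[t1 t2].
have [x] : exists2 x, x \in `[s, t] & f x = 0.
  apply: IVT => //; last by case: (leP (f s)) => h; apply/andP; split; lra.
  apply: continuous_in_subspaceT => x /set_mem /=; rewrite in_itv /= => /andP[x1 x2].
  by apply: fc; rewrite (lt_le_trans s1)//= (le_lt_trans x2).
rewrite in_itv /= => /andP[x1 x2] fx.
have := fn x; rewrite fx eqxx (lt_le_trans s1)//= (le_lt_trans x2)// => /(_ isT).
by [].
Qed.

End IntervalSign.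

Section General.
Context {R : realType}.
Local Notation plane := (plane R).
Implicit Types (x y z p q u v w : plane).

Lemma cvg_subseq (T : topologicalType) (u : nat -> T) (l : T) (k : nat -> nat) :
  (forall n, (n <= k n)%N) -> u n @[n --> \oo] --> l -> u (k n) @[n --> \oo] --> l.
Proof.
move=> kn ul U /ul[N _ HN]; exists N => // n /= Nn; apply: HN => /=.
exact: leq_trans Nn (kn n).
Qed.

Lemma circle_subseq (x : nat -> plane) : (forall n, circle (x n)) ->
  exists (k : nat -> nat) X, [/\ forall n, (n <= k n)%N, circle X & x (k n) @[n --> \oo] --> X].
Proof.
move=> cx; have [X [cX clX]] : circle `&` cluster (x n @[n --> \oo]) !=set0.
  by apply: compact_circle; exists 0%N => // n _; exact: cx.
have /choice[k kP] : forall n : nat, exists m : nat, (n <= m)%N /\ ball X n.+1%:R^-1 (x m).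
  move=> n; pose A := [set x m | m in [set m | (n <= m)%N]].
  have xA : (x m @[m --> \oo]) A by exists n => // m nm; exists m.
  have bX : nbhs X (ball X n.+1%:R^-1) by apply: nbhsx_ballx; rewrite invr_gt0.
  by have [_ [[m /= nm <-] bm]] := clX _ _ xA bX; exists m.
exists k, X; split=> // [n|]; first by have [] := kP n.
by apply: cvg_ball_seq => n; have [] := kP n.
Qed.

(** Only [cexp m] lies strictly between, so the open half-plane beyond the chord from [cexp a] to
    [cexp b] meets [Y] in one point at most. *)
Lemma gap_not_limit (Y : set plane) (a m b t : R) : Y `<=` circle -> infinite_set Y ->
  consecutive Y a m -> consecutive Y m b -> a < t < b -> ~ limit_point Y (cexp t).
Proof.
move=> Yc Yi [am Ya Ym H1] [mb _ Yb H2] /andP[at_ tb] lp.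
have pi0 := pi_gt0 R.
have only s : a < s < b -> Y (cexp s) -> s = m.
  move=> /andP[as_ sb] Ys; have [l|l|//] := ltgtP s m.
    by exfalso; apply: (H1 s) => //; rewrite as_.
  by exfalso; apply: (H2 s) => //; rewrite l.
have ba : b < a + 2 * pi.
  rewrite ltNge; apply/negP => h; apply: Yi.
  apply: (sub_finite_set _ (finite_set2 (cexp a) (cexp m))) => u Yu.
  have [k [k1 k2 uE]] := cexp_surj a (Yc _ Yu); subst u.
  move: k1; rewrite le_eqVlt => /orP[/eqP<-|k1]; first by left.
  by right; congr cexp; apply: only => //; rewrite k1 (lt_le_trans k2).
have ha : a <= a < a + 2 * pi by rewrite lexx ltrDl mulr_gt0.
have hb : a <= b < a + 2 * pi by rewrite ba andbT; lra.
have nb : nbhs (cexp t : plane) [set u | 0 < area (cexp b) (cexp a) u].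
  apply: open_nbhs_nbhs; split; first by apply: open_gt0; exact: continuous_area.
  rewrite /= area_swap oppr_gt0 area_rot area_rot area_swap oppr_lt0.
  by apply: area_cexp_gt0 => //.
have uniq u : Y u -> 0 < area (cexp b) (cexp a) u -> u = cexp m.
  move=> Yu; have [k [k1 k2 uE]] := cexp_surj a (Yc _ Yu); subst u.
  rewrite area_rot; have hk : a <= k < a + 2 * pi by rewrite k1.
  rewrite area_order_base// => kb.
  by congr cexp; apply: only.
have [e|ne] := pselect (cexp t = cexp m :> plane).
  have [u [/eqP ut Yu hu]] := lp _ nb; apply: ut.
  by rewrite e; exact: uniq.
have nm : nbhs (cexp t : plane) (~` [set (cexp m : plane)]).
  by apply: open_nbhs_nbhs; split=> //; rewrite openC; apply: closed_finite; exact: finite_set1.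
have [u [_ Yu [hu hn]]] := lp _ (filterI nb nm).
by apply: hn; exact: uniq.
Qed.

Lemma sep_area (x y u v : plane) : sep x y u v <->
  (0 < area x y u /\ 0 < area y x v) \/ (0 < area y x u /\ 0 < area x y v).
Proof.
rewrite ![area y x _]area_swap !oppr_gt0; split; first by case/sep_case => -[h1 h2]; [left|right].
by case=> -[h1 h2]; rewrite /sep; [rewrite pmulr_rlt0|rewrite nmulr_rlt0].
Qed.

(* If the images of two points of different arcs between x and y were on the same side of the
   image chord, the whole image would be on one side of it. *)
Lemma circle_homeo_sep (f : plane -> plane) :
  {within circle, continuous f} -> f @` circle = circle ->
  (forall x y, circle x -> circle y -> f x = f y -> x = y) ->
  forall x y u v, circle x -> circle y -> circle u -> circle v ->
    (sep (f x) (f y) (f u) (f v) <-> sep x y u v).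
Proof.
move=> fc fs fi x y u v cx cy cu cv.
have fC z : circle z -> circle (f z) by move=> cz; rewrite -fs; exists z.
have [a [_ _ xE]] := cexp_surj 0 cx.
have [b [b0 b1 yE]] := cexp_surj a cy.
have pi0 := pi_gt0 R.
have [xy|xy] := pselect (x = y).
  by rewrite xy /sep !areaxx mul0r ltxx.
have ab : a < b by rewrite lt_neqAle b0 andbT; apply/eqP => e; apply: xy; rewrite xE yE e.
pose F t := area (f x) (f y) (f (cexp t)).
have Fc t : {for t, continuous F}.
  apply: cvg_area; [exact: cvg_cst|exact: cvg_cst|].
  have := fc; move=> /subspace_continuousP/(_ (cexp t) (cexp_circle t)) h.
  apply: cvg_comp _ h => U /=.
  move=> hU; have H : nbhs t [set s | circle (cexp s) -> U (cexp s)] := @continuous_cexp R t _ hU.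
  change (nbhs t [set s | U (cexp s)]).
  by apply: filterS H => s; apply; exact: cexp_circle.
have Fn t : (a < t < b) || (b < t < a + 2 * pi) -> F t != 0.
  move=> tI; apply: (area_circle_neq0 (fC _ cx) (fC _ cy) (fC _ (cexp_circle t))).
  + by move=> e; apply: xy; exact: fi.
  + move/(fi _ _ (cexp_circle t) cx); rewrite xE => e.
    have : t = a; last by case/orP: tI => /andP[? ?]; lra.
    by apply: (@cexp_inj R a) => //; case/orP: tI => /andP[? ?]; lra.
  + move/(fi _ _ (cexp_circle t) cy); rewrite yE => e.
    have : t = b; last by case/orP: tI => /andP[? ?]; lra.
    by apply: (@cexp_inj R a) => //; case/orP: tI => /andP[? ?]; lra.
pose up := [set t | a < t < b]; pose lo := [set t | b < t < a + 2 * pi].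
have Gc t : {for t, continuous (fun t => - F t)} by apply: cvgN; exact: Fc.
have sgn (A : set R) s t : (A = up \/ A = lo) -> A s -> A t -> 0 < F s -> 0 < F t.
  case=> -> sI tI; [apply: (@interval_sign R F a b) => //|apply: (@interval_sign R F b (a + 2 * pi)) => //].
    by move=> k kI; apply: Fn; rewrite kI.
  by move=> k kI; apply: Fn; rewrite kI orbT.
have sgnN (A : set R) s t : (A = up \/ A = lo) -> A s -> A t -> F s < 0 -> F t < 0.
  move=> hA sI tI hs; rewrite ltNge; apply/negP; rewrite le_eqVlt => /orP[/eqP e|ht].
    have := Fn t; rewrite -e eqxx; case: hA tI => -> tI.
      by rewrite tI => /(_ isT).
    by rewrite [X in _ || X]tI orbT => /(_ isT).
  by have := sgn A t s hA tI sI ht; lra.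
have cases z : circle z -> [\/ z = x, z = y | exists2 t, up t \/ lo t & z = cexp t].
  move=> cz; have [t [t1 t2 zE]] := cexp_surj a cz.
  move: t1; rewrite le_eqVlt => /orP[/eqP e|t1]; first by apply: Or31; rewrite zE -e.
  have [tb|bt|e] := ltgtP t b; last by apply: Or32; rewrite zE e.
    by apply: Or33; exists t => //; left; rewrite /up /= t1.
  by apply: Or33; exists t => //; right; rewrite /lo /= bt.
have ha : a <= a < a + 2 * pi by rewrite lexx ltrDl mulr_gt0.
have hb : a <= b < a + 2 * pi by rewrite b0.
have upA t : up t -> area x y (cexp t) < 0.
  move=> /andP[t1 t2]; rewrite xE yE area_rot area_rot area_swap oppr_lt0.
  exact: area_cexp_gt0.
have loA t : lo t -> 0 < area x y (cexp t).
  by move=> /andP[t1 t2]; rewrite xE yE; apply: area_cexp_gt0.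
have opp t t' : up t -> lo t' -> F t * F t' < 0.
  move=> ut lt; have : ~ (0 < F t /\ 0 < F t') /\ ~ (F t < 0 /\ F t' < 0).
    split=> -[h h'].
      have [q cq hq] := circle_between (fC _ cx) (fC _ cy) (fun e => xy (fi _ _ cx cy e)).
      move: cq; rewrite -fs => -[z cz zq]; subst q.
      case: (cases z cz) => [e|e|[k kI e]]; subst z.
      + by move: hq; rewrite areaxyx ltxx.
      + by move: hq; rewrite areaxyy ltxx.
      + have : 0 < F k by case: kI => kI; [apply: (sgn up t k)|apply: (sgn lo t' k)]; auto.
        by rewrite /F; lra.
    have [q cq hq] := circle_between (fC _ cy) (fC _ cx) (fun e => xy (fi _ _ cx cy (esym e))).
    move: cq; rewrite -fs => -[z cz zq]; subst q.
    case: (cases z cz) => [e|e|[k kI e]]; subst z.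
    + by move: hq; rewrite areaxyy ltxx.
    + by move: hq; rewrite areaxyx ltxx.
    + have : F k < 0 by case: kI => kI; [apply: (sgnN up t k)|apply: (sgnN lo t' k)]; auto.
      by move: hq; rewrite area_swap /F; lra.
  have n1 : F t != 0 by apply: Fn; rewrite ut.
  have n2 : F t' != 0 by apply: Fn; rewrite [X in _ || X]lt orbT.
  move: n1 n2; rewrite !neq_lt => /orP[h1|h1] /orP[h2|h2] [k1 k2].
  - by exfalso; apply: k2.
  - by rewrite nmulr_rlt0.
  - by rewrite pmulr_rlt0.
  - by exfalso; apply: k1.
have same (A : set R) t t' : (A = up \/ A = lo) -> A t -> A t' -> ~ F t * F t' < 0.
  move=> hA At At'; have := Fn t; have -> : (a < t < b) || (b < t < a + 2 * pi).
    by case: hA At => -> h; [rewrite [X in X || _]h|rewrite [X in _ || X]h orbT].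
  move=> /(_ isT); rewrite neq_lt => /orP[h|h].
    by have := sgnN A t t' hA At At' h => h'; rewrite nmulr_rlt0// ltNge ltW.
  by have := sgn A t t' hA At At' h => h'; rewrite pmulr_rlt0// ltNge ltW.
have triv z : z = x \/ z = y -> area (f x) (f y) (f z) = 0 /\ area x y z = 0.
  by move=> [->|->]; rewrite !(areaxyx, areaxyy).
rewrite /sep; case: (cases u cu) => [e|e|[t tI tE]].
- by have [-> ->] := triv u (or_introl e); rewrite !mul0r ltxx.
- by have [-> ->] := triv u (or_intror e); rewrite !mul0r ltxx.
case: (cases v cv) => [e|e|[t' t'I t'E]].
- by have [-> ->] := triv v (or_introl e); rewrite !mulr0 ltxx.
- by have [-> ->] := triv v (or_intror e); rewrite !mulr0 ltxx.
subst u v; rewrite -/(F t) -/(F t').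
case: tI t'I => tI [] t'I; split=> // h.
- by case: (same up t t' (or_introl erefl) tI t'I).
- have h1 := upA _ tI; have h2 := upA _ t'I.
  by move: h; rewrite nmulr_rlt0// ltNge ltW.
- by rewrite nmulr_rlt0; [exact: loA|exact: upA].
- exact: opp.
- by rewrite pmulr_rlt0; [exact: upA|exact: loA].
- by rewrite mulrC; exact: opp.
- by case: (same lo t t' (or_intror erefl) tI t'I).
- have h1 := loA _ tI; have h2 := loA _ t'I.
  by move: h; rewrite pmulr_rlt0// ltNge ltW.
Qed.

End General.

(** * Clusters in a disk of the cactus *)

Section PiecePoints.
Context {R : realType}.
Local Notation plane := (plane R).
Implicit Types (u v w : plane).
Variables (Z : set plane) (rho : plane -> plane -> Prop).
Hypothesis Zc : Z `<=` circle.
Hypothesis Zf : finite_set Z.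
Hypothesis Z0 : Z !=set0.
Hypothesis eqv : equivalence_on Z rho.

Let rZ x y : rho x y -> Z x /\ Z y. Proof. by have [H _ _ _] := eqv; exact: H. Qed.

(** If the chord [w w'] separated the ends of the arc, one of its own ends would be on the arc. *)
Lemma arc_same_side (t t' : R) w w' : t <= t' -> (forall x, t <= x <= t' -> ~ Z (cexp x)) ->
  Z w -> Z w' -> w <> w' -> 0 < area w w' (cexp t) * area w w' (cexp t').
Proof.
move=> tt' H Zw Zw' ww'; have pi0 := pi_gt0 R.
have nZ (s : R) : t <= s <= t' -> area w w' (cexp s) != 0.
  move=> sI; apply: (area_circle_neq0 (Zc Zw) (Zc Zw') (cexp_circle s) ww') => e;
  by apply: (H s sI); rewrite e.
have n1 : area w w' (cexp t) != 0 by apply: nZ; rewrite lexx.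
have n2 : area w w' (cexp t') != 0 by apply: nZ; rewrite lexx tt'.
move: tt'; rewrite le_eqVlt => /orP[/eqP <-|tt'].
  by rewrite -expr2 lt_neqAle sqr_ge0 andbT eq_sym sqrf_eq0.
rewrite lt_neqAle eq_sym mulf_neq0//= leNgt; apply/negP => h.
have sp : sep w w' (cexp t) (cexp t') by [].
have {}sp := sep_sym (Zc Zw) (Zc Zw') (cexp_circle t) (cexp_circle t') sp.
have bad v : Z v -> ~ 0 < area (cexp t') (cexp t) v.
  move=> Zv; have [k [k1 k2 vE]] := cexp_surj t (Zc Zv); subst v.
  rewrite area_rot; have [t2|t2] := ltP t' (t + 2 * pi).
    rewrite area_order_base ?k1 ?(ltW tt')// => /andP[_ kt].
    by apply: (H k) => //; rewrite k1 ltW.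
  by move=> _; apply: (H k) => //; rewrite k1 ltW// (lt_le_trans k2).
by have [[_ /(bad _ Zw')]|[/(bad _ Zw)]] := (sep_area _ _ _ _).1 sp.
Qed.

Variable c : plane.
Hypothesis oc : off Z rho c.

Definition inside_at (t : R) := forall w w', rho w w' -> w <> w' ->
  0 < area w w' c * area w w' (cexp t).

Lemma inside_arc t t' : t <= t' -> (forall x, t <= x <= t' -> ~ Z (cexp x)) ->
  inside_at t <-> inside_at t'.
Proof.
move=> tt' H; split=> I w w' r n; have [Zw Zw'] := rZ r;
  have h := arc_same_side tt' H Zw Zw' n; have h' := I w w' r n; have := mulr_gt0 h h'.
- have -> : area w w' (cexp t) * area w w' (cexp t') * (area w w' c * area w w' (cexp t)) =
    area w w' (cexp t) ^+ 2 * (area w w' c * area w w' (cexp t')) by ring.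
  rewrite pmulr_rgt0// exprn_even_gt0//=; apply/eqP => e.
  by move: h; rewrite e mul0r ltxx.
- have -> : area w w' (cexp t) * area w w' (cexp t') * (area w w' c * area w w' (cexp t')) =
    area w w' (cexp t') ^+ 2 * (area w w' c * area w w' (cexp t)) by ring.
  rewrite pmulr_rgt0// exprn_even_gt0//=; apply/eqP => e.
  by move: h; rewrite e mulr0 ltxx.
Qed.

Lemma piece_inside t : piece Z rho c (cexp t) <-> ~ Z (cexp t) /\ inside_at t.
Proof.
split=> [[_ nZ H]|[nZ H]]; first by split.
by split=> //; exact/circle_disk/cexp_circle.
Qed.

Definition vpts : set plane := Zinfty Z `&` piece Z rho c.

Lemma vpts_circle : vpts `<=` circle.
Proof. by move=> x [/Zinfty_circle]. Qed.

Lemma vpts_nZ x : vpts x -> ~ Z x. Proof. by move=> [_ []]. Qed.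

Lemma vpts_inside t : vpts (cexp t) -> inside_at t.
Proof. by move=> [_ /piece_inside[]]. Qed.

Lemma vpts_consecutive a b : consecutive (Zinfty Z) a b -> vpts (cexp a) -> vpts (cexp b) ->
  consecutive vpts a b.
Proof. by move=> [ab _ _ H] Va Vb; split=> // x /H nY [/nY]. Qed.

Lemma vpts_arc t t' : t <= t' -> (forall x, t <= x <= t' -> ~ Z (cexp x)) ->
  Zinfty Z (cexp t) -> Zinfty Z (cexp t') -> inside_at t \/ inside_at t' ->
  vpts (cexp t) /\ vpts (cexp t').
Proof.
move=> tt' H Yt Yt' h.
have [i i'] : inside_at t /\ inside_at t'.
  by case: h => h; split=> //; move: h => /(inside_arc tt' H).
by split; split=> //; apply/piece_inside; split=> //; exact: (Zinfty_notZ _).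
Qed.

Lemma vpts_next t : vpts (cexp t) -> exists2 t', consecutive vpts t t' &
  consecutive (Zinfty Z) t t' /\ forall x, t <= x <= t' -> ~ Z (cexp x).
Proof.
move=> Vt; have [Yt _] := Vt; have [t' ct H] := Zinfty_next Yt.
have [tt' _ Yt' _] := ct.
have [_ Vt'] := vpts_arc (ltW tt') H Yt Yt' (or_introl (vpts_inside Vt)).
by exists t' => //; exact: vpts_consecutive.
Qed.

Lemma vpts_prev t : vpts (cexp t) -> exists2 t', consecutive vpts t' t &
  consecutive (Zinfty Z) t' t /\ forall x, t' <= x <= t -> ~ Z (cexp x).
Proof.
move=> Vt; have [Yt _] := Vt; have [t' ct H] := Zinfty_prev Yt.
have [tt' Yt' _ _] := ct.
have [Vt' _] := vpts_arc (ltW tt') H Yt' Yt (or_intror (vpts_inside Vt)).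
by exists t' => //; exact: vpts_consecutive.
Qed.

Lemma vpts_cover t : piece Z rho c (cexp t) -> exists a b, [/\ consecutive vpts a b &  a <= t < b].
Proof.
move=> /piece_inside[nt it]; have [a [b [ab /andP[at_ tb] H]]] := Zinfty_cover Zc Zf Z0 nt.
have [ab' Ya Yb _] := ab.
have ia : inside_at a.
  apply/(@inside_arc a t at_) => // x /andP[x1 x2]; apply: H.
  by rewrite x1 (le_trans x2)// ltW.
have [Va Vb] := vpts_arc (ltW ab') H Ya Yb (or_introl ia).
by exists a, b; split; [exact: vpts_consecutive|rewrite at_].
Qed.

Lemma inside_zpt a b t n : consecutive Z a b -> a < t < b -> inside_at t -> vpts (cexp (zpt a b n)).
Proof.
move=> ab /andP[at_ tb] it; have [ab' _ _ H] := ab.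
have /andP[z1 z2] := zpt_in n ab'.
split; first exact: Zinfty_zpt.
apply/piece_inside; split; first by apply: H; rewrite z1.
have [h|/ltW h] := leP t (zpt a b n).
  apply/(@inside_arc t (zpt a b n) h) => // x /andP[x1 x2]; apply: H.
  by rewrite (lt_le_trans at_)//= (le_lt_trans x2).
apply/(@inside_arc (zpt a b n) t h) => // x /andP[x1 x2]; apply: H.
by rewrite (lt_le_trans z1)//= (le_lt_trans x2).
Qed.

Section Angle.
Variable h : R -> R.
Hypothesis hc : continuous h.
Hypothesis hp : forall t, h (t + 2 * pi) = h t + 2 * pi.
Hypothesis hm : forall s t, s <= t -> h s <= h t.
Hypothesis hf : forall s t, s < t -> (h s = h t <-> forall x, s < x < t -> ~ inside_at x).

(** Take the right end of the interval on which [h] has the given value: just after it [h] grows, so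
    the circle is inside the piece at points arbitrarily close. *)
Lemma last_parameter th : exists t, cexp (h t) = cexp th :> plane /\ forall x, t < x -> h t < h x.
Proof.
have pi0 := pi_gt0 R.
have [th' [l0 l1 thE]] := cexp_surj (h 0) (cexp_circle th).
have h2 : h (2 * pi) = h 0 + 2 * pi by rewrite -hp add0r.
have [t1 t1I t1E] : exists2 t1, t1 \in `[0, 2 * pi] & h t1 = th'.
  apply: IVT; first by lra.
    exact: continuous_subspaceT.
  by rewrite h2; case: (leP (h 0)) => k; apply/andP; split; lra.
pose A := [set t | t1 <= t /\ h t <= th'].
have A1 : A t1 by split; rewrite ?t1E.
have Aub : ubound A (t1 + 2 * pi).
  move=> t [_ ht]; rewrite leNgt; apply/negP => k.
  by have := hm (ltW k); rewrite hp t1E; lra.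
have hsA : has_sup A by split; [exists t1|exists (t1 + 2 * pi)].
have t1s : t1 <= sup A by exact: (ub_le_sup (ex_intro _ _ Aub)).
have big x : sup A < x -> th' < h x.
  move=> sx; rewrite ltNge; apply/negP => hx.
  have : x <= sup A by apply: (ub_le_sup (ex_intro _ _ Aub)); split=> //; lra.
  by rewrite leNgt sx.
have hs : h (sup A) = th'.
  apply/eqP; rewrite eq_le -{2}t1E hm// andbT leNgt; apply/negP => k.
  have /nbhs_ballP[e /= e0 He] : nbhs (sup A) [set y | 0 < h y - th'].
    apply: open_nbhs_nbhs; split; last by rewrite /= subr_gt0.
    by apply: open_gt0 => y; apply: cvgB; [exact: hc|exact: cvg_cst].
  have [x [x1 x2] x3] := sup_adherent e0 hsA.
  have xs : x <= sup A by apply: (ub_le_sup (ex_intro _ _ Aub)).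
  have /= := He x; rewrite /ball /= => H; have : 0 < h x - th'.
    by apply: H; rewrite ltr_norml; apply/andP; split; lra.
  by lra.
exists (sup A); split; first by rewrite hs.
by move=> x /big; rewrite hs.
Qed.

(** The arcs from a point of [vpts] to its neighbours are inside the piece, so [h] is not constant
    near this point. *)
Lemma vpts_strict s t : s < t -> vpts (cexp s) \/ vpts (cexp t) -> h s < h t.
Proof.
move=> st hv; rewrite lt_neqAle hm ?ltW// andbT; apply/eqP => /(hf st) H.
case: hv => [Vs|Vt].
  have [s' [ss' _ _ _] [_ nZ]] := vpts_next Vs.
  pose m := Num.min s' ((s + t) / 2).
  have m1 : m <= s' by rewrite ge_min lexx.
  have m2 : m <= (s + t) / 2 by rewrite ge_min lexx orbT.
  have sm : s < m by rewrite lt_min ss' /=; lra.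
  apply: (H m); first by apply/andP; split; lra.
  apply/(@inside_arc s m (ltW sm)); last exact: vpts_inside.
  by move=> x /andP[x1 x2]; apply: nZ; rewrite x1 (le_trans x2).
have [t' [tt' _ _ _] [_ nZ]] := vpts_prev Vt.
pose m := Num.max t' ((s + t) / 2).
have m1 : t' <= m by rewrite le_max lexx.
have m2 : (s + t) / 2 <= m by rewrite le_max lexx orbT.
have sm : m < t by rewrite gt_max tt' /=; lra.
apply: (H m); first by apply/andP; split; lra.
apply/(@inside_arc m t (ltW sm)); last exact: vpts_inside.
by move=> x /andP[x1 x2]; apply: nZ; rewrite x2 (le_trans m1).
Qed.

Lemma hlast_inside t : (forall x, t < x -> h t < h x) ->
  exists b x, [/\ t < b, Z (cexp b), forall y, t < y < b -> ~ Z (cexp y), t < x < b & inside_at x].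
Proof.
move=> H; have [b [tb Zb nb]] := next_lift t Zc Zf Z0.
exists b; apply: contrapT => N; have := H _ tb.
suff -> : h t = h b by rewrite ltxx.
by apply/(hf tb) => x xI ix; apply: N; exists x.
Qed.

Lemma vpts_infinite : infinite_set vpts.
Proof.
have [t [_ H]] := last_parameter 0; have [b [x [tb Zb nb xI ix]]] := hlast_inside H.
have nx : ~ Z (cexp x) by exact: nb.
have [a' [b' [ab' xI']]] := Zarc Zc Zf Z0 nx.
by apply: (consecutive_infinite ab') => n; exact: inside_zpt xI' ix.
Qed.

Variables (eta : plane -> plane).
Hypothesis etaE : forall t, vpts (cexp t) -> eta (cexp t) = cexp (h t).

Lemma map_period2 : h (2 * pi) = h 0 + 2 * pi. Proof. by rewrite -hp add0r. Qed.

Let lift x : vpts x -> exists t, [/\ 0 <= t < 0 + 2 * pi, x = cexp t, vpts (cexp t) &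
  h 0 <= h t < h 0 + 2 * pi].
Proof.
move=> Vx; have [t [t0 t1 xE]] := cexp_surj 0 (vpts_circle Vx); exists t; subst x.
split=> //; first by rewrite t0.
rewrite hm//= -map_period2; apply: vpts_strict; last by left.
by rewrite -[ltRHS]add0r.
Qed.

Let hlt s t : vpts (cexp s) -> vpts (cexp t) -> (h s < h t) = (s < t).
Proof.
move=> Vs Vt; apply/idP/idP => [|st]; last by apply: vpts_strict; auto.
by rewrite !ltNge; apply: contra; exact: hm.
Qed.

Lemma eta_area x y z : vpts x -> vpts y -> vpts z ->
  (0 < area (eta x) (eta y) (eta z)) = (0 < area x y z).
Proof.
move=> /lift[a [a1 -> Va a2]] /lift[b [b1 -> Vb b2]] /lift[d [d1 -> Vd d2]].
by rewrite !etaE// (@area_cexp_order _ (h 0))// (@area_cexp_order _ 0)// !hlt.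
Qed.

Lemma eta_inj x y : vpts x -> vpts y -> eta x = eta y -> x = y.
Proof.
move=> /lift[a [a1 -> Va /andP[a2 a3]]] /lift[b [b1 -> Vb /andP[b2 b3]]].
rewrite !etaE// => /(cexp_inj a2 a3 b2 b3) e.
have [l|l|->//] := ltgtP a b; first by move: l; rewrite -hlt// e ltxx.
by move: l; rewrite -hlt// e ltxx.
Qed.

Lemma eta_sep x y u v : vpts x -> vpts y -> vpts u -> vpts v ->
  sep (eta x) (eta y) (eta u) (eta v) <-> sep x y u v.
Proof. by move=> Vx Vy Vu Vv; rewrite !sep_area !eta_area. Qed.

Let W := eta @` vpts.

Lemma eta_circle : W `<=` circle.
Proof. by move=> _ [x /lift[t [_ -> Vt _]] <-]; rewrite etaE//; exact: cexp_circle. Qed.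

Lemma eta_infinite : infinite_set W.
Proof.
have eI : {in vpts &, injective eta}.
  by move=> x y /set_mem Vx /set_mem Vy; exact: eta_inj.
by rewrite /W (eq_finite_set (inj_card_eq eI)); exact: vpts_infinite.
Qed.

Lemma eta_consecutive a b : consecutive vpts a b -> consecutive W (h a) (h b).
Proof.
move=> [ab Va Vb H]; split.
- by rewrite hlt.
- by rewrite -etaE//; exists (cexp a).
- by rewrite -etaE//; exists (cexp b).
move=> d /andP[ad db] [x Vx e].
have [t [t0 t1 xE]] := cexp_surj a (vpts_circle Vx); subst x.
move: e; rewrite etaE// => e.
have ha2 : h a <= h t by exact: hm.
have ht2 : h t < h a + 2 * pi by rewrite -hp; apply: vpts_strict; auto.
have hb2 : h b <= h a + 2 * pi.
  rewrite -hp; apply: hm; rewrite leNgt; apply/negP => k.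
  by apply: (H (a + 2 * pi)); rewrite ?cexpD2pi// k ltrDl mulr_gt0// pi_gt0.
have dE : h t = d.
  by apply: (@cexp_inj R (h a)) => //; [exact: ltW|exact: lt_le_trans hb2].
by apply: (H t) => //; rewrite -(hlt Va Vx) -(hlt Vx Vb) dE ad.
Qed.

(** The images of two consecutive boundary edges surround the point, and [gap_not_limit] applies. *)
Lemma eta_gap t : piece Z rho c (cexp t) -> ~ limit_point W (cexp (h t)).
Proof.
move=> /vpts_cover[a [b [ab /andP[at_ tb]]]]; have [_ Va Vb _] := ab.
have [d da _] := vpts_prev Va; have [da' Vd _ _] := da.
apply: (gap_not_limit eta_circle eta_infinite (eta_consecutive da) (eta_consecutive ab)).
rewrite (vpts_strict tb); last by right.
by rewrite andbT; apply: vpts_strict; [exact: lt_le_trans at_|left].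
Qed.

End Angle.
End PiecePoints.

(** * Tameness of the cluster in the chart *)

Section ChartTame.
Context {R : realType}.
Local Notation plane := (plane R).
Implicit Types (u v w : plane).
Variables (Z : set plane) (rho : plane -> plane -> Prop).
Hypothesis Zc : Z `<=` circle.
Hypothesis Zf : finite_set Z.
Hypothesis Z0 : Z !=set0.
Hypothesis eqv : equivalence_on Z rho.
Hypothesis nc : noncrossing rho.

Local Notation cpi := (cpi Z rho).

Let rZ x y : rho x y -> Z x /\ Z y. Proof. by have [H _ _ _] := eqv; exact: H. Qed.

Lemma comp_cpi_continuous (T : topologicalType) (A : set plane) (g : cactus Z rho -> T) :
  A `<=` disk -> {within cpi @` A, continuous g} -> {within A, continuous (g \o cpi)}.
Proof.
move=> Ad /continuous_closedP gc; apply/continuous_closedP => F /gc /closed_subspaceP[V cV VE].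
have [G cG GE] := (closed_cactus _).1 cV.
apply/closed_subspaceP; exists G => //; apply/seteqP; split=> q [h Aq]; split=> //.
  have : (V `&` cpi @` A) (cpi q) by split; [exact/(GE _ (Ad _ Aq))|exists q].
  by rewrite VE => -[].
apply/(GE _ (Ad _ Aq)).
have : (V `&` cpi @` A) (cpi q) by rewrite VE; split=> //; exists q.
by case.
Qed.

Variable c : plane.
Hypothesis oc : off Z rho c.

Variables (g : cactus Z rho -> plane) (h : R -> R).
Hypothesis gh : homeo_on (cpi @` cpiece rho c) disk g.
Hypothesis hc : continuous h.
Hypothesis hp : forall t, h (t + 2 * pi) = h t + 2 * pi.
Hypothesis hm : forall s t, s <= t -> h s <= h t.
Hypothesis hf : forall s t, s < t -> (h s = h t <-> forall x, s < x < t -> ~ inside_at rho c x).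
Hypothesis gE : forall t, cpiece rho c (cexp t) -> g (cpi (cexp t)) = cexp (h t).

Local Notation V := (vpts Z rho c).
Local Notation eta := (g \o cpi).

Lemma eta_cexp t : V (cexp t) -> eta (cexp t) = cexp (h t).
Proof. by move=> [_ /piece_cpiece/gE]. Qed.

Lemma eta_cont : {within cpiece rho c, continuous eta}.
Proof. by apply: comp_cpi_continuous; [exact: cpiece_disk|case: gh]. Qed.

Variable T : set (set plane).
Hypothesis clT : is_cluster V T.
Hypothesis lfT : locally_finite V T.
Hypothesis limT : forall w w', Z w -> Z w' -> limit_pair T w w' -> rho w w'.

Let W := eta @` V.
Let T' := [set eta @` A | A in T].

Let Vc : V `<=` circle. Proof. exact: vpts_circle. Qed.

Let TV A : T A -> A `<=` V.
Proof.
move=> TA; have [x [y [_ [_ [Vx Vy _ _ [-> _]]]]]] := S_obj Vc clT TA.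
by move=> z [->|->].
Qed.

Lemma chart_tame : tame W T'.
Proof.
have Wc : W `<=` circle by exact: (eta_circle Zc eqv hp hm hf eta_cexp).
have eI := eta_inj Zc eqv hp hm hf eta_cexp.
have eS := eta_sep Zc eqv hp hm hf eta_cexp.
have eC := eta_consecutive Zc eqv hp hm hf eta_cexp.
have eG := eta_gap Zc Zf Z0 eqv hc hp hm hf eta_cexp.
split.
- exact: Wc.
- exact: (eta_infinite Zc Zf Z0 eqv hc hp hm hf eta_cexp).
- exact: (transport_cluster Vc Wc erefl eI eS TV).1.
- exact: (transport_locally_finite erefl eI TV).1.
split.
- move=> _ [x Vx <-]; have [t [_ _ xE]] := cexp_surj 0 (Vc Vx); subst x.
  have [t' tt' _] := vpts_next Zc eqv Vx; exists (cexp (h t')), (h t), (h t').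
  by split=> //; [exact: eC|rewrite eta_cexp].
- move=> _ [x Vx <-]; have [t [_ _ xE]] := cexp_surj 0 (Vc Vx); subst x.
  have [t' tt' _] := vpts_prev Zc eqv Vx; exists (cexp (h t')), (h t'), (h t).
  by split=> //; [exact: eC|rewrite eta_cexp].
- move=> _ [x Vx <-]; have [t [_ _ xE]] := cexp_surj 0 (Vc Vx); subst x.
  by rewrite eta_cexp//; apply: eG; case: Vx.
- move=> p cp nl; have [th [_ _ pE]] := cexp_surj 0 cp.
  have [t [e H]] := last_parameter hc hp hm th.
  rewrite -e in pE; subst p.
  have [b [x [tb Zb nb /andP[tx xb] ix]]] := hlast_inside Zc Zf Z0 hf H.
  (* If [cexp t] is in [Z], the points inserted after it belong to the piece, so their images
     accumulate at its image, which would be a limit point. *)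
  have [Zt|nZt] := pselect (Z (cexp t)).
    have ctb : consecutive Z t b by split=> //; exact: lt_trans xb.
    have Vn n : V (cexp (zpt t b n)) by apply: (inside_zpt Zc eqv _ ctb _ ix); rewrite tx.
    exfalso; apply: nl.
    have zI n := zpt_in n tb.
    apply: (@limit_point_seq _ _ _ (fun n : nat => cexp (h (zpt t b (- n%:Z))))).
    + by move=> n; rewrite -eta_cexp//; exists (cexp (zpt t b (- n%:Z))).
    + move=> n; have /andP[z1 z2] := zI (- n%:Z); have h1 := H _ z1.
      have b2 := consecutive_le ctb.
      have h3 : h (zpt t b (- n%:Z)) < h t + 2 * pi.
        rewrite -hp; apply: (vpts_strict Zc eqv hm hf); last by left.
        exact: lt_le_trans b2.
      have pi0 := pi_gt0 R.
      move=> e'; have : h (zpt t b (- n%:Z)) = h t; last by move: h1 => /[swap] ->; rewrite ltxx.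
      by apply: (@cexp_inj R (h t)) => //; [exact: ltW|rewrite ltrDl mulr_gt0].
    + have zc : (fun n : nat => zpt t b (- n%:Z)) @ \oo --> t.
        apply/cvgrPdist_lt => eps eps0; have [N HN] := cvg_zpt tb eps0.
        exists N => // n /= Nn; have /andP[z1 z2] := zI (- n%:Z).
        have [k1 _] := HN n Nn; rewrite ltr_norml; apply/andP; split; lra.
      have zh : (fun n : nat => h (zpt t b (- n%:Z))) @ \oo --> h t by apply: cvg_comp zc _; exact: hc.
      exact: cvg_cexp.
  have pt : piece Z rho c (cexp t).
    apply/piece_inside; split=> //; apply/(inside_arc Zc eqv _ (ltW tx)) => //.
    move=> y /andP[]; rewrite le_eqVlt => /orP[/eqP<-//|ty] yx.
    by apply: nb; rewrite ty (le_lt_trans yx).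
  have [a' [b' [ab /andP[a1 b1]]]] := vpts_cover Zc Zf Z0 eqv pt.
  exists (h a'), (h b'), (h t); split=> //; first exact: eC.
  by rewrite !hm// ltW.
- move=> w w' lw lw' [x [y [Txy xw yw]]].
  have /choice[q qP] : forall n, exists q : plane * plane,
      [/\ T [set q.1; q.2], V q.1, V q.2, eta q.1 = x n & eta q.2 = y n].
    move=> n; have [A TA e] := Txy n.
    have [a [b [_ [_ [Va Vb _ _ [AE _]]]]]] := S_obj Vc clT TA; subst A.
    move: e; rewrite image2 => e; case: (set2_inj e) => -[ex ey].
      by exists (a, b).
    by exists (b, a); split=> //=; rewrite set2C.
  have [k [X [kn cX kX]]] := circle_subseq (fun n => Vc (let: And5 _ h _ _ _ := qP n in h)).
  have [l [X' [ln cX' lX']]] := circle_subseq (fun n => Vc (let: And5 _ _ h _ _ := qP (k n) in h)).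
  have {}kX : (q (k (l n))).1 @[n --> \oo] --> X by exact: (cvg_subseq ln kX).
  pose m n := k (l n); have mn n : (n <= m n)%N by exact: leq_trans (ln n) (kn _).
  have VP u : V u -> cpiece rho c u by move=> [_ /piece_cpiece].
  have cl : closed (cpiece rho c) by exact: cpiece_closed.
  have PX : cpiece rho c X.
    apply: (closed_cvg (cpiece rho c) cl _ _ kX) => //; apply: nearW => n.
    by apply: VP; have [] := qP (m n).
  have PX' : cpiece rho c X'.
    apply: (closed_cvg (cpiece rho c) cl _ _ lX') => //; apply: nearW => n.
    by apply: VP; have [] := qP (m n).
  have eX : eta X = w.
    apply: (@cvg_unique _ (@norm_hausdorff _ _) (eta (q (m n)).1 @[n --> \oo])).
      apply: (within_cvg eta_cont) => // n; apply: VP; by have [] := qP (m n).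
    have -> : (fun n => eta (q (m n)).1) = (fun n => x (m n)).
      by apply: funext => n; have [] := qP (m n).
    exact: cvg_subseq xw.
  have eX' : eta X' = w'.
    apply: (@cvg_unique _ (@norm_hausdorff _ _) (eta (q (m n)).2 @[n --> \oo])).
      apply: (within_cvg eta_cont) => // n; apply: VP; by have [] := qP (m n).
    have -> : (fun n => eta (q (m n)).2) = (fun n => y (m n)).
      by apply: funext => n; have [] := qP (m n).
    exact: cvg_subseq yw.
  have inZ U u : cpiece rho c U -> circle U -> eta U = u -> limit_point W u -> Z U.
    move=> PU cU eU lu; apply: contrapT => nZU.
    have oU : off Z rho U.
      split; first exact: circle_disk.
      by move=> v Zv /(reg_Z Zc eqv cU)/rZ[].
    have pU := cpiece_off Zc eqv oc oU PU.
    have [t [_ _ UE]] := cexp_surj 0 cU; subst U.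
    by apply: (eG t pU); rewrite -gE//; rewrite /= in eU; rewrite eU.
  have ZX := inZ _ _ PX cX eX lw; have ZX' := inZ _ _ PX' cX' eX' lw'.
  have r : rho X X'.
    apply: limT => //; exists (fun n => (q (m n)).1), (fun n => (q (m n)).2).
    by split=> // n; have [] := qP (m n).
  rewrite -eX -eX' /=; congr (g _).
  have dX := circle_disk cX; have dX' := circle_disk cX'.
  apply: (cpi_reg ZX dX dX' (reg_self eqv ZX)).
  by apply: sub_conv_hull.
Qed.

End ChartTame.

(** * Restriction and union of clusters *)

Lemma conv_gt0 (R : realType) (k a b : R) : 0 <= k -> k <= 1 -> 0 < a -> 0 < b ->
  0 < (1 - k) * a + k * b.
Proof.
rewrite le_eqVlt => /orP[/eqP<-|k0] k1 a0 b0; first by rewrite mul0r addr0 subr0 mul1r.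
by apply: ltr_wpDl; [apply: mulr_ge0; [lra|exact: ltW]|exact: mulr_gt0].
Qed.

Lemma conv_nsep (R : realType) (k l a b d f : R) : 0 <= k -> k <= 1 -> 0 <= l -> l <= 1 ->
  a * d < 0 -> 0 < a * b -> 0 < d * f -> (1 - k) * a + k * b = (1 - l) * d + l * f -> False.
Proof.
move=> k0 k1 l0 l1 s h1 h2 e.
have [a0|a0|a0] := ltgtP a 0; last by move: s; rewrite a0 mul0r ltxx.
  have b0 : b < 0 by move: h1; rewrite nmulr_rgt0.
  have d0 : 0 < d by move: s; rewrite nmulr_rlt0.
  have f0 : 0 < f by move: h2; rewrite pmulr_rgt0.
  have c1 : 0 < (1 - k) * - a + k * - b by apply: conv_gt0; rewrite ?oppr_gt0.
  by have c2 := conv_gt0 l0 l1 d0 f0; lra.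
have b0 : 0 < b by move: h1; rewrite pmulr_rgt0.
have d0 : d < 0 by move: s; rewrite pmulr_rlt0.
have f0 : f < 0 by move: h2; rewrite nmulr_rgt0.
have c1 : 0 < (1 - l) * - d + l * - f by apply: conv_gt0; rewrite ?oppr_gt0.
by have c2 := conv_gt0 k0 k1 a0 b0; lra.
Qed.

Section Restriction.
Context {R : realType}.
Local Notation plane := (plane R).
Implicit Types (x y z p q u v w : plane).
Variables (Z : set plane) (rho : plane -> plane -> Prop).
Hypothesis Zc : Z `<=` circle.
Hypothesis Zf : finite_set Z.
Hypothesis Z0 : Z !=set0.
Hypothesis eqv : equivalence_on Z rho.
Hypothesis nc : noncrossing rho.

Let rZ x y : rho x y -> Z x /\ Z y. Proof. by have [H _ _ _] := eqv; exact: H. Qed.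

Local Notation Y := (Zinfty Z).
Let Yc : Y `<=` circle. Proof. exact: Zinfty_circle. Qed.

Lemma Zinfty_infinite : infinite_set Y.
Proof.
have [z Zz] := Z0; have [t [_ _ zE]] := cexp_surj 0 (Zc Zz); subst z.
have [b [tb Zb nb]] := next_lift t Zc Zf Z0.
have ctb : consecutive Z t b by [].
by apply: (consecutive_infinite ctb) => n; exact: Zinfty_zpt.
Qed.

Lemma Zinfty_limit w : limit_point Y w -> Z w.
Proof.
move=> lw; have cw := limit_point_closed closed_circle Yc lw.
have [t [_ _ wE]] := cexp_surj 0 cw; subst w; apply: contrapT => nZ.
have [a [b [ab /andP[at_ tb] _]]] := Zinfty_cover Zc Zf Z0 nZ.
have [_ Ya _ _] := ab; have [d da _] := Zinfty_prev Ya; have [da' _ _ _] := da.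
apply: (gap_not_limit Yc Zinfty_infinite da ab) lw.
by rewrite tb andbT (lt_le_trans da').
Qed.

Lemma area_YZ x y w : Y x -> Y y -> x <> y -> Z w -> area x y w != 0.
Proof.
move=> Yx Yy xy Zw; apply: (area_circle_neq0 (Yc Yx) (Yc Yy) (Zc Zw) xy) => e.
  by apply: (Zinfty_notZ Yx); rewrite -e.
by apply: (Zinfty_notZ Yy); rewrite -e.
Qed.

Lemma area_ZY w w' x : Z w -> Z w' -> w <> w' -> Y x -> area w w' x != 0.
Proof.
move=> Zw Zw' ww' Yx; apply: (area_circle_neq0 (Zc Zw) (Zc Zw') (Yc Yx) ww') => e.
  by apply: (Zinfty_notZ Yx); rewrite e.
by apply: (Zinfty_notZ Yx); rewrite e.
Qed.

Lemma nsep_ZY w w' x y : Z w -> Z w' -> w <> w' -> Y x -> Y y -> x <> y ->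
  0 < area x y w * area x y w' <-> 0 < area w w' x * area w w' y.
Proof.
move=> Zw Zw' ww' Yx Yy xy.
have n1 := area_YZ Yx Yy xy Zw; have n2 := area_YZ Yx Yy xy Zw'.
have n3 := area_ZY Zw Zw' ww' Yx; have n4 := area_ZY Zw Zw' ww' Yy.
split=> h; rewrite lt_neqAle eq_sym mulf_neq0//= leNgt; apply/negP => s.
  have sp : sep w w' x y by [].
  have := sep_sym (Zc Zw) (Zc Zw') (Yc Yx) (Yc Yy) sp.
  by rewrite /sep ltNge ltW.
have sp : sep x y w w' by [].
have := sep_sym (Yc Yx) (Yc Yy) (Zc Zw) (Zc Zw') sp.
by rewrite /sep ltNge ltW.
Qed.

(* Being on the same side of every chord of the cluster is an equivalence relation on Z
   containing all the limit pairs. *)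
Lemma cluster_side S w w' : is_cluster Y S -> cluster_rel Z S w w' ->
  forall x y, S [set x; y] -> 0 < area x y w * area x y w'.
Proof.
move=> cl cr; pose r u v := [/\ Z u, Z v & forall x y, S [set x; y] -> 0 < area x y u * area x y v].
suff [] : r w w' by [].
have SY x y : S [set x; y] -> [/\ Y x, Y y & x <> y] by move=> /(S_sep Yc cl)[].
apply: cr; first split.
- by move=> x y [].
- move=> u Zu; split=> // x y /SY[Yx Yy xy].
  by rewrite -expr2 lt_neqAle sqr_ge0 andbT eq_sym sqrf_eq0 area_YZ.
- by move=> u v [Zu Zv H]; split=> // x y /H; rewrite mulrC.
- move=> u v t [Zu Zv H] [_ Zt H']; split=> // x y Sxy.
  have h1 := H _ _ Sxy; have h2 := H' _ _ Sxy; have := mulr_gt0 h1 h2.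
  have -> : area x y u * area x y v * (area x y v * area x y t) =
    area x y v ^+ 2 * (area x y u * area x y t) by ring.
  by rewrite pmulr_rgt0// exprn_even_gt0//=; apply/eqP => e; move: h1; rewrite e mulr0 ltxx.
- move=> u u' Zu Zu' [a [b [Sab ua u'b]]]; split=> // x y Sxy.
  have [Yx Yy xy] := SY _ _ Sxy.
  rewrite lt_neqAle eq_sym mulf_neq0 ?area_YZ//= leNgt; apply/negP => s.
  have ca : (fun n => - (area x y (a n) * area x y (b n))) @ \oo --> - (area x y u * area x y u').
    by apply: cvgN; apply: cvgM; apply: cvg_area => //; exact: cvg_cst.
  have : 0 < - (area x y u * area x y u') by rewrite oppr_gt0.
  move=> /(cvgr_gt _ ca)/=[N _ /(_ N (leqnn N))/=]; rewrite oppr_gt0.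
  exact: (S_nsep Yc cl Sxy (Sab N)).
Qed.

Lemma cluster_piece S x y : is_cluster Y S ->
  (forall w w', rho w w' -> cluster_rel Z S w w') -> S [set x; y] -> piece Z rho x y.
Proof.
move=> cl H Sxy; have [Yx Yy xy _] := S_sep Yc cl Sxy.
split; [exact/circle_disk/Yc|exact: Zinfty_notZ|] => w w' r n.
have [Zw Zw'] := rZ r; apply/(nsep_ZY Zw Zw' n Yx Yy xy).
by apply: (cluster_side cl) => //; exact: H.
Qed.

(** Some chord between equivalent points separates the two pieces, and a crossing point would be
    strictly on both of its sides. *)
Lemma pieces_nsep x y u v : Y x -> Y y -> Y u -> Y v -> piece Z rho x y ->
  piece Z rho u v -> ~ piece Z rho x u -> ~ sep x y u v.
Proof.
move=> Yx Yy Yu Yv [_ _ pxy] [_ _ puv] npxu sp.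
apply: npxu; split; [exact/circle_disk/Yc|exact: Zinfty_notZ|] => w w' r n.
have [Zw Zw'] := rZ r.
rewrite lt_neqAle eq_sym mulf_neq0 ?area_ZY//= leNgt; apply/negP => s.
have h1 := pxy w w' r n; have h2 := puv w w' r n.
have [_ /(_ sp)[_ [p [[]]]]] := crossingP (Yc Yx) (Yc Yy) (Yc Yu) (Yc Yv) (sep_neq sp) (sep_neq2 sp).
move=> /geodesicP[k [k0 k1 pE]] /geodesicP[l [l0 l1 pE']] _.
have e : (1 - k) * area w w' x + k * area w w' y = (1 - l) * area w w' u + l * area w w' v.
  by rewrite -!area_mix -pE -pE'.
exact: (conv_nsep k0 k1 l0 l1 s h1 h2 e).
Qed.

End Restriction.

(** * Restriction of a cluster to a piece and union over the pieces *)

Section Pieces.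
Context {R : realType}.
Local Notation plane := (plane R).
Implicit Types (x y z p q u v w : plane).
Variables (Z : set plane) (rho : plane -> plane -> Prop).
Hypothesis Zc : Z `<=` circle.
Hypothesis Zf : finite_set Z.
Hypothesis Z0 : Z !=set0.
Hypothesis eqv : equivalence_on Z rho.
Hypothesis nc : noncrossing rho.

Let rZ x y : rho x y -> Z x /\ Z y. Proof. by have [H _ _ _] := eqv; exact: H. Qed.
Let rxx x : Z x -> rho x x. Proof. by have [_ H _ _] := eqv; exact: H. Qed.
Let rC x y : rho x y -> rho y x. Proof. by have [_ _ H _] := eqv; exact: H. Qed.
Let rT x y z : rho x y -> rho y z -> rho x z.
Proof. by have [_ _ _ H] := eqv; exact: H. Qed.

Local Notation Y := (Zinfty Z).
Local Notation V := (vpts Z rho).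
Let Yc : Y `<=` circle. Proof. exact: Zinfty_circle. Qed.
Let Yi : infinite_set Y. Proof. exact: Zinfty_infinite. Qed.
Let Vc c : V c `<=` circle. Proof. exact: vpts_circle. Qed.

Lemma vpts_sub c : V c `<=` Y. Proof. by move=> x []. Qed.

Lemma Zinfty_has_prev y : Y y -> exists y', next_point Y y' y.
Proof.
move=> Yy; have [t [_ _ yE]] := cexp_surj 0 (Yc Yy); subst y.
by have [t' tt' _] := Zinfty_prev Yy; exists (cexp t'), t', t.
Qed.

(** Charts need a centre in the open disk; a point of the circle is moved slightly towards the
    origin, within its piece. *)
Lemma off_open p : off Z rho p -> exists2 c, off Z rho c /\ open_disk c & piece Z rho p c.
Proof.
move=> op; have [dp _] := op; case: (disk_case dp) => [od|cp].
  by exists p => //; exact: (piece_self Zc eqv).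
have pp := piece_self Zc eqv op.
have /nbhs_planeP[e [e0 He]] := piece_nbhs Zf eqv pp.
pose t := Num.min (1 / 2) (e / 2).
have t0 : 0 < t by rewrite lt_min !divr_gt0.
have t1 : t <= 1 / 2 by rewrite ge_min lexx.
have te : t <= e / 2 by rewrite ge_min lexx orbT.
pose q := mix t p (0, 0).
have oq : open_disk q.
  apply: odisk_mixr => //; last lra.
  by rewrite odiskE /sq /= expr0n addr0.
have pq : piece Z rho p q.
  have b (r : R) : `|r| <= 1 -> `|r - ((1 - t) * r + t * 0)| < e.
    move=> r1; have -> : r - ((1 - t) * r + t * 0) = t * r by ring.
    rewrite normrM (ger0_norm (ltW t0)); apply: le_lt_trans (ler_wpM2l (ltW t0) r1) _.
    by rewrite mulr1; lra.
  have sqb (r s : R) : r ^+ 2 + s ^+ 2 <= 1 -> `|r| <= 1.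
    move=> h; rewrite -(@ler_pXn2r _ 2)// ?nnegrE// real_normK ?num_real// expr1n.
    by have := sqr_ge0 s; lra.
  apply: He; last exact: odisk_disk.
    by apply: b; apply: sqb; exact: dp.
  by apply: b; apply: (sqb _ (p.1 : R)); rewrite addrC; exact: dp.
by exists q => //; split=> //; exact: (piece_off Zc Zf eqv op pq).
Qed.

Lemma piece_eq p c : off Z rho p -> piece Z rho p c -> piece Z rho p = piece Z rho c.
Proof.
move=> op pc; apply/seteqP; split=> q h; last exact: piece_trans h.
by apply: piece_trans h; apply: (piece_sym pc (off_nZ eqv op)); case: op.
Qed.

Lemma cpiece_eq p c : piece Z rho p c -> cpiece rho p = cpiece rho c.
Proof.
move=> [_ _ H]; apply/seteqP; split=> q [dq Hq]; split=> // w w' r n.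
  have h := H w w' r n; have h' := Hq w w' r n.
  have : 0 <= area w w' p ^+ 2 * (area w w' c * area w w' q).
    have -> : area w w' p ^+ 2 * (area w w' c * area w w' q) =
      area w w' p * area w w' c * (area w w' p * area w w' q) by ring.
    by rewrite mulr_ge0// ltW.
  rewrite pmulr_rge0// exprn_even_gt0//=; apply/eqP => e.
  by move: h; rewrite e mul0r ltxx.
have h := H w w' r n; have h' := Hq w w' r n.
have : 0 <= area w w' c ^+ 2 * (area w w' p * area w w' q).
  have -> : area w w' c ^+ 2 * (area w w' p * area w w' q) =
    area w w' p * area w w' c * (area w w' c * area w w' q) by ring.
  by rewrite mulr_ge0// ltW.
rewrite pmulr_rge0// exprn_even_gt0//=; apply/eqP => e.
by move: h; rewrite e mulr0 ltxx.
Qed.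

Section OnePiece.
Variable c : plane.
Hypothesis oc : off Z rho c.
Hypothesis odc : open_disk c.

Lemma vpts_inf : infinite_set (V c).
Proof.
have [g [h [_ _ hc hp [hm hf _]]]] := disk_chart Zc Zf eqv nc oc odc.
exact: (vpts_infinite Zc Zf Z0 eqv hc hp hm hf).
Qed.

Let Vi := vpts_inf.

Lemma vpts_next_point x y : next_point (V c) x y -> next_point Y x y.
Proof.
move=> n; have [Vx _] := next_pointY n.
have [t [_ _ xE]] := cexp_surj 0 (Vc Vx); subst x.
have [t' tt' [tt'' _]] := vpts_next Zc eqv Vx.
have n' : next_point (V c) (cexp t) (cexp t') by exists t, t'.
by rewrite (next_uniq (@Vc c) Vi n n'); exists t, t'.
Qed.

Lemma vpts_boundary x y : boundary_edge (V c) [set x; y] -> boundary_edge Y [set x; y].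
Proof. by move=> [u [v [/vpts_next_point n e]]]; exists u, v. Qed.

Lemma vpts_has_prev y : V c y -> exists y', next_point (V c) y' y.
Proof.
move=> Vy; have [t [_ _ yE]] := cexp_surj 0 (Vc Vy); subst y.
by have [t' tt' _] := vpts_prev Zc eqv Vy; exists (cexp t'), t', t.
Qed.

Lemma vpts_limit w : limit_point (V c) w -> Z w.
Proof.
by move=> lw; apply: (Zinfty_limit Zc Zf Z0) => U /lw[y [ny Vy Uy]]; exists y; split=> //; exact: vpts_sub Vy.
Qed.

(* The clusters on the points of one disk which correspond to its triangulations. *)
Definition good_cluster (T : set (set plane)) := [/\ is_cluster (V c) T, locally_finite (V c) T &
  forall w w', Z w -> Z w' -> limit_pair T w w' -> rho w w'].

Lemma limit_pair_sub (S T : set (set plane)) w w' : T `<=` S -> limit_pair T w w' -> limit_pair S w w'.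
Proof. by move=> TS [x [y [Txy ? ?]]]; exists x, y; split=> // n; exact: TS. Qed.

(** Maximality survives restriction because a chord between points of one piece is crossed by no
    edge of another piece. *)
Lemma restrict_good S : is_cluster Y S -> locally_finite Y S ->
  (forall w w', cluster_rel Z S w w' <-> rho w w') -> good_cluster [set A | S A /\ A `<=` V c].
Proof.
move=> cl lf cr.
have Sp x y : S [set x; y] -> piece Z rho x y.
  by apply: (cluster_piece Zc eqv cl) => w w' /cr.
have [S1 S2 S3] := (clusterP S Yc).1 cl.
split.
- apply/clusterP => //; split.
  + move=> A [SA AV]; have [x [y [_ [_ [Yx Yy _ _ [AE _]]]]]] := S1 A SA; subst A.
    have Vx : V c x by apply: AV; left.
    have Vy : V c y by apply: AV; right.
    have [_ _ xy _] := S_sep Yc cl SA.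
    apply: contrapT => H; apply: (S_nboundary Yc cl SA); apply: vpts_boundary.
    apply: nsep_boundary => // u v Vu Vv h; apply: H.
    by exists x, y, u, v; split=> //; split.
  + by move=> x y u v [Sxy _] [Suv _]; exact: S2.
  + move=> x y Vx Vy [u [v [Vu Vv h]]] H; split; last by move=> z [->|->].
    apply: S3; [exact: vpts_sub Vx|exact: vpts_sub Vy| |].
      by exists u, v; split=> //; [exact: vpts_sub Vu|exact: vpts_sub Vv].
    move=> a b Sab sp; have [Ya Yb ab _] := S_sep Yc cl Sab.
    have [pxa|npxa] := pselect (piece Z rho x a).
      have pca : piece Z rho c a by apply: piece_trans pxa; case: Vx.
      apply: (H a b) => //; split=> // z [->|->]; split=> //.
      by apply: piece_trans (Sp _ _ Sab).
    apply: (pieces_nsep Zc eqv (vpts_sub Vx) (vpts_sub Vy) Ya Yb _ (Sp _ _ Sab) npxa sp).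
    apply: piece_trans (_ : piece Z rho c y); last by case: Vy.
    by apply: piece_sym; [case: Vx|exact: (off_nZ eqv oc)|case: oc].
- move=> y Vy; apply: sub_finite_set (lf y (vpts_sub Vy)) => A [[SA _] Ay].
  by split.
- move=> w w' Zw Zw' lp; apply/cr => r _ H; apply: H => //.
  by apply: limit_pair_sub lp => A [].
Qed.

End OnePiece.

Section Union.
Variable S : set (set plane).
Hypothesis Spiece : forall A, S A -> exists c, [/\ off Z rho c, open_disk c & A `<=` V c].
Hypothesis Sgood : forall c, off Z rho c -> open_disk c -> good_cluster c [set A | S A /\ A `<=` V c].
Hypothesis pfin : exists (k : nat) (c : 'I_k -> plane), forall x, off Z rho x ->
  exists i, [/\ off Z rho (c i), open_disk (c i) & piece Z rho (c i) x].

Let T c := [set A | S A /\ A `<=` V c].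

Let Voff x : Y x -> off Z rho x.
Proof. by apply: (Zinfty_off Zc eqv); [exact: Zinfty_circle|exact: Zinfty_notZ]. Qed.

Let Vex x : Y x -> exists c, [/\ off Z rho c, open_disk c & V c x].
Proof.
move=> Yx; have ox := Voff Yx; have [c [oc odc] xc] := off_open ox.
exists c; split=> //; split=> //.
by apply: (piece_sym xc (off_nZ eqv ox)); case: ox.
Qed.

Let Vpiece c x y : off Z rho c -> V c x -> Y y -> piece Z rho x y -> V c y.
Proof. by move=> oc [_ px] Yy pxy; split=> //; exact: piece_trans pxy. Qed.

Let VV c x y : off Z rho c -> V c x -> V c y -> piece Z rho x y.
Proof.
move=> oc [Yx px] [Yy py]; apply: piece_trans py.
by apply: (piece_sym px (off_nZ eqv oc)); case: oc.
Qed.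

Let Tcl c (oc : off Z rho c) (odc : open_disk c) : is_cluster (V c) (T c).
Proof. by have [] := Sgood oc odc. Qed.

Let Spair x y : S [set x; y] -> exists c, [/\ off Z rho c, open_disk c, V c x, V c y & T c [set x; y]].
Proof.
move=> Sxy; have [c [oc odc h]] := Spiece Sxy; exists c; split=> //.
- by apply: h; left.
- by apply: h; right.
Qed.

Let nearby c x y : off Z rho c -> V c x -> circle y -> x <> y ->
  exists k, [/\ 0 < k < 1, piece Z rho c (mix k x y) & open_disk (mix k x y)].
Proof.
move=> oc [Yx px] cy xy; have dx := circle_disk (Yc Yx); have dy := circle_disk cy.
have um : (fun n : nat => mix (n.+2%:R^-1 : R) x y) @ \oo --> x.
  rewrite -[X in _ --> X](mix0 x y); apply: cvg_mix; [|exact: cvg_cst|exact: cvg_cst].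
  exact: (cvg_subseq leqnSn (@cvg_harmonic R)).
have [N _ /(_ N (leqnn N)) H] := um _ (piece_nbhs Zf eqv px).
have k0 : 0 < (N.+2%:R^-1 : R) by rewrite invr_gt0.
have k1 : (N.+2%:R^-1 : R) < 1 by rewrite invf_lt1// ltr1n.
have om : open_disk (mix (N.+2%:R^-1 : R) x y) by exact: odisk_mix.
exists (N.+2%:R^-1); split=> //; first by rewrite k0.
by apply: H; exact: odisk_disk.
Qed.

(* A chord leaving a piece crosses an edge: near its end in the piece it runs through a
   triangle, which it has to leave. *)
Lemma leaving_chord c x y : off Z rho c -> open_disk c -> V c x -> Y y -> ~ piece Z rho x y ->
  exists u v, T c [set u; v] /\ sep x y u v.
Proof.
move=> oc odc Vx Yy npy; have [cl lf lim] := Sgood oc odc.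
have cx := Vc Vx; have cy := Yc Yy.
have xy : x <> y.
  by move=> e; apply: npy; rewrite -e; exact: (piece_self Zc eqv (Voff (vpts_sub Vx))).
have [k [/andP[k0 k1] pp op]] := nearby oc Vx cy xy.
have [t [_ _ xE]] := cexp_surj 0 cx; subst x.
have [t' tt' _] := vpts_next Zc eqv Vx; have [_ _ Vx' _] := tt'.
have nx : next_point (V c) (cexp t) (cexp t') by exists t, t'.
have Vi := vpts_inf oc odc; have Vcc := @Vc c.
have xx' := next_neq Vcc Vi nx.
have E0 : E (V c) (T c) (cexp t) (cexp t') by right; exists (cexp t), (cexp t').
have om : open_disk (mix (1 / 2) (cexp t) (cexp t')).
  by apply: (odisk_mix (circle_disk cx) (circle_disk (Vc Vx')) xx'); lra.
have pm : piece Z rho c (mix (1 / 2) (cexp t) (cexp t')).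
  by have [_ v1] := Vx; have [_ v2] := Vx'; apply: (cvx_piece Zc v1 v2 _ _ oc); lra.
have am : area (cexp t) (cexp t') (mix (1 / 2) (cexp t) (cexp t')) = 0.
  by rewrite area_mix areaxyx areaxyy !mulr0 addr0.
(* Both points are in the piece of [c] and limit pairs of its cluster are equivalent, so no chord of
   a limit pair separates them. *)
have sepH w w' : limit_point (V c) w -> limit_point (V c) w' -> w <> w' ->
    limit_pair (T c) w w' -> ~ (0 <= area w w' (mix k (cexp t) y) /\
      area w w' (mix (1 / 2) (cexp t) (cexp t')) <= 0).
  move=> /vpts_limit Zw /vpts_limit Zw' ww' /(lim _ _ Zw Zw') r [h1 h2].
  have [_ _ H1] := pp; have [_ _ H2] := pm.
  have k1' := H1 _ _ r ww'; have k2' := H2 _ _ r ww'.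
  have := mulr_gt0 k1' k2'; rewrite mulrACA -expr2 => h.
  have : 0 < area w w' (mix k (cexp t) y) * area w w' (mix (1 / 2) (cexp t) (cexp t')).
    by move: h; rewrite pmulr_rgt0// exprn_even_gt0//=; apply/eqP => e; move: k1'; rewrite e mul0r ltxx.
  by rewrite ltNge mulr_ge0_le0.
have [x1 [x2 [x3 [tri reg]]]] := coverage Vcc Vi cl lf (vpts_has_prev (c := c)) op om E0 am sepH.
have nyV : ~ V c y by move=> Vy; apply: npy; exact: VV Vx Vy.
(* If [y] is beyond the side [ab], this side is in the cluster, since no point of [Y] is beyond a
   boundary edge; then the chord to [y] crosses it. *)
have key a b d : ctri (V c) (T c) a b d -> treg (T c) a b d (mix k (cexp t) y) ->
    area a b y < 0 -> exists u v, T c [set u; v] /\ sep (cexp t) y u v.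
  move=> [Eab Ebd Eda h] [_ r1 _ _] hy.
  have [Va Vb ab] := E_Y Vcc Vi cl Eab; have [_ Vd _] := E_Y Vcc Vi cl Ebd.
  have Tab : T c [set a; b].
    case: Eab => // /(boundary_edgeP _ ab)[] /(vpts_next_point oc odc) n.
      have [_ _ H] := (nextP Yc ab).1 n.
      by have := H _ Yy; rewrite leNgt hy.
    have [_ _ H] := (nextP Yc (nesym ab)).1 n.
    by have := H _ (vpts_sub Vd); rewrite area_swap oppr_ge0 leNgt h.
  exists a, b; split=> //.
  have := r1 Tab; rewrite area_mix => hm.
  have hx : 0 < area a b (cexp t).
    rewrite ltNge; apply/negP => hx.
    have := mulr_ge0 (_ : 0 <= 1 - k) (_ : 0 <= - area a b (cexp t)).
    have := mulr_gt0 k0 (_ : 0 < - area a b y).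
    by rewrite oppr_ge0 oppr_gt0 => /(_ hy) g1 /(_ _ hx) g2; have := g2 _; lra.
  apply: (sep_sym (Vc Va) (Vc Vb) cx cy).
  by rewrite /sep pmulr_rlt0.
have [E1 E2 E3 h] := tri.
have [V1 V2 _] := E_Y Vcc Vi cl E1; have [_ V3 _] := E_Y Vcc Vi cl E2.
have [h1|h1] := ltP (area x1 x2 y) 0; first exact: (key x1 x2 x3).
have [h2|h2] := ltP (area x2 x3 y) 0.
  by apply: (key x2 x3 x1) => //; [exact: ctri_rot|exact: treg_rot].
have [h3|h3] := ltP (area x3 x1 y) 0.
  by apply: (key x3 x1 x2) => //; [exact/ctri_rot/ctri_rot|exact/treg_rot/treg_rot].
case: (circle_tri (Vc V1) (Vc V2) (Vc V3) cy h h1 h2 h3) => e; exfalso; apply: nyV; by rewrite e.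
Qed.

(** Chords in different pieces do not cross. A chord that crosses nothing cannot leave its piece, by
    [leaving_chord], and inside the piece maximality applies. *)
Lemma union_cluster : is_cluster Y S.
Proof.
apply/clusterP => //; split.
- move=> A SA; have [c [oc odc AV]] := Spiece SA.
  have [x [y [u [v [Vx Vy Vu Vv h]]]]] := S_obj (@Vc c) (Tcl oc odc) (conj SA AV).
  by exists x, y, u, v; split=> //; apply: (@vpts_sub c).
- move=> x y u v /Spair[c [oc odc Vx Vy Txy]] Suv.
  have [c' [oc' odc' Vu Vv _]] := Spair Suv.
  have [pxu|npxu] := pselect (piece Z rho x u).
    have Vcu := Vpiece oc Vx (vpts_sub Vu) pxu.
    have Vcv := Vpiece oc Vcu (vpts_sub Vv) (VV oc' Vu Vv).
    apply: (S_nsep (@Vc c) (Tcl oc odc) Txy); split=> // z [->|->] //.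
  exact: (pieces_nsep Zc eqv (vpts_sub Vx) (vpts_sub Vy) (vpts_sub Vu) (vpts_sub Vv) (VV oc Vx Vy) (VV oc' Vu Vv) npxu).
- move=> x y Yx Yy [u [v [Yu Yv h]]] H; have xy := sep_neq h.
  have [c [oc odc Vx]] := Vex Yx.
  have [pxy|npxy] := pselect (piece Z rho x y); last first.
    have [a [b [[Sab _] sp]]] := leaving_chord oc odc Vx Yy npxy.
    by case: (H a b Sab sp).
  have Vy := Vpiece oc Vx Yy pxy.
  have : E (V c) (T c) x y.
    by apply: (E_max (@Vc c) (Tcl oc odc)) => // a b [Sab _]; exact: H.
  case=> [[]//|/(vpts_boundary oc odc) bd].
  by case: (boundary_nsep Yc Yu Yv bd h).
Qed.

Lemma union_locally_finite : locally_finite Y S.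
Proof.
move=> y Yy; have [c [oc odc Vy]] := Vex Yy; have [_ lf _] := Sgood oc odc.
apply: sub_finite_set (lf y Vy) => A [SA Ay]; split=> //; split=> // z Az.
have [c' [oc' odc' AV]] := Spiece SA.
by apply: (Vpiece oc Vy (vpts_sub (AV _ Az))); exact: VV (AV _ Ay) (AV _ Az).
Qed.

(** There are finitely many disks, so infinitely many of the chords are in one of them; that
    subsequence has the same limits. *)
Lemma union_limit w w' : Z w -> Z w' -> limit_pair S w w' -> rho w w'.
Proof.
move=> Zw Zw' [x [y [Sxy xw yw]]]; have [k [c cP]] := pfin.
have /choice[i iP] : forall n, exists i, [/\ off Z rho (c i), open_disk (c i), T (c i) [set x n; y n] & True].
  move=> n; have [d [od odd Vx Vy _]] := Spair (Sxy n).
  have [i [oi odi pix]] := cP _ (Voff (vpts_sub Vx)); exists i; split=> //; split=> //.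
  have Vix : V (c i) (x n) by split=> //; exact: vpts_sub Vx.
  move=> z [->|->] //; apply: (Vpiece oi Vix (vpts_sub Vy)); exact: VV Vx Vy.
have [j jP] : exists j, forall N : nat, exists n : nat, (N <= n)%N /\ i n = j.
  apply: contrapT => /forallNP H.
  have /choice[N NP] : forall j, exists N : nat, forall n : nat, (N <= n)%N -> i n <> j.
    move=> j; have /existsNP[N HN] := H j; exists N => n Nn e; apply: HN; by exists n.
  pose M := \max_j N j.
  by apply: (NP (i M) M) => //; exact: leq_bigmax.
have [m mP] := choice jP.
have [_ _ lim] : good_cluster (c j) (T (c j)).
  have [n [_ e]] := jP 0%N; have [h1 h2 _ _] := iP n; rewrite e in h1 h2.
  exact: Sgood.
apply: lim => //; exists (fun n => x (m n)), (fun n => y (m n)); split.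
- by move=> n; have [_ e] := mP n; have [_ _ h _] := iP (m n); rewrite e in h.
- by apply: cvg_subseq xw => n; have [] := mP n.
- by apply: cvg_subseq yw => n; have [] := mP n.
Qed.

End Union.

End Pieces.

(** * Equivalent points as limit pairs *)

Section RelationLimits.
Context {R : realType}.
Local Notation plane := (plane R).
Implicit Types (u v w : plane).
Variables (Z : set plane) (rho : plane -> plane -> Prop).
Hypothesis Zc : Z `<=` circle.
Hypothesis Zf : finite_set Z.
Hypothesis Z0 : Z !=set0.
Hypothesis eqv : equivalence_on Z rho.
Hypothesis nc : noncrossing rho.

Let rZ x y : rho x y -> Z x /\ Z y. Proof. by have [H _ _ _] := eqv; exact: H. Qed.
Let rxx x : Z x -> rho x x. Proof. by have [_ H _ _] := eqv; exact: H. Qed.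
Let rC x y : rho x y -> rho y x. Proof. by have [_ _ H _] := eqv; exact: H. Qed.
Let rT x y z : rho x y -> rho y z -> rho x z.
Proof. by have [_ _ _ H] := eqv; exact: H. Qed.

Local Notation Y := (Zinfty Z).
Let Yc : Y `<=` circle. Proof. exact: Zinfty_circle. Qed.
Let Yi : infinite_set Y. Proof. exact: Zinfty_infinite. Qed.

Variable S : set (set plane).
Hypothesis cl : is_cluster Y S.
Hypothesis lf : locally_finite Y S.
Hypothesis Sp : forall x y, S [set x; y] -> piece Z rho x y.
Hypothesis lim : forall w w', Z w -> Z w' -> limit_pair S w w' -> rho w w'.

(** No chord [uv] of a class separates [cexp t0] from [cexp a], since [Z] has no point between them,
    nor from [cexp b]: if its class is that of [cexp a], adjacency forbids it; otherwise noncrossing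
    does. *)
Let same_class_side (a b t0 : R) u v : a < t0 -> t0 < b -> b < a + 2 * pi ->
  Z (cexp a) -> Z (cexp b) -> rho (cexp a) (cexp b) -> rho u v -> u <> v ->
  (forall x, a < x <= t0 -> ~ Z (cexp x)) ->
  (forall x, a < x < b -> ~ rho (cexp a) (cexp x)) ->
  [/\ area u v (cexp t0) != 0, 0 <= area u v (cexp t0) * area u v (cexp a) &
      0 <= area u v (cexp t0) * area u v (cexp b)].
Proof.
move=> at0 t0b ba Za Zb rab ruv uv nZ ncl; have [Zu Zv] := rZ ruv.
have pi0 := pi_gt0 R.
have cx := @cexp_circle R.
have ha : a <= a < a + 2 * pi by rewrite lexx ltrDl mulr_gt0.
have hb : a <= b < a + 2 * pi by rewrite ba andbT ltW// (lt_trans at0).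
have ht : a <= t0 < a + 2 * pi by rewrite ltW//= (lt_trans t0b).
have nZt : ~ Z (cexp t0) by apply: nZ; rewrite at0 lexx.
have n0 : area u v (cexp t0) != 0.
  by apply: (area_circle_neq0 (Zc Zu) (Zc Zv) (cx _) uv) => e; apply: nZt; rewrite e.
have lo z : Z z -> ~ 0 < area (cexp t0) (cexp a) z.
  move=> Zz; have [k [k1 k2 zE]] := cexp_surj a (Zc Zz); subst z.
  rewrite area_rot area_order_base// ?k1// => /andP[l1 l2].
  by apply: (nZ k) => //; rewrite l1 ltW.
have A1 : 0 <= area u v (cexp t0) * area u v (cexp a).
  rewrite leNgt; apply/negP => s; have sp : sep u v (cexp t0) (cexp a) by [].
  have := sep_sym (Zc Zu) (Zc Zv) (cx _) (cx _) sp.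
  by move/sep_area => [[/(lo _ Zu)]|[_ /(lo _ Zv)]].
split=> //.
have hi z : Z z -> rho (cexp a) z -> ~ 0 < area (cexp b) (cexp t0) z.
  move=> Zz rz; have [k [k1 k2 zE]] := cexp_surj a (Zc Zz); subst z.
  have hk : a <= k < a + 2 * pi by rewrite k1.
  rewrite area_rot (@area_cexp_order _ a)// => /or3P[]/andP[l1 l2].
  - by apply: (ncl k) => //; rewrite l2 andbT (lt_trans at0).
  - by have := lt_trans l2 t0b; rewrite ltxx.
  - by have := lt_trans l1 t0b; rewrite ltxx.
rewrite leNgt; apply/negP => s.
have [rau|nr] := pselect (rho (cexp a) u).
  have sp : sep u v (cexp t0) (cexp b) by [].
  have := sep_sym (Zc Zu) (Zc Zv) (cx _) (cx _) sp.
  by move/sep_area => [[_ /(hi _ Zv (rT rau ruv))]|[/(hi _ Zu rau)]].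
have nsp : ~ sep u v (cexp a) (cexp b).
  by move=> sp; apply: nr; apply: rC; exact: (noncrossing_sep Zc eqv nc ruv rab sp).
have na : area u v (cexp a) != 0.
  apply: (area_circle_neq0 (Zc Zu) (Zc Zv) (cx _) uv) => e; apply: nr; rewrite e; first exact: rxx.
  exact: rC.
have nb : area u v (cexp b) != 0.
  apply: (area_circle_neq0 (Zc Zu) (Zc Zv) (cx _) uv) => e; apply: nr; apply: rT rab _; rewrite e.
    exact: rxx.
  exact: rC.
move: A1 s nsp na nb n0; rewrite /sep.
move: (area u v (cexp t0)) (area u v (cexp a)) (area u v (cexp b)) => x y z A1 s nsp na nb n0.
apply: nsp; rewrite lt_neqAle mulf_neq0//= leNgt; apply/negP => yz.
have xy : 0 < x * y by rewrite lt_neqAle eq_sym mulf_neq0.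
have := mulr_gt0 xy yz; have -> : x * y * (y * z) = y ^+ 2 * (x * z) by ring.
by rewrite pmulr_rgt0 ?exprn_even_gt0// ltNge ltW.
Qed.

Let next_side x y w : next_point Y x y -> Z w -> 0 <= area x y w.
Proof.
move=> n Zw; have [Yx _] := next_pointY n; have xy := next_neq Yc Yi n.
have [s [_ _ xE]] := cexp_surj 0 (Yc Yx); subst x.
have [s' ss' nZ] := Zinfty_next Yx.
have yE : y = cexp s' by apply: (next_uniq Yc Yi n); exists s, s'.
subst y; have [lt _ _ _] := ss'.
have s2 : s' < s + 2 * pi.
  rewrite lt_neqAle (consecutive_le ss') andbT; apply/eqP => e.
  by apply: xy; rewrite e cexpD2pi.
have [k [k1 k2 wE]] := cexp_surj s (Zc Zw); subst w.
rewrite leNgt area_lt0 area_rot area_order_base ?k1 ?s2 ?(ltW lt)//.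
by apply/negP => /andP[l1 l2]; apply: (nZ k) => //; rewrite k1 ltW.
Qed.

(* Otherwise a triangle of the cluster would cross the chord between the two points; its edges
   do not, so one of these points would lie on the arc of a boundary edge. *)
Lemma adjacent_limit_pair (a b : R) : a < b -> b < a + 2 * pi -> rho (cexp a) (cexp b) ->
  (forall x, a < x < b -> ~ rho (cexp a) (cexp x)) ->
  limit_pair S (cexp a) (cexp b) \/ limit_pair S (cexp b) (cexp a).
Proof.
move=> ab ba rab ncl; apply: contrapT => /not_orP[nl1 nl2].
have [Za Zb] := rZ rab; have cx := @cexp_circle R.
have ww' : cexp a <> cexp b :> plane.
  move=> /(cexp_inj (lexx a)) e; have : a = b; last by move: ab => /[swap] ->; rewrite ltxx.
  by apply: e => //; [rewrite ltrDl mulr_gt0// pi_gt0|exact: ltW].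
have [b1 [ab1 Zb1 nb1]] := next_lift a Zc Zf Z0.
have b1b : b1 <= b by rewrite leNgt; apply/negP => l; apply: (nb1 b) => //; rewrite ab.
have cab1 : consecutive Z a b1 by [].
pose t0 := zpt a b1 0; pose t1 := zpt a b1 (0 + 1).
have c01 : consecutive Y t0 t1 by exact: Zinfty_consecutive.
have [t01 Y0 Y1 _] := c01.
have /andP[at0 t0b] := zpt_in 0 ab1; rewrite -/t0 in at0 t0b.
have /andP[at1 t1b] := zpt_in (0 + 1) ab1; rewrite -/t1 in at1 t1b.
have n01 : next_point Y (cexp t0) (cexp t1) by exists t0, t1.
have x01 := next_neq Yc Yi n01.
have E0 : E Y S (cexp t0) (cexp t1) by right; exists (cexp t0), (cexp t1).
have hf0 : (0 : R) < 1 / 2 by rewrite divr_gt0.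
have hf1 : (1 / 2 : R) < 1 by rewrite ltr_pdivrMr// mul1r ltr1n.
have hfE : 1 - 1 / 2 = 1 / 2 :> R by field.
pose m0 := mix (1 / 2) (cexp t0) (cexp t1) : plane.
pose p := mix (1 / 2) (cexp a) (cexp b) : plane.
have om : open_disk m0 by apply: odisk_mix => //; exact/circle_disk/cx.
have op : open_disk p by apply: odisk_mix => //; exact/circle_disk/cx.
have am : area (cexp t0) (cexp t1) m0 = 0.
  by rewrite area_mix areaxyx areaxyy !mulr0 addr0.
(* Every chord of a class except that from [a] to [b] has [p] and [m0] strictly on the same side, so
   only the excluded limit pairs could separate them. *)
have HA u v : rho u v -> u <> v -> ~ (u = cexp a /\ v = cexp b) -> ~ (u = cexp b /\ v = cexp a) ->
    0 < area u v p * area u v m0.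
  move=> ruv uv ne1 ne2; have [Zu Zv] := rZ ruv.
  have nZ0 x : a < x <= t0 -> ~ Z (cexp x).
    by move=> /andP[x1 x2]; apply: nb1; rewrite x1 (le_lt_trans x2).
  have [n0 A1 A2] := same_class_side at0 (lt_le_trans t0b b1b) ba Za Zb rab ruv uv nZ0 ncl.
  have A3 : 0 < area u v (cexp t0) * area u v (cexp t1).
    apply: (arc_same_side Zc (ltW t01)) => // x /andP[x1 x2]; apply: nb1.
    by rewrite (lt_le_trans at0)//= (le_lt_trans x2).
  have A4 : area u v (cexp a) != 0 \/ area u v (cexp b) != 0.
    have z0 t : area u v (cexp t) = 0 -> cexp t = u \/ cexp t = v.
      move=> e; apply: contrapT => /not_orP[k1 k2].
      by have := area_circle_neq0 (Zc Zu) (Zc Zv) (cx t) uv k1 k2; rewrite e eqxx.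
    have [e|] := eqVneq (area u v (cexp a)) 0; last by left.
    have [e'|] := eqVneq (area u v (cexp b)) 0; last by right.
    exfalso; case: (z0 _ e) => e1; case: (z0 _ e') => e2.
    - by apply: ww'; rewrite e1 e2.
    - by apply: ne1; rewrite e1 e2.
    - by apply: ne2; rewrite e1 e2.
    - by apply: ww'; rewrite e1 e2.
  rewrite /p /m0 !area_mix hfE.
  move: (area u v (cexp t0)) (area u v (cexp t1)) (area u v (cexp a)) (area u v (cexp b))
    n0 A1 A2 A3 A4 => x y z t n0 A1 A2 A3 A4.
  have xx : 0 < x ^+ 2 by rewrite exprn_even_gt0.
  rewrite -(pmulr_rgt0 _ xx).
  have -> : x ^+ 2 * ((1 / 2 * z + 1 / 2 * t) * (1 / 2 * x + 1 / 2 * y)) =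
    (1 / 2) ^+ 2 * ((x * z + x * t) * (x ^+ 2 + x * y)) by ring.
  apply: mulr_gt0; first by rewrite exprn_gt0.
  apply: mulr_gt0; last exact: addr_gt0.
  have [p1|p1] : 0 < x * z \/ 0 < x * t.
  - by case: A4 => nn; [left|right]; rewrite lt_neqAle eq_sym mulf_neq0.
  - exact: ltr_pwDl.
  - by rewrite addrC; exact: ltr_pwDl.
have sepH u v : limit_point Y u -> limit_point Y v -> u <> v -> limit_pair S u v ->
    ~ (0 <= area u v p /\ area u v m0 <= 0).
  move=> /(Zinfty_limit Zc Zf Z0) Zu /(Zinfty_limit Zc Zf Z0) Zv uv luv [h1 h2].
  have q1 : ~ (u = cexp a /\ v = cexp b) by move=> [e1 e2]; apply: nl1; rewrite -e1 -e2.
  have q2 : ~ (u = cexp b /\ v = cexp a) by move=> [e1 e2]; apply: nl2; rewrite -e1 -e2.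
  by have := HA u v (lim Zu Zv luv) uv q1 q2; rewrite ltNge mulr_ge0_le0.
have [x1 [x2 [x3 [tri reg]]]] := coverage Yc Yi cl lf (Zinfty_has_prev (Z := Z)) op om E0 am sepH.
(* A cluster edge has [p], the midpoint, on its inner side and does not separate [cexp a] from
   [cexp b]; hence [cexp a] is on its inner side as well. *)
have key x y z : ctri Y S x y z -> treg S x y z p -> 0 <= area x y (cexp a).
  move=> [Exy Eyz Ezx h] [_ r1 _ _].
  have [Yx Yy xy] := E_Y Yc Yi cl Exy; have [_ Yz _] := E_Y Yc Yi cl Eyz.
  case: Exy => [Sxy|/(boundary_edgeP _ xy)[n|n]]; last first.
  - have [_ _ H] := (nextP Yc (nesym xy)).1 n.
    by have := H _ Yz; rewrite area_swap oppr_ge0 leNgt h.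
  - exact: next_side.
  have [_ _ H] := Sp Sxy.
  have hs := (nsep_ZY Zc Za Zb ww' Yx Yy xy).2 (H _ _ rab ww').
  have := r1 Sxy; rewrite /p area_mix hfE -mulrDr pmulr_rge0// => hsum.
  rewrite leNgt; apply/negP => neg.
  have : area x y (cexp b) < 0 by move: hs; rewrite nmulr_rgt0.
  by move: hsum; rewrite leNgt => /negP hh h'; apply: hh; rewrite -[ltRHS]addr0; exact: ltrD.
have [E1 E2 E3 h] := tri.
have [V1 V2 _] := E_Y Yc Yi cl E1; have [_ V3 _] := E_Y Yc Yi cl E2.
have h1 := key _ _ _ tri reg.
have h2 := key _ _ _ (ctri_rot tri) (treg_rot reg).
have h3 := key _ _ _ (ctri_rot (ctri_rot tri)) (treg_rot (treg_rot reg)).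
(* On the inner side of all three sides, [cexp a] would be a vertex of the triangle, but vertices
   are not in [Z]. *)
case: (circle_tri (Yc V1) (Yc V2) (Yc V3) (cx a) h h1 h2 h3) => e.
- by apply: (Zinfty_notZ V1); rewrite -e.
- by apply: (Zinfty_notZ V2); rewrite -e.
- by apply: (Zinfty_notZ V3); rewrite -e.
Qed.

(** Go around from [w] to the first point of its class not related to it by [r]. The last related
    point before is adjacent to it in the class, and [adjacent_limit_pair] relates the two. *)
Lemma rho_cluster_rel w w' : rho w w' -> cluster_rel Z S w w'.
Proof.
move=> rww r [r1 r2 r3 r4] rl; have [Zw Zw'] := rZ rww.
have [a [_ _ wE]] := cexp_surj 0 (Zc Zw).
have ex u : exists k : R, circle u -> [/\ a <= k, k < a + 2 * pi & u = cexp k].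
  have [cu|ncu] := pselect (circle u); last by exists 0.
  by have [k kP] := cexp_surj a cu; exists k.
have [K KP] := choice ex.
have KZ u : Z u -> [/\ a <= K u, K u < a + 2 * pi & u = cexp (K u)] by move=> /Zc/KP.
apply: contrapT => nr.
pose C := [set z | rho w z /\ ~ r w z].
have Cf : finite_set C by apply: sub_finite_set Zf => z [/rZ[]].
have C0 : C !=set0 by exists w'.
have [z1 [rz1 nz1] zmin] := finite_argmin K Cf C0.
have [_ Zz1] := rZ rz1; have [k1 k2 z1E] := KZ _ Zz1.
pose D := [set z | [/\ rho w z, r w z & K z < K z1]].
have Df : finite_set D by apply: sub_finite_set Zf => z [/rZ[]].
have Kw : K w = a.
  have [l1 l2 l3] := KZ _ Zw; apply: (@cexp_inj R a) => //.
    by rewrite ltrDl mulr_gt0// pi_gt0.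
  by rewrite -l3 wE.
have D0 : D !=set0.
  exists w; split; [exact: rxx|exact: r2|].
  rewrite Kw lt_neqAle k1 andbT; apply/eqP => e; apply: nz1.
  by rewrite z1E -e -wE; exact: r2.
have [z0 [rz0 r0 lt0] zmax] := finite_argmin (fun u => - K u) Df D0.
have [_ Zz0] := rZ rz0; have [l1 l2 z0E] := KZ _ Zz0.
have r01 : rho (cexp (K z0)) (cexp (K z1)) by rewrite -z0E -z1E; exact: rT (rC rz0) rz1.
have b2 : K z1 < K z0 + 2 * pi by apply: lt_le_trans k2 _; rewrite lerD2r.
apply: nz1; apply: r4 r0 _.
have r10 : limit_pair S z0 z1 \/ limit_pair S z1 z0.
  rewrite z0E z1E; apply: adjacent_limit_pair => //.
  move=> x /andP[x1 x2] rx; have rwx : rho w (cexp x) by apply: rT rz0 _; rewrite z0E.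
  have Kx : K (cexp x) = x.
    have [_ Zx] := rZ rwx; have [m1 m2 m3] := KZ _ Zx; apply: (@cexp_inj R a) => //.
      exact: le_trans l1 (ltW x1).
    exact: lt_trans k2.
  have [rrx|nrx] := pselect (r w (cexp x)).
    have : D (cexp x) by split=> //; rewrite Kx.
    by move=> /zmax; rewrite lerN2 Kx leNgt x1.
  have : C (cexp x) by [].
  by move=> /zmin; rewrite Kx leNgt x2.
by case: r10 => h; [exact: rl|apply: r3; exact: rl].
Qed.

End RelationLimits.

Lemma within_comp (T U W : topologicalType) (A : set T) (B : set U) (f : T -> U) (g : U -> W) :
  {within A, continuous f} -> {within B, continuous g} -> (forall x, A x -> B (f x)) ->
  {within A, continuous (g \o f)}.
Proof.
move=> /continuous_closedP fc /continuous_closedP gc fAB; apply/continuous_closedP => F.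
move=> /gc /closed_subspaceP[V cV VE].
have /closed_subspaceP[G cG GE] := fc V cV.
apply/closed_subspaceP; exists G => //; apply/seteqP; split=> x [h Ax]; split=> //.
  have [Vfx _] : (f @^-1` V `&` A) x by rewrite -GE.
  by have [] : (g @^-1` F `&` B) (f x) by rewrite -VE; split=> //; exact: fAB.
have [Vfx _] : (V `&` B) (f x) by rewrite VE; split=> //; exact: fAB.
by have [] : (G `&` A) x by rewrite GE.
Qed.

(** * Triangulations of a disk as clusters on its points *)

Section DiskTriangulation.
Context {R : realType}.
Local Notation plane := (plane R).
Implicit Types (u v w : plane).
Variables (Z : set plane) (rho : plane -> plane -> Prop).
Hypothesis Zc : Z `<=` circle.
Hypothesis Zf : finite_set Z.
Hypothesis Z0 : Z !=set0.
Hypothesis eqv : equivalence_on Z rho.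
Hypothesis nc : noncrossing rho.

Let rxx x : Z x -> rho x x. Proof. by have [_ H _ _] := eqv; exact: H. Qed.
Let rC x y : rho x y -> rho y x. Proof. by have [_ _ H _] := eqv; exact: H. Qed.
Let rT x y z : rho x y -> rho y z -> rho x z.
Proof. by have [_ _ _ H] := eqv; exact: H. Qed.

Variable c : plane.
Hypothesis oc : off Z rho c.
Hypothesis odc : open_disk c.

Local Notation cpi := (cpi Z rho).
Local Notation V := (vpts Z rho c).
Local Notation D := (cpi @` cpiece rho c).

Let Vc : V `<=` circle. Proof. exact: vpts_circle. Qed.
Let Vd : V `<=` disk. Proof. by move=> x /Vc/circle_disk. Qed.
Let VP : V `<=` cpiece rho c. Proof. by move=> x [_ /piece_cpiece]. Qed.

Lemma disk_points_vpts : disk_points D = V.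
Proof. by rewrite (disk_pointsE Zc Zf eqv nc)//; [exact: Zinfty_circle|exact: Zinfty_notZ]. Qed.

Let imageE (g : cactus Z rho -> plane) A : A `<=` V -> g @` cactus_image Z rho A = (g \o cpi) @` A.
Proof.
move=> AV; rewrite cactus_imageE -image_comp; congr (_ @` (_ @` _)).
by apply/seteqP; split=> [x []//|x Ax]; split=> //; exact/Vd/AV.
Qed.

Let imagesE (g : cactus Z rho -> plane) (T : set (set plane)) : (forall A, T A -> A `<=` V) ->
  [set g @` cactus_image Z rho A | A in T] = [set (g \o cpi) @` A | A in T].
Proof.
by move=> TV; apply/seteqP; split=> B [A TA <-]; exists A => //; rewrite imageE//; exact: TV.
Qed.

Lemma good_triangulation T : good_cluster Z rho c T -> disk_triangulation D T.
Proof.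
move=> [cl lf lim].
have TV A : T A -> A `<=` V.
  move=> TA; have [x [y [_ [_ [Vx Vy _ _ [-> _]]]]]] := S_obj Vc cl TA.
  by move=> z [->|->].
have [g [h [gh gb hc hp [hm hf gE]]]] := disk_chart Zc Zf eqv nc oc odc.
split; first by rewrite disk_points_vpts.
exists g; split=> //; rewrite disk_points_vpts imageE// imagesE//.
apply: tame_triangulation.
exact: (chart_tame Zc Zf Z0 eqv oc gh hc hp hm hf gE cl lf lim).
Qed.

(** The given homeomorphism [g] need not respect angles. Compared with the chart [g0], it induces a
    homeomorphism of the circle, which preserves [sep] by [circle_homeo_sep]. *)
Lemma triangulation_good T : disk_triangulation D T -> good_cluster Z rho c T.
Proof.
rewrite /disk_triangulation disk_points_vpts => -[TV [g [gh gb]]].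
rewrite imageE// imagesE// => tr.
have [[gD gI gS] gc _] := gh.
have [g0 [h [g0h g0b hc hp [hm hf g0E]]]] := disk_chart Zc Zf eqv nc oc odc.
have [[g0D g0I g0S] _ [k [kc kK]]] := g0h.
have eE := eta_cexp g0E.
have eC := eta_circle Zc eqv hp hm hf eE.
have eS := eta_sep Zc eqv hp hm hf eE.
have bD e : disk_boundary D e -> D e by move=> [].
have Voff x : V x -> off Z rho x by move=> [_]; exact: (piece_off Zc Zf eqv oc).
have Vb x : V x -> disk_boundary D (cpi x).
  by move=> Vx; rewrite disk_boundaryE; split; exists x => //; [exact: VP|exact: Vc].
pose phi := g \o k.
have kD q : disk q -> D (k q).
  by move=> dq; have [e De eq] := g0S q dq; rewrite -eq kK.
have phic : {within circle, continuous phi}.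
  apply: (@within_comp _ _ _ _ D) gc _; last by move=> q /circle_disk; exact: kD.
  by apply: continuous_subspaceW kc => q; exact: circle_disk.
have phig0 e : D e -> phi (g0 e) = g e by move=> De; rewrite /phi /= kK.
have phis : phi @` circle = circle.
  apply/seteqP; split=> q.
    move=> [u cu <-]; have [e be <-] : (g0 @` disk_boundary D) u by rewrite g0b.
    by rewrite phig0; [rewrite -gb; exists e|exact: bD].
  move=> cq; have [e be <-] : (g @` disk_boundary D) q by rewrite gb.
  by exists (g0 e); [rewrite -g0b; exists e|rewrite phig0//; exact: bD].
have phii x y : circle x -> circle y -> phi x = phi y -> x = y.
  rewrite -g0b => -[e /bD De <-] [e' /bD De' <-]; rewrite !phig0// => E.
  by rewrite (gI e e')// inE.
have gV x : V x -> (g \o cpi) x = phi ((g0 \o cpi) x).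
  by move=> Vx; rewrite /= phig0//; exact/bD/Vb.
have eVc x : V x -> circle ((g0 \o cpi) x) by move=> Vx; apply: eC; exists x.
have sS x y u v : V x -> V y -> V u -> V v ->
    sep ((g \o cpi) x) ((g \o cpi) y) ((g \o cpi) u) ((g \o cpi) v) <-> sep x y u v.
  move=> Vx Vy Vu Vv; rewrite !gV// (circle_homeo_sep phic phis phii)//; try exact: eVc.
  exact: eS.
have ginj e e' : D e -> D e' -> g e = g e' -> e = e'.
  by move=> De De' E; apply: gI => //; rewrite inE.
have sI x y : V x -> V y -> (g \o cpi) x = (g \o cpi) y -> x = y.
  move=> Vx Vy /= E; apply: (cpi_off Zc Zf eqv nc (Vd Vx) (Voff _ Vy)).
  by apply: ginj E; exact/bD/Vb.
pose W := (g \o cpi) @` V; pose T' := [set (g \o cpi) @` A | A in T].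
have Wc : W `<=` circle by move=> _ [x Vx <-]; rewrite -gb; exists (cpi x) => //; exact: Vb.
have sC : {within cpiece rho c, continuous (g \o cpi)}.
  by apply: comp_cpi_continuous => //; exact: cpiece_disk.
split.
- by apply/(transport_cluster Vc Wc erefl sI sS TV); have [] := tr.
- apply/(transport_locally_finite erefl sI TV).
  exact: (triangulation_locally_finite Wc tr).
- move=> w w' Zw Zw' [x [y [Txy xw yw']]].
  have Vx n : V (x n) by apply: (TV _ (Txy n)); left.
  have Vy n : V (y n) by apply: (TV _ (Txy n)); right.
  have cl : closed (cpiece rho c) by exact: cpiece_closed.
  have Pw : cpiece rho c w.
    by apply: (closed_cvg (cpiece rho c) cl _ _ xw) => //; apply: nearW => n; exact/VP.
  have Pw' : cpiece rho c w'.
    by apply: (closed_cvg (cpiece rho c) cl _ _ yw') => //; apply: nearW => n; exact/VP.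
  have dw := circle_disk (Zc Zw); have dw' := circle_disk (Zc Zw').
  have sx := within_cvg sC Pw (fun n => VP (Vx n)) xw.
  have sy := within_cvg sC Pw' (fun n => VP (Vy n)) yw'.
  have ne u v : V u -> Z v -> cpiece rho c v -> (g \o cpi) u <> (g \o cpi) v.
    move=> Vu Zv Pv /= E; have Dv : D (cpi v) by exists v.
    have e := cpi_off Zc Zf eqv nc (circle_disk (Zc Zv)) (Voff _ Vu) (esym (ginj _ _ (bD _ (Vb _ Vu)) Dv E)).
    by apply: (vpts_nZ Vu); rewrite -e.
  have lw : limit_point W ((g \o cpi) w).
    by apply: limit_point_seq sx => n; [exists (x n)|exact: ne].
  have lw' : limit_point W ((g \o cpi) w').
    by apply: limit_point_seq sy => n; [exists (y n)|exact: ne].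
  have lp : limit_pair T' ((g \o cpi) w) ((g \o cpi) w').
    exists (fun n => (g \o cpi) (x n)), (fun n => (g \o cpi) (y n)); split=> // n.
    by exists [set x n; y n] => //; rewrite image2.
  (* The ends of the limit pair are limit points in the triangulated disk, so they have the same
     image; and points of [Z] are identified only if equivalent. *)
  have e := triangulation_limit_pair Wc tr lw lw' lp.
  have {}e : cpi w = cpi w' by apply: ginj e; [exists w|exists w'].
  case: (cpi_eq Zc Zf eqv nc dw dw' e) => [<-|[z [Zz h1 h2]]]; first exact: rxx.
  apply: (rT (rC (reg_Z Zc eqv (Zc Zw) h1))); exact: (reg_Z Zc eqv (Zc Zw') h2).
Qed.

End DiskTriangulation.

(** * Restriction to the disks as a bijection *)

Theorem proposition4p40 (R : realType) (Z : set (plane R))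
    (rho : plane R -> plane R -> Prop) (k : nat)
    (D : 'I_k -> set (cactus Z rho)) :
  Z `<=` circle -> finite_set Z -> Z !=set0 ->
  equivalence_on Z rho -> noncrossing rho ->
  set_bij [set: 'I_k] (cactus_disks Z rho) D ->
  exists f : set (set (plane R)) -> 'I_k -> set (set (plane R)),
    set_bij
      [set S | [/\ is_cluster (Zinfty Z) S, locally_finite (Zinfty Z) S &
                   forall w w', cluster_rel Z S w w' <-> rho w w']]
      [set T | forall i, disk_triangulation (D i) (T i)]
      f /\
    forall S, is_cluster (Zinfty Z) S -> locally_finite (Zinfty Z) S ->
      (forall w w', cluster_rel Z S w w' <-> rho w w') ->
      forall i, f S i = [set A | S A /\ A `<=` disk_points (D i)].
Proof.
move=> Zc Zf Z0 eqv nc [Dfun Dinj Dsurj].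
have Yc : Zinfty Z `<=` circle by exact: Zinfty_circle.
have Yoff x : Zinfty Z x -> off Z rho x.
  by apply: (Zinfty_off Zc eqv) => //; exact: Zinfty_notZ.
have /choice[c cP] : forall i, exists c,
    [/\ off Z rho c, open_disk c & D i = cpi Z rho @` cpiece rho c].
  move=> i; have /(cactus_disksP Zc Zf eqv nc)[p op De] := Dfun i I.
  have [c [oc odc] pc] := off_open Zc Zf eqv op; exists c; split=> //.
  by rewrite De (cpiece_eq pc).
pose V i := vpts Z rho (c i).
have DV i : disk_points (D i) = V i.
  by have [oc _ ->] := cP i; exact: disk_points_vpts.
have trG i T : disk_triangulation (D i) T <-> good_cluster Z rho (c i) T.
  have [oc odc ->] := cP i; split; first exact: (triangulation_good Zc Zf eqv nc oc odc).
  exact: (good_triangulation Zc Zf Z0 eqv nc oc odc).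
(* The enumeration [D] hits the disk of every point outside the contracted regions. *)
have idx x : off Z rho x -> exists i, piece Z rho (c i) x.
  move=> ox; have [i _ De] : (D @` [set: 'I_k]) (cpi Z rho @` cpiece rho x).
    by apply: Dsurj; apply/(cactus_disksP Zc Zf eqv nc); exists x.
  have [oc _ De'] := cP i; exists i.
  apply/(cpi_cpiece Zc Zf eqv nc oc ox.1 ox); rewrite -De' De.
  by exists x => //; exact/(piece_cpiece (Z := Z))/(piece_self Zc eqv ox).
have idx_inj i j : piece Z rho (c i) (c j) -> i = j.
  move=> pij; have [oi _ Di] := cP i; have [oj _ Dj] := cP j.
  by apply: Dinj; rewrite ?inE// Di Dj (cpiece_eq pij).
have VV i j x : V i x -> V j x -> i = j.
  move=> [_ pi_] [_ pj]; apply: idx_inj; apply: piece_trans pi_ _.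
  have [oj _ _] := cP j.
  by apply: (piece_sym pj (off_nZ eqv oj)); case: oj.
have pieceV i x y : V i x -> V i y -> piece Z rho x y.
  move=> [_ px] [_ py]; apply: piece_trans py; have [oc _ _] := cP i.
  by apply: (piece_sym px (off_nZ eqv oc)); case: oc.
have pieceVT i x y : V i x -> Zinfty Z y -> piece Z rho x y -> V i y.
  by move=> [_ px] Yy pxy; split=> //; exact: piece_trans pxy.
pose f (S : set (set (plane R))) i := [set A | S A /\ A `<=` V i].
exists f; split; last by move=> S _ _ _ i; rewrite DV.
split.
- move=> S [cl lf cr] i; apply/trG; have [oc odc _] := cP i.
  exact: (restrict_good Zc Zf Z0 eqv nc oc odc cl lf cr).
- have sub S S' A : is_cluster (Zinfty Z) S -> (forall w w', cluster_rel Z S w w' <-> rho w w') ->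
      f S = f S' -> S A -> S' A.
    move=> cl cr e SA; have [x [y [_ [_ [Yx Yy _ _ [AE _]]]]]] := S_obj Yc cl SA; subst A.
    have pxy : piece Z rho x y by apply: (cluster_piece Zc eqv cl) SA => w w' /cr.
    have [i px] := idx x (Yoff x Yx).
    have Vx : V i x by [].
    have : f S i [set x; y] by split=> // z [->|->] //; exact: pieceVT pxy.
    by rewrite e => -[].
  move=> S S' /set_mem[cl _ cr] /set_mem[cl' _ cr'] e.
  by apply/seteqP; split=> A; [exact: sub|exact: (sub S' S)].
- move=> T /= Ttr.
  have TG i : good_cluster Z rho (c i) (T i) by exact/trG.
  have Tobj i A : T i A -> exists x y, [/\ V i x, V i y & A = [set x; y]].
    have [cl _ _] := TG i => TA.
    have [x [y [_ [_ [Vx Vy _ _ [AE _]]]]]] := S_obj (@vpts_circle _ _ _ _) cl TA.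
    by exists x, y.
  have TV i A : T i A -> A `<=` V i by move=> /Tobj[x [y [Vx Vy ->]]] z [->|->].
  (* The preimage of a family is its union; restricting it to [V i] gives back [T i] because the
     sets [V i] are disjoint. *)
  pose S : set (set (plane R)) := [set A | exists i, T i A].
  have fS i : f S i = T i.
    apply/seteqP; split=> A; last by move=> TA; split; [exists i|exact: TV].
    move=> [[j TA] AV]; have [x [y [Vx _ AE]]] := Tobj j A TA.
    have Vix : V i x by apply: AV; rewrite AE; left.
    by rewrite (VV i j x Vix Vx).
  have Spiece A : S A -> exists c, [/\ off Z rho c, open_disk c & A `<=` vpts Z rho c].
    by move=> [i /TV AV]; have [oc odc _] := cP i; exists (c i).
  have Sgood d : off Z rho d -> open_disk d -> good_cluster Z rho d [set A | S A /\ A `<=` vpts Z rho d].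
    move=> od odd; have [i pd] := idx d od; have [oc _ _] := cP i.
    have e : vpts Z rho d = V i by rewrite /V /vpts (piece_eq eqv oc pd).
    by rewrite /good_cluster e -/(f S i) fS; exact: TG.
  have pfin : exists (n : nat) (c : 'I_n -> plane R), forall x, off Z rho x ->
      exists i, [/\ off Z rho (c i), open_disk (c i) & piece Z rho (c i) x].
    by exists k, c => x /idx[i px]; have [oc odc _] := cP i; exists i.
  have cl := union_cluster Zc Zf Z0 eqv nc Spiece Sgood.
  have lf := union_locally_finite Zc Zf eqv Spiece Sgood.
  have lim := union_limit Zc eqv Spiece Sgood pfin.
  have Sp x y : S [set x; y] -> piece Z rho x y.
    by move=> [i /TV AV]; apply: (pieceV i); apply: AV; [left|right].
  exists S; last by apply: funext.
  split=> // w w'; split; first by apply.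
  exact: (rho_cluster_rel Zc Zf Z0 eqv nc cl lf Sp lim).
Qed.
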